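(* Let $n\ge1$ and $0<p_2<\min\{p_1,q_1,q_2\}$. Assume that $v_1,v_2\in\mathcal W(\mathbb R^n)$ and $w_1,w_2\in\mathcal W(0,\infty)$ are such that $\int_t^\infty w_i^{q_i}<\infty$, $i=1,2$, for all $t\in(0,\infty)$. Write $LM_i:=LM_{p_i,q_i}(v_i,w_i)$, $i=1,2$, and for $0\le s<t$ put $$V(s,t):=\int_{\{y\in\mathbb R^n:\,s<|y|<t\}}v_1(y)^{-\frac{p_1p_2}{p_1-p_2}}v_2(y)^{\frac{p_1p_2}{p_1-p_2}}\,dy .$$ Suppose that $$0<\int_0^tV(s,t)^{\frac{q_1(p_1-p_2)}{p_1(q_1-p_2)}}\bigg(\int_s^\infty w_1^{q_1}\bigg)^{-\frac{q_1}{q_1-p_2}}w_1(s)^{q_1}\,ds<\infty$$ holds for all $t\in(0,\infty)$. Define $$I_3:=\bigg(\int_0^\infty w_1^{q_1}\bigg)^{-\frac1{q_1}}\sup_{t\in(0,\infty)}V(0,t)^{\frac{p_1-p_2}{p_1p_2}}\bigg(\int_t^\infty w_2^{q_2}\bigg)^{\frac1{q_2}},$$ $$I_4:=\sup_{t\in(0,\infty)}\bigg(\int_t^\infty w_2^{q_2}\bigg)^{\frac1{q_2}}\bigg(\int_0^tV(s,t)^{\frac{q_1(p_1-p_2)}{p_1(q_1-p_2)}}\bigg(\int_s^\infty w_1^{q_1}\bigg)^{-\frac{q_1}{q_1-p_2}}w_1(s)^{q_1}\,ds\bigg)^{\frac{q_1-p_2}{q_1p_2}},$$ $$I_5:=\Bigg(\int_0^\infty\bigg(\int_0^t\bigg(\int_s^\infty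 w_1^{q_1}\bigg)^{-\frac{q_1}{q_1-p_2}}w_1(s)^{q_1}\,ds\bigg)^{\frac{q_1(q_2-p_2)}{p_2(q_1-q_2)}}\bigg(\int_t^\infty w_1^{q_1}\bigg)^{-\frac{q_1}{q_1-p_2}}w_1(t)^{q_1}\sup_{z\in(t,\infty)}V(t,z)^{\frac{q_1q_2(p_1-p_2)}{p_1p_2(q_1-q_2)}}\bigg(\int_z^\infty w_2^{q_2}\bigg)^{\frac{q_1}{q_1-q_2}}dt\Bigg)^{\frac{q_1-q_2}{q_1q_2}},$$ $$I_6:=\Bigg(\int_0^\infty\bigg(\int_0^t\bigg(\int_s^\infty w_1^{q_1}\bigg)^{-\frac{q_1}{q_1-p_2}}w_1(s)^{q_1}V(s,t)^{\frac{q_1(p_1-p_2)}{p_1(q_1-p_2)}}\,ds\bigg)^{\frac{q_1(q_2-p_2)}{p_2(q_1-q_2)}}\sup_{z\in(t,\infty)}V(t,z)^{\frac{q_1(p_1-p_2)}{p_1(q_1-p_2)}}\bigg(\int_z^\infty w_2^{q_2}\bigg)^{\frac{q_1}{q_1-q_2}}\bigg(\int_t^\infty w_1^{q_1}\bigg)^{-\frac{q_1}{q_1-p_2}}w_1(t)^{q_1}\,dt\Bigg)^{\frac{q_1-q_2}{q_1q_2}},$$ $$I_7:=\bigg(\int_0^\infty w_1^{q_1}\bigg)^{-\frac1{q_1}}\bigg(\int_0^\infty V(0,t)^{\frac{q_2(p_1-p_2)}{p_2(p_1-q_2)}}\bigg(\int_t^\infty w_2^{q_2}\bigg)^{\frac{q_2}{p_1-q_2}}w_2(t)^{q_2}\,dt\bigg)^{\frac{p_1-q_2}{p_1q_2}},$$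 $$I_8:=\sup_{t\in(0,\infty)}\bigg(\int_0^t\bigg(\int_s^\infty w_1^{q_1}\bigg)^{-\frac{q_1}{q_1-p_2}}w_1(s)^{q_1}\,ds\bigg)^{\frac{q_1-p_2}{q_1p_2}}\bigg(\int_t^\infty V(t,s)^{\frac{q_2(p_1-p_2)}{p_2(p_1-q_2)}}\bigg(\int_s^\infty w_2^{q_2}\bigg)^{\frac{q_2}{p_1-q_2}}w_2(s)^{q_2}\,ds\bigg)^{\frac{p_1-q_2}{p_1q_2}},$$ $$I_9:=\Bigg(\int_0^\infty\bigg(\int_0^t\bigg(\int_s^\infty w_1^{q_1}\bigg)^{-\frac{q_1}{q_1-p_2}}w_1(s)^{q_1}\,ds\bigg)^{\frac{q_1(q_2-p_2)}{p_2(q_1-q_2)}}\bigg(\int_t^\infty w_1^{q_1}\bigg)^{-\frac{q_1}{q_1-p_2}}w_1(t)^{q_1}\bigg(\int_t^\infty V(t,s)^{\frac{q_2(p_1-p_2)}{p_2(p_1-q_2)}}\bigg(\int_s^\infty w_2^{q_2}\bigg)^{\frac{q_2}{p_1-q_2}}w_2(s)^{q_2}\,ds\bigg)^{\frac{q_1(p_1-q_2)}{p_1(q_1-q_2)}}dt\Bigg)^{\frac{q_1-q_2}{q_1q_2}}.$$ (i) If $\max\{p_1,q_1\}\le q_2<\infty$, then $LM_1\hookrightarrow LM_2$ if and only if $I_3<\infty$ and $I_4<\infty$. Moreover, $\|\mathrm I\|_{LM_1\to LM_2}\approx I_3+I_4$. (ii) If $p_1\le q_2<q_1<\infty$, then $LM_1\hookrightarrow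 LM_2$ if and only if $I_3<\infty$, $I_5<\infty$ and $I_6<\infty$. Moreover, $\|\mathrm I\|_{LM_1\to LM_2}\approx I_3+I_5+I_6$. (iii) If $q_1\le q_2<p_1<\infty$, then $LM_1\hookrightarrow LM_2$ if and only if $I_4<\infty$, $I_7<\infty$ and $I_8<\infty$. Moreover, $\|\mathrm I\|_{LM_1\to LM_2}\approx I_4+I_7+I_8$. (iv) If $p_1<\infty$, $q_1<\infty$ and $q_2<\min\{p_1,q_1\}$, then $LM_1\hookrightarrow LM_2$ if and only if $I_6<\infty$, $I_7<\infty$ and $I_9<\infty$. Moreover, $\|\mathrm I\|_{LM_1\to LM_2}\approx I_6+I_7+I_9$.
   Context: $\mathcal M^+(\mathbb R^n)$ is the set of nonnegative measurable functions on $\mathbb R^n$. $\mathcal W(A)$ is the set of weights on $A$, i.e. measurable functions on $A$ that are positive and finite a.e. $B(0,t)$ is the open ball in $\mathbb R^n$ centred at $0$ of radius $t$. For $p,q\in(0,\infty)$, the weighted local Morrey-type space $LM_{p,q}(v,w)$ is the collection of all functions $f\in L^{loc}_{p,v}(\mathbb R^n)$ (locally $fv\in L_p$) such that $$\|f\|_{LM_{p,q}(v,w)}=\bigg(\int_0^\infty\bigg(\int_{B(0,t)}|f(s)|^pv(s)^p\,ds\bigg)^{\frac qp}w(t)^q\,dt\bigg)^{\frac1q}<\infty.$$ $X\hookrightarrow Y$ means $X\subset Y$ and there is a constant $C>0$ with $\|z\|_Y\le C\|z\|_X$ for all $z\in X$; here this amounts to $\|f\|_{LM_2}\le C\|f\|_{LM_1}$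 for all $f\in\mathcal M^+(\mathbb R^n)$. $\|\mathrm I\|_{LM_1\to LM_2}=\sup_{f\in\mathcal M^+(\mathbb R^n)}\|f\|_{LM_2}/\|f\|_{LM_1}$ is the best such constant. Differentials are omitted in some integrals: $\int_t^\infty w_i^{q_i}$ means $\int_t^\infty w_i(s)^{q_i}\,ds$. If $\int_0^\infty w_1^{q_1}=\infty$, then $(\int_0^\infty w_1^{q_1})^{-1/q_1}=0$, with the usual convention $0\cdot\infty=0$. $A\approx B$ means $\lambda^{-1}B\le A\le\lambda B$ for some constant $\lambda>0$ depending only on inessential parameters (at most on $n,p_1,p_2,q_1,q_2$, not on the weights). *)

(* Defs.v *)
From HB Require Import structures.
From mathcomp Require Import all_boot all_order all_algebra.
From mathcomp Require Import all_classical all_reals all_analysis.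
From mathcomp Require Import measurable_realfun.

Set Implicit Arguments.
Unset Strict Implicit.
Unset Printing Implicit Defensive.

Import Order.TTheory GRing.Theory Num.Theory.
Import numFieldNormedType.Exports.

Local Open Scope classical_set_scope.
Local Open Scope ring_scope.

(* The library has no Lebesgue measure on R^n: it is built here, on the Borel
   sets of R^n, as the n-fold product of the one-dimensional one. *)
Section borel_lebesgue.
Context {R : realType}.
Local Open Scope ereal_scope.

Definition tuple_cons n (z : measurableTypeR R * n.-tuple (measurableTypeR R)) :
  n.+1.-tuple (measurableTypeR R) := [tuple of z.1 :: z.2].

Definition tuple_uncons n (y : n.+1.-tuple (measurableTypeR R)) :
  measurableTypeR R * n.-tuple (measurableTypeR R) :=
  (tnth y ord0, [tuple of behead y]).

Lemma tuple_consK n : cancel (@tuple_cons n) (@tuple_uncons n).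
Proof. by move=> [x t]; congr pair; apply/val_inj. Qed.

Lemma tuple_unconsK n : cancel (@tuple_uncons n) (@tuple_cons n).
Proof. by move=> y; rewrite [RHS]tuple_eta; apply/val_inj. Qed.

Lemma measurable_tuple_cons n : measurable_fun setT (@tuple_cons n).
Proof. by apply: measurable_cons. Qed.

Lemma measurable_tuple_uncons n : measurable_fun setT (@tuple_uncons n).
Proof.
apply: measurable_fun_pair; first exact: measurable_tnth.
exact: measurable_behead.
Qed.

Section cons_measure.
Variable n : nat.
Variable nu : {sigma_finite_measure set (n.-tuple (measurableTypeR R)) -> \bar R}.

Definition cons_measure : set (n.+1.-tuple (measurableTypeR R)) -> \bar R :=
  pushforward (lebesgue_measure \x nu) (@tuple_cons n).

Let mpreimage (A : set (n.+1.-tuple (measurableTypeR R))) :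
  measurable A -> measurable (@tuple_cons n @^-1` A).
Proof.
by move=> mA; rewrite -[X in measurable X]setTI; exact: measurable_tuple_cons.
Qed.

Let cons_measure0 : cons_measure set0 = 0.
Proof. by rewrite /cons_measure /pushforward preimage_set0 measure0. Qed.

Let cons_measure_ge0 A : 0 <= cons_measure A.
Proof. exact: (measure_ge0 (lebesgue_measure \x nu)). Qed.

Let cons_measure_sigma_additive : semi_sigma_additive cons_measure.
Proof.
move=> F mF tF mUF; rewrite /cons_measure /pushforward preimage_bigcup.
apply: measure_semi_sigma_additive.
- by move=> i; exact: mpreimage.
- apply/trivIsetP => /= i j _ _ ij; rewrite -preimage_setI.
  by move/trivIsetP : tF => /(_ _ _ _ _ ij) ->//; rewrite preimage_set0.
- by rewrite -preimage_bigcup; exact: mpreimage.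
Qed.

HB.instance Definition _ := isMeasure.Build _ _ _ cons_measure
  cons_measure0 cons_measure_ge0 cons_measure_sigma_additive.

Let cons_measure_sigma_finite : sigma_finite setT cons_measure.
Proof.
have /sigma_finiteP[F [TF ndF Foo]] := sigma_finiteT (@lebesgue_measure R).
have /sigma_finiteP[G [TG ndG Goo]] := sigma_finiteT nu.
exists (fun k => @tuple_uncons n @^-1` (F k `*` G k)).
  apply/esym; rewrite -subTset => y _.
  have [i _ Fi] : (\bigcup_i F i) (tuple_uncons y).1 by rewrite -TF.
  have [j _ Gj] : (\bigcup_i G i) (tuple_uncons y).2 by rewrite -TG.
  exists (maxn i j) => //; split.
  - by move: Fi; exact/subsetPset/ndF/leq_maxl.
  - by move: Gj; exact/subsetPset/ndG/leq_maxr.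
move=> k; have [mF Fk] := Foo k; have [mG Gk] := Goo k; split.
  rewrite -[X in measurable X]setTI.
  by apply: measurable_tuple_uncons => //; exact: measurableX.
rewrite /cons_measure /pushforward -comp_preimage.
rewrite (_ : _ \o _ = id); last by apply/funext => z /=; rewrite tuple_consK.
by rewrite preimage_id product_measure1E// lte_mul_pinfty// ge0_fin_numE.
Qed.

HB.instance Definition _ := Measure_isSigmaFinite.Build _ _ _ cons_measure
  cons_measure_sigma_finite.

End cons_measure.

Fixpoint lebesgue_tuple n :
    {sigma_finite_measure set (n.-tuple (measurableTypeR R)) -> \bar R} :=
  match n with
  | 0%N => \d_([tuple] : 0.-tuple (measurableTypeR R))
  | m.+1 => cons_measure (lebesgue_tuple m)
  end.

Lemma lebesgue_tuple_box n (A : 'I_n -> set (measurableTypeR R)) :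
  (forall i, measurable (A i)) ->
  lebesgue_tuple n [set y | forall i, A i (tnth y i)] =
  \prod_(i < n) lebesgue_measure (A i).
Proof.
elim: n A => [|n IHn] A mA.
  rewrite big_ord0 /= diracE mem_set//=.
  by case.
rewrite big_ord_recl /= /cons_measure /pushforward.
rewrite (_ : _ @^-1` _ = A ord0 `*`
  [set y | forall i, A (lift ord0 i) (tnth y i)]); last first.
  apply/seteqP; split => [[x t] /= h|[x t] /= [hx ht] i].
    split; first exact: (h ord0).
    by move=> i; have := h (lift ord0 i); rewrite tnthS.
  by have [j ->|->//] := unliftP ord0 i; rewrite tnthS.
rewrite product_measure1E//; first by congr (_ * _); exact: (IHn (fun i => A (lift ord0 i))).
rewrite (_ : [set _ | _] = \bigcap_(i in [set: 'I_n])
   ((@tnth _ _ ^~ i) @^-1` A (lift ord0 i))).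
  apply: fin_bigcap_measurable => // i _.
  rewrite -[X in measurable X]setTI.
  exact: measurable_tnth.
by apply/seteqP; split => y /= h i; [move=> _|]; apply: h.
Qed.

End borel_lebesgue.

(* Measurability is Lebesgue measurability throughout: R^n and R carry the
   Caratheodory (i.e. completed) sigma-algebras of Lebesgue measure. *)
Definition realR (R : realType) := caratheodory_type (@wlength R idfun)^*%mu.

HB.instance Definition _ (R : realType) := Measurable.on (realR R).

Definition euclidean (R : realType) (n : nat) :=
  caratheodory_type (@lebesgue_tuple R n)^*%mu.

HB.instance Definition _ (R : realType) n := Measurable.on (euclidean R n).

Section lebesgue_euclidean.
Context {R : realType} {n : nat}.

Definition lebesgue_euclidean : set (euclidean R n) -> \bar R :=
  @completed_measure_extension _ _ _ (lebesgue_tuple n).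

HB.instance Definition _ := Measure.on lebesgue_euclidean.

Let lebesgue_euclidean_sigma_finite : sigma_finite setT lebesgue_euclidean.
Proof. exact/completed_measure_extension_sigma_finite/sigma_finiteT. Qed.

HB.instance Definition _ := Measure_isSigmaFinite.Build _ _ _
  lebesgue_euclidean lebesgue_euclidean_sigma_finite.

Definition enorm (y : euclidean R n) : R :=
  Num.sqrt (\sum_(i < n) (tnth y i : R) ^+ 2).

Definition eball (t : R) : set (euclidean R n) := [set y | enorm y < t].

Definition eshell (s t : R) : set (euclidean R n) := [set y | s < enorm y < t].

End lebesgue_euclidean.
Arguments lebesgue_euclidean {R n}.
Arguments euclidean : clear implicits.

Section weights.
Context {R : realType}.
Local Open Scope ereal_scope.

Definition weight d (T : measurableType d) (mu : {measure set T -> \bar R})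
    (A : set T) (v : T -> \bar R) : Prop :=
  measurable_fun A v /\ {ae mu, forall x, A x -> 0 < v x < +oo}.

Definition space_weight n (v : euclidean R n -> \bar R) : Prop :=
  weight lebesgue_euclidean setT v.

Definition halfline_weight (w : realR R -> \bar R) : Prop :=
  weight completed_lebesgue_measure `]0%R, +oo[ w.

End weights.

Section local_Morrey.
Context {R : realType} {n : nat}.
Local Open Scope ereal_scope.
Local Notation mun := (@lebesgue_euclidean R n).
Local Notation mu1 := (@completed_lebesgue_measure R).
Variables (p q : R) (v : euclidean R n -> \bar R) (w : realR R -> \bar R).

(* Every compact subset of R^n lies in some ball centred at the origin. *)
Definition Lploc (f : euclidean R n -> \bar R) : Prop :=
  measurable_fun setT f /\
  forall r : R, (0 < r)%R -> \int[mun]_(y in eball r) `|f y * v y| `^ p < +oo.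

Definition LMnorm (f : euclidean R n -> \bar R) : \bar R :=
  (\int[mu1]_(t in `]0%R, +oo[)
     ((\int[mun]_(y in eball t) (`|f y| `^ p * v y `^ p)) `^ (q / p)
      * w t `^ q)) `^ q^-1.

Definition LM : set (euclidean R n -> \bar R) :=
  [set f | Lploc f /\ LMnorm f < +oo].

End local_Morrey.

Definition embeds (R : realType) (T : Type) (X Y : set (T -> \bar R))
    (normX normY : (T -> \bar R) -> \bar R) : Prop :=
  X `<=` Y /\
  exists2 C : R, 0 < C & forall z, X z -> (normY z <= C%:E * normX z)%E.

(* With the conventions of \bar R, 0 / 0 = 0, x / 0 = +oo for x > 0, and
   x / +oo = 0 for all x, so the functions with normX f = 0 = normY f or
   normX f = +oo do not contribute to the supremum. *)
Definition best_constant (R : realType) d (T : measurableType d)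
    (normX normY : (T -> \bar R) -> \bar R) : \bar R :=
  ereal_sup [set (normY f / normX f)%E | f in
    [set f : T -> \bar R | measurable_fun setT f /\ forall x, (0 <= f x)%E]].

Definition equivalent_up_to (R : realType) (lam : R) (A B : \bar R) : Prop :=
  ((lam^-1)%:E * B <= A)%E /\ (A <= lam%:E * B)%E.

(* In this section negative powers are written as inverses of positive powers:
   on \bar R, 0^-1 = +oo and (+oo)^-1 = 0, whereas x `^ r with r < 0 takes the
   values 0 at 0 and +oo at +oo. *)
Section characteristics.
Context {R : realType} {n : nat}.
Local Open Scope ereal_scope.
Local Notation mun := (@lebesgue_euclidean R n).
Local Notation mu1 := (@completed_lebesgue_measure R).

Definition tail (q : R) (w : realR R -> \bar R) (t : R) : \bar R :=
  \int[mu1]_(s in `]t, +oo[) w s `^ q.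

Variables (p1 p2 q1 q2 : R).
Variables (v1 v2 : euclidean R n -> \bar R) (w1 w2 : realR R -> \bar R).

Definition V (s t : R) : \bar R :=
  \int[mun]_(y in eshell s t)
    ((v1 y `^ (p1 * p2 / (p1 - p2)))^-1 * v2 y `^ (p1 * p2 / (p1 - p2))).

Local Notation W1 := (tail q1 w1).
Local Notation W2 := (tail q2 w2).

Definition omega (s : R) : \bar R :=
  (W1 s `^ (q1 / (q1 - p2)))^-1 * w1 s `^ q1.

Definition I3 : \bar R :=
  (W1 0 `^ q1^-1)^-1 *
  ereal_sup [set V 0 t `^ ((p1 - p2) / (p1 * p2)) * W2 t `^ q2^-1
            | t in `]0%R, +oo[%classic].

(* The integral of the nondegeneracy hypothesis, which recurs in I_4 and I_6. *)
Definition J (t : R) : \bar R :=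
  \int[mu1]_(s in `]0%R, t[)
    (V s t `^ (q1 * (p1 - p2) / (p1 * (q1 - p2))) * omega s).

Definition I4 : \bar R :=
  ereal_sup [set W2 t `^ q2^-1 * J t `^ ((q1 - p2) / (q1 * p2))
            | t in `]0%R, +oo[%classic].

Definition I5 : \bar R :=
  (\int[mu1]_(t in `]0%R, +oo[)
     ((\int[mu1]_(s in `]0%R, t[) omega s)
        `^ (q1 * (q2 - p2) / (p2 * (q1 - q2)))
      * omega t
      * ereal_sup
          [set V t z `^ (q1 * q2 * (p1 - p2) / (p1 * p2 * (q1 - q2)))
               * W2 z `^ (q1 / (q1 - q2))
          | z in `]t, +oo[%classic])) `^ ((q1 - q2) / (q1 * q2)).

Definition I6 : \bar R :=
  (\int[mu1]_(t in `]0%R, +oo[)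
     (J t `^ (q1 * (q2 - p2) / (p2 * (q1 - q2)))
      * ereal_sup
          [set V t z `^ (q1 * (p1 - p2) / (p1 * (q1 - p2)))
               * W2 z `^ (q1 / (q1 - q2))
          | z in `]t, +oo[%classic]
      * omega t)) `^ ((q1 - q2) / (q1 * q2)).

(* The inner integral of I_7 (at t = 0), I_8 and I_9. *)
Definition K (t : R) : \bar R :=
  \int[mu1]_(s in `]t, +oo[)
    (V t s `^ (q2 * (p1 - p2) / (p2 * (p1 - q2)))
     * W2 s `^ (q2 / (p1 - q2)) * w2 s `^ q2).

Definition I7 : \bar R :=
  (W1 0 `^ q1^-1)^-1 * K 0 `^ ((p1 - q2) / (p1 * q2)).

Definition I8 : \bar R :=
  ereal_sup
    [set (\int[mu1]_(s in `]0%R, t[) omega s) `^ ((q1 - p2) / (q1 * p2))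
         * K t `^ ((p1 - q2) / (p1 * q2))
    | t in `]0%R, +oo[%classic].

Definition I9 : \bar R :=
  (\int[mu1]_(t in `]0%R, +oo[)
     ((\int[mu1]_(s in `]0%R, t[) omega s)
        `^ (q1 * (q2 - p2) / (p2 * (q1 - q2)))
      * omega t
      * K t `^ (q1 * (p1 - q2) / (p1 * (q1 - q2)))))
  `^ ((q1 - q2) / (q1 * q2)).

Definition admissible : Prop :=
  [/\ space_weight v1 /\ space_weight v2,
      halfline_weight w1 /\ halfline_weight w2,
      forall t : R, (0 < t)%R -> tail q1 w1 t < +oo /\ tail q2 w2 t < +oo &
      forall t : R, (0 < t)%R -> 0 < J t < +oo].

End characteristics.

(* Main.v *)
(* Put p = p1/p2, a = q1/p2, b = q2/p2 and u = (v2/v1)^(p1 p2/(p1 - p2)). For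
   g = (|f| v2)^p2 and h = (|f| v1)^p1, Hoelder's inequality gives
   (int_S g)^p <= (int_S u)^(p-1) int_S h on every shell S, with equality for
   suitable f. Hence the embedding compares int G^b w2^q2 with
   (int F^(a/p) w1^q1)^(b/a), where G and F are the masses of g and h on B(0,t).

   Upper bounds: cut (x0, oo) where the tail of w1^q1 is halved. Inside a block
   the growth of G is controlled by a Hardy inequality, proved by cutting at the
   levels of G; the masses of the earlier blocks form a step function, to which
   the same Hardy inequality applies with exponents (a, b). The two
   contributions are bounded by the integrals I_3, ..., I_9, and x0 tends to 0.

   Lower bounds: test the inequality on finite sums of normalised functions
   supported in shells. When the tail of w1^q1 decreases geometrically along the
   inner radii, the norm of such a sum in the first space is comparable with a
   weighted sequence norm of the coefficients, and an optimal choice of the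
   coefficients yields the discrete forms of the I_k. *)
Require Import Defs.
From mathcomp Require Import all_boot all_order all_algebra.
From mathcomp Require Import all_classical all_reals all_analysis.
From mathcomp Require Import measurable_realfun.
From mathcomp Require Import ring lra.

Set Implicit Arguments.
Unset Strict Implicit.
Unset Printing Implicit Defensive.

Import Order.TTheory GRing.Theory Num.Theory.
Import numFieldNormedType.Exports.

Local Open Scope classical_set_scope.
Local Open Scope ring_scope.

(** * Powers and finite sums *)

Section real_inequalities.
Context {R : realType}.
Implicit Types (x y r s : R).

(** The hypothesis on [J] makes [V s t] finite for [0 < s] only; [V 0 t] and the total mass of
    [w1^q1] may be infinite. Hence the estimates live on [(x0, +oo)] with real-valued shells and
    tails, and [x0 = 0] is reached by monotone exhaustion. The link between blocks and integrals is
    the dual weight [W^(-a') w]: if the tail [W] is halved on a block, the dual mass of the block is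
    comparable with [W^(-1/(a-1))] at either end, and these values grow geometrically from block to
    block. So a block can be charged to the dual mass of the block before it. The first block has no
    predecessor: it is paid by [I_3] or [I_7] if the total mass is at most twice its tail, and by a
    block further left otherwise. No derivative is taken: integrals of powers of a tail are
    estimated at the point where half of the decrease has taken place. Each constant is produced
    before the weights are introduced, so the final [lam] depends on the parameters alone. *)

Lemma le_powR r x y : 0 <= r -> 0 <= x -> x <= y -> x `^ r <= y `^ r.
Proof.
by move=> r0 x0 xy; apply: ge0_ler_powR => //; rewrite nnegrE // (le_trans x0).
Qed.

Lemma le_powR_inv r x y : 0 < r -> 0 <= y -> x `^ r <= y `^ r -> x <= y.
Proof.
move=> r0 y0; apply: contraTT; rewrite -!ltNge => yx.
by apply: gt0_ltr_powR => //; rewrite nnegrE // (le_trans y0) // ltW.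
Qed.

Lemma powR_powK r s x : 0 <= x -> r * s = 1 -> (x `^ r) `^ s = x.
Proof. by move=> x0 rs; rewrite -powRrM rs powRr1. Qed.

Lemma powR_addr r s x : 0 < r + s -> x `^ (r + s) = x `^ r * x `^ s.
Proof. by move=> rs; rewrite powRD // gt_eqF. Qed.

Lemma powR_mul_self r x : 0 <= x -> 0 < r + 1 -> x * x `^ r = x `^ (r + 1).
Proof. by move=> x0 r1; rewrite powR_addr // powRr1 // mulrC. Qed.

Lemma powRM_powR (r s t x y : R) : (x `^ s * y `^ t) `^ r = x `^ (s * r) * y `^ (t * r).
Proof. by rewrite powRM ?powR_ge0 // -!powRrM. Qed.

(** Absorption: [Q] is a real number, hence finite, so [Q ^ s] can be divided out. This closes the
    duality arguments below, where an extremal test bounds [Q] by a smaller power of itself. *)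
Lemma ler_of_powR_mul (Q A s : R) :
  0 <= A -> 0 <= Q -> 0 < s -> s < 1 -> Q <= A * Q `^ s -> Q <= A `^ (1 - s)^-1.
Proof.
move=> A0 Q0 s0 s1; have [->|Qn0] := eqVneq Q 0; first by rewrite powR_ge0.
have Qp : 0 < Q by rewrite lt_def Qn0.
move=> h; have h1 : Q `^ (1 - s) <= A.
  rewrite powRD ?Qn0 ?implybT // powRr1 // powRN.
  by rewrite ler_pdivrMr ?powR_gt0.
rewrite -[X in X <= _](@powR_powK (1 - s) (1 - s)^-1) //; last first.
  by rewrite mulfV //; lra.
by apply: le_powR => //; rewrite ?invr_ge0 ?powR_ge0 //; lra.
Qed.

Lemma powR_add_le r x y : 0 < r -> 0 <= x -> 0 <= y ->
  (x + y) `^ r <= 2 `^ r * (x `^ r + y `^ r).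
Proof.
move=> r0; wlog xy : x y / x <= y => [hw x0 y0|x0 y0].
  have [xy|yx] := leP x y; first exact: hw.
  by rewrite addrC [x `^ r + _]addrC; apply: hw => //; exact: ltW.
apply: (@le_trans _ _ (2 `^ r * y `^ r)).
  by rewrite -powRM //; apply: le_powR; [exact: ltW|exact: addr_ge0|lra].
by rewrite ler_wpM2l ?powR_ge0 // lerDr powR_ge0.
Qed.

(** The factor of [y ^ r] may be as close to 1 as desired, unlike in [powR_add_le]; the recursion of
    [geometric_tail_sum] contracts because of this. If [x] is at most [e y], with
    [1 + e = l ^ (1/r)], the first term suffices; otherwise [y] is dominated by [x]. *)
Lemma powR_add_le_near r (l : R) : 0 < r -> 1 < l -> exists2 C : R, 0 < C &
  forall x y, 0 <= x -> 0 <= y -> (x + y) `^ r <= l * y `^ r + C * x `^ r.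
Proof.
move=> r0 l1; pose e := l `^ r^-1 - 1.
have l0 : 0 < l by apply: lt_trans l1.
have l0' := ltW l0.
have e0 : 0 < e.
  rewrite subr_gt0 (_ : 1 = 1 `^ r^-1); last by rewrite powR1.
  by apply: gt0_ltr_powR; rewrite ?invr_gt0 // nnegrE.
exists ((1 + e^-1) `^ r); first by rewrite powR_gt0 // addr_gt0 // invr_gt0.
move=> x y x0 y0; have [xy|yx] := leP x (e * y).
  apply: (@le_trans _ _ (l * y `^ r)).
    have -> : l * y `^ r = (l `^ r^-1 * y) `^ r.
      by rewrite powRM ?powR_ge0 // powR_powK // mulVf // gt_eqF.
    apply: le_powR; rewrite ?addr_ge0 //; first exact: ltW.
    by rewrite /e in xy; lra.
  by rewrite lerDl mulr_ge0 ?powR_ge0.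
have e1 : 0 <= 1 + e^-1 by rewrite addr_ge0 // invr_ge0 ltW.
apply: (@le_trans _ _ ((1 + e^-1) `^ r * x `^ r)).
  rewrite -powRM //; apply: le_powR.
  - exact: ltW.
  - exact: addr_ge0.
  - by rewrite mulrDl mul1r lerD2l mulrC ler_pdivlMr // mulrC ltW.
by rewrite lerDr mulr_ge0 ?powR_ge0 // ltW.
Qed.

Section finite_sums.
Variables (I : finType).
Implicit Types (P : pred I) (u v : I -> R).

(** Young's inequality for the terms divided by the two norms [a] and [b], summed up. *)
Lemma finite_holder_mul P u v p : 1 < p ->
  (forall i, 0 <= u i) -> (forall i, 0 <= v i) ->
  (\sum_(i | P i) u i * v i) `^ p <=
  (\sum_(i | P i) u i `^ (p / (p - 1))) `^ (p - 1) * \sum_(i | P i) v i `^ p.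
Proof.
move=> p1 u0 v0.
set A := \sum_(i | P i) u i `^ _; have AE : A = \sum_(i | P i) u i `^ (p / (p - 1)) by [].
clearbody A; set B := \sum_(i | P i) _ `^ p.
have BE : B = \sum_(i | P i) v i `^ p by []. clearbody B.
have p0 : 0 < p by lra.
have q0 : 0 < p / (p - 1) by rewrite divr_gt0 //; lra.
have A0 : 0 <= A by rewrite AE; apply: sumr_ge0 => i _; exact: powR_ge0.
have B0 : 0 <= B by rewrite BE; apply: sumr_ge0 => i _; exact: powR_ge0.
have z (r : R) (w : I -> R) : 0 < r -> (forall i, 0 <= w i) ->
    \sum_(i | P i) w i `^ r = 0 -> forall i, P i -> w i = 0.
  move=> r0 w0 /eqP; rewrite psumr_eq0 => [/allP h i Pi|i _]; last exact: powR_ge0.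
  have := h i (mem_index_enum i); rewrite Pi implyTb powR_eq0.
  by case/andP => /eqP.
(* The normalisation divides by both norms; if one of them is 0, all products vanish. *)
have [A00|An0] := eqVneq A 0.
  rewrite big1 ?powR0 ?gt_eqF ?mulr_ge0 ?powR_ge0 //.
  by move=> i Pi; rewrite (z _ _ q0 u0 (etrans (esym AE) A00)) ?mul0r.
have [B00|Bn0] := eqVneq B 0.
  rewrite big1 ?powR0 ?gt_eqF ?mulr_ge0 ?powR_ge0 //.
  by move=> i Pi; rewrite (z _ _ p0 v0 (etrans (esym BE) B00)) ?mulr0.
have Ap : 0 < A by rewrite lt_def An0.
have Bp : 0 < B by rewrite lt_def Bn0.
have pn0 : p != 0 by rewrite gt_eqF.
have p1n0 : p - 1 != 0 by rewrite gt_eqF // subr_gt0.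
have [a aE] : {a | a = A `^ ((p - 1) / p)} by exists (A `^ ((p - 1) / p)).
have [b bE] : {b | b = B `^ p^-1} by exists (B `^ p^-1).
have ap : 0 < a by rewrite aE powR_gt0.
have bp : 0 < b by rewrite bE powR_gt0.
have [ap' bp'] := (ltW ap, ltW bp).
have key : \sum_(i | P i) u i * v i <= a * b.
  have abp : 0 < a * b by exact: mulr_gt0.
  rewrite -[leRHS]mulr1 -(ler_pdivrMl _ _ abp).
  have -> : (a * b)^-1 * \sum_(i | P i) u i * v i =
      \sum_(i | P i) (u i / a) * (v i / b).
    rewrite mulr_sumr; apply: eq_bigr => i _; field.
    by rewrite (gt_eqF ap) (gt_eqF bp).
  apply: (@le_trans _ _ (\sum_(i | P i) ((u i `^ (p / (p - 1)) / A) / (p / (p - 1))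
      + (v i `^ p / B) / p))).
    apply: ler_sum => i _.
    apply: (le_trans (conjugate_powR (divr_ge0 (u0 i) ap')
      (divr_ge0 (v0 i) bp') q0 p0 _)).
      by field; rewrite p1n0 pn0.
    rewrite le_eqVlt; apply/orP; left; apply/eqP; congr (_ / _ + _ / _).
      rewrite powRM ?invr_ge0 // -(powR_inv1 ap') -powRrM mulN1r powRN.
      by rewrite aE powR_powK //; field; rewrite pn0 p1n0.
    rewrite powRM ?invr_ge0 // -(powR_inv1 bp') -powRrM mulN1r powRN.
    by rewrite bE powR_powK // mulVf.
  rewrite big_split /= -!mulr_suml -AE -BE !divff // !mul1r.
  by rewrite le_eqVlt; apply/orP; left; apply/eqP; field; rewrite p1n0 pn0.
apply: (@le_trans _ _ ((a * b) `^ p)).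
  apply: le_powR => //; first exact: ltW.
  by apply: sumr_ge0 => i _; exact: mulr_ge0.
rewrite powRM // bE powR_powK ?mulVf // aE -powRrM.
by rewrite divfK.
Qed.

(** The relation [w ^ p <= u ^ (p - 1) * v] is stable under addition, because
    [u ^ ((p - 1) / p) * v ^ (1 / p)] is superadditive by Hoelder's inequality. It carries
    inequalities for single blocks to unions of blocks. *)
Lemma finite_holder P (w u v : I -> R) p : 1 < p ->
  (forall i, 0 <= u i) -> (forall i, 0 <= v i) ->
  (forall i, P i -> 0 <= w i /\ w i `^ p <= u i `^ (p - 1) * v i) ->
  (\sum_(i | P i) w i) `^ p <= (\sum_(i | P i) u i) `^ (p - 1) * \sum_(i | P i) v i.
Proof.
move=> p1 u0 v0 hw.
have p0 : 0 < p by lra.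
have pn0 : p != 0 by rewrite gt_eqF //; lra.
have p1n0 : p - 1 != 0 by rewrite gt_eqF // subr_gt0.
apply: (@le_trans _ _ ((\sum_(i | P i) u i `^ ((p - 1) / p) * v i `^ p^-1) `^ p)).
  apply: le_powR; first exact: ltW.
    by apply: sumr_ge0 => i /hw[].
  apply: ler_sum => i /hw[w0 wle]; apply: (@le_powR_inv p) => //.
    by rewrite mulr_ge0 ?powR_ge0.
  rewrite powRM ?powR_ge0 // (powR_powK (v0 i)) ?mulVf // -powRrM.
  by rewrite divfK.
apply: le_trans.
  by apply: finite_holder_mul => // i; rewrite powR_ge0.
rewrite le_eqVlt; apply/orP; left; apply/eqP; congr (_ `^ _ * _).
  by apply: eq_bigr => i _; rewrite powR_powK //; field; rewrite p1n0 pn0.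
by apply: eq_bigr => i _; rewrite powR_powK // mulVf.
Qed.

Lemma finite_jensen P u v p : 1 < p ->
  (forall i, 0 <= u i) -> (forall i, 0 <= v i) ->
  (\sum_(i | P i) u i * v i) `^ p <=
  (\sum_(i | P i) u i) `^ (p - 1) * \sum_(i | P i) u i * v i `^ p.
Proof.
move=> p1 u0 v0; apply: finite_holder => // i; first by rewrite mulr_ge0 ?powR_ge0.
move=> _; split; first exact: mulr_ge0.
rewrite powRM // mulrA ler_wpM2r ?powR_ge0 // mulrC powR_mul_self //; last by lra.
by rewrite subrK.
Qed.

Lemma sum_powR_le P u r : 1 <= r -> (forall i, 0 <= u i) ->
  \sum_(i | P i) u i `^ r <= (\sum_(i | P i) u i) `^ r.
Proof.
move=> r1 u0; set S := \sum_(i | P i) u i.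
have S0 : 0 <= S by exact: sumr_ge0.
have -> : S `^ r = \sum_(i | P i) u i * S `^ (r - 1).
  by rewrite -mulr_suml powR_mul_self ?subrK //; lra.
apply: ler_sum => i Pi.
have -> : u i `^ r = u i * u i `^ (r - 1) by rewrite powR_mul_self ?subrK //; lra.
rewrite ler_wpM2l //; apply: le_powR => //; first by lra.
by rewrite /S (bigD1 i) //= lerDl sumr_ge0.
Qed.

(* The indices whose partial sum is at most half the total carry at most half
   of the mass: the largest of them has a partial sum containing them all. *)
Lemma half_sum P (z : I -> R) u r : 0 <= r -> (forall i, 0 <= u i) ->
  (forall i j, z j <= z i -> P i -> P j) ->
  (\sum_(i | P i) u i) `^ (r + 1) <=
  2 `^ (r + 1) * \sum_(i | P i) u i * (\sum_(j | z j <= z i) u j) `^ r.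
Proof.
move=> r0 u0 cP; set T := \sum_(i | P i) u i; set S := fun i => \sum_(j | z j <= z i) u j.
have T0 : 0 <= T by exact: sumr_ge0.
have S0 i : 0 <= S i by exact: sumr_ge0.
pose L i := P i && (S i < T / 2).
have half : \sum_(i | L i) u i <= T / 2.
  have [/existsP[i0 Li0]|/existsPn noL] := boolP [exists i, L i]; last first.
    rewrite big_pred0 ?divr_ge0 // => i; exact/negbTE/noL.
  case: (arg_maxP z Li0) => m /andP[Pm /ltW Sm] zm.
  apply: le_trans Sm; rewrite [leRHS](bigID L) /=.
  rewrite [X in _ <= X + _](_ : _ = \sum_(i | L i) u i); last first.
    by apply: eq_bigl => i; case Li: (L i); rewrite ?andbF // andbT; exact: zm.
  by rewrite lerDl sumr_ge0.
have other : T / 2 <= \sum_(i | P i && ~~ L i) u i.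
  have : T = \sum_(i | L i) u i + \sum_(i | P i && ~~ L i) u i.
    rewrite /T (bigID L) /=; congr (_ + _); apply: eq_bigl => i.
    by rewrite /L andbA andbb.
  by lra.
have h : (T / 2) * (T / 2) `^ r <= \sum_(i | P i) u i * S i `^ r.
  apply: (@le_trans _ _ (\sum_(i | P i && ~~ L i) u i * (T / 2) `^ r)).
    by rewrite -mulr_suml ler_wpM2r ?powR_ge0.
  rewrite [leRHS](bigID L) /= -[leLHS]add0r; apply: lerD.
    by apply: sumr_ge0 => i _; rewrite mulr_ge0 ?powR_ge0.
  apply: ler_sum => i /andP[Pi]; rewrite /L Pi /= -leNgt => h.
  by rewrite ler_wpM2l //; apply: le_powR => //; rewrite divr_ge0.
rewrite powR_mul_self ?divr_ge0 // in h; last by lra.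
have Te : T = 2 * (T / 2) by rewrite mulrC divfK.
by rewrite [in leLHS]Te powRM ?divr_ge0 // ler_wpM2l ?powR_ge0.
Qed.

(** [H] bounds the norm of the multiplication by [h] from l^a to l^b: this norm is the supremum of
    [h] if [a <= b], and its l^r norm with [1/r = 1/b - 1/a] if [b < a]. *)
Definition multiplier_bound (a b : R) (h : I -> R) (H : R) :=
  (a <= b -> forall i, h i <= H) /\
  (b < a -> \sum_i h i `^ (a * b / (a - b)) <= H `^ (a * b / (a - b))).

Lemma multiplier_le (a b : R) (h y : I -> R) (H : R) : 0 < a -> 0 < b -> 0 <= H ->
  (forall i, 0 <= h i) -> (forall i, 0 <= y i) -> multiplier_bound a b h H ->
  \sum_i (h i * y i) `^ b <= H `^ b * (\sum_i y i `^ a) `^ (b / a).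
Proof.
move=> a0 b0 H0 h0 y0 [hle hgt]; have [ab|ba] := leP a b.
  apply: (@le_trans _ _ (\sum_i H `^ b * (y i `^ a) `^ (b / a))).
    apply: ler_sum => i _; rewrite powRM // -[in leRHS]powRrM [a * _]mulrC divfK ?gt_eqF //.
    by rewrite ler_wpM2r ?powR_ge0 //; apply: le_powR => //; [exact: ltW|exact: hle].
  rewrite -mulr_sumr ler_wpM2l ?powR_ge0 //.
  by apply: sum_powR_le => [|i]; rewrite ?powR_ge0 // ler_pdivlMr // mul1r.
have abn : a - b != 0 by rewrite gt_eqF // subr_gt0.
have bn : b != 0 by rewrite gt_eqF.
have an : a != 0 by rewrite gt_eqF.
have e1 : 1 < a / b by rewrite ltr_pdivlMr // mul1r.
have ab1 : a / b * (b / a) = 1 by field; rewrite an bn.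
have S0 : 0 <= \sum_i (h i * y i) `^ b by apply: sumr_ge0 => i _; exact: powR_ge0.
(* Raised to the power [a / b > 1], the claim is Hoelder's inequality with this exponent. *)
rewrite -(powR_powK S0 ab1).
apply: (@le_trans _ _ ((H `^ (b * (a / b)) * \sum_i y i `^ a) `^ (b / a))).
  apply: le_powR; [by rewrite divr_ge0 // ltW|exact: powR_ge0|].
  apply: (@le_trans _ _ ((\sum_i h i `^ (a * b / (a - b))) `^ (a / b - 1)
      * \sum_i y i `^ a)).
    apply: finite_holder => // i; rewrite ?powR_ge0 // => _; split => //.
    rewrite -!powRrM powRM // [b * _]mulrC divfK // le_eqVlt; apply/orP; left.
    by apply/eqP; congr (_ `^ _ * _); field; rewrite abn bn.
  rewrite ler_wpM2r //; first by apply: sumr_ge0 => i _; exact: powR_ge0.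
  have -> : H `^ (b * (a / b)) = (H `^ (a * b / (a - b))) `^ (a / b - 1).
    by rewrite -powRrM; congr (_ `^ _); field; rewrite abn bn.
  apply: le_powR; [by lra| |exact: hgt].
  by apply: sumr_ge0 => i _; exact: powR_ge0.
rewrite powRM ?powR_ge0 //; last by apply: sumr_ge0 => i _; exact: powR_ge0.
by rewrite -powRrM -mulrA [a / b * _](_ : _ = 1) ?mulr1 //; field; rewrite an bn.
Qed.

(** The sequence [c = h ^ (b / (a - b))] is extremal: [(h c) ^ b] and [c ^ a] both equal
    [h ^ (a b / (a - b))], so the inequality bounds their sum by a smaller power of itself. *)
Lemma multiplier_sharp (a b : R) (h : I -> R) (D : R) : 0 < b -> b < a -> 0 <= D ->
  (forall i, 0 <= h i) ->
  (forall c : I -> R, (forall i, 0 <= c i) ->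
    \sum_i (h i * c i) `^ b <= D `^ b * (\sum_i c i `^ a) `^ (b / a)) ->
  \sum_i h i `^ (a * b / (a - b)) <= D `^ (a * b / (a - b)).
Proof.
move=> b0 ba D0 h0 hyp; have a0 : 0 < a by apply: lt_trans ba.
have abn : a - b != 0 by rewrite gt_eqF // subr_gt0.
have an : a != 0 by rewrite gt_eqF.
have E1 : \sum_i (h i * h i `^ (b / (a - b))) `^ b = \sum_i h i `^ (a * b / (a - b)).
  apply: eq_bigr => i _; rewrite powR_mul_self // -?powRrM.
    by congr (_ `^ _); field; rewrite abn.
  by rewrite addr_gt0 // divr_gt0 // subr_gt0.
have E2 : \sum_i (h i `^ (b / (a - b))) `^ a = \sum_i h i `^ (a * b / (a - b)).
  by apply: eq_bigr => i _; rewrite -powRrM; congr (_ `^ _); field; rewrite abn.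
have := hyp (fun i => h i `^ (b / (a - b))) (fun i => powR_ge0 _ _).
rewrite [leLHS]E1 E2.
move=> /ler_of_powR_mul hQ; apply: le_trans.
  apply: hQ.
  - exact: powR_ge0.
  - by apply: sumr_ge0 => i _; exact: powR_ge0.
  - by rewrite divr_gt0.
  - by rewrite ltr_pdivrMr // mul1r.
by rewrite -powRrM le_eqVlt; apply/orP; left; apply/eqP; congr (_ `^ _); field; rewrite an abn.
Qed.

End finite_sums.

(** A discrete Hardy inequality: against geometrically growing weights, tail sums are no larger than
    single terms. Since [A i = y i + A i.+1], a shift of the index gives [T <= (l / L) T + C Y], and
    [l < L] lets the first term be absorbed. *)
Lemma geometric_tail_sum r (L : R) : 0 < r -> 1 < L -> exists2 C : R, 0 < C &
  forall (n : nat) (y : nat -> R), (forall i, 0 <= y i) ->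
  \sum_(0 <= i < n) L ^+ i * (\sum_(i <= j < n) y j) `^ r <=
  C * \sum_(0 <= i < n) L ^+ i * y i `^ r.
Proof.
move=> r0 L1; pose l := (1 + L) / 2.
have l1 : 1 < l by rewrite /l; lra.
have lL : l < L by rewrite /l; lra.
have L0 : 0 < L by lra.
have [C C0 hC] := powR_add_le_near r0 l1.
exists (C / (1 - l / L)).
  by rewrite divr_gt0 // subr_gt0 ltr_pdivrMr // mul1r.
move=> n y y0; set Y := \sum_(0 <= i < n) _ * y _ `^ _.
pose A i := \sum_(i <= j < n) y j.
set T := \sum_(0 <= i < n) _.
have A0 i : 0 <= A i by apply: sumr_ge0.
have T1 : T <= \sum_(0 <= i < n) L ^+ i * (l * A i.+1 `^ r + C * y i `^ r).
  rewrite /T !big_nat; apply: ler_sum => i /andP[_ ik].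
  rewrite ler_wpM2l ?exprn_ge0 ?(ltW L0) // big_ltn //; apply: hC => //; exact: A0.
have T2 : \sum_(0 <= i < n) L ^+ i * (l * A i.+1 `^ r + C * y i `^ r) =
    l / L * \sum_(0 <= i < n) L ^+ i.+1 * A i.+1 `^ r + C * Y.
  rewrite !mulr_sumr -big_split /=; apply: eq_bigr => i _; rewrite exprS.
  by field; rewrite gt_eqF.
have T3 : \sum_(0 <= i < n) L ^+ i.+1 * A i.+1 `^ r <= T.
  case: n @A A0 @T @Y T1 T2 => [|n] A A0 T Y _ _; first by rewrite /T !big_geq.
  rewrite big_nat_recr //= /T [leRHS]big_nat_recl //=.
  rewrite [A n.+1]big_geq // powR0 ?gt_eqF // mulr0 addr0.
  by rewrite lerDr mulr_ge0 ?powR_ge0 ?expr0.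
have q0 : 0 < 1 - l / L by rewrite subr_gt0 ltr_pdivrMr // mul1r.
rewrite mulrAC ler_pdivlMr //.
have : l / L * \sum_(0 <= i < n) L ^+ i.+1 * A i.+1 `^ r <= l / L * T.
  by rewrite ler_wpM2l // divr_ge0 //; lra.
by lra.
Qed.

End real_inequalities.

(** * Integrals over half-lines and tails of a weight *)

Section half_line_integrals.
Context {R : realType}.
Local Notation mu1 := (@completed_lebesgue_measure R).
Implicit Types (c s t : R) (b : itv_bound R).

Lemma measurable_realR (A : set R) : measurable (A : set (measurableTypeR R)) ->
  measurable (A : set (realR R)).
Proof. by move=> mA; exact: sub_caratheodory. Qed.

Lemma measurable_itvR (i : interval R) : measurable ([set` i] : set (realR R)).
Proof. by apply: measurable_realR; exact: measurable_itv. Qed.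
Hint Resolve measurable_itvR : core.

(** The preimage of a ray is an interval. Tails, shells and ball masses are monotone in the radius,
    which is how their measurability is obtained. *)
Lemma measurable_homo (f : R -> \bar R) : {homo f : s t / s <= t >-> (s <= t)%E} ->
  measurable_fun setT (f : realR R -> \bar R).
Proof.
move=> hf; apply: (measurability _ (ErealGenOInfty.measurableE R)).
move=> _ [_ [r ->] <-]; rewrite setTI; apply: measurable_realR.
apply: is_interval_measurable => x y /=.
rewrite !in_itv/= !andbT => fx _ z /andP[xz _].
by rewrite in_itv/= andbT (lt_le_trans fx) // hf.
Qed.

Lemma measurable_antihomo (f : R -> \bar R) :
  {homo f : s t / s <= t >-> (t <= s)%E} ->
  measurable_fun setT (f : realR R -> \bar R).
Proof.
move=> hf; apply: (measurability _ (ErealGenOInfty.measurableE R)).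
move=> _ [_ [r ->] <-]; rewrite setTI; apply: measurable_realR.
apply: is_interval_measurable => x y /=.
rewrite !in_itv/= !andbT => _ fy z /andP[_ zy].
by rewrite in_itv/= andbT (lt_le_trans fy) // hf.
Qed.

(** Monotone convergence in the form used for all limits: a bound on each set of an exhaustion
    passes to the union, so no limit has to be identified. *)
Lemma integral_bigcup_le d (T : measurableType d) (mu : {measure set T -> \bar R})
    (A : nat -> set T) (f : T -> \bar R) (M : \bar R) :
  (forall m n, (m <= n)%N -> A m `<=` A n) -> (forall n, measurable (A n)) ->
  measurable_fun (\bigcup_n A n) f -> (forall x, 0 <= f x)%E ->
  (forall n, \int[mu]_(x in A n) f x <= M)%E ->
  (\int[mu]_(x in \bigcup_n A n) f x <= M)%E.
Proof.
move=> ndA mA mf f0 hM.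
have h : (\int[mu]_(x in A n) f x)%E @[n --> \oo] -->
    (\int[mu]_(x in \bigcup_n A n) f x)%E.
  apply: ge0_nondecreasing_set_cvg_integral => //.
  - by move=> m n mn; apply/subsetPset; exact: ndA.
  - move=> i; apply: measurable_funS mf => //; first exact: bigcup_measurable.
    exact: bigcup_sup.
rewrite -(cvg_lim _ h) //; apply: lime_le; first by apply/cvg_ex; eexists; exact: h.
by apply: nearW.
Qed.

Lemma integral_pt (f : realR R -> \bar R) t : measurable_fun setT f ->
  (\int[mu1]_(x in [set t]) f x = 0)%E.
Proof.
move=> mf; apply: null_set_integral.
- by apply: measurable_realR; exact: measurable_set1.
- by apply: measurable_funTS.
- exact: (@lebesgue_measure_set1 R t).
Qed.

Section nonnegative.
Variables (f : realR R -> \bar R).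
Hypotheses (mf : measurable_fun setT f) (f0 : forall x, (0 <= f x)%E).

(** The pieces are open at [t]; the lost point is null, so the formula is exact. *)
Lemma integral_itv_split s t b : s <= t -> (BRight t <= b)%O ->
  (\int[mu1]_(x in [set` Interval (BRight s) b]) f x =
   \int[mu1]_(x in `]s, t[) f x + \int[mu1]_(x in [set` Interval (BRight t) b]) f x)%E.
Proof.
move=> st tb.
rewrite (@itv_bndbnd_setU _ _ (BRight s) (BRight t) b) // ge0_integral_setU //; last 2 first.
- by apply: measurable_funTS.
- apply/disj_setPS => x /= []; rewrite !itv_boundlr => /andP[_ +] /andP[+ _].
  by rewrite !bnd_simp => xt tx; have := le_lt_trans xt tx; rewrite ltxx.
congr (_ + _)%E; have [->|] := eqVneq s t.
  by rewrite !set_itv_ge //= ?bnd_simp ?ltxx // -leNgt.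
move=> sNt; have {}st : s < t by rewrite lt_neqAle sNt.
rewrite (_ : [set` `]s, t]] = [set` `]s, t[] `|` [set t]); last first.
  by rewrite -(@setUitv1 _ _ _ _ true) // bnd_simp.
rewrite ge0_integral_setU //; last 3 first.
- by apply: measurable_realR; exact: measurable_set1.
- by apply: measurable_funTS.
- by apply/disj_setPS => x /= [] + xt; rewrite xt in_itv/= ltxx andbF.
by rewrite integral_pt // adde0.
Qed.

Lemma integral_itv_split_oo c s t : c <= s -> s <= t ->
  (\int[mu1]_(x in `]c, t[) f x =
   \int[mu1]_(x in `]c, s[) f x + \int[mu1]_(x in `]s, t[) f x)%E.
Proof.
move=> cs; rewrite le_eqVlt => /predU1P[->|st].
  by rewrite [in X in (_ + X)%E]set_itv_ge ?bnd_simp ?ltxx // integral_set0 adde0.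
by apply: integral_itv_split => //; rewrite bnd_simp.
Qed.

Lemma integral_itv_sum (x : nat -> R) n : (forall i, x i <= x i.+1) ->
  (\int[mu1]_(y in `]x 0%N, x n[) f y = \sum_(i < n) \int[mu1]_(y in `]x i, x i.+1[) f y)%E.
Proof.
move=> xS; have x0 m : x 0%N <= x m by elim: m => // m; move/le_trans; apply.
elim: n => [|n IH]; first by rewrite big_ord0 set_itv_ge ?bnd_simp ?ltxx // integral_set0.
by rewrite big_ord_recr /= -IH; exact: integral_itv_split_oo.
Qed.

Lemma integral_itv_sum_down (x : nat -> R) n : (forall i, x i.+1 <= x i) ->
  (\int[mu1]_(y in `]x n, x 0%N[) f y = \sum_(i < n) \int[mu1]_(y in `]x i.+1, x i[) f y)%E.
Proof.
move=> xS; have x0 m : x m <= x 0%N.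
  by elim: m => // m; apply: le_trans.
elim: n => [|n IH]; first by rewrite big_ord0 set_itv_ge ?bnd_simp ?ltxx // integral_set0.
by rewrite big_ord_recr /= -IH addeC; exact: integral_itv_split_oo.
Qed.

Lemma integral_itv_subset (i j : interval R) : [set` i] `<=` [set` j] ->
  (\int[mu1]_(x in [set` i]) f x <= \int[mu1]_(x in [set` j]) f x)%E.
Proof.
by move=> ij; apply: ge0_subset_integral => //; apply: measurable_funTS.
Qed.

Lemma integral_itv_left_le c b (M : \bar R) : (0 <= M)%E ->
  (forall s, c < s -> (BRight s < b)%O ->
     (\int[mu1]_(x in [set` Interval (BRight s) b]) f x <= M)%E) ->
  (\int[mu1]_(x in [set` Interval (BRight c) b]) f x <= M)%E.
Proof.
move=> M0 hM; pose A n := [set` Interval (BRight (c + n.+1%:R^-1)) b].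
rewrite (_ : [set` Interval (BRight c) b] = \bigcup_n A n).
  apply: integral_bigcup_le => //.
  - move=> m n mn x; rewrite /A /= !itv_boundlr => /andP[h ->]; rewrite andbT.
    apply: le_trans h; rewrite bnd_simp lerD2l lef_pV2 ?posrE //.
    by rewrite ler_nat ltnS.
  - by move=> n; exact: measurable_itvR.
  - by apply: measurable_funTS.
  (* The first sets of the exhaustion may be empty; for these [0 <= M] is used. *)
  - move=> n; rewrite /A; case: (ltP (BRight (c + n.+1%:R^-1)) b) => hb.
      by apply: hM => //; rewrite ltrDl.
    by rewrite set_itv_ge ?integral_set0 // -leNgt.
apply/seteqP; split => x /=.
  rewrite itv_boundlr => /andP[cx xb].
  have {}cx : 0 < x - c by rewrite subr_gt0; move: cx; rewrite bnd_simp.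
  have [n _ hn] := near_infty_natSinv_lt (PosNum cx).
  exists n => //; rewrite /A /= itv_boundlr xb andbT bnd_simp.
  by have := hn n (leqnn n); rewrite /= ltrBrDl.
case=> n _; rewrite /A /= !itv_boundlr => /andP[h ->]; rewrite andbT.
by apply: le_trans h; rewrite bnd_simp lerDl.
Qed.

Lemma integral_itv_right_le c t (M : \bar R) :
  (forall s, s < t -> (\int[mu1]_(x in `]c, s[) f x <= M)%E) ->
  (\int[mu1]_(x in `]c, t[) f x <= M)%E.
Proof.
move=> hM; pose A n := `]c, (t - n.+1%:R^-1)%R[%classic.
rewrite (_ : `]c, t[%classic = \bigcup_n A n).
  apply: integral_bigcup_le => //.
  - move=> m n mn x; rewrite /A /= !in_itv/= => /andP[-> h] /=.
    apply: lt_le_trans h _; rewrite lerD2l lerN2 lef_pV2 ?posrE //.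
    by rewrite ler_nat ltnS.
  - by move=> n; exact: measurable_itvR.
  - by apply: measurable_funTS.
  - by move=> n; apply: hM; rewrite ltrBlDr ltrDl.
apply/seteqP; split => x /=.
  rewrite in_itv/= => /andP[cx xt].
  have {}xt : 0 < t - x by rewrite subr_gt0.
  have [n _ hn] := near_infty_natSinv_lt (PosNum xt).
  exists n => //; rewrite /A /= in_itv/= cx /=.
  by have := hn n (leqnn n); rewrite /= ltrBrDl ltrBrDr addrC.
case=> n _; rewrite /A /= !in_itv/= => /andP[-> h] /=.
by apply: lt_trans h _; rewrite ltrBlDr ltrDl.
Qed.

Lemma integral_itv_infty_le c (M : \bar R) :
  (forall t, c < t -> (\int[mu1]_(x in `]c, t[) f x <= M)%E) ->
  (\int[mu1]_(x in `]c, +oo[) f x <= M)%E.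
Proof.
move=> hM; pose A n := `]c, (c + n.+1%:R)%R[%classic.
rewrite (_ : `]c, +oo[%classic = \bigcup_n A n).
  apply: integral_bigcup_le => //.
  - move=> m n mn x; rewrite /A /= !in_itv/= => /andP[-> h] /=.
    by apply: lt_le_trans h _; rewrite lerD2l ler_nat ltnS.
  - by move=> n; exact: measurable_itvR.
  - by apply: measurable_funTS.
  - by move=> n; apply: hM; rewrite ltrDl.
apply/seteqP; split => x /=.
  rewrite in_itv/= andbT => cx; exists (Num.truncn (x - c)) => //.
  rewrite /A /= in_itv/= cx /= -ltrBlDl; exact: truncnS_gt.
by case=> n _; rewrite /A /= !in_itv/= => /andP[-> _].
Qed.

End nonnegative.

Section weighted.
Variables (w : realR R -> \bar R).
Hypotheses (mw : measurable_fun setT w) (w0 : forall x, (0 <= w x)%E).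

Lemma integral_weighted_le (i : interval R) (X : realR R -> R) (k : R) :
  measurable_fun setT X -> (forall x, 0 <= X x) -> (forall x, x \in i -> X x <= k) ->
  (\int[mu1]_(x in [set` i]) ((X x)%:E * w x) <=
   k%:E * \int[mu1]_(x in [set` i]) w x)%E.
Proof.
move=> mX X0 Xk; have [[x xi]|ni] := pselect (exists x, x \in i); last first.
  rewrite (_ : [set` i] = set0) ?integral_set0 ?mule0 //.
  by apply/seteqP; split => // x xi; apply: ni; exists x.
rewrite -ge0_integralZl //; last 2 first.
- by apply: measurable_funTS.
- by rewrite lee_fin (le_trans (X0 x)) // Xk.
apply: ge0_le_integral; first exact: measurable_itvR.
- by move=> y _; rewrite mule_ge0 // lee_fin.
- apply: measurable_funTS; apply: emeasurable_funM; [exact/measurable_EFinP|exact: mw].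
- apply: measurable_funTS; apply: emeasurable_funM; [exact: measurable_cst|exact: mw].
- by move=> y yi; rewrite lee_wpmul2r // lee_fin Xk.
Qed.

Lemma integral_weighted_ge (i : interval R) (X : realR R -> R) (k : R) : 0 <= k ->
  measurable_fun setT X -> (forall x, 0 <= X x) -> (forall x, x \in i -> k <= X x) ->
  (k%:E * \int[mu1]_(x in [set` i]) w x <=
   \int[mu1]_(x in [set` i]) ((X x)%:E * w x))%E.
Proof.
move=> k0 mX X0 Xk; rewrite -ge0_integralZl //; last by apply: measurable_funTS.
apply: ge0_le_integral; first exact: measurable_itvR.
- by move=> y _; rewrite mule_ge0.
- apply: measurable_funTS; apply: emeasurable_funM; [exact: measurable_cst|exact: mw].
- apply: measurable_funTS; apply: emeasurable_funM; [exact/measurable_EFinP|exact: mw].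
- by move=> y yi; rewrite lee_wpmul2r // lee_fin Xk.
Qed.

End weighted.

End half_line_integrals.
#[export] Hint Resolve measurable_itvR : core.

(** Continuity is encoded by one-sided order bounds because these are what monotone convergence of
    integrals yields directly. The point is the supremum of the sublevel set of [y]. *)
Lemma monotone_ivt (R : realType) (f : R -> R) (s t y : R) : s <= t ->
  (forall x z, s <= x -> x <= z -> z <= t -> f x <= f z) ->
  (forall x M, s < x -> x <= t -> (forall z, s <= z -> z < x -> f z <= M) -> f x <= M) ->
  (forall x M, s <= x -> x < t -> (forall z, x < z -> z <= t -> M <= f z) -> M <= f x) ->
  f s <= y -> y <= f t -> exists2 x, s <= x <= t & f x = y.
Proof.
move=> st fh fl fr fs ft; pose A := [set x | s <= x <= t /\ f x <= y].
have As : A s by split; rewrite ?lexx.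
have hA : has_sup A by split; [exists s|exists t => x [/andP[]]].
have sx : s <= sup A by exact: sup_upper_bound.
have xt : sup A <= t by apply: ge_sup; [exists s|move=> x [/andP[]]].
have lo z : s <= z -> z < sup A -> f z <= y.
  move=> sz /sup_gt -/(_ (ex_intro _ s As)) [x [/andP[sx' xt'] fx] zx].
  by apply: le_trans fx; apply: fh => //; exact: ltW.
have hi z : sup A < z -> z <= t -> y <= f z.
  move=> zA zt; rewrite leNgt; apply/negP => fz.
  have : z <= sup A.
    by apply: sup_upper_bound => //; split; [rewrite zt (le_trans sx) // ltW|exact: ltW].
  by rewrite leNgt zA.
exists (sup A); first by rewrite sx.
apply/eqP; rewrite eq_le; apply/andP; split.
  move: (sx); rewrite [s <= _]le_eqVlt => /predU1P[<- //|{}sx].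
  by apply: fl => // z sz zx; exact: lo.
move: (xt); rewrite [_ <= t]le_eqVlt => /predU1P[-> //|{}xt].
by apply: fr => // z zx zt; exact: hi.
Qed.

Section tails.
Context {R : realType}.
Local Notation mu1 := (@completed_lebesgue_measure R).

Definition tail_int (w : realR R -> \bar R) (s : R) : \bar R :=
  (\int[mu1]_(x in `]s, +oo[) w x)%E.

Definition rtail (w : realR R -> \bar R) (s : R) : R := fine (tail_int w s).

(** Strict positivity allows division by tails; finiteness is asked at positive radii only, since
    the total mass may be infinite. *)
Definition tail_weight (w : realR R -> \bar R) : Prop :=
  [/\ measurable_fun setT w, (forall x, (0 <= w x)%E) &
      forall s : R, 0 < s -> (0 < tail_int w s < +oo)%E].

Variable w : realR R -> \bar R.
Hypothesis hw : tail_weight w.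
Local Notation W := (rtail w).

Let mw : measurable_fun setT w. Proof. by case: hw. Qed.
Let w0 x : (0 <= w x)%E. Proof. by case: hw. Qed.

Lemma tail_int_anti (s t : R) : s <= t -> (tail_int w t <= tail_int w s)%E.
Proof.
move=> st; apply: integral_itv_subset => // x /=; rewrite !in_itv/= !andbT.
exact: le_lt_trans.
Qed.

Lemma rtailE (s : R) : 0 < s -> tail_int w s = (W s)%:E.
Proof.
move=> s0; have [_ _ /(_ s s0)/andP[h1 h2]] := hw.
by rewrite fineK // ge0_fin_numE // ltW.
Qed.

Lemma rtail_gt0 (s : R) : 0 < s -> 0 < W s.
Proof.
by move=> s0; have [_ _ /(_ s s0)/andP[h1 _]] := hw; rewrite -lte_fin -rtailE.
Qed.

Lemma rtail_ge0 (s : R) : 0 <= W s.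
Proof. by rewrite fine_ge0 // integral_ge0. Qed.

Lemma rtail_anti (s t : R) : 0 < s -> s <= t -> W t <= W s.
Proof.
move=> s0 st; rewrite -lee_fin -!rtailE // ?(lt_le_trans s0) //.
exact: tail_int_anti.
Qed.

Lemma rtail_int (s t : R) : 0 < s -> s <= t ->
  (\int[mu1]_(x in `]s, t[) w x = (W s - W t)%:E)%E.
Proof.
move=> s0 st; have t0 : 0 < t by exact: lt_le_trans st.
have h : tail_int w s = (\int[mu1]_(x in `]s, t[) w x + tail_int w t)%E.
  exact: integral_itv_split.
by rewrite EFinB -!rtailE // h addeK // rtailE.
Qed.

Lemma measurable_rtail : measurable_fun setT (W : realR R -> R).
Proof.
apply: (@measurableT_comp _ _ _ _ _ _ fine); first exact: fine_measurable.
by apply: measurable_antihomo => s t; exact: tail_int_anti.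
Qed.

(** Continuity from the right in the form asked by [monotone_ivt]: the integral from [c] is the
    supremum of the integrals from [s > c]. *)
Lemma rtail_right_le (c d M : R) : 0 < c -> c < d ->
  (forall t, c < t -> t < d -> W t <= M) -> W c <= M.
Proof.
move=> c0 cd hM.
have M0 : 0 <= M.
  have m1 : c < (c + d) / 2 by lra.
  have m2 : (c + d) / 2 < d by lra.
  by apply: le_trans (hM _ m1 m2); exact: rtail_ge0.
rewrite -lee_fin -rtailE //; apply: integral_itv_left_le => // s cs _.
have s0 : 0 < s by exact: lt_trans cs.
have [sd|ds] := ltP s d; first by rewrite [leLHS]rtailE // lee_fin hM.
have cm : c < (c + d) / 2 by lra.
have md : (c + d) / 2 < d by lra.
rewrite [leLHS]rtailE // lee_fin; apply: le_trans (hM _ cm md).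
by apply: rtail_anti; lra.
Qed.

Lemma rtail_left_ge (c d M : R) : 0 < c -> c < d ->
  (forall t, c < t -> t < d -> M <= W t) -> M <= W d.
Proof.
move=> c0 cd hM.
have : (\int[mu1]_(x in `]c, d[) w x <= (W c - M)%:E)%E.
  apply: integral_itv_right_le => // s sd.
  have [cs|sc] := ltP c s; last first.
    rewrite set_itv_ge ?bnd_simp -?leNgt // integral_set0 lee_fin subr_ge0.
    have cm : c < (c + d) / 2 by lra.
    have md : (c + d) / 2 < d by lra.
    by apply: le_trans (hM _ cm md) _; apply: rtail_anti; lra.
  by rewrite (rtail_int c0 (ltW cs)) lee_fin lerD2l lerN2 hM.
by rewrite (rtail_int c0 (ltW cd)) lee_fin lerD2l lerN2.
Qed.

Lemma rtail_ivt (s t y : R) : 0 < s -> s <= t -> W t <= y -> y <= W s ->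
  exists2 x, s <= x <= t & W x = y.
Proof.
move=> s0 st ty ys.
have [x xst] : exists2 x, s <= x <= t & - W x = - y.
  apply: (@monotone_ivt R (fun x => - W x)) => //; rewrite ?lerN2 //.
  - by move=> x z sx xz zt; rewrite lerN2; apply: rtail_anti => //; lra.
  - move=> x M sx xt h; rewrite lerNl; apply: (@rtail_left_ge s) => // z sz zx.
    by rewrite lerNl; apply: h => //; exact: ltW.
  - move=> x M sx xt h; rewrite lerNr.
    apply: (@rtail_right_le x t) => //; first exact: lt_le_trans sx.
    by move=> z xz zt; rewrite lerNr; apply: h => //; exact: ltW.
by move=> /oppr_inj <-; exists x.
Qed.

(** Were the tail above [y] everywhere, all integrals from [s] would stay below [W s - y], and so
    would their supremum [W s]. *)
Lemma rtail_vanish (s y : R) : 0 < s -> 0 < y -> exists2 t, s <= t & W t <= y.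
Proof.
move=> s0 y0; apply: contrapT => h.
have : (tail_int w s <= (W s - y)%:E)%E.
  apply: integral_itv_infty_le => // t st.
  rewrite rtail_int // ?(ltW st) // lee_fin lerD2l lerN2 leNgt; apply/negP => yt.
  by apply: h; exists t; exact: ltW.
by rewrite rtailE // lee_fin; lra.
Qed.

Lemma rtail_ivt_right (s y : R) : 0 < s -> 0 < y -> y <= W s ->
  exists2 t, s <= t & W t = y.
Proof.
move=> s0 y0 ys; have [t st ty] := rtail_vanish s0 y0.
by have [x /andP[sx _] <-] := rtail_ivt s0 st ty ys; exists x.
Qed.

(** The total mass is compared in the extended reals because it may be infinite; it is the supremum
    of the tails, so some tail reaches [y]. *)
Lemma rtail_ivt_left (s y : R) : 0 < s -> W s <= y -> (y%:E < tail_int w 0)%E ->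
  exists2 t, 0 < t <= s & W t = y.
Proof.
move=> s0 sy y0.
have [t t0 ty] : exists2 t, 0 < t & y <= W t.
  apply: contrapT => h; have : (tail_int w 0 <= y%:E)%E.
    apply: integral_itv_left_le => //.
      by rewrite lee_fin (le_trans _ sy) // rtail_ge0.
    move=> t t0 _; rewrite [leLHS]rtailE // lee_fin leNgt; apply/negP => yt.
    by apply: h; exists t => //; exact: ltW.
  by rewrite leNgt y0.
have [ts|st] := leP t s.
  have [x /andP[tx xs] <-] := rtail_ivt t0 ts sy ty.
  by exists x => //; rewrite xs (lt_le_trans t0).
exists s; first by rewrite s0 lexx.
by apply/eqP; rewrite eq_le sy (le_trans ty) // rtail_anti // ltW.
Qed.

Lemma rtail_split_half (c d : R) : 0 < c -> c <= d ->
  exists2 u, c <= u <= d & W u = (W c + W d) / 2.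
Proof.
move=> c0 cd; apply: rtail_ivt => //; have := rtail_anti c0 cd; lra.
Qed.

Lemma measurable_powR_rtail r : measurable_fun setT (fun t : realR R => W t `^ r).
Proof.
apply: (@measurableT_comp _ _ _ _ _ _ (fun x => x `^ r)); last exact: measurable_rtail.
exact: measurable_powR.
Qed.

(** Substitute for integrating the derivative of [W ^ r]. Up to the point [u] where half of the
    decrease has taken place, [W] is at least [(W c - W d) / 2], and the mass of [(c, u)] equals the
    same number. *)
Lemma powR_rtail_le (c d r : R) : 1 <= r -> 0 < c -> c <= d ->
  (((W c - W d) `^ r)%:E <=
   (2 `^ r)%:E * \int[mu1]_(t in `]c, d[) ((W t `^ (r - 1))%:E * w t))%E.
Proof.
move=> r1 c0 cd; have [u /andP[cu ud] uE] := rtail_split_half c0 cd.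
have u0 : 0 < u by exact: lt_le_trans cu.
have Wcd := rtail_anti c0 cd; have Wd := rtail_ge0 d.
apply: (@le_trans _ _ ((2 `^ r)%:E * ((W u `^ (r - 1))%:E * (W c - W u)%:E))%E).
  rewrite -!EFinM lee_fin uE.
  have -> : W c - (W c + W d) / 2 = (W c - W d) / 2 by lra.
  have -> : (W c - W d) `^ r = 2 `^ r * (((W c - W d) / 2) `^ (r - 1) * ((W c - W d) / 2)).
    rewrite [X in _ * X]mulrC powR_mul_self ?subrK; [|lra..].
    by rewrite -powRM; [congr (_ `^ _); lra|lra..].
  rewrite ler_wpM2l ?powR_ge0 // ler_wpM2r //; first by lra.
  by apply: le_powR; lra.
rewrite lee_wpmul2l ?lee_fin ?powR_ge0 // -rtail_int //.
apply: (@le_trans _ _ (\int[mu1]_(t in `]c, u[) ((W t `^ (r - 1))%:E * w t))%E).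
  apply: (integral_weighted_ge mw w0); first exact: powR_ge0.
  - exact: measurable_powR_rtail.
  - by move=> x; exact: powR_ge0.
  - move=> x; rewrite in_itv/= => /andP[cx xu].
    apply: le_powR; [lra|exact: rtail_ge0|].
    by apply: rtail_anti; [exact: lt_trans cx|exact: ltW].
apply: integral_itv_subset.
- apply: emeasurable_funM; last exact: mw.
  by apply/measurable_EFinP; exact: measurable_powR_rtail.
- by move=> x; rewrite mule_ge0 // lee_fin powR_ge0.
- by move=> x /=; rewrite !in_itv/= => /andP[-> xu]; exact: lt_le_trans ud.
Qed.

Lemma powR_rtail_infty_le (c r : R) : 1 <= r -> 0 < c ->
  (((W c) `^ r)%:E <=
   (4 `^ r)%:E * \int[mu1]_(t in `]c, +oo[) ((W t `^ (r - 1))%:E * w t))%E.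
Proof.
move=> r1 c0; have Wc := rtail_gt0 c0.
(* Stopping where the tail is halved gives [W c = 2 (W c - W d)], which accounts for the second
   factor [2 ^ r]. *)
have [d cd dE] : exists2 d, c <= d & W d = W c / 2.
  by apply: rtail_ivt_right => //; lra.
apply: (@le_trans _ _ ((2 `^ r)%:E * ((W c - W d) `^ r)%:E)%E).
  rewrite -EFinM lee_fin -powRM //; last by lra.
  by apply: le_powR; lra.
apply: (@le_trans _ _ ((2 `^ r)%:E * ((2 `^ r)%:E * \int[mu1]_(t in `]c, d[) ((W t `^ (r - 1))%:E * w t)))%E).
  by rewrite lee_wpmul2l ?lee_fin ?powR_ge0 // powR_rtail_le.
rewrite muleA -EFinM -powRM //.
rewrite (_ : 2 * 2 = 4) ?lee_wpmul2l ?lee_fin ?powR_ge0 //; last by lra.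
apply: integral_itv_subset.
- apply: emeasurable_funM; last exact: mw.
  by apply/measurable_EFinP; exact: measurable_powR_rtail.
- by move=> x; rewrite mule_ge0 // lee_fin powR_ge0.
- by move=> x /=; rewrite !in_itv/= => /andP[->].
Qed.

Lemma int_powR_rtail_le (c r : R) : 1 <= r -> 0 < c ->
  (\int[mu1]_(t in `]c, +oo[) ((W t `^ (r - 1))%:E * w t) <= ((W c) `^ r)%:E)%E.
Proof.
move=> r1 c0.
apply: (@le_trans _ _ ((W c `^ (r - 1))%:E * tail_int w c)%E).
  apply: (integral_weighted_le mw w0).
  - exact: measurable_powR_rtail.
  - by move=> x; exact: powR_ge0.
  - move=> x; rewrite in_itv/= andbT => cx.
    apply: le_powR; [lra|exact: rtail_ge0|].
    by apply: rtail_anti => //; exact: ltW.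
rewrite rtailE // -EFinM lee_fin mulrC powR_mul_self ?subrK ?rtail_ge0 //.
by lra.
Qed.

End tails.

(** * Hardy's inequality *)

Section hardy.
Context {R : realType}.
Local Notation mu1 := (@completed_lebesgue_measure R).

(** The interval is cut where [G] crosses the levels [gm / 2 ^ k]. Neighbouring levels leave no gap,
    but a point of the k-th block and a point below level [k + 2] differ in [G] by at least a
    quarter of [gm / 2 ^ k]. So each block sees an increment of [F] across two levels of definite
    size. *)
Lemma hardy_levels (e c d gm Fm : R) (G U F : R -> R) : 0 < e -> c <= d -> 0 < gm -> 0 <= Fm ->
  (forall t, t \in `]c, d[ -> [/\ 0 <= G t, G t <= gm, 0 <= U t, 0 <= F t & F t <= Fm]) ->
  (forall s t, c < s -> s <= t -> t < d -> G s <= G t) ->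
  (forall t, t \in `]c, d[ -> G t `^ e <= U t * F t) ->
  (forall s t, c < s -> s < t -> t < d -> (G t - G s) `^ e <= U t * (F t - F s)) ->
  exists x y : nat -> R,
  [/\ x 0%N = d, forall k, x k.+1 <= x k, forall k, c <= x k,
      (forall k t, t \in `]c, x k[ -> G t <= gm / 2 ^+ k) &
      [/\ forall k, 0 <= y k, forall n, \sum_(k < n) y k <= 2 * Fm &
          forall k t, t \in `]x k.+1, x k[ -> (gm / 2 ^+ k / 4) `^ e <= U t * y k]].
Proof.
move=> e0 cd gm0 Fm0 bnd Gmono GF GFF.
pose lev k := gm / 2 ^+ k.
have lev0 k : 0 < lev k by rewrite divr_gt0 // exprn_gt0.
have levS k : lev k.+1 = lev k / 2 by rewrite /lev exprS; field; rewrite expf_neq0.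
pose A k := [set t | (t \in `]c, d[) /\ G t <= lev k].
have AS k : A k.+1 `<=` A k.
  move=> t [td tk]; split=> //; apply: le_trans tk _; rewrite levS.
  by have := lev0 k; lra.
(* The point [c] keeps the supremum in [[c, d]] when no point lies below the level. *)
pose S k := A k `|` [set c].
have Sc k : S k c by right.
have Sd k : ubound (S k) d.
  by move=> t [[+ _]|-> //]; rewrite in_itv/= => /andP[_ /ltW].
have hS k : has_sup (S k) by split; [exists c|exists d].
pose x k := if k is 0%N then d else sup (S k).
have cx k : c <= x k by case: k => // k; exact: sup_upper_bound.
have xd k : x k <= d by case: k => // k; apply: ge_sup; [exists c|exact: Sd].
have xS k : x k.+1 <= x k.
  case: k => [|k]; first exact: (xd 1%N).
  apply: ge_sup; first by exists c.
  by move=> t [/AS tA|->]; apply: sup_upper_bound => //; left.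
have Glev k t : t \in `]c, x k[ -> A k t.
  rewrite in_itv/= => /andP[ct].
  case: k => [|k] tx.
    have td : t \in `]c, d[ by rewrite in_itv/= ct.
    by split => //; rewrite /lev expr0 divr1; have [] := bnd _ td.
  have td : t \in `]c, d[ by rewrite in_itv/= ct (lt_le_trans tx) // (xd k.+1).
  split=> //; have [s] := sup_gt (ex_intro _ c (Sc k.+1)) tx.
  case=> [[sd sk] ts|-> tc]; last by have := lt_trans ct tc; rewrite ltxx.
  apply: le_trans sk; apply: Gmono => //; first exact: ltW.
  by move: sd; rewrite in_itv/= => /andP[].
have ltG k t : x k.+1 < t -> t < d -> lev k.+1 < G t.
  move=> xt td; rewrite ltNge; apply/negP => Gt.
  have : t <= x k.+1.
    apply: sup_upper_bound => //; left; split=> //.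
    by rewrite in_itv/= td (le_lt_trans (cx k.+1)).
  by rewrite leNgt xt.
(* The value 0 is included for levels that [G] never falls below; there [G ^ e <= U F] replaces the
   inequality for increments. *)
pose B k := [set z | z = 0 \/ exists2 s, A k s & z = F s].
have B0 k : B k 0 by left.
have BF k : ubound (B k) Fm.
  by move=> z [-> //|[s [sd _] ->]]; have [] := bnd _ sd.
have hB k : has_sup (B k) by split; [exists 0|exists Fm].
pose f k := if (k <= 1)%N then Fm else sup (B k).
have fF k : f k <= Fm.
  by rewrite /f; case: ifP => // _; apply: ge_sup; [exists 0|exact: BF].
have f0 k : 0 <= f k by rewrite /f; case: ifP => // _; exact: sup_upper_bound.
have fSS k : f k.+2 <= f k.
  rewrite [f k]/f; case: ifP => [_|k1]; first exact: fF.
  apply: ge_sup; first by exists 0.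
  move=> z [->|[s /AS/AS As ->]]; apply: (sup_upper_bound (hB k)) => //.
  by right; exists s.
(* Increments of step two telescope to at most [f 0 + f 1], hence the bound [2 Fm]. *)
exists x, (fun k => f k - f k.+2); split=> //; first by move=> k t /Glev[].
split.
- by move=> k; rewrite subr_ge0.
- move=> n; have -> : \sum_(k < n) (f k - f k.+2) = f 0%N + f 1%N - f n - f n.+1.
    elim: n => [|n IH]; first by rewrite big_ord0; lra.
    by rewrite big_ord_recr /= IH; lra.
  by have := f0 n; have := f0 n.+1; rewrite /f /=; lra.
- move=> k t; rewrite in_itv/= => /andP[xt tx].
  have ct : c < t by exact: le_lt_trans (cx k.+1) xt.
  have td : t < d by exact: lt_le_trans tx (xd k).
  have tcd : t \in `]c, d[ by rewrite in_itv/= ct.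
  have [Gt0 _ Ut0 Ft0 FtFm] := bnd _ tcd.
  have Gt := ltG _ _ xt td.
  have Atk : A k t by apply: Glev; rewrite in_itv/= ct.
  have Ff : F t <= f k.
    rewrite /f; case: ifP => // _; apply: sup_upper_bound => //; right.
    by exists t.
  have y0 : 0 < (gm / 2 ^+ k / 4) `^ e by rewrite powR_gt0 // divr_gt0 // lev0.
  have yB z : B k.+2 z -> (gm / 2 ^+ k / 4) `^ e <= U t * (F t - z).
    case=> [->|[s [sd Gs] ->]].
      rewrite subr0; apply: le_trans (GF _ tcd); apply: le_powR.
      - exact: ltW.
      - by rewrite divr_ge0 // ltW // lev0.
      - by move: Gt; rewrite levS /lev; have := lev0 k; rewrite /lev; lra.
    move: sd; rewrite in_itv/= => /andP[cs sd].
    have st : s < t.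
      rewrite ltNge; apply/negP => ts.
      have := Gmono _ _ ct ts sd; move: Gs Gt; rewrite !levS.
      by have := lev0 k; lra.
    apply: le_trans (GFF _ _ cs st td); apply: le_powR.
    - exact: ltW.
    - by rewrite divr_ge0 // ltW // lev0.
    - by move: Gs Gt; rewrite !levS /lev; lra.
  have U0 : 0 < U t.
    rewrite lt_def Ut0 andbT; apply/eqP => U0.
    by have := yB _ (B0 k.+2); rewrite U0 mul0r leNgt y0.
  have key : f k.+2 <= F t - (gm / 2 ^+ k / 4) `^ e / U t.
    rewrite /f /=; apply: ge_sup; first by exists 0.
    move=> z /yB h; rewrite lerBrDl -lerBrDr ler_pdivrMr //.
    by rewrite [leRHS]mulrC.
  rewrite [leRHS]mulrC -ler_pdivrMr //; lra.
Qed.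

(** The weighted Hardy inequality for exponents [(e, b)] and a pair [G], [F] whose increments are
    tied through [U]. On the k-th level block [G ^ b] contributes at most
    [4 ^ b (h k y k ^ (1/e)) ^ b], so the claim becomes a multiplier inequality from l^e to l^b; the
    bound [2 Fm] for the sum of [y] gives the factor [2 ^ (b / e)]. *)
Lemma hardy_upper (e b : R) : 1 < e -> 0 < b -> exists2 C : R, 0 < C &
  forall (w : realR R -> \bar R) (c d gm Fm H : R) (G U F : realR R -> R),
  tail_weight w -> 0 < c -> c <= d -> 0 <= Fm -> 0 <= H ->
  measurable_fun setT G -> measurable_fun setT U ->
  (forall t, t \in `]c, d[ -> [/\ 0 <= G t, G t <= gm, 0 <= U t, 0 <= F t & F t <= Fm]) ->
  (forall s t, c < s -> s <= t -> t < d -> G s <= G t) ->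
  (forall t, t \in `]c, d[ -> G t `^ e <= U t `^ (e - 1) * F t) ->
  (forall s t, c < s -> s < t -> t < d ->
     (G t - G s) `^ e <= U t `^ (e - 1) * (F t - F s)) ->
  (e <= b -> forall t, t \in `]c, d[ ->
     U t `^ ((e - 1) / e) * rtail w t `^ b^-1 <= H) ->
  (b < e ->
     (\int[mu1]_(t in `]c, d[)
        ((U t `^ (b * (e - 1) / (e - b)) * rtail w t `^ (b / (e - b)))%:E * w t) <=
      (H `^ (e * b / (e - b)))%:E)%E) ->
  (\int[mu1]_(t in `]c, d[) ((G t `^ b)%:E * w t) <=
   (C * (H `^ b * Fm `^ (b / e)))%:E)%E.
Proof.
move=> e1 b0; have e0 : 0 < e by lra.
exists (4 `^ b * 2 * 2 `^ (b / e)); first by rewrite !mulr_gt0 ?powR_gt0.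
move=> w c d gm' Fm H G U F hw c0 cd Fm0 H0 mG mU bnd' Gmono GF GFF Hle Hlt.
have [mw w0 _] := hw.
(* The levels must be positive even if [gm'] is 0. *)
pose gm := Num.max gm' 1.
have gm0 : 0 < gm by rewrite lt_max ltr01 orbT.
have bnd t : t \in `]c, d[ ->
    [/\ 0 <= G t, G t <= gm, 0 <= U t `^ (e - 1), 0 <= F t & F t <= Fm].
  by move=> /bnd'[? h *]; split=> //; [rewrite le_max h|exact: powR_ge0].
have [x [y [x0 xS cx Gx [y0 ysum yU]]]] := hardy_levels e0 cd gm0 Fm0 bnd Gmono GF GFF.
have xp k : 0 < x k by exact: lt_le_trans (cx k).
pose W := rtail w; pose m k := W (x k.+1) - W (x k).
have m0 k : 0 <= m k by rewrite subr_ge0; apply: rtail_anti.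
pose Y k := (gm / 2 ^+ k / 4) `^ e.
have Y0 k : 0 < Y k by rewrite powR_gt0 // !divr_gt0 // exprn_gt0.
pose h k := (Y k / y k) `^ e^-1 * m k `^ b^-1.
have h0 k : 0 <= h k by rewrite mulr_ge0 ?powR_ge0.
(* This makes up for the loss [2 ^ r], [r = e / (e - b)], in [powR_rtail_le]; raised to the power
   [b] it is the factor 2 of the constant. *)
pose H' := 2 `^ b^-1 * H.
have en : e != 0 by rewrite gt_eqF.
have bn : b != 0 by rewrite gt_eqF.
have HH' : H <= H'.
  rewrite /H' -[leLHS]mul1r ler_wpM2r //.
  by have := @le_powR R b^-1 1 2; rewrite powR1 => ->//; rewrite ?invr_ge0 ?ler1n // ltW.
have m_empty k : x k <= x k.+1 -> m k = 0.
  by move=> xx; rewrite /m (_ : x k = x k.+1) ?subrr //; apply/eqP; rewrite eq_le xx xS.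
have y_pos k : x k.+1 < x k -> 0 < y k.
  move=> xx; rewrite lt_def y0 andbT; apply/eqP => yk.
  have := yU k ((x k.+1 + x k) / 2); rewrite in_itv/= yk mulr0.
  have -> : x k.+1 < (x k.+1 + x k) / 2 < x k by apply/andP; split; lra.
  by move=> /(_ isT); rewrite leNgt Y0.
have YU k t : t \in `]x k.+1, x k[ -> Y k / y k <= U t `^ (e - 1).
  move=> tx; have yk : 0 < y k.
    by apply: y_pos; move: tx; rewrite in_itv/= => /andP[]; exact: lt_trans.
  by rewrite ler_pdivrMr //; exact: yU.
have tcd k t : t \in `]x k.+1, x k[ -> t \in `]c, d[.
  rewrite !in_itv/= => /andP[t1 t2]; rewrite (le_lt_trans (cx _) t1) /=.
  apply: lt_le_trans t2 _; rewrite -x0.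
  by elim: k {t1} => // k; exact: le_trans.
have step n : multiplier_bound e b (fun k : 'I_n => h k) H'.
  split=> [eb k|be].
    apply: le_trans HH'; have [xx|xx] := leP (x k) (x k.+1).
      by rewrite /h m_empty // powR0 ?invr_eq0 // mulr0.
    have Yk : 0 < (Y k / y k) `^ e^-1 by rewrite powR_gt0 // divr_gt0 // y_pos.
    (* The condition holds inside the block; right continuity of the tail carries it to the inner
       end [x k.+1]. *)
    have hW t : x k.+1 < t -> t < x k -> W t <= (H / (Y k / y k) `^ e^-1) `^ b.
      move=> t1 t2; have tx : t \in `]x k.+1, x k[ by rewrite in_itv/= t1 t2.
      rewrite -[leLHS](@powR_powK _ b^-1 b) ?mulVf ?rtail_ge0 //.
      apply: le_powR; [exact: ltW|exact: powR_ge0|].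
      rewrite ler_pdivlMr // mulrC; apply: le_trans (Hle eb _ (tcd _ _ tx)).
      rewrite ler_wpM2r ?powR_ge0 // powRrM; apply: le_powR.
      - by rewrite invr_ge0 ltW.
      - by rewrite divr_ge0 ?(ltW (Y0 _)) ?y0.
      - exact: YU.
    have hx := rtail_right_le hw (xp _) xx hW.
    rewrite /h mulrC -ler_pdivlMr //.
    rewrite -[leRHS](@powR_powK _ b b^-1) ?mulfV ?divr_ge0 ?powR_ge0 //.
    apply: le_powR => //; first by rewrite invr_ge0 ltW.
    by apply: le_trans hx; rewrite /m gerBl rtail_ge0.
  have ebn : e - b != 0 by rewrite gt_eqF // subr_gt0.
  pose X t := U t `^ (b * (e - 1) / (e - b)) * rtail w t `^ (b / (e - b)).
  have mX : measurable_fun setT (X : realR R -> R).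
    apply: measurable_funM; last exact: measurable_powR_rtail.
    apply: (@measurableT_comp _ _ _ _ _ _ (fun x => x `^ _)); last exact: mU.
    exact: measurable_powR.
  have X0 t : 0 <= X t by rewrite mulr_ge0 ?powR_ge0.
  have mXw : measurable_fun setT (fun t : realR R => (X t)%:E * w t)%E.
    by apply: emeasurable_funM; [exact/measurable_EFinP|exact: mw].
  have Xw0 t : (0 <= (X t)%:E * w t)%E by rewrite mule_ge0 // lee_fin.
  pose r := e / (e - b).
  have r1 : 1 <= r by rewrite /r ler_pdivlMr ?subr_gt0 //; lra.
  have blk k : ((h k `^ (e * b / (e - b)))%:E <= (2 `^ r)%:E *
      \int[mu1]_(t in `]x k.+1, x k[) ((X t)%:E * w t))%E.
    have Yr : 0 <= (Y k / y k) `^ (b / (e - b)) by exact: powR_ge0.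
    have -> : h k `^ (e * b / (e - b)) = (Y k / y k) `^ (b / (e - b)) * m k `^ r.
      rewrite /h powRM ?powR_ge0 // -!powRrM; congr (_ `^ _ * _ `^ _).
        by field; rewrite ebn en.
      by rewrite /r; field; rewrite ebn bn.
    rewrite EFinM; apply: (@le_trans _ _ (((Y k / y k) `^ (b / (e - b)))%:E *
        ((2 `^ r)%:E * \int[mu1]_(t in `]x k.+1, x k[) ((W t `^ (r - 1))%:E * w t)))%E).
      by rewrite lee_wpmul2l ?lee_fin //; apply: powR_rtail_le.
    rewrite muleCA lee_wpmul2l ?lee_fin ?powR_ge0 //.
    have mWw : measurable_fun setT (fun t : realR R => (W t `^ (r - 1))%:E * w t)%E.
      by apply: emeasurable_funM; [apply/measurable_EFinP; exact: measurable_powR_rtail|exact: mw].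
    rewrite -ge0_integralZl; [|exact: measurable_itvR|exact: measurable_funTS| |by rewrite lee_fin]; last first.
      by move=> t _; rewrite mule_ge0 // lee_fin powR_ge0.
    apply: ge0_le_integral; first exact: measurable_itvR.
    - by move=> t _; rewrite !mule_ge0 // lee_fin powR_ge0.
    - apply: measurable_funTS; apply: emeasurable_funM => //; exact: measurable_cst.
    - exact: measurable_funTS.
    - move=> t tx; rewrite muleA -EFinM lee_wpmul2r // lee_fin /X.
      rewrite (_ : r - 1 = b / (e - b)); last by rewrite /r; field.
      rewrite ler_wpM2r ?powR_ge0 // (_ : b * (e - 1) / (e - b) = (e - 1) * (b / (e - b))).
        rewrite [leRHS]powRrM; apply: le_powR; last exact: YU.
          by rewrite divr_ge0 ?subr_ge0 ?(ltW be) ?(ltW b0).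
        by rewrite divr_ge0 ?(ltW (Y0 _)) ?y0.
      by field.
  rewrite -lee_fin -sumEFin.
  apply: (@le_trans _ _ ((2 `^ r)%:E * \sum_(k < n) \int[mu1]_(t in `]x k.+1, x k[) ((X t)%:E * w t))%E).
    rewrite ge0_sume_distrr; last by move=> k _; exact: integral_ge0.
    by apply: lee_sum => k _; exact: blk.
  have -> : (H' `^ (e * b / (e - b)))%:E = ((2 `^ r)%:E * (H `^ (e * b / (e - b)))%:E)%E.
    rewrite /H' powRM ?powR_ge0 // -powRrM EFinM; congr (_%:E * _)%E.
    by congr (_ `^ _); rewrite /r; field; rewrite bn ebn.
  rewrite lee_wpmul2l ?lee_fin ?powR_ge0 //; apply: le_trans (Hlt be).
  rewrite -integral_itv_sum_down //; apply: integral_itv_subset => // t /=.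
  rewrite !in_itv/= x0 => /andP[xt ->]; rewrite andbT.
  exact: le_lt_trans (cx n) xt.
have mGw : measurable_fun setT (fun t : realR R => (G t `^ b)%:E * w t)%E.
  apply: emeasurable_funM; last exact: mw.
  apply/measurable_EFinP; apply: (@measurableT_comp _ _ _ _ _ _ (fun x => x `^ _)).
    exact: measurable_powR.
  exact: mG.
have mGb : measurable_fun setT (fun t : realR R => G t `^ b).
  apply: (@measurableT_comp _ _ _ _ _ _ (fun x => x `^ _)); last exact: mG.
  exact: measurable_powR.
have Gw0 t : (0 <= (G t `^ b)%:E * w t)%E by rewrite mule_ge0 // lee_fin powR_ge0.
have main n : (\int[mu1]_(t in `]x n, d[) ((G t `^ b)%:E * w t) <=
    (4 `^ b * 2 * 2 `^ (b / e) * (H `^ b * Fm `^ (b / e)))%:E)%E.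
  rewrite -x0 integral_itv_sum_down //.
  apply: (@le_trans _ _ (\sum_(k < n) (4 `^ b * (h k * y k `^ e^-1) `^ b)%:E)%E).
    apply: lee_sum => k _.
    apply: (@le_trans _ _ (((gm / 2 ^+ k) `^ b)%:E *
        \int[mu1]_(t in `]x k.+1, x k[) w t)%E).
      apply: (integral_weighted_le mw w0) => //; first by move=> t; exact: powR_ge0.
      move=> t tx; apply: le_powR; [exact: ltW|by have [] := bnd _ (tcd _ _ tx)|].
      apply: Gx; have := tcd _ _ tx; rewrite !in_itv/= => /andP[-> _].
      by move: tx; rewrite in_itv/= => /andP[].
    rewrite rtail_int // -EFinM lee_fin -/(m k).
    have [xx|xx] := leP (x k) (x k.+1).
      by rewrite m_empty // mulr0 mulr_ge0 ?powR_ge0.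
    have yk := y_pos _ xx.
    have -> : h k * y k `^ e^-1 = Y k `^ e^-1 * m k `^ b^-1.
      rewrite /h mulrAC -powRM; [|by rewrite divr_ge0 ?(ltW (Y0 _)) // ltW|exact: ltW].
      by rewrite divfK // gt_eqF.
    rewrite powRM ?powR_ge0 // [in leRHS](powR_powK (m0 k)) ?mulVf //.
    rewrite /Y (@powR_powK _ e e^-1) ?mulfV //; last first.
      by rewrite !divr_ge0 // ?(ltW gm0) // exprn_ge0.
    rewrite mulrA -powRM //; last by rewrite !divr_ge0 // ?(ltW gm0) // exprn_ge0.
    by rewrite (_ : 4 * (gm / 2 ^+ k / 4) = gm / 2 ^+ k) //; field; rewrite expf_neq0.
  rewrite sumEFin lee_fin -mulr_sumr -!mulrA ler_wpM2l ?powR_ge0 //.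
  apply: le_trans.
    apply: (@multiplier_le R _ e b _ (fun k : 'I_n => y k `^ e^-1) H') => //.
    - by rewrite (le_trans H0).
    - by move=> k; exact: powR_ge0.
  rewrite /H' powRM ?powR_ge0 // (@powR_powK _ b^-1 b) ?mulVf // -mulrA ler_wpM2l //.
  rewrite mulrCA ler_wpM2l ?powR_ge0 //.
  rewrite -powRM //; apply: le_powR; first by rewrite divr_ge0 // ltW.
    by apply: sumr_ge0 => k _; exact: powR_ge0.
  apply: le_trans (ysum n); apply: ler_sum => k _.
  by rewrite powR_powK // mulVf.
(* Finitely many blocks cover only the part above the n-th level. Below it the integral is at most
   [(gm / 2 ^ n) ^ b W c], which is small for large [n]. *)
apply/lee_addgt0Pr => eps eps0.
have Wc : 0 < W c by exact: rtail_gt0.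
have [n hn] : exists n, (gm / 2 ^+ n) `^ b * W c <= eps.
  pose z := (eps / W c) `^ b^-1.
  have z0 : 0 < z by rewrite powR_gt0 // divr_gt0.
  exists (Num.truncn (gm / z)); rewrite -ler_pdivlMr //.
  rewrite -[leRHS](@powR_powK _ b^-1 b) ?mulVf ?divr_ge0 ?(ltW eps0) ?(ltW Wc) //.
  apply: le_powR; [exact: ltW|by rewrite divr_ge0 ?(ltW gm0) ?exprn_ge0|].
  rewrite ler_pdivrMr ?exprn_gt0 // mulrC -ler_pdivrMr //.
  apply: ltW; apply: lt_le_trans (truncnS_gt _) _.
  by rewrite -natrX ler_nat ltn_expl.
rewrite (@integral_itv_split_oo _ _ mGw Gw0 c (x n) d) //; last first.
  by rewrite -x0; elim: n {hn} => // n; exact: le_trans.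
rewrite addeC; apply: leeD; first exact: main.
apply: (@le_trans _ _ (((gm / 2 ^+ n) `^ b)%:E * \int[mu1]_(t in `]c, x n[) w t)%E).
  apply: (integral_weighted_le mw w0) => //; first by move=> t; exact: powR_ge0.
  move=> t tx; apply: le_powR; [exact: ltW| |exact: Gx].
  have /bnd[] // : t \in `]c, d[.
  move: tx; rewrite !in_itv/= => /andP[-> tx]; apply: lt_le_trans tx _.
  by rewrite -x0; elim: n {hn} => // n; exact: le_trans.
rewrite rtail_int // -EFinM lee_fin; apply: le_trans hn.
by rewrite ler_wpM2l ?powR_ge0 // gerBl rtail_ge0.
Qed.

End hardy.

(** * Weighted integrals and the dual weight *)

Section weighted_integrals.
Context {R : realType}.
Local Notation mu1 := (@completed_lebesgue_measure R).

Definition wint (w : realR R -> \bar R) (i : interval R) (X : realR R -> R) : \bar R :=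
  (\int[mu1]_(t in [set` i]) ((X t)%:E * w t))%E.

Definition posmeas (X : realR R -> R) := measurable_fun setT X /\ forall t, 0 <= X t.

Definition nnweight (w : realR R -> \bar R) :=
  measurable_fun setT w /\ forall t, (0 <= w t)%E.

Lemma tail_nnweight w : tail_weight w -> nnweight w.
Proof. by case. Qed.

Lemma measurable_homoR (f : R -> R) : {homo f : s t / s <= t} ->
  measurable_fun setT (f : realR R -> R).
Proof.
move=> hf; apply/measurable_EFinP; apply: measurable_homo => s t st /=.
by rewrite lee_fin hf.
Qed.

Lemma posmeas_homo (f : R -> R) : (forall t, 0 <= f t) -> {homo f : s t / s <= t} ->
  posmeas f.
Proof. by move=> f0 hf; split => //; exact: measurable_homoR. Qed.

Lemma posmeas_cst (k : R) : 0 <= k -> posmeas (fun=> k).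
Proof. by move=> k0; split => //; exact: measurable_cst. Qed.

Lemma measurable_powR_comp (X : realR R -> R) r : measurable_fun setT X ->
  measurable_fun setT (fun t => X t `^ r).
Proof.
move=> mX; apply: (@measurableT_comp _ _ _ _ _ _ (fun x => x `^ r)); last exact: mX.
exact: measurable_powR.
Qed.

Lemma posmeas_powR (X : realR R -> R) r : measurable_fun setT X ->
  posmeas (fun t => X t `^ r).
Proof. by move=> mX; split => [|t]; [exact: measurable_powR_comp|exact: powR_ge0]. Qed.

Lemma posmeasM X Y : posmeas X -> posmeas Y -> posmeas (fun t => X t * Y t).
Proof.
by move=> [mX X0] [mY Y0]; split => [|t]; [exact: measurable_funM|exact: mulr_ge0].
Qed.

Lemma posmeasD X Y : posmeas X -> posmeas Y -> posmeas (fun t => X t + Y t).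
Proof.
by move=> [mX X0] [mY Y0]; split => [|t]; [exact: measurable_funD|exact: addr_ge0].
Qed.

Lemma posmeas_step (s k : R) : 0 <= k -> posmeas (fun t => if s < t then k else 0).
Proof.
move=> k0; apply: posmeas_homo => [t|x y xy]; first by case: ifP.
by case: ifPn => sx; [rewrite (lt_le_trans sx xy)|case: ifP].
Qed.

Lemma posmeas_sum (I : finType) (X : I -> realR R -> R) :
  (forall i, posmeas (X i)) -> posmeas (fun t => \sum_i X i t).
Proof.
move=> hX; split => [|t]; last by apply: sumr_ge0 => i _; exact: (hX i).2.
by apply: measurable_sum => i; exact: (hX i).1.
Qed.

Lemma posmeas_step_sum (I : finType) (z : I -> R) (g : I -> R) : (forall i, 0 <= g i) ->
  posmeas (fun t => \sum_(i | z i < t) g i).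
Proof.
move=> g0; apply: posmeas_homo => [t|x y xy]; first exact: sumr_ge0.
rewrite [leLHS]big_mkcond [leRHS]big_mkcond /=; apply: ler_sum => i _.
by case: ifPn => sx; [rewrite (lt_le_trans sx xy)|case: ifP].
Qed.

Section fixed_weight.
Variable w : realR R -> \bar R.
Hypothesis hw : nnweight w.

Let mw : measurable_fun setT w := hw.1.
Let w0 := hw.2.

Lemma measurable_wint (X : realR R -> R) : measurable_fun setT X ->
  measurable_fun setT (fun t => (X t)%:E * w t)%E.
Proof. by move=> mX; apply: emeasurable_funM; [exact/measurable_EFinP|exact: mw]. Qed.

Lemma posmeas_nnweight X : posmeas X -> nnweight (fun t => (X t)%:E * w t)%E.
Proof.
move=> [mX X0]; split; first exact: measurable_wint.
by move=> t; rewrite mule_ge0 // lee_fin.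
Qed.

Lemma wint_ge0 i X : posmeas X -> (0 <= wint w i X)%E.
Proof. by move=> hX; apply: integral_ge0 => t _; exact: (posmeas_nnweight hX).2. Qed.

Lemma wint_le i X Y : posmeas X -> posmeas Y -> (forall t, t \in i -> X t <= Y t) ->
  (wint w i X <= wint w i Y)%E.
Proof.
move=> hX hY XY; apply: ge0_le_integral; first exact: measurable_itvR.
- by move=> t _; exact: (posmeas_nnweight hX).2.
- by apply: measurable_funTS; exact: measurable_wint hX.1.
- by apply: measurable_funTS; exact: measurable_wint hY.1.
- by move=> t ti; apply: lee_wpmul2r => //; rewrite lee_fin; exact: XY.
Qed.

Lemma wint_le_cst i X (k : R) : posmeas X -> (forall t, t \in i -> X t <= k) ->
  (wint w i X <= k%:E * \int[mu1]_(t in [set` i]) w t)%E.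
Proof. by move=> [mX X0] h; exact: integral_weighted_le. Qed.

Lemma wint_ge_cst i X (k : R) : 0 <= k -> posmeas X -> (forall t, t \in i -> k <= X t) ->
  (k%:E * \int[mu1]_(t in [set` i]) w t <= wint w i X)%E.
Proof. by move=> k0 [mX X0] h; exact: integral_weighted_ge. Qed.

Lemma wintZ i (k : R) X : 0 <= k -> posmeas X ->
  (wint w i (fun t => k * X t)%R = k%:E * wint w i X)%E.
Proof.
move=> k0 hX; rewrite /wint -ge0_integralZl; first last.
- by rewrite lee_fin.
- by move=> t _; exact: (posmeas_nnweight hX).2.
- by apply: measurable_funTS; exact: measurable_wint hX.1.
- exact: measurable_itvR.
by apply: eq_integral => t _; rewrite EFinM muleA.
Qed.

Lemma wintD i X Y : posmeas X -> posmeas Y ->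
  (wint w i (fun t => X t + Y t)%R = wint w i X + wint w i Y)%E.
Proof.
move=> hX hY; rewrite /wint -ge0_integralD; first last.
- by apply: measurable_funTS; exact: measurable_wint hY.1.
- by move=> t _; exact: (posmeas_nnweight hY).2.
- by apply: measurable_funTS; exact: measurable_wint hX.1.
- by move=> t _; exact: (posmeas_nnweight hX).2.
- exact: measurable_itvR.
apply: eq_integral => t _; rewrite EFinD ge0_muleDl // lee_fin; first exact: hX.2.
exact: hY.2.
Qed.

Lemma wint_sum i (I : finType) (X : I -> realR R -> R) : (forall j, posmeas (X j)) ->
  (wint w i (fun t => \sum_j X j t)%R = \sum_j wint w i (X j))%E.
Proof.
move=> hX; rewrite /wint -ge0_integral_sum; first last.
- by move=> j t _; exact: (posmeas_nnweight (hX j)).2.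
- by move=> j; apply: measurable_funTS; exact: measurable_wint (hX j).1.
- exact: measurable_itvR.
apply: eq_integral => t _; rewrite -sumEFin ge0_sume_distrl // => j _.
by rewrite lee_fin; exact: (hX j).2.
Qed.

Lemma wint_subset i j X : posmeas X -> [set` i] `<=` [set` j] ->
  (wint w i X <= wint w j X)%E.
Proof.
move=> hX ij; have [m p] := posmeas_nnweight hX.
exact: (integral_itv_subset m p).
Qed.

Lemma wint_after (z c : R) X : posmeas X -> c <= z ->
  (wint w `]c, +oo[ (fun t => if z < t then X t else 0)%R = wint w `]z, +oo[ X)%E.
Proof.
move=> hX cz; rewrite /wint.
transitivity (\int[mu1]_(t in `]c, +oo[%classic)
    ((fun t => (X t)%:E * w t)%E \_ `]z, +oo[%classic) t)%E.
  apply: eq_integral => t _; rewrite /patch mem_setE in_itv/= andbT.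
  by case: ifP => _; rewrite ?mul0e.
rewrite -integral_mkcondr; congr integral; apply/seteqP; split => t /=.
  by case.
by rewrite !in_itv/= !andbT => zt; split => //; exact: le_lt_trans zt.
Qed.

End fixed_weight.

Lemma eq_wint w i X Y : (forall t, t \in i -> X t = Y t) -> wint w i X = wint w i Y.
Proof.
by move=> h; apply: eq_integral => t; rewrite inE /= => /h ->.
Qed.

Lemma posmeas_rtail_powR w r : tail_weight w -> posmeas (fun t => rtail w t `^ r).
Proof. by move=> hw; apply: posmeas_powR; exact: measurable_rtail. Qed.

(* The measure [W^{-a'} w dt] is, up to constants, [d (W ^ (-1/(a-1)))]. *)
Definition dual_weight (a : R) (w : realR R -> \bar R) (t : realR R) : \bar R :=
  ((rtail w t `^ (- (a / (a - 1))))%:E * w t)%E.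

Definition dual_tail (a : R) (w : realR R -> \bar R) (t : R) : R :=
  rtail w t `^ (- (a - 1)^-1).

Section dual.
Variables (a : R) (w : realR R -> \bar R).
Hypotheses (a1 : 1 < a) (hw : tail_weight w).
Local Notation W := (rtail w).
Local Notation om := (dual_weight a w).
Local Notation nu := (dual_tail a w).

Lemma dual_nnweight : nnweight om.
Proof. by apply: posmeas_nnweight; [exact: tail_nnweight|exact: posmeas_rtail_powR]. Qed.

Lemma powR_neg_anti (r x y : R) : 0 <= r -> 0 < x -> x <= y -> y `^ (- r) <= x `^ (- r).
Proof.
move=> r0 x0 xy; rewrite !powRN lef_pV2 ?posrE ?powR_gt0 //; last exact: lt_le_trans xy.
by apply: le_powR => //; exact: ltW.
Qed.

Let a'_ge0 : 0 <= a / (a - 1). Proof. by have h := a1; apply: divr_ge0; lra. Qed.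

Lemma dual_tail_gt0 t : 0 < t -> 0 < nu t.
Proof. by move=> t0; rewrite powR_gt0 // rtail_gt0. Qed.

Lemma dual_tail_homo s t : 0 < s -> s <= t -> nu s <= nu t.
Proof.
move=> s0 st; have h := a1; apply: powR_neg_anti; first by rewrite invr_ge0; lra.
  by apply: rtail_gt0 => //; exact: lt_le_trans st.
exact: rtail_anti.
Qed.

Lemma dual_tail_mul t : 0 < t -> W t `^ (- (a / (a - 1))) * W t = nu t.
Proof.
move=> t0; rewrite mulrC -[X in X * _](@powRr1 R) ?rtail_ge0 // -powRD; last first.
  by rewrite (gt_eqF (rtail_gt0 hw t0)) implybT.
by congr (_ `^ _); field; rewrite gt_eqF // subr_gt0.
Qed.

Lemma dual_int_ge s t : 0 < s -> s <= t ->
  ((W s `^ (- (a / (a - 1))) * (W s - W t))%:E <= \int[mu1]_(x in `]s, t[) om x)%E.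
Proof.
move=> s0 st; rewrite EFinM -rtail_int //.
apply: (wint_ge_cst (tail_nnweight hw)); first exact: powR_ge0.
  exact: posmeas_rtail_powR.
move=> x; rewrite in_itv/= => /andP[sx _]; apply: powR_neg_anti => //.
  by apply: rtail_gt0 => //; exact: lt_trans sx.
by apply: rtail_anti => //; exact: ltW.
Qed.

Lemma dual_int_le s t : 0 < s -> s <= t ->
  (\int[mu1]_(x in `]s, t[) om x <= (W t `^ (- (a / (a - 1))) * (W s - W t))%:E)%E.
Proof.
move=> s0 st; rewrite EFinM -rtail_int //.
apply: (wint_le_cst (tail_nnweight hw)); first exact: posmeas_rtail_powR.
have t0 : 0 < t by exact: lt_le_trans st.
move=> x; rewrite in_itv/= => /andP[sx xt]; apply: powR_neg_anti => //.
  exact: rtail_gt0.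
by apply: rtail_anti => //; [exact: lt_trans sx|exact: ltW].
Qed.

(** The tail is continuous, positive and vanishes at infinity, so every value [W x0 / 2 ^ k] is
    attained. The points increase strictly because the tail is nonincreasing and its values strictly
    decrease. *)
Lemma halving_points (x0 : R) : 0 < x0 -> exists x : nat -> R,
  [/\ x 0%N = x0, forall k, W (x k) = W x0 / 2 ^+ k, forall k, 0 < x k &
      forall k, x k < x k.+1].
Proof.
move=> x00; have W0 := rtail_gt0 hw x00.
have /choice[y hy] (k : nat) : exists t, x0 <= t /\ W t = W x0 / 2 ^+ k.
  have [||t x0t Wt] := @rtail_ivt_right _ _ hw x0 (W x0 / 2 ^+ k) x00.
  - by rewrite divr_gt0 // exprn_gt0.
  - by rewrite ler_pdivrMr ?exprn_gt0 // ler_peMr ?(ltW W0) // exprn_ege1 // ler1n.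
  - by exists t.
(* The intermediate value theorem gives some point with tail [W x0], not [x0] itself. *)
pose x k := if k is 0%N then x0 else y k.
have xW k : W (x k) = W x0 / 2 ^+ k.
  by case: k => [|k]; [rewrite expr0 divr1|exact: (hy k.+1).2].
have xp k : 0 < x k by case: k => // k; exact: lt_le_trans (hy k.+1).1.
exists x; split => // k; rewrite ltNge; apply/negP => xx.
have := rtail_anti hw (xp _) xx; rewrite !xW exprS leNgt => /negP; apply.
rewrite invfM mulrCA -[ltRHS]mul1r ltr_pM2r; last by rewrite divr_gt0 // exprn_gt0.
by lra.
Qed.

End dual.

End weighted_integrals.

(** * Upper bounds by cutting into blocks *)

Section upper_bound.
Context {R : realType}.
Local Notation mu1 := (@completed_lebesgue_measure R).
Implicit Types (w : realR R -> \bar R) (V : R -> R -> R).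

(** The classical condition for the Hardy inequality on [(x, +oo)] with exponents [(p, b)]: a
    supremum for [p <= b], an integral for [b < p]. *)
Definition hardy_cond (p b : R) w V (x h : R) : Prop :=
  (p <= b -> forall z, x < z -> V x z `^ ((p - 1) / p) * rtail w z `^ b^-1 <= h) /\
  (b < p -> (wint w `]x, +oo[ (fun s => V x s `^ (b * (p - 1) / (p - b))
                                * rtail w s `^ (b / (p - b)))%R
             <= (h `^ (p * b / (p - b)))%:E)%E).

(** Monotonicity is restricted to positive inner radii: at radius 0 the shell mass may be infinite,
    and its real value is then the default 0. *)
Definition shell_fun V : Prop :=
  (forall s t, 0 <= V s t) /\
  (forall s s' t t', 0 < s' -> s' <= s -> t <= t' -> V s t <= V s' t').

Lemma posmeas_shell V x : shell_fun V -> 0 < x -> posmeas (V x).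
Proof.
by move=> [V0 Vm] x0; apply: posmeas_homo => // s t st; exact: Vm.
Qed.

Lemma posmeas_shell_powR V x r : shell_fun V -> 0 < x -> posmeas (fun t => V x t `^ r).
Proof. by move=> hV x0; apply: posmeas_powR; exact: (posmeas_shell hV x0).1. Qed.

(* The pointwise form of the Hardy condition when [b < p], from
   [W z ^ (p / (p - b)) <= C \int_z^oo W ^ (b / (p - b)) w]. *)
Lemma hardy_cond_sup (p b : R) : 1 < p -> 0 < b -> exists2 C : R, 0 < C &
  forall w V x h z, tail_weight w -> shell_fun V -> 0 < x -> x < z -> 0 <= h ->
  hardy_cond p b w V x h -> V x z `^ ((p - 1) / p) * rtail w z `^ b^-1 <= C * h.
Proof.
move=> p1 b0; have [pb|bp] := leP p b.
  exists 1 => // w V x h z hw hV x0 xz h0 [hle _]; rewrite mul1r; exact: hle.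
have p0 : 0 < p by lra.
have pn : p != 0 by rewrite gt_eqF.
have bn : b != 0 by rewrite gt_eqF.
have pbn : p - b != 0 by rewrite gt_eqF // subr_gt0.
pose r := p * b / (p - b); have r0 : 0 < r by rewrite divr_gt0 ?mulr_gt0 // subr_gt0.
have rn : r != 0 by rewrite gt_eqF.
pose q := p / (p - b).
have q1 : 1 <= q by rewrite /q ler_pdivlMr ?subr_gt0 //; lra.
exists ((4 `^ q) `^ r^-1); first by rewrite !powR_gt0.
move=> w V x h z hw hV x0 xz h0 [_ /(_ bp) hlt].
have z0 : 0 < z by exact: lt_trans xz.
rewrite -[X in X <= _](@powR_powK _ r r^-1); last 2 first.
- by rewrite mulr_ge0 ?powR_ge0.
- by rewrite mulfV.
rewrite -[X in _ <= _ * X](@powR_powK _ r r^-1) ?mulfV // -powRM ?powR_ge0 //.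
apply: le_powR; [by rewrite invr_ge0 ltW|exact: powR_ge0|].
rewrite powRM ?powR_ge0 // -!powRrM.
rewrite (_ : (p - 1) / p * r = b * (p - 1) / (p - b)); last first.
  by rewrite /r; field; rewrite pbn pn.
rewrite (_ : b^-1 * r = q); last by rewrite /r /q; field; rewrite pbn bn.
rewrite -lee_fin EFinM.
apply: (@le_trans _ _ ((V x z `^ (b * (p - 1) / (p - b)))%:E *
   ((4 `^ q)%:E * wint w `]z, +oo[ (fun t => rtail w t `^ (q - 1))%R))%E).
  by rewrite lee_wpmul2l ?lee_fin ?powR_ge0 //; exact: powR_rtail_infty_le.
rewrite muleCA EFinM lee_wpmul2l ?lee_fin ?powR_ge0 //.
apply: le_trans hlt.
have hw' := tail_nnweight hw.
have pW := posmeas_rtail_powR (b / (p - b)) hw.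
have pV := posmeas_shell_powR (b * (p - 1) / (p - b)) hV x0.
rewrite (_ : q - 1 = b / (p - b)); last by rewrite /q; field.
rewrite -(wintZ hw' _ (powR_ge0 _ _) pW).
apply: (@le_trans _ _ (wint w `]z, +oo[ (fun s => V x s `^ (b * (p - 1) / (p - b))
                                * rtail w s `^ (b / (p - b)))%R)).
  apply: (wint_le hw').
  - by apply: posmeasM; [apply: posmeas_cst; exact: powR_ge0|exact: pW].
  - by apply: posmeasM; [exact: pV|exact: pW].
  - move=> t; rewrite in_itv/= andbT => zt.
    rewrite ler_wpM2r ?powR_ge0 //; apply: le_powR.
    + by rewrite divr_ge0 ?subr_ge0 ?(ltW bp) // mulr_ge0 ?(ltW b0) // subr_ge0 ltW.
    + exact: hV.1.
    + by apply: hV.2 => //; exact: ltW.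
apply: (wint_subset hw'); first by apply: posmeasM; [exact: pV|exact: pW].
by move=> t /=; rewrite !in_itv/= !andbT => zt; exact: lt_trans zt.
Qed.

(** [hardy_upper] for the increments from [x], with [U = V x], which dominates the shells with inner
    radius [s >= x]. *)
Lemma local_hardy (p b : R) : 1 < p -> 0 < b -> exists2 C : R, 0 < C &
  forall w V x d h (G F : R -> R), tail_weight w -> shell_fun V -> 0 < x -> x <= d ->
  0 <= h -> hardy_cond p b w V x h -> measurable_fun setT (G : realR R -> R) ->
  (forall s t, x <= s -> s <= t -> G s <= G t /\ F s <= F t) ->
  (forall s t, x <= s -> s < t ->
     (G t - G s) `^ p <= V s t `^ (p - 1) * (F t - F s)) ->
  (wint w `]x, d[ (fun t => (G t - G x) `^ b)%R
   <= (C * (h `^ b * (F d - F x) `^ (b / p)))%:E)%E.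
Proof.
move=> p1 b0; have [C C0 HU] := hardy_upper p1 b0.
exists C => // w V x d h G F hw hV x0 xd h0 hc mG GFm GF.
have VV s t : x <= s -> V s t `^ (p - 1) <= V x t `^ (p - 1).
  by move=> xs; apply: le_powR; [lra|exact: hV.1|exact: hV.2].
apply: (HU w x d (G d - G x) (F d - F x) h (fun t => G t - G x) (V x)
   (fun t => F t - F x) hw x0 xd _ h0).
- by rewrite subr_ge0; have [] := GFm x d (lexx _) xd.
- by apply: measurable_funB; [exact: mG|exact: measurable_cst].
- exact: (posmeas_shell hV x0).1.
- move=> t; rewrite in_itv/= => /andP[xt td].
  have [h1 h2] := GFm x t (lexx _) (ltW xt); have [h3 h4] := GFm t d (ltW xt) (ltW td).
  by split; [lra|lra|exact: hV.1|lra|lra].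
- by move=> s t xs st td; rewrite lerD2r; have [] := GFm s t (ltW xs) st.
- by move=> t; rewrite in_itv/= => /andP[xt td]; exact: GF.
- move=> s t xs st td.
  rewrite (_ : _ - _ = G t - G s); last by lra.
  rewrite (_ : F t - _ - _ = F t - F s); last by lra.
  apply: (le_trans (GF s t (ltW xs) st)); apply: ler_wpM2r; last exact: VV (ltW xs).
  by have [_ ?] := GFm s t (ltW xs) (ltW st); rewrite subr_ge0.
- move=> pb t; rewrite in_itv/= => /andP[xt _]; exact: hc.1.
- move=> bp; apply: le_trans (hc.2 bp); apply: (wint_subset (tail_nnweight hw)).
  + apply: posmeasM; first exact: posmeas_shell_powR.
    exact: posmeas_rtail_powR.
  + by move=> t /=; rewrite !in_itv/= andbT => /andP[].
Qed.

Definition halving w (x : nat -> R) : Prop :=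
  [/\ forall k, rtail w (x k) = rtail w (x 0%N) / 2 ^+ k, forall k, 0 < x k &
      forall k, x k < x k.+1].

Lemma halving_mono w x : halving w x -> forall j k, (j <= k)%N -> x j <= x k.
Proof.
move=> [_ _ xS] j k /subnK <-; elim: (k - j)%N => // m; move/le_trans; apply.
exact: ltW (xS _).
Qed.

(** Let [g] and [D] be the increments of [G] and [F] over a block. The exponent is the one for which
    Hoelder's inequality on the block, raised to the power [a / p], reads
    [g ^ a <= block_weight ^ (a - 1) * B] with [B = W (x j) D ^ (a / p)]: the shape it has on
    shells, with [a] in place of [p]. *)
Definition block_weight (p a : R) w V (x : nat -> R) (j : nat) : R :=
  dual_tail a w (x j) * V (x j) (x j.+1) `^ (a * (p - 1) / (p * (a - 1))).

(** Only blocks completed before [t] count, so this is the step function that plays the role of [U]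
    for the exponents [(a, b)]. *)
Definition block_sum (p a : R) w V (x : nat -> R) n (t : R) : R :=
  \sum_(j < n | x j.+1 < t) block_weight p a w V x j.

Lemma block_weight_ge0 p a w V x j : 0 <= block_weight p a w V x j.
Proof. by rewrite mulr_ge0 ?powR_ge0. Qed.

(** On the k-th block [G t = G (x k) + (G t - G (x k))]. The increment is treated by [local_hardy]
    and the multipliers [h]; the value [G (x k)] is a step function of [t], to which [hardy_upper]
    applies with exponents [(a, b)] and [U = block_sum]. *)
Lemma upper_blocks (p a b : R) : 1 < p -> 1 < a -> 1 < b -> exists2 C : R, 0 < C &
  forall (w1 w2 : realR R -> \bar R) V x n (h : nat -> R) S N (G F : R -> R),
  tail_weight w1 -> tail_weight w2 -> shell_fun V -> halving w1 x ->
  measurable_fun setT (G : realR R -> R) -> measurable_fun setT (F : realR R -> R) ->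
  (forall s t, x 0%N <= s -> s <= t -> G s <= G t /\ F s <= F t) ->
  G (x 0%N) = 0 -> F (x 0%N) = 0 ->
  (forall s t, x 0%N <= s -> s < t ->
     (G t - G s) `^ p <= V s t `^ (p - 1) * (F t - F s)) ->
  0 <= S -> 0 <= N -> (wint w1 `]x 0%N, +oo[ (fun t => F t `^ (a / p))%R <= N%:E)%E ->
  (forall k, 0 <= h k /\ hardy_cond p b w2 V (x k) (h k)) ->
  multiplier_bound a b (fun k : 'I_n => h k * rtail w1 (x k) `^ (- a^-1)) S ->
  (a <= b -> forall t, t \in `]x 0%N, x n[ ->
     block_sum p a w1 V x n t `^ ((a - 1) / a) * rtail w2 t `^ b^-1 <= S) ->
  (b < a -> (wint w2 `]x 0%N, x n[ (fun t =>
      block_sum p a w1 V x n t `^ (b * (a - 1) / (a - b)) *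
      rtail w2 t `^ (b / (a - b)))%R <= (S `^ (a * b / (a - b)))%:E)%E) ->
  (wint w2 `]x 0%N, x n[ (fun t => G t `^ b)%R <= (C * (S `^ b * N `^ (b / a)))%:E)%E.
Proof.
move=> p1 a1 b1.
have [p0 [a0 b0]] : 0 < p /\ (0 < a /\ 0 < b) by lra.
have pn : p != 0 by rewrite gt_eqF.
have an : a != 0 by rewrite gt_eqF.
have [C1 C10 LH] := local_hardy p1 b0.
have [C2 C20 HU] := hardy_upper a1 b0.
exists (2 `^ b * (C1 + C2) * 4 `^ (b / a)); first by rewrite !mulr_gt0 ?powR_gt0 ?addr_gt0.
move=> w1 w2 V x n h S N G F hw1 hw2 hV hx mG mF GFm Gx0 Fx0 GF S0 N0 hN hh hm hsup hint.
have [xW xp xS] := hx.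
have xm := halving_mono hx.
have nw2 := tail_nnweight hw2; have nw1 := tail_nnweight hw1.
pose D k := F (x k.+1) - F (x k); pose g k := G (x k.+1) - G (x k).
have xSle k : x k <= x k.+1 by exact: ltW.
have D0 k : 0 <= D k by have [_ ?] := GFm _ _ (xm 0%N k (leq0n _)) (xSle k); rewrite subr_ge0.
have g0 k : 0 <= g k by have [? _] := GFm _ _ (xm 0%N k (leq0n _)) (xSle k); rewrite subr_ge0.
pose B k := rtail w1 (x k) * D k `^ (a / p).
have W1p k : 0 < rtail w1 (x k) by exact: rtail_gt0.
have B0 k : 0 <= B k by rewrite mulr_ge0 ?powR_ge0 // ltW.
have F0 t : x 0%N <= t -> 0 <= F t by move=> xt; rewrite -Fx0; have [] := GFm _ _ (lexx _) xt.
have G0 t : x 0%N <= t -> 0 <= G t by move=> xt; rewrite -Gx0; have [] := GFm _ _ (lexx _) xt.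
have pF := posmeas_powR (a / p) mF.
(* The value of [F] at the end of a block is charged to the next block, whose [w1]-mass is a quarter
   of [W (x k)]. *)
have sumB : \sum_(k < n) B k <= 4 * N.
  rewrite -lee_fin EFinM -sumEFin.
  apply: (@le_trans _ _ (4%:E * \sum_(k < n) wint w1 `]x k.+1, x k.+2[ (fun t => F t `^ (a / p))%R)%E).
    rewrite ge0_sume_distrr; last by move=> k _; exact: (wint_ge0 nw1 _ pF).
    apply: lee_sum => k _.
    apply: (@le_trans _ _ (4%:E * ((F (x k.+1) `^ (a / p))%:E * (rtail w1 (x k.+1) - rtail w1 (x k.+2))%:E))%E).
      rewrite -!EFinM lee_fin.
      have -> : rtail w1 (x k.+1) - rtail w1 (x k.+2) = rtail w1 (x k) / 4.
        by rewrite (xW k.+1) (xW k.+2) [in RHS](xW k) !exprS; field; rewrite expf_neq0.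
      rewrite /B mulrC [F _ `^ _ * _]mulrC mulrA [4 * _]mulrC divfK // mulrC.
      rewrite ler_wpM2l ?(ltW (W1p _)) //; apply: le_powR => //; first by rewrite divr_ge0 // ltW.
      by rewrite /D gerBl F0 // xm.
    rewrite lee_wpmul2l ?lee_fin // -rtail_int //.
    apply: (wint_ge_cst nw1); [exact: powR_ge0|exact: pF|].
    move=> t; rewrite in_itv/= => /andP[xt _]; apply: le_powR; first by rewrite divr_ge0 // ltW.
      by rewrite F0 // xm.
    by have [_ ->] := GFm (x k.+1) t (xm 0%N k.+1 (leq0n _)) (ltW xt).
  rewrite lee_wpmul2l ?lee_fin //; apply: le_trans hN.
  have [m1 m2] := posmeas_nnweight nw1 pF.
  rewrite -(@integral_itv_sum _ _ m1 m2 (fun k => x k.+1) n) //.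
  apply: (wint_subset nw1 pF) => t /=; rewrite !in_itv/= andbT => /andP[xt _].
  exact: lt_trans xt.
have NB : (\sum_(k < n) B k) `^ (b / a) <= 4 `^ (b / a) * N `^ (b / a).
  rewrite -powRM //; apply: le_powR => //; first by rewrite divr_ge0 // ltW.
  by apply: sumr_ge0 => k _.
have local : (\sum_(k < n) wint w2 `]x k, x k.+1[ (fun t => (G t - G (x k)) `^ b)%R
    <= (C1 * (S `^ b * (4 `^ (b / a) * N `^ (b / a))))%:E)%E.
  apply: (@le_trans _ _ (\sum_(k < n) (C1 * ((h k * rtail w1 (x k) `^ (- a^-1)) *
      B k `^ a^-1) `^ b)%:E)%E).
    apply: lee_sum => k _.
    apply: (le_trans (LH w2 V (x k) (x k.+1) (h k) G F hw2 hV (xp k) (xSle k)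
      (hh k).1 (hh k).2 mG _ _)) => [s t xs st|s t xs st|].
    - by apply: GFm => //; exact: le_trans (xm 0%N k (leq0n _)) xs.
    - by apply: GF => //; exact: le_trans (xm 0%N k (leq0n _)) xs.
    rewrite lee_fin ler_wpM2l ?(ltW C10) //.
    have -> : h k * rtail w1 (x k) `^ (- a^-1) * B k `^ a^-1 = h k * D k `^ p^-1.
      have WW : rtail w1 (x k) `^ (- a^-1) * rtail w1 (x k) `^ a^-1 = 1.
        by rewrite -powRD ?(gt_eqF (W1p _)) ?implybT // addNr powRr0.
      have DD : (D k `^ (a / p)) `^ a^-1 = D k `^ p^-1.
        by rewrite -powRrM mulrAC divff // mul1r.
      by rewrite /B powRM ?powR_ge0 ?(ltW (W1p _)) // DD -mulrA [_ `^ (- _) * _]mulrA WW mul1r.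
    rewrite powRM ?powR_ge0 ?(hh k).1 // -powRrM [p^-1 * b]mulrC.
    by [].
  rewrite sumEFin lee_fin -mulr_sumr ler_wpM2l ?(ltW C10) //.
  apply: le_trans.
    apply: (@multiplier_le R _ a b _ (fun k : 'I_n => B k `^ a^-1) S) => //.
    - by move=> k; rewrite mulr_ge0 ?powR_ge0 // (hh k).1.
    - by move=> k; exact: powR_ge0.
  rewrite ler_wpM2l ?powR_ge0 //; apply: le_trans NB.
  rewrite le_eqVlt; apply/orP; left; apply/eqP; congr (_ `^ _).
  by apply: eq_bigr => k _; rewrite powR_powK // mulVf.
pose Gs t := \sum_(j < n | x j.+1 < t) g j.
pose Fs t := \sum_(j < n | x j.+1 < t) B j.
pose Us := block_sum p a w1 V x n.
have pGs : posmeas (Gs : realR R -> R).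
  exact: (posmeas_step_sum (fun j : 'I_n => x j.+1) (g := fun j : 'I_n => g j)).
have pUs : posmeas (Us : realR R -> R).
  by apply: (posmeas_step_sum (fun j : 'I_n => x j.+1)) => j; exact: block_weight_ge0.
have gB j : 0 <= g j /\ g j `^ a <= block_weight p a w1 V x j `^ (a - 1) * B j.
  split => //; have := GF _ _ (xm 0%N j (leq0n _)) (xS j); rewrite -/(g j) -/(D j) => gD.
  have an1 : a - 1 != 0 by rewrite gt_eqF // subr_gt0.
  have -> : block_weight p a w1 V x j `^ (a - 1) * B j =
      (V (x j) (x j.+1) `^ (p - 1) * D j) `^ (a / p).
    rewrite /block_weight /B powRM ?powR_ge0 // -!powRrM.
    rewrite [in RHS]powRM ?powR_ge0 // -powRrM.
    rewrite mulNr mulVf // mulrACA powRN powRr1 ?(ltW (W1p _)) // mulVf ?gt_eqF // mul1r.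
    by congr (_ `^ _ * _); field; rewrite pn an1.
  rewrite -[X in X <= _](@powR_powK _ (p / a) (a / p)) ?powR_ge0 //; last first.
    by field; rewrite pn an.
  apply: le_powR; [by rewrite divr_ge0 // ltW|exact: powR_ge0|].
  by rewrite -powRrM mulrCA divff // mulr1.
have inc (s t : R) : s <= t -> forall f : nat -> R,
    \sum_(j < n | x j.+1 < t) f j - \sum_(j < n | x j.+1 < s) f j =
    \sum_(j < n | (x j.+1 < t) && ~~ (x j.+1 < s)) f j.
  move=> st f; rewrite [X in X - _](bigID (fun j : 'I_n => x j.+1 < s)) /=.
  have -> : \sum_(j < n | (x j.+1 < t) && (x j.+1 < s)) f j = \sum_(j < n | x j.+1 < s) f j.
    by apply: eq_bigl => j; case xs: (x j.+1 < s); rewrite ?andbF // andbT (lt_le_trans xs st).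
  by rewrite addrAC subrr add0r.
have inc_le (s t : R) : s <= t ->
    (Gs t - Gs s) `^ a <= Us t `^ (a - 1) * (Fs t - Fs s).
  move=> st; rewrite /Gs /Fs !inc //.
  apply: (le_trans (@finite_holder R _ _ (fun j : 'I_n => g j)
    (fun j : 'I_n => block_weight p a w1 V x j) (fun j : 'I_n => B j) a a1
    (fun j => block_weight_ge0 _ _ _ _ _ _) (fun j => B0 j) (fun j _ => gB j))).
  rewrite ler_wpM2r ?sumr_ge0 //; apply: le_powR; first by lra.
    by apply: sumr_ge0 => j _; exact: block_weight_ge0.
  rewrite /Us /block_sum [leRHS](bigID (fun j : 'I_n => x j.+1 < s)) /= addrC lerDl.
  by apply: sumr_ge0 => j _; exact: block_weight_ge0.
have disc : (wint w2 `]x 0%N, x n[ (fun t => Gs t `^ b)%R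
    <= (C2 * (S `^ b * (4 `^ (b / a) * N `^ (b / a))))%:E)%E.
  have sub (t : R) (f : nat -> R) : (forall k, 0 <= f k) ->
      \sum_(j < n | x j.+1 < t) f j <= \sum_(j < n) f j.
    move=> f0; rewrite [leRHS](bigID (fun j : 'I_n => x j.+1 < t)) /= lerDl.
    exact: sumr_ge0.
  have FB0 : 0 <= \sum_(k < n) B k by exact: sumr_ge0.
  apply: (@le_trans _ _ (C2 * (S `^ b * (\sum_(k < n) B k) `^ (b / a)))%:E).
    rewrite /wint; apply: (HU w2 (x 0%N) (x n) (\sum_(j < n) g j) (\sum_(k < n) B k) S Gs Us Fs hw2
      (xp 0%N) (xm 0%N n (leq0n _)) FB0 S0).
    - exact: pGs.1.
    - exact: pUs.1.
    - move=> t _; split; [exact: pGs.2|exact: sub g0|exact: pUs.2| |exact: sub B0].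
      exact: sumr_ge0.
    - by move=> s t _ st _; rewrite -subr_ge0 inc // sumr_ge0.
    - move=> t; rewrite in_itv/= => /andP[xt _].
      have /inc_le : x 0%N <= t by exact: ltW.
      have z (f : nat -> R) : \sum_(j < n | x j.+1 < x 0%N) f j = 0.
        by rewrite big_pred0 // => j; apply/negbTE; rewrite -leNgt xm.
      by rewrite /Gs /Fs !z !subr0.
    - by move=> s t _ st _; apply: inc_le; exact: ltW.
    - exact: hsup.
    - exact: hint.
  rewrite lee_fin ler_wpM2l ?(ltW C20) // ler_wpM2l ?powR_ge0 //.
have [m1 m2] := posmeas_nnweight nw2 (posmeas_powR b mG).
have pGsb := posmeas_powR b pGs.1.
have pGk k : posmeas (fun t : realR R => (G t - G (x k)) `^ b).
  by apply: posmeas_powR; apply: measurable_funB; [exact: mG|exact: measurable_cst].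
have [m3 m4] := posmeas_nnweight nw2 pGsb.
rewrite [leLHS](@integral_itv_sum _ _ m1 m2 x n) //.
apply: (@le_trans _ _ (\sum_(k < n) ((2 `^ b)%:E * (wint w2 `]x k, x k.+1[ (fun t => Gs t `^ b)%R
    + wint w2 `]x k, x k.+1[ (fun t => (G t - G (x k)) `^ b)%R))%E)%E).
  apply: lee_sum => k _.
  rewrite -(wintD nw2 _ pGsb (pGk k)) -(wintZ nw2 _ (powR_ge0 _ _) (posmeasD pGsb (pGk k))).
  apply: (wint_le nw2); first exact: posmeas_powR.
    by apply: posmeasM; [exact/posmeas_cst/powR_ge0|apply: posmeasD; [exact: pGsb|exact: pGk]].
  move=> t; rewrite in_itv/= => /andP[xt tx].
  (* Inside the k-th block exactly the blocks [j < k] are completed, and their increments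
     telescope. *)
  have GsE : Gs t = G (x k).
    rewrite /Gs (eq_bigl (fun j : 'I_n => (j < k)%N)); last first.
      move=> j; apply/idP/idP => [jt|jk]; last exact: le_lt_trans (xm _ _ jk) xt.
      rewrite ltnNge; apply/negP => kj.
      by have := lt_trans jt tx; rewrite ltNge xm.
    rewrite -(big_ord_widen n g (ltnW (ltn_ord k))).
    by rewrite -(big_mkord xpredT g) telescope_sumr // Gx0 subr0.
  rewrite GsE -[X in X `^ b <= _](subrKC (G (x k))).
  apply: powR_add_le => //; first exact: G0 (xm 0%N k (leq0n _)).
  by rewrite subr_ge0; have [] := GFm (x k) t (xm 0%N k (leq0n _)) (ltW xt).
rewrite -ge0_sume_distrr; last first.
  by move=> k _; apply: adde_ge0; apply: (wint_ge0 nw2); [exact: pGsb|exact: pGk].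
have disc' : (\sum_(k < n) wint w2 `]x k, x k.+1[ (fun t => Gs t `^ b)%R
    <= (C2 * (S `^ b * (4 `^ (b / a) * N `^ (b / a))))%:E)%E.
  apply: le_trans disc; rewrite le_eqVlt; apply/orP; left; apply/eqP.
  by symmetry; exact: (integral_itv_sum m3 m4 n xSle).
have -> : 2 `^ b * (C1 + C2) * 4 `^ (b / a) * (S `^ b * N `^ (b / a)) =
    2 `^ b * (C2 * (S `^ b * (4 `^ (b / a) * N `^ (b / a))) +
              C1 * (S `^ b * (4 `^ (b / a) * N `^ (b / a)))) by ring.
rewrite big_split EFinM EFinD; apply: lee_wpmul2l; first by rewrite lee_fin powR_ge0.
by apply: leeD; [exact: disc'|exact: local].
Qed.

End upper_bound.

(** * Mass of the dual weight and growth of [J] *)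

Section dual_estimates.
Context {R : realType}.
Local Notation mu1 := (@completed_lebesgue_measure R).

Lemma halving_unbounded (w : realR R -> \bar R) x t : tail_weight w -> halving w x ->
  exists n, t < x n.
Proof.
move=> hw [xW xp _]; have [t0|t0] := ltP 0 t; last by exists 0%N; exact: le_lt_trans t0 (xp _).
have Wt := rtail_gt0 hw t0; have W0 := rtail_gt0 hw (xp 0%N).
exists (Num.truncn (rtail w (x 0%N) / rtail w t)); rewrite ltNge; apply/negP => xt.
have := rtail_anti hw (xp _) xt; rewrite xW leNgt => /negP; apply.
rewrite ltr_pdivrMr ?exprn_gt0 // mulrC -ltr_pdivrMr //.
by apply: lt_le_trans (truncnS_gt _) _; rewrite -natrX ler_nat ltn_expl.
Qed.

Section dual.
Variables (a : R).
Hypothesis a1 : 1 < a.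
Let ka := (a - 1)^-1.
Let ka0 : 0 < ka. Proof. by rewrite invr_gt0 subr_gt0. Qed.

Lemma dual_tail_div (w : realR R -> \bar R) s t (c : R) : tail_weight w -> 0 < s -> 0 < c ->
  rtail w t = rtail w s / c -> dual_tail a w t = c `^ ka * dual_tail a w s.
Proof.
move=> hw s0 c0 E; rewrite /dual_tail E powRM ?invr_ge0 ?(ltW c0) ?rtail_ge0 // mulrC.
by congr (_ * _); rewrite -(powR_inv1 (ltW c0)) -powRrM mulN1r opprK.
Qed.

(** A block on which the tail is halved has dual mass at least half of the dual tail at its left
    end; at the right end the dual tail is larger by the fixed factor [2 ^ (1/(a-1))]. *)
Lemma dual_half_le : exists2 C : R, 0 < C & forall (w : realR R -> \bar R) s t,
  tail_weight w -> 0 < s -> s <= t -> rtail w t = rtail w s / 2 ->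
  ((dual_tail a w t)%:E <= C%:E * \int[mu1]_(x in `]s, t[) dual_weight a w x)%E.
Proof.
exists (2 * 2 `^ ka); first by rewrite mulr_gt0 ?powR_gt0.
move=> w s t hw s0 st E; rewrite (dual_tail_div hw s0 _ E) //.
apply: (@le_trans _ _ ((2 * 2 `^ ka)%:E * (rtail w s `^ (- (a / (a - 1))) * (rtail w s - rtail w t))%:E)%E).
  rewrite -EFinM lee_fin E (_ : rtail w s - _ = rtail w s / 2); last by lra.
  have E2 := dual_tail_mul a1 hw s0.
  move: E2; set nu := dual_tail a w s; set q := rtail w s `^ _; set W := rtail w s.
  clearbody nu q W; move=> <-.
  by rewrite le_eqVlt; apply/orP; left; apply/eqP; field.
by apply: lee_wpmul2l; [rewrite lee_fin mulr_ge0 ?powR_ge0|exact: dual_int_ge].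
Qed.

(** Along halving points the dual tail grows by the factor [L > 1], so the blocks form a geometric
    sum dominated by the last one. The bound does not depend on the starting point [s], which then
    tends to 0. *)
Lemma dual_int_le_tail : exists2 C : R, 0 < C & forall (w : realR R -> \bar R) (t : R),
  tail_weight w -> 0 < t ->
  (\int[mu1]_(x in `]0%R, t[) dual_weight a w x <= (C * dual_tail a w t)%:E)%E.
Proof.
pose L := 2 `^ ka; have L1 : 1 < L.
  have E1 : 1 = 1 `^ ka :> R by rewrite powR1.
  by rewrite /L [ltLHS]E1; apply: gt0_ltr_powR; rewrite ?nnegrE ?ltr1n ?ler01 ?ler0n.
have L0 : 0 < L by lra.
have LE : L = 2 `^ ka by []. clearbody L.
(* [K = L / (L - 1)] solves [K + L = K L], which closes the induction over the blocks. *)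
have [K K0 KE] : exists2 K, 0 < K & forall z, K * z + L * z = K * (L * z).
  exists (L / (L - 1)); first by rewrite divr_gt0 // subr_gt0.
  by move=> z; field; rewrite gt_eqF // subr_gt0.
exists (K + 1); first by lra.
move=> w t hw t0; have [mo o0] := dual_nnweight a hw.
apply: (integral_itv_left_le mo o0) => [|s s0 _].
  by rewrite lee_fin mulr_ge0 ?powR_ge0 //; lra.
have [x [x0 xW xp xS]] := halving_points hw s0.
have hx : halving w x by split => // k; rewrite xW x0.
have xm := halving_mono hx.
have nuS k : dual_tail a w (x k.+1) = L * dual_tail a w (x k).
  by rewrite LE; apply: dual_tail_div => //; rewrite !xW exprS invfM mulrCA mulrC.
have step u v : 0 < u -> u <= v -> rtail w u <= 2 * rtail w v ->
    (\int[mu1]_(y in `]u, v[) dual_weight a w y <= (dual_tail a w v)%:E)%E.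
  move=> u0 uv W2; have v0 : 0 < v by exact: lt_le_trans uv.
  apply: (le_trans (dual_int_le a1 hw u0 uv)).
  rewrite lee_fin -(dual_tail_mul a1 hw v0) ler_wpM2l ?powR_ge0 //; lra.
have W2 k : rtail w (x k) = 2 * rtail w (x k.+1).
  by rewrite !xW exprS invfM; field; rewrite expf_neq0.
have sx k : s <= x k by rewrite -x0; exact: xm.
have blk k : (\int[mu1]_(y in `]s, x k[) dual_weight a w y <= (K * dual_tail a w (x k))%:E)%E.
  elim: k => [|k IH].
    rewrite x0 set_itv_ge ?bnd_simp ?ltxx // integral_set0 lee_fin mulr_ge0 ?powR_ge0 //.
    exact: ltW.
  rewrite (integral_itv_split_oo mo o0 (sx k) (ltW (xS k))).
  apply: (le_trans (leeD IH (step _ _ (xp _) (ltW (xS k)) _))); first by rewrite W2.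
  by rewrite -EFinD lee_fin nuS KE.
(* A point inside a block costs one more, incomplete block, hence [K + 1]. *)
have all_t k v : s <= v -> v <= x k ->
    (\int[mu1]_(y in `]s, v[) dual_weight a w y <= ((K + 1) * dual_tail a w v)%:E)%E.
  elim: k v => [|k IH] v sv vx.
    rewrite set_itv_ge ?bnd_simp -?leNgt -?x0 // integral_set0 lee_fin mulr_ge0 ?powR_ge0 //.
    lra.
  have [vk|kv] := leP v (x k); first exact: IH.
  rewrite (integral_itv_split_oo mo o0 (sx k) (ltW kv)).
  have Wv : rtail w (x k) <= 2 * rtail w v.
    rewrite W2; apply: ler_wpM2l => //; apply: rtail_anti => //.
    exact: lt_trans (xp k) kv.
  apply: (le_trans (leeD (blk k) (step _ _ (xp _) (ltW kv) Wv))).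
  have nn : dual_tail a w (x k) <= dual_tail a w v.
    by apply: dual_tail_homo => //; exact: ltW.
  move: nn; move: (dual_tail a w (x k)) (dual_tail a w v) => n1 n2 n12.
  rewrite -EFinD lee_fin mulrDl mul1r lerD2r.
  by apply: ler_wpM2l => //; exact: ltW.
have [n tn] := halving_unbounded t hw hx.
have [st|ts] := leP s t; first by apply: all_t st (ltW tn).
rewrite set_itv_ge ?bnd_simp -?leNgt ?(ltW ts) // integral_set0 lee_fin mulr_ge0 ?powR_ge0 //.
lra.
Qed.

End dual.

(** What the upper bounds use of the shell masses. The last clause is additivity across a sphere,
    which holds because spheres are null. *)
Definition shell_data (V : R -> R -> R) : Prop :=
  [/\ shell_fun V, forall t, measurable_fun setT (fun s : realR R => V s t),
      forall s t, t <= s -> V s t = 0 &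
      forall r s t, 0 < r -> r <= s -> s <= t -> V r t = V r s + V s t].

(** The exponent [q1 (p1 - p2) / (p1 (q1 - p2))] of the statement in the rescaled exponents; it
    satisfies [theta (a - 1) / a = (p - 1) / p]. *)
Definition theta (p a : R) := a * (p - 1) / (p * (a - 1)).

Lemma theta_gt0 p a : 1 < p -> 1 < a -> 0 < theta p a.
Proof. by move=> p1 a1; rewrite divr_gt0 // mulr_gt0 //; lra. Qed.

Definition Jint (p a : R) (w : realR R -> \bar R) (V : R -> R -> R) (c t : R) : \bar R :=
  wint (dual_weight a w) `]c, t[ (fun s => V s t `^ theta p a).

(** For [r < s], [V r t] splits into [V r s] and [V s t]. The second part, and the whole range
    [(s, t)], cost the shell [V s t] times a dual mass, which [dual_int_le_tail] bounds by the dual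
    tail at [t]. *)
Lemma Jint_growth (p a : R) : 1 < p -> 1 < a -> exists2 C : R, 0 < C &
  forall (w : realR R -> \bar R) (V : R -> R -> R) (c s t : R),
  tail_weight w -> shell_data V -> 0 <= c -> c <= s -> 0 < s -> s <= t ->
  (Jint p a w V c t <=
   C%:E * (Jint p a w V c s + (V s t `^ theta p a * dual_tail a w t)%:E))%E.
Proof.
move=> p1 a1; have th0 := theta_gt0 p1 a1.
have [C C0 hC] := dual_int_le_tail a1.
pose q := 2 `^ theta p a; have q0 : 0 < q by rewrite powR_gt0.
exists (q + q * C + C); first by rewrite !addr_gt0 ?mulr_gt0.
move=> w V c s t hw [[V0 Vm] mV Vn Va] c0 cs s0 st.
have t0 : 0 < t by exact: lt_le_trans st.
have no := dual_nnweight a hw.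
have pV v : posmeas (fun r : realR R => V r v `^ theta p a).
  by apply: posmeas_powR; exact: mV.
have [m1 m2] := posmeas_nnweight no (pV t).
have E : Jint p a w V c t = (wint (dual_weight a w) `]c, s[ (fun r => V r t `^ theta p a)%R
   + wint (dual_weight a w) `]s, t[ (fun r => V r t `^ theta p a)%R)%E.
  exact: (integral_itv_split_oo m1 m2 cs st).
have om_le u v : 0 <= u -> v <= t ->
    (\int[mu1]_(x in `]u, v[) dual_weight a w x <= (C * dual_tail a w t)%:E)%E.
  move=> u0 vt; apply: le_trans (hC w t hw t0).
  apply: (integral_itv_subset no.1 no.2) => x /=; rewrite !in_itv/= => /andP[ux xv].
  by rewrite (le_lt_trans u0 ux) (lt_le_trans xv vt).
have V1 : 0 <= V s t `^ theta p a by exact: powR_ge0.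
have h2 : (wint (dual_weight a w) `]s, t[ (fun r => V r t `^ theta p a)%R
    <= (V s t `^ theta p a * (C * dual_tail a w t))%:E)%E.
  rewrite EFinM; apply: (@le_trans _ _ ((V s t `^ theta p a)%:E *
     \int[mu1]_(x in `]s, t[) dual_weight a w x)%E).
    apply: (wint_le_cst no (pV t)) => r; rewrite in_itv/= => /andP[sr _].
    by apply: le_powR; [exact: ltW|exact: V0|apply: Vm => //; exact: ltW].
  by apply: lee_wpmul2l; [rewrite lee_fin|exact: om_le (ltW s0) (lexx _)].
have h1 : (wint (dual_weight a w) `]c, s[ (fun r => V r t `^ theta p a)%R
    <= q%:E * (Jint p a w V c s + (V s t `^ theta p a * (C * dual_tail a w t))%:E))%E.
  apply: (@le_trans _ _ (wint (dual_weight a w) `]c, s[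
     (fun r => q * (V r s `^ theta p a + V s t `^ theta p a))%R)).
    apply: (wint_le no (pV t)).
      apply: posmeasM; first exact: posmeas_cst (ltW q0).
      by apply: posmeasD; [exact: pV|exact: posmeas_cst].
    move=> r; rewrite in_itv/= => /andP[cr rs].
    rewrite (Va r s t (le_lt_trans c0 cr) (ltW rs) st).
    exact: powR_add_le.
  rewrite (wintZ no _ (ltW q0) (posmeasD (pV s) (posmeas_cst V1))).
  apply: lee_wpmul2l; first by rewrite lee_fin ltW.
  rewrite (wintD no _ (pV s) (posmeas_cst V1)); apply: leeD; first exact: lexx.
  rewrite EFinM; apply: (@le_trans _ _ ((V s t `^ theta p a)%:E *
     \int[mu1]_(x in `]c, s[) dual_weight a w x)%E).
    by apply: (wint_le_cst no (posmeas_cst V1)).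
  by apply: lee_wpmul2l; [rewrite lee_fin|exact: om_le c0 st].
rewrite E; apply: (le_trans (leeD h1 h2)).
have J0 : (0 <= Jint p a w V c s)%E by exact: (wint_ge0 no _ (pV s)).
set X := V s t `^ theta p a in V1 *; set nu := dual_tail a w t.
have nu0 : 0 <= nu by exact: powR_ge0.
move: J0; case: (Jint p a w V c s) => [j j0|_|//]; last first.
  by rewrite !addye // !gt0_muley ?lte_fin ?addr_gt0 ?mulr_gt0 // addye // leey.
rewrite -!(EFinD, EFinM) lee_fin; rewrite lee_fin in j0.
have h : 0 <= X * nu by exact: mulr_ge0.
have h3 : 0 <= (q * C + C) * j by rewrite mulr_ge0 //; have := mulr_gt0 q0 C0; lra.
have h4 : 0 <= q * (X * nu) by rewrite mulr_ge0 // ltW.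
by lra.
Qed.

End dual_estimates.

(** * Block sums against [J] and the Hardy condition *)

Section upper_bound_conditions.
Context {R : realType}.
Local Notation mu1 := (@completed_lebesgue_measure R).

(** Block [i.+1] is charged to the dual mass of the preceding block: there [V r t] is at least the
    shell of block [i.+1], and [dual_half_le] gives the mass. Block 0 has no predecessor and is left
    to [block_head_le]. *)
Lemma block_tail_sum_le (p a : R) : 1 < p -> 1 < a -> exists2 C : R, 0 < C &
  forall (w : realR R -> \bar R) (V : R -> R -> R) (x : nat -> R) n (t : R),
  tail_weight w -> shell_data V -> halving w x -> 0 < t ->
  ((\sum_(i < n | x i.+2 <= t) block_weight p a w V x i.+1)%:E <=
   C%:E * Jint p a w V 0 t)%E.
Proof.
move=> p1 a1; have th0 := theta_gt0 p1 a1.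
have [C C0 hC] := dual_half_le a1.
exists C => // w V x n t hw [[V0 Vm] mV Vn Va] hx t0; have [xW xp xS] := hx.
have no := dual_nnweight a hw.
have pV : posmeas (fun r : realR R => V r t `^ theta p a).
  by apply: posmeas_powR; exact: mV.
have [m1 m2] := posmeas_nnweight no pV.
pose X i := wint (dual_weight a w) `]x i, x i.+1[ (fun r => V r t `^ theta p a).
have X0 i : (0 <= X i)%E by exact: (wint_ge0 no _ pV).
have blk i : x i.+2 <= t -> ((block_weight p a w V x i.+1)%:E <= C%:E * X i)%E.
  move=> xt; rewrite /block_weight -/(theta p a) mulrC EFinM.
  apply: (@le_trans _ _ ((V (x i.+1) (x i.+2) `^ theta p a)%:E *
     (C%:E * \int[mu1]_(y in `]x i, x i.+1[) dual_weight a w y))%E).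
    apply: lee_wpmul2l; first by rewrite lee_fin powR_ge0.
    by apply: hC => //; [exact: ltW|rewrite (xW i.+1) (xW i) exprS invfM; field; rewrite expf_neq0].
  rewrite muleCA; apply: lee_wpmul2l; first by rewrite lee_fin ltW.
  apply: (wint_ge_cst no); [exact: powR_ge0|exact: pV|].
  move=> y; rewrite in_itv/= => /andP[xy yx]; apply: le_powR; [exact: ltW|exact: V0|].
  by apply: Vm => //; [exact: lt_trans xy|exact: ltW].
rewrite -sumEFin.
apply: (@le_trans _ _ (\sum_(i < n) C%:E * X i)%E).
  rewrite big_mkcond /=; apply: lee_sum => i _; case: ifP => [|_]; first exact: blk.
  by apply: mule_ge0; [rewrite lee_fin ltW|exact: X0].
rewrite -ge0_sume_distrr; last by move=> i _; exact: X0.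
apply: lee_wpmul2l; first by rewrite lee_fin ltW.
have -> : (\sum_(i < n) X i)%E = wint (dual_weight a w) `]x 0%N, x n[ (fun r => V r t `^ theta p a).
  by symmetry; exact: (integral_itv_sum m1 m2 n (fun k => ltW (xS k))).
(* The point [x n] may exceed [t]; beyond [t] the shell is empty and contributes nothing. *)
apply: (@le_trans _ _ (wint (dual_weight a w) `]0, +oo[ (fun r => V r t `^ theta p a)%R)).
  apply: (wint_subset no pV) => y /=; rewrite !in_itv/= andbT => /andP[xy _].
  exact: lt_trans xy.
rewrite /wint (integral_itv_split m1 m2 (ltW t0) (b := +oo%O)) //.
rewrite -[leRHS]adde0; apply: leeD; first exact: lexx.
apply: (le_trans (wint_le_cst no pV (k := 0) _)) => [y|]; last by rewrite mul0e.
rewrite in_itv/= andbT => ty; rewrite Vn ?(ltW ty) // powR0 ?lexx //.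
by rewrite gt_eqF.
Qed.

Lemma block_sum_le (p a : R) (w : realR R -> \bar R) (V : R -> R -> R) x n t :
  block_sum p a w V x n.+1 t <= (if x 1%N < t then block_weight p a w V x 0 else 0)
    + \sum_(i < n | x i.+2 < t) block_weight p a w V x i.+1.
Proof.
rewrite /block_sum big_mkcond big_ord_recl /= lerD2l [leRHS]big_mkcond /=.
exact: lexx.
Qed.

Lemma block_power (p a : R) (w : realR R -> \bar R) (V : R -> R -> R) s t :
  1 < p -> 1 < a ->
  (dual_tail a w s * V s t `^ theta p a) `^ ((a - 1) / a) =
  rtail w s `^ (- a^-1) * V s t `^ ((p - 1) / p).
Proof.
move=> p1 a1; have pn : p != 0 by rewrite gt_eqF //; lra.
have an : a != 0 by rewrite gt_eqF //; lra.
have an1 : a - 1 != 0 by rewrite gt_eqF // subr_gt0.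
rewrite powRM ?powR_ge0 // -!powRrM; congr (_ `^ _ * _ `^ _); rewrite /theta.
  by field; rewrite an an1.
by field; rewrite an an1 pn.
Qed.

(** After the power [(a - 1) / a] the block weight is [W1 ^ (-1/a) V ^ ((p - 1) / p)], so the
    pointwise Hardy condition at the inner radius pays for a block without a predecessor. *)
Lemma block_head_le (p a b : R) : 1 < p -> 1 < a -> 0 < b -> exists2 C : R, 0 < C &
  forall (w1 w2 : realR R -> \bar R) V x h z, tail_weight w2 -> shell_fun V ->
  0 < x -> x < z -> 0 <= h -> hardy_cond p b w2 V x h ->
  (dual_tail a w1 x * V x z `^ theta p a) `^ ((a - 1) / a) * rtail w2 z `^ b^-1 <=
  C * (h * rtail w1 x `^ (- a^-1)).
Proof.
move=> p1 a1 b0; have [C C0 hC] := hardy_cond_sup p1 b0.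
exists C => // w1 w2 V x h z hw2 hV x0 xz h0 hh.
rewrite block_power //.
have := hC w2 V x h z hw2 hV x0 xz h0 hh.
set A := V x z `^ _; set B := rtail w2 z `^ _; set D := rtail w1 x `^ _ => hAB.
have D0 : 0 <= D by exact: powR_ge0.
have := ler_wpM2l D0 hAB; clearbody A B D; lra.
Qed.

End upper_bound_conditions.

(** * Upper bounds for [a <= b] and for [b < a] *)

Section upper_bound_cases.
Context {R : realType}.
Local Notation mu1 := (@completed_lebesgue_measure R).

Lemma halving_bound (w1 w2 : realR R -> \bar R) (x0 : R) (X : realR R -> R) (M : \bar R) :
  tail_weight w1 -> tail_weight w2 -> 0 < x0 -> posmeas X ->
  (forall x n, halving w1 x -> x 0%N = x0 -> (wint w2 `]x 0%N, x n.+1[ X <= M)%E) ->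
  (wint w2 `]x0, +oo[ X <= M)%E.
Proof.
move=> hw1 hw2 x00 pX h; have nw2 := tail_nnweight hw2.
have [x [xE xW xp xS]] := halving_points hw1 x00.
have hx : halving w1 x by split => // k; rewrite xE.
have [m1 m2] := posmeas_nnweight nw2 pX.
apply: (integral_itv_infty_le m1 m2) => t tx.
have [n tn] := halving_unbounded t hw1 hx.
apply: le_trans (h x n hx xE).
apply: (wint_subset nw2 pX) => y /=; rewrite !in_itv/= xE => /andP[-> yt] /=.
by apply: lt_trans yt (lt_le_trans tn _); exact: ltW (xS n).
Qed.

(** With [h x = S W1(x) ^ (1/a)] the multipliers of the blocks are all equal to [S]. The supremum
    condition for [block_sum] follows by treating block 0 with the Hardy condition and the other
    blocks with [J]. *)
Lemma upper_le (p a b : R) : 1 < p -> 1 < a -> 1 < b -> a <= b -> exists2 C : R, 0 < C &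
  forall (w1 w2 : realR R -> \bar R) V (Jr : R -> R) S N x0 (G F : R -> R),
  tail_weight w1 -> tail_weight w2 -> shell_data V -> 0 < x0 ->
  measurable_fun setT (G : realR R -> R) -> measurable_fun setT (F : realR R -> R) ->
  (forall s t, x0 <= s -> s <= t -> G s <= G t /\ F s <= F t) ->
  G x0 = 0 -> F x0 = 0 ->
  (forall s t, x0 <= s -> s < t -> (G t - G s) `^ p <= V s t `^ (p - 1) * (F t - F s)) ->
  0 <= S -> 0 <= N -> (wint w1 `]x0, +oo[ (fun t => F t `^ (a / p))%R <= N%:E)%E ->
  (forall t, 0 < t -> Jint p a w1 V 0 t = (Jr t)%:E) ->
  (forall x, 0 < x -> hardy_cond p b w2 V x (S * rtail w1 x `^ a^-1)) ->
  (forall t, 0 < t -> Jr t `^ ((a - 1) / a) * rtail w2 t `^ b^-1 <= S) ->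
  (wint w2 `]x0, +oo[ (fun t => G t `^ b)%R <= (C * (S `^ b * N `^ (b / a)))%:E)%E.
Proof.
move=> p1 a1 b1 ab; have b0 : 0 < b by lra.
have a0 : 0 < a by lra.
have an : a != 0 by rewrite gt_eqF.
have [C1 C10 hU] := upper_blocks p1 a1 b1.
have [C2 C20 hT] := block_tail_sum_le p1 a1.
have [C3 C30 hH] := block_head_le p1 a1 b0.
pose e := (a - 1) / a; have e0 : 0 < e by rewrite divr_gt0 // subr_gt0.
(* [K >= 1] lets the one constant [K S] also dominate the multiplier bound [S]. *)
have [K K1 KE] : exists2 K, 1 <= K & 2 `^ e * (C3 + C2 `^ e) <= K.
  by exists (Num.max 1 (2 `^ e * (C3 + C2 `^ e))); rewrite le_max lexx ?orbT.
have K0 : 0 < K by lra.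
exists (C1 * K `^ b); first by rewrite mulr_gt0 ?powR_gt0.
move=> w1 w2 V Jr S N x0 G F hw1 hw2 hV x00 mG mF GFm Gx0 Fx0 GF S0 N0 hN hJ hh hJS.
apply: (halving_bound hw1 hw2 x00 (posmeas_powR b mG)) => x n hx xE.
have [xW xp xS] := hx; have [hV1 _ _ _] := hV.
have Wa k : rtail w1 (x k) `^ a^-1 * rtail w1 (x k) `^ (- a^-1) = 1.
  have W1p : 0 < rtail w1 (x k) by exact: rtail_gt0.
  by rewrite -powRD ?(gt_eqF W1p) ?implybT // subrr powRr0.
have -> : C1 * K `^ b * (S `^ b * N `^ (b / a)) = C1 * ((K * S) `^ b * N `^ (b / a)).
  by rewrite powRM ?(ltW K0) // -!mulrA.
have KS0 : 0 <= K * S by rewrite mulr_ge0 // ltW.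
rewrite -xE in GFm Gx0 Fx0 GF hN.
apply: (hU w1 w2 V x n.+1 (fun k => S * rtail w1 (x k) `^ a^-1) (K * S) N G F
  hw1 hw2 hV1 hx mG mF GFm Gx0 Fx0 GF KS0 N0 hN).
- by move=> k; split; [rewrite mulr_ge0 ?powR_ge0|exact: hh].
- split=> [_ k|]; last by rewrite ltNge ab.
  by rewrite -mulrA Wa mulr1 ler_peMl.
- move=> _ t; rewrite in_itv/= => /andP[xt _].
  have t0 : 0 < t by exact: lt_trans xt.
  have B0 : 0 <= rtail w2 t `^ b^-1 by exact: powR_ge0.
  have hsum : \sum_(i < n | x i.+2 < t) block_weight p a w1 V x i.+1 <= C2 * Jr t.
    rewrite -lee_fin EFinM -hJ //; apply: le_trans (hT w1 V x n t hw1 hV hx t0).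
    rewrite lee_fin [leLHS]big_mkcond [leRHS]big_mkcond /=; apply: ler_sum => i _.
    case: ifP => [/ltW ->|_]; first exact: lexx.
    by case: ifP => // _; exact: block_weight_ge0.
  have J0 : 0 <= Jr t.
    rewrite -lee_fin -hJ //; apply: wint_ge0; first exact: dual_nnweight.
    by apply: posmeas_powR; have [_ mV _ _] := hV; exact: mV.
  have head : (if x 1%N < t then block_weight p a w1 V x 0 else 0) `^ e
      * rtail w2 t `^ b^-1 <= C3 * S.
    case: ifP => [x1t|_]; last by rewrite powR0 ?gt_eqF // mul0r mulr_ge0 // ltW.
    have := hH w1 w2 V (x 0%N) (S * rtail w1 (x 0%N) `^ a^-1) t hw2 hV1 (xp 0%N) xt
      (mulr_ge0 S0 (powR_ge0 _ _)) (hh _ (xp 0%N)).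
    rewrite -mulrA Wa mulr1; apply: le_trans.
    apply: ler_wpM2r; first exact: B0.
    apply: le_powR; [exact: ltW|exact: block_weight_ge0|].
    apply: ler_wpM2l; first exact: powR_ge0.
    apply: le_powR; [exact: ltW (theta_gt0 p1 a1)|exact: hV1.1|].
    by apply: hV1.2; [exact: xp|exact: lexx|exact: ltW].
  apply: (@le_trans _ _ ((2 `^ e * (C3 + C2 `^ e)) * S)); last by apply: ler_wpM2r; [exact: S0|exact: KE].
  have u0 : 0 <= (if x 1%N < t then block_weight p a w1 V x 0 else 0).
    by case: ifP => // _; exact: block_weight_ge0.
  apply: (@le_trans _ _ ((2 `^ e * ((if x 1%N < t then block_weight p a w1 V x 0 else 0) `^ e
      + (C2 * Jr t) `^ e)) * rtail w2 t `^ b^-1)).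
    apply: ler_wpM2r; first exact: B0.
    apply: (@le_trans _ _ (((if x 1%N < t then block_weight p a w1 V x 0 else 0)
      + C2 * Jr t) `^ e)).
      apply: le_powR; [exact: ltW| |].
        by apply: sumr_ge0 => j _; exact: block_weight_ge0.
      by apply: (le_trans (block_sum_le _ _ _ _ _ _ _)); rewrite lerD2l.
    by apply: powR_add_le; [exact: e0|exact: u0|apply: mulr_ge0 => //; exact: ltW].
  rewrite -mulrA -[leRHS]mulrA; apply: ler_wpM2l; first exact: powR_ge0.
  rewrite mulrDl [leRHS]mulrDl; apply: lerD; first exact: head.
  rewrite (powRM _ (ltW C20) J0) -mulrA; apply: ler_wpM2l; first exact: powR_ge0.
  exact: hJS.
- by rewrite ltNge ab.
Qed.

Lemma ge_cst_integral (w : realR R -> \bar R) (i : interval R) (Z : realR R -> \bar R) (k : R) :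
  nnweight w -> measurable_fun setT Z -> (forall t, 0 <= Z t)%E -> 0 <= k ->
  (forall t, t \in i -> (k%:E <= Z t)%E) ->
  (k%:E * \int[mu1]_(t in [set` i]) w t <= \int[mu1]_(t in [set` i]) (Z t * w t))%E.
Proof.
move=> [mw w0] mZ Z0 k0 h; rewrite -ge0_integralZl; first last.
- by rewrite lee_fin.
- by move=> t _; exact: w0.
- exact: measurable_funTS.
- exact: measurable_itvR.
apply: ge0_le_integral; first exact: measurable_itvR.
- by move=> t _; apply: mule_ge0 => //; rewrite lee_fin.
- by apply: measurable_funTS; apply: emeasurable_funM; [exact: measurable_cst|exact: mw].
- by apply: measurable_funTS; apply: emeasurable_funM.
- by move=> t ti; apply: lee_wpmul2r => //; exact: h.
Qed.

(** The integral of [block_sum ^ q] is linearised: [half_sum] replaces [(sum s) ^ (q1 + 1)] by the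
    sum of [s T ^ q1], where [T] collects the blocks up to the current one, and each step integrated
    against the tail power gives [W2 (x i.+2) ^ rho]. Then [T i] is bounded by [J (x i)] and one
    shell; the first leads to the integral with [M], the second to the multipliers [h]. *)
Lemma upper_gt (p a b : R) : 1 < p -> 1 < a -> 1 < b -> b < a -> exists2 C : R, 0 < C &
  forall (w1 w2 : realR R -> \bar R) V (Jr : R -> R) (M : R -> \bar R) (h : R -> R) S N x0 (G F : R -> R),
  tail_weight w1 -> tail_weight w2 -> shell_data V -> 0 < x0 ->
  measurable_fun setT (G : realR R -> R) -> measurable_fun setT (F : realR R -> R) ->
  (forall s t, x0 <= s -> s <= t -> G s <= G t /\ F s <= F t) ->
  G x0 = 0 -> F x0 = 0 ->
  (forall s t, x0 <= s -> s < t -> (G t - G s) `^ p <= V s t `^ (p - 1) * (F t - F s)) ->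
  0 <= S -> 0 <= N -> (wint w1 `]x0, +oo[ (fun t => F t `^ (a / p))%R <= N%:E)%E ->
  (forall t, 0 < t -> Jint p a w1 V 0 t = (Jr t)%:E) ->
  measurable_fun setT (Jr : realR R -> R) ->
  (forall s t, 0 < s -> s <= t -> 0 <= Jr s /\ Jr s <= Jr t) ->
  (forall x, 0 < x -> 0 <= h x /\ hardy_cond p b w2 V x (h x)) ->
  (forall x n, halving w1 x -> x 0%N = x0 ->
     \sum_(k < n) (h (x k) * rtail w1 (x k) `^ (- a^-1)) `^ (a * b / (a - b))
       <= S `^ (a * b / (a - b))) ->
  measurable_fun setT (M : realR R -> \bar R) -> (forall t, 0 <= M t)%E ->
  (forall t z, 0 < t -> t < z ->
     ((V t z `^ theta p a * rtail w2 z `^ (a / (a - b)))%:E <= M t)%E) ->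
  (forall s t, s <= t -> (M t <= M s)%E) ->
  (\int[mu1]_(t in `]0%R, +oo[)
      ((Jr t `^ (a * (b - 1) / (a - b)))%:E * M t * dual_weight a w1 t)
    <= (S `^ (a * b / (a - b)))%:E)%E ->
  (wint w2 `]x0, +oo[ (fun t => G t `^ b)%R <= (C * (S `^ b * N `^ (b / a)))%:E)%E.
Proof.
move=> p1 a1 b1 ba; have b0 : 0 < b by lra.
have a0 : 0 < a by lra.
have [an [bn abn]] : a != 0 /\ (b != 0 /\ a - b != 0).
  by rewrite !gt_eqF // subr_gt0.
have an1 : a - 1 != 0 by rewrite gt_eqF // subr_gt0.
have ab0 : 0 < a - b by rewrite subr_gt0.
have [C1 C10 hU] := upper_blocks p1 a1 b1.
have [C2 C20 hT] := block_tail_sum_le p1 a1.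
have [C3 C30 hH] := block_head_le p1 a1 b0.
have [C4 C40 hG] := Jint_growth p1 a1.
have [C5 C50 hD] := dual_half_le a1.
set q1 := a * (b - 1) / (a - b); set r := a * b / (a - b); set rho := a / (a - b).
move: hU; set q := b * (a - 1) / (a - b); rewrite -/r; set rho' := b / (a - b) => hU.
have q0 : 0 < q by rewrite divr_gt0 // mulr_gt0 // subr_gt0.
have q10 : 0 < q1 by rewrite divr_gt0 // mulr_gt0 // subr_gt0.
have r0 : 0 < r by rewrite divr_gt0 // mulr_gt0.
have rn : r != 0 by rewrite gt_eqF.
have qE : q = q1 + 1 by rewrite /q /q1; field.
have rhoE : rho - 1 = rho' by rewrite /rho /rho'; field.
have rho1 : 1 <= rho by rewrite /rho ler_pdivlMr //; lra.
(* The pointwise Hardy condition raised to the power [r] produces exactly the exponents [q] and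
   [rho]. *)
have qr : (a - 1) / a * r = q by rewrite /r /q; field; rewrite an abn.
have br : b^-1 * r = rho by rewrite /r /rho; field; rewrite bn abn.
have rE : r = a * b / (a - b) by [].
clearbody q1 r rho q rho'.
have [ka kaE] : {k | k = 2 `^ (a - 1)^-1} by exists (2 `^ (a - 1)^-1).
have [ka4 ka4E] : {k | k = 4 `^ (a - 1)^-1} by exists (4 `^ (a - 1)^-1).
have ka0 : 0 < ka by rewrite kaE powR_gt0.
have ka40 : 0 < ka4 by rewrite ka4E powR_gt0.
have [A AE] : {A | A = 2 `^ q1 * ((C2 * C4) `^ q1)} by exists (2 `^ q1 * ((C2 * C4) `^ q1)).
have A0 : 0 < A by rewrite AE mulr_gt0 ?powR_gt0 ?mulr_gt0.
have [B BE] : {B | B = C5 + ka4 `^ q1 * ka * C3 `^ r} by exists (C5 + ka4 `^ q1 * ka * C3 `^ r).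
have B0 : 0 < B by rewrite BE addr_gt0 // !mulr_gt0 // powR_gt0.
have [K0 K0E] : {K0 | K0 = 2 `^ q * (C3 `^ r + 2 `^ q * (A * B))}.
  by exists (2 `^ q * (C3 `^ r + 2 `^ q * (A * B))).
have K00 : 0 < K0.
  by rewrite K0E mulr_gt0 ?powR_gt0 // addr_gt0 ?powR_gt0 // mulr_gt0 ?powR_gt0 // mulr_gt0.
have [K K1 KE] : exists2 K, 1 <= K & K0 <= K `^ r.
  exists (Num.max 1 (K0 `^ r^-1)); first by rewrite le_max lexx.
  rewrite -[leLHS](@powR_powK _ r^-1 r) ?mulVf ?(ltW K00) //.
  by apply: le_powR; [exact: ltW|exact: powR_ge0|rewrite le_max lexx orbT].
have Kp : 0 < K by exact: lt_le_trans K1.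
exists (C1 * K `^ b); first by rewrite mulr_gt0 ?powR_gt0.
move=> w1 w2 V Jr M h S N x0 G F hw1 hw2 hV x00 mG mF GFm Gx0 Fx0 GF S0 N0 hN hJ mJ Jm hh hS
  mM M0 hM Mm hI.
apply: (halving_bound hw1 hw2 x00 (posmeas_powR b mG)) => x n hx xE.
have [xW xp xS] := hx; have [hV1 mV _ _] := hV.
have nw2 := tail_nnweight hw2.
have xm := halving_mono hx.
have -> : C1 * K `^ b * (S `^ b * N `^ (b / a)) = C1 * ((K * S) `^ b * N `^ (b / a)).
  by rewrite powRM ?(ltW Kp) // -!mulrA.
pose H k := h (x k) * rtail w1 (x k) `^ (- a^-1).
have H0 k : 0 <= H k by rewrite mulr_ge0 ?powR_ge0 // (hh _ (xp k)).1.
have sumH m : \sum_(k < m) H k `^ r <= S `^ r by exact: hS.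
have Sr0 : 0 <= S `^ r by exact: powR_ge0.
have KS : S `^ r <= (K * S) `^ r.
  by apply: le_powR; [exact: ltW|exact: S0|rewrite ler_peMl].
have headpow k z : x k < z ->
    (dual_tail a w1 (x k) * V (x k) z `^ theta p a) `^ q * rtail w2 z `^ rho
    <= C3 `^ r * H k `^ r.
  move=> xz; have [h0 hc] := hh _ (xp k).
  have := hH w1 w2 V (x k) (h (x k)) z hw2 hV1 (xp k) xz h0 hc.
  move=> /(le_powR (ltW r0) (mulr_ge0 (powR_ge0 _ _) (powR_ge0 _ _))).
  rewrite -/(H k) (powRM _ (ltW C30) (H0 k)).
  apply: le_trans; rewrite -qr -br le_eqVlt; apply/orP; left; apply/eqP.
  by symmetry; exact: powRM_powR.
have KS0 : 0 <= K * S by rewrite mulr_ge0 // ltW.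
rewrite -xE in GFm Gx0 Fx0 GF hN.
apply: (hU w1 w2 V x n.+1 (h \o x) (K * S) N G F
  hw1 hw2 hV1 hx mG mF GFm Gx0 Fx0 GF KS0 N0 hN).
- by move=> k; exact: hh.
- by split=> [|_]; [rewrite leNgt ba|rewrite -rE; exact: le_trans (sumH n.+1) KS].
- by rewrite leNgt ba.
move=> _; rewrite -rhoE.
pose s i := block_weight p a w1 V x i.
have s0 i : 0 <= s i by exact: block_weight_ge0.
(* Indices are shifted by one: block 0 is kept apart, and the block [(x i.+1, x i.+2)] is completed
   at [x i.+2]. *)
pose T i := \sum_(l < n | x l.+2 <= x i.+2) s l.+1.
have T0 i : 0 <= T i by exact: sumr_ge0.
pose U0 t := (if x 1%N < t then s 0%N else 0).
pose Wr t := rtail w2 t `^ (rho - 1).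
have pWr : posmeas (Wr : realR R -> R) by exact: posmeas_rtail_powR.
pose Us t := \sum_(i < n) (if x i.+2 < t then s i.+1 * T i `^ q1 else 0).
have pU0 : posmeas (fun t : realR R => (if x 1%N < t then s 0%N `^ q else 0)).
  by apply: posmeas_step; exact: powR_ge0.
have pUs : posmeas (Us : realR R -> R).
  by apply: posmeas_sum => i; apply: posmeas_step; rewrite mulr_ge0 ?powR_ge0.
have ptw t : block_sum p a w1 V x n.+1 t `^ q <=
    2 `^ q * ((if x 1%N < t then s 0%N `^ q else 0) + 2 `^ q * Us t).
  have E1 : (if x 1%N < t then s 0%N `^ q else 0) = U0 t `^ q.
    by rewrite /U0; case: ifP => // _; rewrite powR0 ?gt_eqF.
  have U00 : 0 <= U0 t by rewrite /U0; case: ifP.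
  have V0 : 0 <= \sum_(i < n | x i.+2 < t) s i.+1 by exact: sumr_ge0.
  apply: (@le_trans _ _ ((U0 t + \sum_(i < n | x i.+2 < t) s i.+1) `^ q)).
    apply: le_powR; [exact: ltW| |exact: block_sum_le].
    by apply: sumr_ge0 => i _; exact: s0.
  apply: (le_trans (powR_add_le q0 U00 V0)).
  rewrite E1; apply: ler_wpM2l; first exact: powR_ge0.
  rewrite lerD2l qE; apply: le_trans.
    apply: (@half_sum R _ (fun i : 'I_n => x i.+2 < t) (fun i : 'I_n => x i.+2)
      (fun i : 'I_n => s i.+1) q1 (ltW q10) (fun i => s0 _)).
    by move=> i j xji; exact: le_lt_trans.
  rewrite ler_wpM2l ?powR_ge0 // /Us [leLHS]big_mkcond /=.
  by apply: ler_sum => i _; case: ifP.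
have pB : posmeas (fun t : realR R => block_sum p a w1 V x n.+1 t).
  by apply: (posmeas_step_sum (fun j : 'I_n.+1 => x j.+1)) => j; exact: s0.
have q2 : 0 <= 2 `^ q by exact: powR_ge0.
have pUW := posmeasM pUs pWr; have pU0W := posmeasM pU0 pWr.
apply: (@le_trans _ _ ((2 `^ q)%:E * (wint w2 `]x 0%N, +oo[
     (fun t => (if x 1%N < t then s 0%N `^ q else 0) * Wr t)%R +
   (2 `^ q)%:E * wint w2 `]x 0%N, +oo[ (fun t => Us t * Wr t)%R))%E).
  have p2UW := posmeasM (posmeas_cst q2) pUW.
  rewrite -(wintZ nw2 _ q2 pUW) -(wintD nw2 _ pU0W p2UW) -(wintZ nw2 _ q2 (posmeasD pU0W p2UW)).
  apply: (@le_trans _ _ (wint w2 `]x 0%N, +oo[ (fun t =>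
       block_sum p a w1 V x n.+1 t `^ q * Wr t)%R)).
    apply: (wint_subset nw2); first by apply: posmeasM; [exact: posmeas_powR pB.1|exact: pWr].
    by move=> t /=; rewrite !in_itv/= andbT => /andP[].
  apply: (wint_le nw2).
  - by apply: posmeasM; [exact: posmeas_powR pB.1|exact: pWr].
  - exact: (posmeasM (posmeas_cst q2) (posmeasD pU0W p2UW)).
  - move=> t _; have := ler_wpM2r (pWr.2 t) (ptw t).
    set u := (if _ then _ else _); set v := Us t; set y := Wr t; set z := 2 `^ q.
    set y' := _ `^ q; clearbody u v y z y'.
    by move=> h1; apply: (le_trans h1); rewrite le_eqVlt; apply/orP; left; apply/eqP; ring.
have Wint z : 0 < z -> (wint w2 `]z, +oo[ Wr <= (rtail w2 z `^ rho)%:E)%E.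
  by move=> z0; exact: int_powR_rtail_le.
have I0 : (wint w2 `]x 0%N, +oo[ (fun t => (if x 1%N < t then s 0%N `^ q else 0) * Wr t)%R
    <= (C3 `^ r * S `^ r)%:E)%E.
  have pX : posmeas (fun t => s 0%N `^ q * Wr t) by exact: (posmeasM (posmeas_cst (powR_ge0 _ _)) pWr).
  have -> : wint w2 `]x 0%N, +oo[ (fun t => (if x 1%N < t then s 0%N `^ q else 0) * Wr t)%R =
      wint w2 `]x 0%N, +oo[ (fun t => if x 1%N < t then s 0%N `^ q * Wr t else 0)%R.
    by apply: eq_wint => t _; case: ifP => // _; rewrite mul0r.
  rewrite (wint_after w2 pX (ltW (xS 0%N))) (wintZ nw2 _ (powR_ge0 _ _) pWr).
  apply: (@le_trans _ _ ((s 0%N `^ q)%:E * (rtail w2 (x 1%N) `^ rho)%:E)%E).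
    by apply: lee_wpmul2l; [rewrite lee_fin powR_ge0|exact: Wint].
  rewrite -EFinM lee_fin; apply: (le_trans (headpow 0%N _ (xS 0%N))).
  apply: ler_wpM2l; first exact: powR_ge0.
  by apply: le_trans (sumH 1%N); rewrite big_ord1.
have nu2 i : dual_tail a w1 (x i.+2) = ka4 * dual_tail a w1 (x i).
  rewrite ka4E; apply: dual_tail_div => //; rewrite (xW i.+2) (xW i) !exprS; field.
  by rewrite expf_neq0.
have nu1 i : dual_tail a w1 (x i.+1) = ka * dual_tail a w1 (x i).
  rewrite kaE; apply: dual_tail_div => //; rewrite (xW i.+1) (xW i) !exprS; field.
  by rewrite expf_neq0.
pose Y (t : realR R) := ((Jr t `^ q1)%:E * M t * dual_weight a w1 t)%E.
have no := dual_nnweight a hw1.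
have mZ : measurable_fun setT (fun t : realR R => (Jr t `^ q1)%:E * M t)%E.
  apply: emeasurable_funM; last exact: mM.
  by apply/measurable_EFinP; exact: measurable_powR_comp.
have Z0 t : (0 <= (Jr t `^ q1)%:E * M t)%E.
  by apply: mule_ge0; [rewrite lee_fin powR_ge0|exact: M0].
have mY : measurable_fun setT Y by apply: emeasurable_funM; [exact: mZ|exact: no.1].
have Y0 t : (0 <= Y t)%E by apply: mule_ge0; [exact: Z0|exact: no.2].
(* [T i] is compared with [J] at [x i], two points to the left, because [J (x i)] is a lower bound
   of [J] on the block [(x i, x i.+1)] whose dual mass is used. *)
have term i : ((s i.+1 * T i `^ q1 * rtail w2 (x i.+2) `^ rho)%:E <=
   (A * C5)%:E * \int[mu1]_(t in `]x i, x i.+1[) Y t +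
   (A * (ka4 `^ q1 * ka * C3 `^ r) * H i `^ r)%:E)%E.
  have [v vE] : {v | v = V (x i) (x i.+2) `^ theta p a}.
    by exists (V (x i) (x i.+2) `^ theta p a).
  have [nu nuE] : {nu | nu = dual_tail a w1 (x i)} by exists (dual_tail a w1 (x i)).
  have v0 : 0 <= v by rewrite vE powR_ge0.
  have nu0 : 0 <= nu by rewrite nuE powR_ge0.
  have [J0 _] := Jm _ _ (xp i) (lexx _).
  have [xi1 xi2] : x i <= x i.+1 /\ x i.+1 <= x i.+2 by split; exact: ltW.
  have T1 : T i <= C2 * C4 * (Jr (x i) + v * (ka4 * nu)).
    have TJ : T i <= C2 * Jr (x i.+2).
      by rewrite -lee_fin EFinM -hJ //; exact: hT.
    have xi : x i <= x i.+2 by exact: le_trans xi2.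
    have := hG w1 V 0 (x i) (x i.+2) hw1 hV (lexx _) (ltW (xp i)) (xp i) xi.
    rewrite !hJ // -EFinD -EFinM lee_fin nu2 -vE -nuE => JJ.
    by apply: (le_trans TJ); rewrite -mulrA ler_wpM2l // ltW.
  have T2 : T i `^ q1 <= A * (Jr (x i) `^ q1 + ka4 `^ q1 * (nu * v) `^ q1).
    have h1 : 0 <= v * (ka4 * nu) by rewrite !mulr_ge0 // ltW.
    apply: (@le_trans _ _ ((C2 * C4 * (Jr (x i) + v * (ka4 * nu))) `^ q1)).
      by apply: le_powR; [exact: ltW|exact: T0|exact: T1].
    have C24 : 0 <= C2 * C4 by rewrite mulr_ge0 // ltW.
    rewrite powRM ?addr_ge0 // AE [2 `^ q1 * _]mulrC -mulrA.
    apply: ler_wpM2l; first exact: powR_ge0.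
    have E3 : v * (ka4 * nu) = ka4 * (nu * v) by rewrite mulrCA (mulrC v).
    have E4 := powRM q1 (ltW ka40) (mulr_ge0 nu0 v0).
    by rewrite -E4 -E3; exact: powR_add_le.
  have sv : s i.+1 <= ka * (nu * v).
    rewrite /s /block_weight -/(theta p a) nu1 -mulrA -nuE.
    apply: ler_wpM2l; first exact: ltW.
    apply: ler_wpM2l; first exact: nu0.
    rewrite vE.
    apply: le_powR; [exact: ltW (theta_gt0 p1 a1)|exact: hV1.1|].
    by apply: hV1.2 => //.
  have W0 : 0 <= rtail w2 (x i.+2) `^ rho by exact: powR_ge0.
  (* The part with [J]: the block weight is charged to the dual mass of [(x i, x i.+1)], where [J]
     is at least [J (x i)] and [M] at least [M (x i.+1)]. *)
  have alpha : ((s i.+1 * Jr (x i) `^ q1 * rtail w2 (x i.+2) `^ rho)%:E <=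
      C5%:E * \int[mu1]_(t in `]x i, x i.+1[) Y t)%E.
    pose v1 := V (x i.+1) (x i.+2) `^ theta p a.
    have v10 : 0 <= v1 by exact: powR_ge0.
    apply: (@le_trans _ _ ((Jr (x i) `^ q1 * (v1 * rtail w2 (x i.+2) `^ rho))%:E *
       (C5%:E * \int[mu1]_(t in `]x i, x i.+1[) dual_weight a w1 t))%E).
      apply: (@le_trans _ _ ((Jr (x i) `^ q1 * (v1 * rtail w2 (x i.+2) `^ rho))%:E *
         (dual_tail a w1 (x i.+1))%:E)%E).
        rewrite -EFinM lee_fin /s /block_weight -/(theta p a) -/v1.
        by rewrite le_eqVlt; apply/orP; left; apply/eqP; ring.
      apply: lee_wpmul2l; first by rewrite lee_fin !mulr_ge0 ?powR_ge0.
      apply: hD => //; rewrite (xW i.+1) (xW i) exprS; field.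
      by rewrite expf_neq0.
    rewrite muleCA; apply: lee_wpmul2l; first by rewrite lee_fin ltW.
    apply: (@ge_cst_integral _ `]x i, x i.+1[ _ _ no mZ Z0).
      by rewrite !mulr_ge0 ?powR_ge0.
    move=> t; rewrite in_itv/= => /andP[xt tx]; rewrite EFinM.
    have t0 : 0 < t by exact: lt_trans xt.
    apply: lee_pmul.
    - by rewrite lee_fin powR_ge0.
    - by rewrite lee_fin mulr_ge0.
    - rewrite lee_fin; apply: le_powR; [exact: ltW|exact: J0|].
      by have [_] := Jm _ _ (xp i) (ltW xt).
    - apply: (@le_trans _ _ (M (x i.+1))); first exact: hM.
      by apply: Mm; exact: ltW.
  (* The part with the shell [V (x i) (x i.+2)]: both factors are bounded by powers of the same
     quantity [nu v], and [headpow] turns the total power [q] into the multiplier. *)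
  have beta : s i.+1 * (nu * v) `^ q1 * rtail w2 (x i.+2) `^ rho <= ka * (C3 `^ r * H i `^ r).
    apply: (@le_trans _ _ (ka * ((nu * v) `^ q * rtail w2 (x i.+2) `^ rho))).
      have q1p := addr_gt0 q10 ltr01.
      rewrite mulrA qE -(powR_mul_self (mulr_ge0 nu0 v0) q1p) mulrA.
      apply: ler_wpM2r; first exact: W0.
      by apply: ler_wpM2r; [exact: powR_ge0|exact: sv].
    apply: ler_wpM2l; first exact: ltW.
    by rewrite nuE vE; apply: headpow; exact: lt_le_trans (xS i) xi2.
  apply: (@le_trans _ _ (A%:E * (s i.+1 * Jr (x i) `^ q1 * rtail w2 (x i.+2) `^ rho)%:E +
     (A * (ka4 `^ q1 * (s i.+1 * (nu * v) `^ q1 * rtail w2 (x i.+2) `^ rho)))%:E)%E).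
    rewrite -EFinM -EFinD lee_fin.
    have := ler_wpM2r W0 (ler_wpM2l (s0 i.+1) T2).
    by move/le_trans; apply; rewrite le_eqVlt; apply/orP; left; apply/eqP; ring.
  apply: leeD.
    by rewrite (EFinM A C5) -muleA; apply: lee_wpmul2l; [rewrite lee_fin ltW|exact: alpha].
  rewrite lee_fin -!mulrA; apply: ler_wpM2l; first exact: ltW.
  apply: ler_wpM2l; first exact: powR_ge0.
  by move: beta; rewrite -!mulrA.
have I1 : (wint w2 `]x 0%N, +oo[ (fun t => Us t * Wr t)%R <= (A * B * S `^ r)%:E)%E.
  pose c i := s i.+1 * T i `^ q1.
  have c0 i : 0 <= c i by rewrite mulr_ge0 ?powR_ge0.
  have pc i : posmeas (fun t : realR R => c i * Wr t) by exact: (posmeasM (posmeas_cst (c0 i)) pWr).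
  have pci (i : 'I_n) : posmeas (fun t : realR R => (if x i.+2 < t then c i else 0) * Wr t).
    by apply: posmeasM; [exact: posmeas_step|exact: pWr].
  have -> : wint w2 `]x 0%N, +oo[ (fun t => Us t * Wr t)%R =
      (\sum_(i < n) wint w2 `]x 0%N, +oo[ (fun t => (if x i.+2 < t then c i else 0) * Wr t)%R)%E.
    rewrite -(wint_sum nw2 _ pci); apply: eq_wint => t _.
    by rewrite /Us mulr_suml.
  apply: (@le_trans _ _ (\sum_(i < n) ((A * C5)%:E * \int[mu1]_(t in `]x i, x i.+1[) Y t +
     (A * (ka4 `^ q1 * ka * C3 `^ r) * H i `^ r)%:E))%E).
    apply: lee_sum => i _; apply: le_trans (term i).
    have -> : wint w2 `]x 0%N, +oo[ (fun t => (if x i.+2 < t then c i else 0) * Wr t)%R =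
        wint w2 `]x 0%N, +oo[ (fun t => if x i.+2 < t then c i * Wr t else 0)%R.
      by apply: eq_wint => t _; case: ifP => // _; rewrite mul0r.
    rewrite (wint_after w2 (pc i) (xm 0%N i.+2 (leq0n _))) (wintZ nw2 _ (c0 i) pWr).
    rewrite (EFinM (c i)); apply: lee_wpmul2l; first by rewrite lee_fin.
    exact: Wint.
  rewrite big_split /= sumEFin -mulr_sumr.
  have intY0 i : (0 <= \int[mu1]_(t in `]x i, x i.+1[) Y t)%E.
    by apply: integral_ge0 => t _; exact: Y0.
  rewrite -ge0_sume_distrr; last by move=> i _; exact: intY0.
  have hY : (\sum_(i < n) \int[mu1]_(t in `]x i, x i.+1[) Y t <= (S `^ r)%:E)%E.
    apply: le_trans hI.
    have -> : (\sum_(i < n) \int[mu1]_(t in `]x i, x i.+1[) Y t =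
        \int[mu1]_(t in `]x 0%N, x n[) Y t)%E.
      by symmetry; exact: (integral_itv_sum mY Y0 n (fun k => ltW (xS k))).
    apply: (integral_itv_subset mY Y0) => t /=; rewrite !in_itv/= andbT => /andP[xt _].
    exact: lt_trans xt.
  have -> : A * B * S `^ r = A * C5 * S `^ r + A * (ka4 `^ q1 * ka * C3 `^ r) * S `^ r.
    by rewrite BE; ring.
  rewrite EFinD (EFinM (A * C5)); apply: leeD.
    by apply: lee_wpmul2l => //; rewrite lee_fin mulr_ge0 // ltW.
  rewrite lee_fin; apply: ler_wpM2l; last exact: sumH.
  by rewrite !mulr_ge0 ?powR_ge0 // ltW.
apply: (@le_trans _ _ ((2 `^ q)%:E * ((C3 `^ r * S `^ r)%:E + (2 `^ q)%:E * (A * B * S `^ r)%:E))%E).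
  apply: lee_wpmul2l; first by rewrite lee_fin.
  by apply: leeD => //; apply: lee_wpmul2l => //; rewrite lee_fin.
apply: (@le_trans _ _ (2 `^ q * (C3 `^ r * S `^ r + 2 `^ q * (A * B * S `^ r)))%:E).
  exact: lexx.
rewrite lee_fin (powRM _ (ltW Kp) S0).
apply: (@le_trans _ _ (K0 * S `^ r)); last exact: ler_wpM2r.
by rewrite le_eqVlt; apply/orP; left; apply/eqP; rewrite K0E; ring.
Qed.

End upper_bound_cases.

(** * Duality for weighted sequences *)

Section discrete_lower.
Context {R : realType}.
Local Notation mu1 := (@completed_lebesgue_measure R).

(** Necessity by duality. The test [y i = k i ^ (e' - 1) S i ^ g W (z i) ^ (1/(e - b))] is chosen so
    that [y i ^ e] is the i-th term of the sum [Q] to be bounded, while the integral on the left is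
    at least a multiple of [Q]. The inequality then bounds [Q] by a multiple of [Q ^ (b / e)]. *)
Lemma discrete_lower (e b : R) : 1 < b -> b < e -> exists2 C : R, 0 < C &
  forall (w : realR R -> \bar R) (I : finType) (z k : I -> R) (D : R),
  tail_weight w -> 0 <= D -> (forall i, 0 < z i) -> (forall i, 0 <= k i) ->
  (forall y : I -> R, (forall i, 0 <= y i) ->
     (wint w `]0%R, +oo[ (fun t => (\sum_(i | z i < t) y i * k i) `^ b)%R <=
       (D `^ b * (\sum_i y i `^ e) `^ (b / e))%:E)%E) ->
  \sum_i k i `^ (e / (e - 1)) *
    (\sum_(l | z l <= z i) k l `^ (e / (e - 1))) `^ (e * (b - 1) / (e - b)) *
    rtail w (z i) `^ (e / (e - b)) <= C * D `^ (e * b / (e - b)).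
Proof.
move=> b1 be.
have [b0 e0] : 0 < b /\ 0 < e by lra.
have eb0 : 0 < e - b by rewrite subr_gt0.
have e10 : 0 < e - 1 by lra.
have [en [ebn e1n]] : e != 0 /\ (e - b != 0 /\ e - 1 != 0) by rewrite !gt_eqF.
set e' := e / (e - 1); set q1 := e * (b - 1) / (e - b); set rho := e / (e - b).
set r := e * b / (e - b).
have [g gE] : {g | g = (b - 1) / (e - b)} by exists ((b - 1) / (e - b)).
have [q qE] : {q | q = q1 + 1} by exists (q1 + 1).
have g0 : 0 < g by rewrite gE divr_gt0 // subr_gt0.
have q10 : 0 < q1 by rewrite divr_gt0 // mulr_gt0 // subr_gt0.
have q0 : 0 < q by rewrite qE addr_gt0.
have qg : q = (g + 1) * b by rewrite qE gE /q1; field.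
have q1g : q1 = g * e by rewrite gE /q1; field.
have rho1 : 1 <= rho by rewrite /rho ler_pdivlMr //; lra.
have e'1 : 0 < e' - 1 by rewrite /e' subr_gt0 ltr_pdivlMr //; lra.
have e'e : (e' - 1) * e = e' by rewrite /e'; field.
have rhoe : (e - b)^-1 * e = rho by rewrite /rho mulrC.
have rhob : (e - b)^-1 * b = rho - 1 by rewrite /rho; field.
have bs : 0 < b / e by rewrite divr_gt0.
have bs1 : b / e < 1 by rewrite ltr_pdivrMr // mul1r.
have rD : b * (1 - b / e)^-1 = r by rewrite /r; field; rewrite ebn en.
have e'0 : 0 < e' by lra.
clearbody e' q1 rho r.
have [K KE] : {K | K = 4 `^ rho * 2 `^ q} by exists (4 `^ rho * 2 `^ q).
have K0 : 0 < K by rewrite KE mulr_gt0 ?powR_gt0.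
exists (K `^ (1 - b / e)^-1); first exact: powR_gt0.
move=> w I z k D hw D0 z0 k0 hyp; have nw := tail_nnweight hw.
pose s i := k i `^ e'; have s0 i : 0 <= s i by exact: powR_ge0.
pose S i := \sum_(l | z l <= z i) s l; have S0 i : 0 <= S i by exact: sumr_ge0.
pose W t := rtail w t.
pose q' := (e - b)^-1; have q'0 : 0 < q' by rewrite invr_gt0.
pose y i := k i `^ (e' - 1) * (S i `^ g * W (z i) `^ q').
have y0 i : 0 <= y i by rewrite !mulr_ge0 ?powR_ge0.
have yk i : y i * k i = s i * (S i `^ g * W (z i) `^ q').
  rewrite /y mulrAC [_ * k i]mulrC powR_mul_self ?subrK //; exact: ltW.
have ye i : y i `^ e = s i * S i `^ q1 * W (z i) `^ rho.
  rewrite /y -mulrA powRM ?powR_ge0 ?mulr_ge0 ?powR_ge0 // -powRrM e'e.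
  by rewrite (@powRM_powR R e g q' (S i) (W (z i))) -q1g rhoe.
set Q := \sum_i _; have QE : \sum_i y i `^ e = Q by apply: eq_bigr => i _; exact: ye.
have Q0 : 0 <= Q by rewrite -QE; apply: sumr_ge0 => i _; exact: powR_ge0.
pose T t := \sum_(i | z i < t) s i.
have T0 t : 0 <= T t by exact: sumr_ge0.
pose Y t := \sum_(i | z i < t) y i * k i.
have pY : posmeas (Y : realR R -> R).
  by apply: posmeas_step_sum => i; exact: mulr_ge0.
pose Wr t := W t `^ (rho - 1).
have pWr : posmeas (Wr : realR R -> R) by exact: posmeas_rtail_powR.
pose c i := s i * S i `^ q1; have c0 i : 0 <= c i by rewrite mulr_ge0 ?powR_ge0.
(* Tails at [z i < t] are at least [W t], so this power leaves the sum, and [half_sum] recovers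
   [T ^ (g + 1)] from the sum of [s S ^ g]. *)
have low t : 0 < t -> T t `^ q * Wr t <= 2 `^ q * Y t `^ b.
  move=> t0.
  have h1 : W t `^ q' * \sum_(i | z i < t) s i * S i `^ g <= Y t.
    rewrite mulr_sumr; apply: ler_sum => i it; rewrite yk mulrCA.
    apply: ler_wpM2l; first exact: s0.
    rewrite mulrC; apply: ler_wpM2l; first exact: powR_ge0.
    apply: le_powR; [exact: ltW|exact: rtail_ge0|].
    by apply: rtail_anti => //; exact: ltW.
  have h2 : T t `^ (g + 1) <= 2 `^ (g + 1) * \sum_(i | z i < t) s i * S i `^ g.
    apply: half_sum => //; first exact: ltW.
    by move=> i j ji; exact: le_lt_trans.
  have h3 : W t `^ q' * T t `^ (g + 1) <= 2 `^ (g + 1) * Y t.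
    apply: (le_trans (ler_wpM2l (powR_ge0 _ _) h2)).
    by rewrite mulrCA; apply: ler_wpM2l; first exact: powR_ge0.
  have h4 := le_powR (ltW b0) (mulr_ge0 (powR_ge0 _ _) (powR_ge0 _ _)) h3.
  rewrite (@powRM_powR R b q' (g + 1) (W t) (T t)) rhob -qg mulrC in h4.
  apply: (le_trans h4); rewrite (powRM _ (powR_ge0 _ _) (pY.2 t)).
  by rewrite -powRrM -qg.
(* Each [W (z i) ^ rho] is bounded by an integral over [(z i, +oo)]; after exchanging sum and
   integral the terms [s S ^ q1] add up to at most [T ^ q]. *)
have QY : (Q%:E <= (K%:E * wint w `]0%R, +oo[ (fun t => Y t `^ b)%R))%E.
  have pTW : posmeas (fun t => T t `^ q * Wr t).
    apply: posmeasM; last exact: pWr.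
    by apply: posmeas_powR; exact: (posmeas_step_sum z s0).1.
  have pci i : posmeas (fun t : realR R => (if z i < t then c i else 0) * Wr t).
    by apply: posmeasM; [exact: posmeas_step|exact: pWr].
  have pcW i : posmeas (fun t : realR R => c i * Wr t).
    by apply: posmeasM; [exact: posmeas_cst|exact: pWr].
  have pYb : posmeas (fun t : realR R => Y t `^ b) by apply: posmeas_powR; exact: pY.1.
  apply: (@le_trans _ _ (\sum_i (4 `^ rho)%:E * wint w `]0%R, +oo[
      (fun t => (if z i < t then c i else 0) * Wr t)%R)%E).
    rewrite -sumEFin; apply: lee_sum => i _.
    have -> : wint w `]0%R, +oo[ (fun t => (if z i < t then c i else 0) * Wr t)%R =
        wint w `]0%R, +oo[ (fun t => if z i < t then c i * Wr t else 0)%R.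
      by apply: eq_wint => t _; case: ifP => // _; rewrite mul0r.
    rewrite (wint_after w (pcW i) (ltW (z0 i))) (wintZ nw _ (c0 i) pWr).
    rewrite muleCA EFinM; apply: lee_wpmul2l; first by rewrite lee_fin; exact: c0.
    have h := powR_rtail_infty_le hw rho1 (z0 i). exact h.
  rewrite -ge0_sume_distrr; last by move=> i _; exact: (wint_ge0 nw _ (pci i)).
  rewrite KE EFinM -muleA; apply: lee_wpmul2l; first by rewrite lee_fin powR_ge0.
  rewrite -(wint_sum nw _ pci) -(wintZ nw _ (powR_ge0 _ _) pYb).
  apply: (wint_le nw).
  - exact: (posmeas_sum pci).
  - by apply: posmeasM; [apply: posmeas_cst; exact: powR_ge0|exact: pYb].
  - move=> t; rewrite in_itv/= andbT => t0; apply: le_trans (low t t0).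
    rewrite -mulr_suml; apply: ler_wpM2r; first exact: pWr.2.
    rewrite -big_mkcond /= qE -(powR_mul_self (T0 t)); last by rewrite addr_gt0.
    rewrite [X in _ <= X * _]/T mulr_suml; apply: ler_sum => i it.
    apply: ler_wpM2l; first exact: s0.
    apply: le_powR; [exact: ltW|exact: S0|].
    rewrite /S /T [leLHS]big_mkcond [leRHS]big_mkcond /=; apply: ler_sum => l _.
    by case: ifP => [li|_]; [rewrite (le_lt_trans li it)|case: ifP].
have Qle : Q <= (K * D `^ b) * Q `^ (b / e).
  rewrite -lee_fin; apply: (le_trans QY).
  rewrite -mulrA EFinM; apply: lee_wpmul2l; first by rewrite lee_fin ltW.
  by have := hyp y y0; rewrite QE.
have KD : 0 <= K * D `^ b by rewrite mulr_ge0 ?powR_ge0 // ltW.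
apply: le_trans (ler_of_powR_mul KD Q0 bs bs1 Qle) _.
by rewrite powRM ?powR_ge0 ?(ltW K0) // -powRrM rD.
Qed.

End discrete_lower.

(** * Radial weights and test functions *)

Lemma poweR_le (R : realType) (x y : \bar R) (r : R) : 0 <= r -> (0 <= x)%E -> (x <= y)%E ->
  (x `^ r <= y `^ r)%E.
Proof.
move=> r0 x0 xy; apply: gt0_ler_poweR => //; rewrite in_itv/= leey andbT //.
exact: le_trans xy.
Qed.

Lemma sum_powR_single (R : realType) (I : finType) (f : I -> R) (r : R) : 0 < r ->
  (forall i j, i != j -> f i = 0 \/ f j = 0) ->
  (\sum_i f i) `^ r = \sum_i f i `^ r.
Proof.
move=> r0 h; have [/existsP[i fi]|/existsPn h0] := boolP [exists i, f i != 0].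
  have z j : j != i -> f j = 0.
    by move=> /h[//|/eqP]; rewrite (negPf fi).
  rewrite (bigD1 i) //= [in RHS](bigD1 i) //= !big1 ?addr0 // => j /z -> //.
  by rewrite powR0 // gt_eqF.
have z i : f i = 0 by have := h0 i; rewrite negbK => /eqP.
rewrite !big1 // => [|i _]; last by rewrite z powR0 // gt_eqF.
by rewrite powR0 // gt_eqF.
Qed.

Section radial_space.
Context {R : realType} {d : measure_display} {T : measurableType d}.
Variables (mu : {measure set T -> \bar R}) (rho : T -> R) (u : T -> \bar R).
Hypotheses (mrho : measurable_fun setT rho) (mu_ : measurable_fun setT u)
  (u0 : forall y, (0 <= u y)%E).

Definition rball (t : R) : set T := [set y | rho y < t].
Definition rshell (s t : R) : set T := [set y | s < rho y < t].

Lemma measurable_rball t : measurable (rball t).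
Proof.
rewrite (_ : rball t = setT `&` rho @^-1` `]-oo, t[); last first.
  by apply/seteqP; split => y /=; rewrite in_itv/= => //; case.
exact: mrho.
Qed.

Lemma measurable_rshell s t : measurable (rshell s t).
Proof.
rewrite (_ : rshell s t = setT `&` rho @^-1` `]s, t[); last first.
  by apply/seteqP; split => y /=; rewrite in_itv/= => //; case.
exact: mrho.
Qed.

(** Functions are written as [f u]: with [g = f u] the relation [g ^ p = u ^ (p - 1) h] gives
    [h = f ^ p u], so both masses are integrals against the one density [u]. *)
Definition sint (A : set T) (f : T -> R) : \bar R := (\int[mu]_(y in A) ((f y)%:E * u y))%E.

Definition ptest (f : T -> R) := measurable_fun setT f /\ forall y, 0 <= f y.

Lemma ptest_weighted f : ptest f ->
  measurable_fun setT (fun y => (f y)%:E * u y)%E /\ forall y, (0 <= (f y)%:E * u y)%E.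
Proof.
move=> [mf f0]; split; last by move=> y; apply: mule_ge0; rewrite ?lee_fin.
by apply: emeasurable_funM; [exact/measurable_EFinP|exact: mu_].
Qed.

Lemma ptest_powR f r : ptest f -> ptest (fun y => f y `^ r).
Proof.
move=> [mf f0]; split => [|y]; last exact: powR_ge0.
apply: (@measurableT_comp _ _ _ _ _ _ (fun x => x `^ r)); last exact: mf.
exact: measurable_powR.
Qed.

Lemma ptestZ c f : 0 <= c -> ptest f -> ptest (fun y => c * f y).
Proof.
move=> c0 [mf f0]; split => [|y]; last exact: mulr_ge0.
by apply: measurable_funM; [exact: measurable_cst|exact: mf].
Qed.

Lemma ptest_sum (I : finType) (f : I -> T -> R) : (forall i, ptest (f i)) ->
  ptest (fun y => \sum_i f i y).
Proof.
move=> hf; split => [|y]; last by apply: sumr_ge0 => i _; exact: (hf i).2.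
by apply: measurable_sum => i; exact: (hf i).1.
Qed.

Lemma sint_ge0 A f : ptest f -> (0 <= sint A f)%E.
Proof. by move=> hf; apply: integral_ge0 => y _; exact: (ptest_weighted hf).2. Qed.

Lemma sint_le A f g : measurable A -> ptest f -> ptest g ->
  (forall y, A y -> f y <= g y) -> (sint A f <= sint A g)%E.
Proof.
move=> mA hf hg fg; apply: ge0_le_integral => //.
- by move=> y _; exact: (ptest_weighted hf).2.
- by apply: measurable_funTS; exact: (ptest_weighted hf).1.
- by apply: measurable_funTS; exact: (ptest_weighted hg).1.
- by move=> y Ay; apply: lee_wpmul2r => //; rewrite lee_fin; exact: fg.
Qed.

Lemma sint_subset A B f : measurable A -> measurable B -> ptest f -> A `<=` B ->
  (sint A f <= sint B f)%E.
Proof.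
move=> mA mB hf AB; apply: ge0_subset_integral => //.
- by apply: measurable_funTS; exact: (ptest_weighted hf).1.
- by move=> y _; exact: (ptest_weighted hf).2.
Qed.

Lemma sintZ A c f : measurable A -> 0 <= c -> ptest f ->
  (sint A (fun y => c * f y)%R = c%:E * sint A f)%E.
Proof.
move=> mA c0 hf; rewrite /sint -ge0_integralZl; first last.
- by rewrite lee_fin.
- by move=> y _; exact: (ptest_weighted hf).2.
- by apply: measurable_funTS; exact: (ptest_weighted hf).1.
- exact: mA.
by apply: eq_integral => y _; rewrite EFinM muleA.
Qed.

Lemma sint_sum A (I : finType) (f : I -> T -> R) : measurable A -> (forall i, ptest (f i)) ->
  (sint A (fun y => \sum_i f i y)%R = \sum_i sint A (f i))%E.
Proof.
move=> mA hf; rewrite /sint -ge0_integral_sum; first last.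
- by move=> i y _; exact: (ptest_weighted (hf i)).2.
- by move=> i; apply: measurable_funTS; exact: (ptest_weighted (hf i)).1.
- exact: mA.
apply: eq_integral => y _; rewrite -sumEFin ge0_sume_distrl // => i _.
by rewrite lee_fin; exact: (hf i).2.
Qed.

Definition eV (s t : R) : \bar R := (\int[mu]_(y in rshell s t) u y)%E.
Definition rV (s t : R) : R := fine (eV s t).

Hypothesis V_fin : forall s t, 0 < s -> (eV s t < +oo)%E.

Lemma eVE s t : 0 < s -> eV s t = (rV s t)%:E.
Proof.
move=> s0; rewrite fineK // ge0_fin_numE; first exact: V_fin.
by apply: integral_ge0.
Qed.

Lemma rV_ge0 s t : 0 <= rV s t.
Proof. by rewrite fine_ge0 // integral_ge0. Qed.

(** The extremal function of Hoelder's inequality on the shell, normalised in L^p. On a null shell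
    it is 0, because a power of 0 with nonzero exponent is 0. *)
Definition shell_test (p s t : R) (y : T) : R :=
  if s < rho y < t then rV s t `^ (- p^-1) else 0.

Lemma ptest_shell p s t : ptest (shell_test p s t).
Proof.
split=> [|y]; last by rewrite /shell_test; case: ifP => // _; exact: powR_ge0.
rewrite (_ : shell_test p s t = fun y => rV s t `^ (- p^-1) * \1_(rshell s t) y); last first.
  apply/funext => y; rewrite /shell_test indicE.
  have -> : (y \in rshell s t) = (s < rho y < t) by apply/idP/idP; rewrite inE.
  by case: ifP; rewrite ?mulr1 ?mulr0.
apply: measurable_funM; first exact: measurable_cst.
by apply: measurable_indic; exact: measurable_rshell.
Qed.

Lemma sint_shell (s t c : R) A : 0 < s -> 0 <= c -> measurable A -> rshell s t `<=` A ->
  sint A (fun y => if s < rho y < t then c else 0) = (c * rV s t)%:E.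
Proof.
move=> s0 c0 mA sA; rewrite EFinM -eVE // /eV -ge0_integralZl; first last.
- by rewrite lee_fin.
- by move=> y _; exact: u0.
- exact: measurable_funTS.
- exact: measurable_rshell.
rewrite /sint; transitivity (\int[mu]_(y in A) ((fun y => c%:E * u y)%E \_ (rshell s t)) y)%E.
  apply: eq_integral => y _; rewrite /patch.
  have -> : (y \in rshell s t) = (s < rho y < t) by apply/idP/idP; rewrite inE.
  by case: ifP; rewrite ?mul0e.
by rewrite -integral_mkcondr; congr integral; apply/setIidPr.
Qed.

Lemma shell_test_norm p s t : 1 < p -> 0 < s ->
  (sint setT (fun y => shell_test p s t y `^ p)%R <= 1)%E.
Proof.
move=> p1 s0; have p0 : 0 < p by lra.
have -> : (fun y => shell_test p s t y `^ p) =
    fun y => if s < rho y < t then rV s t `^ (-1) else 0.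
  apply/funext => y; rewrite /shell_test; case: ifP => _; last by rewrite powR0 ?gt_eqF.
  by rewrite -powRrM mulNr mulVf // gt_eqF.
rewrite sint_shell ?powR_ge0 // lee_fin powR_inv1 ?rV_ge0 //.
by have [->|V0] := eqVneq (rV s t) 0; [rewrite mulr0|rewrite mulVf].
Qed.

Lemma shell_test_mass p s t A : 1 < p -> 0 < s -> measurable A -> rshell s t `<=` A ->
  sint A (shell_test p s t) = (rV s t `^ ((p - 1) / p))%:E.
Proof.
move=> p1 s0 mA sA; have pn : p != 0 by rewrite gt_eqF //; lra.
rewrite [LHS]sint_shell ?powR_ge0 //; congr EFin.
rewrite mulrC powR_mul_self ?rV_ge0 //; last first.
  by rewrite addrC subr_gt0 invf_lt1 //; lra.
by congr (_ `^ _); field.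
Qed.

(** The outer root is omitted: this is the [b]-th power of the second norm, as [Lnorm1] is the
    [a]-th power of the first. *)
Definition Lnorm2 (b : R) (w2 : realR R -> \bar R) (f : T -> R) : \bar R :=
  (\int[@completed_lebesgue_measure R]_(t in `]0%R, +oo[)
     ((sint (rball t) f) `^ b * w2 t))%E.

Definition Lnorm1 (p a : R) (w1 : realR R -> \bar R) (f : T -> R) : \bar R :=
  (\int[@completed_lebesgue_measure R]_(t in `]0%R, +oo[)
     ((sint (rball t) (fun y => f y `^ p)%R) `^ (a / p) * w1 t))%E.

Lemma measurable_sint_ball f r : ptest f -> 0 <= r ->
  measurable_fun setT ((fun t => sint (rball t) f `^ r)%E : realR R -> \bar R).
Proof.
move=> hf r0; apply: measurable_homo => s t st; apply: poweR_le => //.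
  exact: sint_ge0.
apply: sint_subset => //; [exact: measurable_rball..|].
by move=> y /= ys; exact: lt_le_trans ys st.
Qed.

Section tests.
Variables (p a b : R) (w1 w2 : realR R -> \bar R).
Hypotheses (p1 : 1 < p) (a1 : 1 < a) (b1 : 1 < b).
Hypotheses (hw1 : tail_weight w1) (hw2 : tail_weight w2).

Let p0 : 0 < p. Proof. exact: lt_trans p1. Qed.
Let a0 : 0 < a. Proof. exact: lt_trans a1. Qed.
Let b0 : 0 < b. Proof. exact: lt_trans b1. Qed.
Let w2_0 t : (0 <= w2 t)%E. Proof. by case: hw2. Qed.
Let w1_0 t : (0 <= w1 t)%E. Proof. by case: hw1. Qed.
Let mw2 : measurable_fun setT w2. Proof. by case: hw2. Qed.
Let mw1 : measurable_fun setT w1. Proof. by case: hw1. Qed.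

Lemma measurable_Lnorm2 f : ptest f ->
  measurable_fun setT (fun t : realR R => (sint (rball t) f) `^ b * w2 t)%E.
Proof.
move=> hf; apply: emeasurable_funM; last exact: mw2.
by apply: measurable_sint_ball => //; exact: ltW.
Qed.

Lemma Lnorm2_wint_le f (X : realR R -> R) : ptest f -> posmeas X ->
  (forall t, 0 < t -> ((X t)%:E <= sint (rball t) f `^ b)%E) ->
  (wint w2 `]0%R, +oo[ X <= Lnorm2 b w2 f)%E.
Proof.
move=> hf hX h; apply: ge0_le_integral; first exact: measurable_itvR.
- by move=> t _; apply: mule_ge0 => //; rewrite lee_fin; exact: hX.2.
- by apply: measurable_funTS; exact: (measurable_wint (tail_nnweight hw2) hX.1).
- by apply: measurable_funTS; exact: measurable_Lnorm2.
- move=> t /=; rewrite in_itv/= andbT => t0; apply: lee_wpmul2r => //.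
  exact: h.
Qed.

Lemma Lnorm1_le_wint f (X : realR R -> R) : ptest f -> posmeas X ->
  (forall t, 0 < t -> (sint (rball t) (fun y => f y `^ p)%R `^ (a / p) <= (X t)%:E)%E) ->
  (Lnorm1 p a w1 f <= wint w1 `]0%R, +oo[ X)%E.
Proof.
move=> hf hX h; apply: ge0_le_integral; first exact: measurable_itvR.
- by move=> t _; apply: mule_ge0 => //; exact: poweR_ge0.
- apply: measurable_funTS; apply: emeasurable_funM; last exact: mw1.
  apply: measurable_sint_ball; first exact: ptest_powR.
  by rewrite divr_ge0 // ltW.
- by apply: measurable_funTS; exact: (measurable_wint (tail_nnweight hw1) hX.1).
- move=> t /=; rewrite in_itv/= andbT => t0; apply: lee_wpmul2r => //.
  exact: h.
Qed.

Lemma sint_scaled_sum (I : finType) (c : I -> R) (f : I -> T -> R) t : (forall i, 0 <= c i) ->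
  (forall i, ptest (f i)) ->
  sint (rball t) (fun y => \sum_i c i * f i y) = (\sum_i (c i)%:E * sint (rball t) (f i))%E.
Proof.
move=> c0 hf; rewrite sint_sum; [|exact: measurable_rball|by move=> i; exact: ptestZ].
by apply: eq_bigr => i _; apply: sintZ => //; exact: measurable_rball.
Qed.

Lemma ptest_scaled_sum (I : finType) (c : I -> R) (f : I -> T -> R) : (forall i, 0 <= c i) ->
  (forall i, ptest (f i)) -> ptest (fun y => \sum_i c i * f i y).
Proof. by move=> c0 hf; apply: ptest_sum => i; exact: ptestZ. Qed.

(* The [L^p] norm of the sum over a ball is at most the sum of the coefficients
   of the functions whose support meets the ball. *)
Lemma glue_norm_le (I : finType) (z c : I -> R) (f : I -> T -> R) t :
  (forall i, 0 <= c i) -> (forall i, ptest (f i)) ->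
  (forall i y, rho y <= z i -> f i y = 0) ->
  (forall i, (sint setT (fun y => f i y `^ p)%R <= 1)%E) ->
  (sint (rball t) (fun y => (\sum_i c i * f i y) `^ p)%R
   <= ((\sum_(i | z i < t) c i) `^ p)%:E)%E.
Proof.
move=> c0 hf fz f1; set K := \sum_(i | z i < t) c i.
have K0 : 0 <= K by exact: sumr_ge0.
have mB := measurable_rball t.
pose g i y := (if z i < t then c i else 0) * f i y `^ p.
have hc i : 0 <= (if z i < t then c i else 0) by case: ifP.
have hfp i : ptest (fun y => f i y `^ p) by exact: ptest_powR.
have hg i : ptest (g i) by exact: ptestZ.
have Kp : 0 <= K `^ (p - 1) by exact: powR_ge0.
apply: (@le_trans _ _ (sint (rball t) (fun y => K `^ (p - 1) * \sum_i g i y)%R)).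
  apply: sint_le => //.
  - by apply: ptest_powR; exact: ptest_scaled_sum.
  - by apply: ptestZ => //; exact: ptest_sum.
  - move=> y /= yt; rewrite (bigID (fun i => z i < t)) /= addrC big1 ?add0r; last first.
      move=> i; rewrite -leNgt => ti; rewrite fz ?mulr0 //.
      exact: le_trans (ltW yt) ti.
    apply: (le_trans (finite_jensen _ p1 c0 (fun i => (hf i).2 y))).
    apply: ler_wpM2l => //; rewrite big_mkcond /=; apply: ler_sum => i _.
    by rewrite /g; case: ifP; rewrite ?mul0r.
rewrite sintZ //; last exact: ptest_sum.
have -> : K `^ p = K `^ (p - 1) * K by rewrite mulrC powR_mul_self ?subrK.
rewrite EFinM; apply: lee_wpmul2l; first by rewrite lee_fin.
rewrite sint_sum // [K]big_mkcond -sumEFin; apply: lee_sum => i _.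
rewrite /g sintZ //; case: ifP => _; last by rewrite mul0e.
rewrite -[leRHS]mule1; apply: lee_wpmul2l; first by rewrite lee_fin.
by apply: le_trans (f1 i); apply: sint_subset => //; exact: measurableT.
Qed.

(** The embedding for powers of the norms. A real majorant [N] of the first one avoids products with
    infinite values. *)
Definition bounded_by (B : R) : Prop := forall f, ptest f -> forall N, 0 <= N ->
  (Lnorm1 p a w1 f <= N%:E)%E -> (Lnorm2 b w2 f <= (B `^ b * N `^ (b / a))%:E)%E.

Definition hardy_test (x D : R) : Prop := forall f, ptest f ->
  (forall y, rho y <= x -> f y = 0) -> (sint setT (fun y => f y `^ p)%R <= 1)%E ->
  (Lnorm2 b w2 f <= (D `^ b)%:E)%E.

(** A test supported outside [B(0, x)] has no mass for [t <= x] and L^p mass at most 1 afterwards,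
    so its [Lnorm1] is at most the tail [W1 x]. *)
Lemma bounded_hardy_test B x : 0 <= B -> 0 < x -> bounded_by B ->
  hardy_test x (B * rtail w1 x `^ a^-1).
Proof.
move=> B0 x0 hB f hf fx f1.
have W0 : 0 <= rtail w1 x by exact: ltW (rtail_gt0 hw1 x0).
rewrite (powRM _ B0 (powR_ge0 _ _)) -powRrM mulrC [a^-1 * b]mulrC mulrC.
apply: hB => //.
have pX : posmeas (fun t => if x < t then 1 else 0 : R) by exact: posmeas_step.
apply: (le_trans (Lnorm1_le_wint hf pX _)) => [t t0|].
  have h0 : (0 <= sint (rball t) (fun y => f y `^ p)%R)%E.
    by apply: sint_ge0; exact: ptest_powR.
  case: ifPn => [xt|]; last first.
    rewrite -leNgt => tx; rewrite /sint integral0_eq ?poweR0r ?lexx //.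
      by rewrite gt_eqF // divr_gt0.
    move=> y /= yt; rewrite fx ?powR0 ?mul0e //; first by rewrite gt_eqF.
    exact: le_trans (ltW yt) tx.
  rewrite -(poweR1r (a / p)); apply: poweR_le => //; first by rewrite divr_ge0 ?(ltW a0) ?(ltW p0).
  apply: le_trans f1; apply: sint_subset => //; first exact: measurable_rball.
  exact: ptest_powR.
rewrite (wint_after w1 (posmeas_cst ler01) (ltW x0)).
rewrite -rtailE // -[leRHS]mul1e.
by apply: (wint_le_cst (tail_nnweight hw1)) => //; exact: posmeas_cst.
Qed.

Lemma step_sum_diff (I : finType) (z g : I -> R) (s t : R) : s <= t ->
  \sum_(i | z i < t) g i - \sum_(i | z i < s) g i =
  \sum_(i | (z i < t) && ~~ (z i < s)) g i.
Proof.
move=> st; rewrite [X in X - _](bigID (fun i => z i < s)) /=.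
have -> : \sum_(i | (z i < t) && (z i < s)) g i = \sum_(i | z i < s) g i.
  by apply: eq_bigl => i; case zs: (z i < s); rewrite ?andbF // andbT (lt_le_trans zs st).
by rewrite addrAC subrr add0r.
Qed.

Lemma dual_tail_powR s : 0 < s -> dual_tail a w1 s `^ (a - 1) * rtail w1 s = 1.
Proof.
move=> s0; have W0 := rtail_gt0 hw1 s0.
have an1 : a - 1 != 0 by rewrite gt_eqF // subr_gt0.
by rewrite /dual_tail -powRrM mulNr mulVf // powRN powRr1 ?mulVf ?gt_eqF // ltW.
Qed.

Hypothesis null_sphere : forall t, mu [set y | rho y = t] = 0%E.

Lemma shell_data_rV : shell_data rV.
Proof.
split; [split|..].
- exact: rV_ge0.
- move=> s s' t t' s0 ss' tt'.
  rewrite -lee_fin -!eVE //; last exact: lt_le_trans ss'.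
  apply: ge0_subset_integral; try exact: measurable_rshell.
  + exact: measurable_funTS.
  + by [].
  + by move=> y /= /andP[h1 h2]; apply/andP; split; [exact: le_lt_trans ss' h1|exact: lt_le_trans h2 tt'].
- move=> t; apply: (@measurableT_comp _ _ _ _ _ _ fine); first exact: fine_measurable.
  apply: measurable_antihomo => s s' ss'.
  apply: ge0_subset_integral; try exact: measurable_rshell.
  + exact: measurable_funTS.
  + by [].
  + by move=> y /= /andP[h1 h2]; apply/andP; split=> //; exact: le_lt_trans ss' h1.
- move=> s t ts; rewrite /rV /eV (_ : rshell s t = set0) ?integral_set0 //.
  apply/seteqP; split => // y /= /andP[h1 h2].
  by have := lt_trans h1 h2; rewrite ltNge ts.
- move=> r s t r0; rewrite le_eqVlt => /predU1P[<-|rs].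
    rewrite [rV r r]/rV /eV (_ : rshell r r = set0) ?integral_set0 ?add0r //.
    apply/seteqP; split => // y /= /andP[h1 h2].
    by have := lt_trans h1 h2; rewrite ltxx.
  rewrite le_eqVlt => /predU1P[<-|st].
    rewrite [rV s s]/rV /eV (_ : rshell s s = set0) ?integral_set0 ?addr0 //.
    apply/seteqP; split => // y /= /andP[h1 h2].
    by have := lt_trans h1 h2; rewrite ltxx.
  have s0 : 0 < s by exact: lt_trans rs.
  apply: EFin_inj; rewrite EFinD -!eVE //.
  (* The two shells miss the sphere of radius [s], which is null. *)
  pose Sp := [set y | rho y = s].
  have mSp : measurable Sp.
    rewrite (_ : Sp = setT `&` rho @^-1` [set s]); last by rewrite setTI.
    by apply: mrho => //; exact: measurable_set1.
  rewrite /eV (_ : rshell r t = (rshell r s `|` Sp) `|` rshell s t); last first.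
    apply/seteqP; split => y /=.
      move=> /andP[h1 h2]; case: (ltgtP (rho y) s) => h.
      - by left; left; apply/andP.
      - by right; apply/andP.
      - by left; right.
    rewrite /rshell /= => -[[/andP[h1 h2]|->]|/andP[h1 h2]].
    - by apply/andP; split=> //; exact: lt_trans h2 st.
    - by apply/andP.
    - by apply/andP; split=> //; exact: lt_trans rs h1.
  rewrite ge0_integral_setU //; first last.
  - apply/disj_setPS => y /= [[/andP[_ h]|h] /andP[h' _]].
      by have := lt_trans h h'; rewrite ltxx.
    by move: h'; rewrite h ltxx.
  - exact: measurable_funTS.
  - exact: measurable_rshell.
  - by apply: measurableU => //; exact: measurable_rshell.
  congr (_ + _)%E; rewrite ge0_integral_setU //; first last.
  - by apply/disj_setPS => y /= [/andP[_ h] h']; move: h; rewrite h' ltxx.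
  - exact: measurable_funTS.
  - exact: measurable_rshell.
  rewrite (null_set_integral _ _ (null_sphere s)) ?adde0 //.
  exact: measurable_funTS.
Qed.

Lemma rV_left_le x t M : 0 < x -> x < t -> (forall s, x < s -> s < t -> rV x s <= M) ->
  rV x t <= M.
Proof.
move=> x0 xt h; rewrite -lee_fin -eVE //.
have M0 : 0 <= M.
  by apply: le_trans (h ((x + t) / 2) _ _); [exact: rV_ge0|lra|lra].
rewrite /eV (_ : rshell x t = \bigcup_n rshell x (t - n.+1%:R^-1)).
  apply: integral_bigcup_le => //.
  - move=> m n mn y /= /andP[h0 h1]; apply/andP; split=> //; apply: lt_le_trans h1 _.
    by rewrite lerD2l lerN2 lef_pV2 ?posrE // ler_nat ltnS.
  - by move=> n; exact: measurable_rshell.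
  - exact: measurable_funTS.
  - move=> n; rewrite -/(eV _ _) eVE // lee_fin.
    have [xs|sx] := ltP x (t - n.+1%:R^-1).
      by apply: h => //; rewrite ltrBlDr ltrDl.
    by have [_ _ -> //] := shell_data_rV.
apply/seteqP; split => y; rewrite /rshell /=.
  move=> /andP[h1 h2]; have h3 : 0 < t - rho y by rewrite subr_gt0.
  have [n _ hn] := near_infty_natSinv_lt (PosNum h3).
  exists n => //; rewrite /rshell /= h1 /=.
  by have := hn n (leqnn n); rewrite /= ltrBrDl ltrBrDr addrC.
case=> n _ /= /andP[-> h1] /=; apply: lt_trans h1 _.
by rewrite ltrBlDr ltrDl.
Qed.

Lemma rV_right_le x t M : 0 < x -> x < t -> (forall s, x < s -> s < t -> rV s t <= M) ->
  rV x t <= M.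
Proof.
move=> x0 xt h; rewrite -lee_fin -eVE //.
have M0 : 0 <= M.
  by apply: le_trans (h ((x + t) / 2) _ _); [exact: rV_ge0|lra|lra].
rewrite /eV (_ : rshell x t = \bigcup_n rshell (x + n.+1%:R^-1) t).
  apply: integral_bigcup_le => //.
  - move=> m n mn y /= /andP[h1 h2]; apply/andP; split=> //; apply: le_lt_trans h1.
    by rewrite lerD2l lef_pV2 ?posrE // ler_nat ltnS.
  - by move=> n; exact: measurable_rshell.
  - exact: measurable_funTS.
  - move=> n; rewrite -/(eV _ _) eVE ?addr_gt0 // lee_fin.
    have [xs|sx] := ltP (x + n.+1%:R^-1) t.
      by apply: h => //; rewrite ltrDl.
    by have [_ _ -> //] := shell_data_rV.
apply/seteqP; split => y; rewrite /rshell /=.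
  move=> /andP[h1 h2]; have h3 : 0 < rho y - x by rewrite subr_gt0.
  have [n _ hn] := near_infty_natSinv_lt (PosNum h3).
  exists n => //; rewrite /rshell /= h2 andbT.
  by have := hn n (leqnn n); rewrite /= ltrBrDl.
case=> n _ /= /andP[h1 ->]; rewrite andbT; apply: le_lt_trans h1.
by rewrite lerDl.
Qed.

Lemma rV_ivt x s t y : 0 < x -> x <= s -> s <= t -> rV x s <= y -> y <= rV x t ->
  exists2 v, s <= v <= t & rV x v = y.
Proof.
move=> x0 xs st; have [[V0 Vm] mV Vn Va] := shell_data_rV.
apply: (@monotone_ivt R (rV x)) => //.
- by move=> v z sv vz zt; exact: Vm.
- move=> v M sv vt h; have xv : x < v by exact: le_lt_trans sv.
  apply: rV_left_le => // z xz zv.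
  have [sz|zs] := leP s z; first exact: h.
  by apply: (le_trans (Vm x x z s x0 (lexx _) (ltW zs))); exact: h.
- move=> v M sv vt h.
  have xv : x <= v by exact: le_trans sv.
  have v0 : 0 < v by exact: lt_le_trans xv.
  (* Continuity from the right in the outer radius becomes, through additivity, continuity in the
     inner radius, where monotone convergence applies. *)
  have : rV v t <= rV x t - M.
    apply: rV_right_le => // z vz zt; rewrite lerBrDl -lerBrDr.
    have xz : x <= z by exact: ltW (le_lt_trans xv vz).
    by rewrite (Va x z t x0 xz (ltW zt)) addrK; apply: h => //; exact: ltW.
  by rewrite (Va x v t x0 xv (ltW vt)); lra.
Qed.
End tests.

End radial_space.

(** * Lower bounds by testing on shells *)

Section lower_bound.
Context {R : realType}.
Local Notation mu1 := (@completed_lebesgue_measure R).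
Implicit Types (w : realR R -> \bar R) (V : R -> R -> R).

Lemma dual_tail_halving (a : R) w x k : tail_weight w -> halving w x ->
  dual_tail a w (x k.+1) = 2 `^ (a - 1)^-1 * dual_tail a w (x k).
Proof.
move=> hw [xW xp _]; apply: dual_tail_div => //.
by rewrite (xW k.+1) (xW k) exprS; field; rewrite expf_neq0.
Qed.

(** The dual tails at halving points grow geometrically, so the last one before [t] dominates the
    sum. This is the packing hypothesis of [shell_bounded]. *)
Lemma halving_dual_sum (a : R) : 1 < a -> exists2 Ga : R, 0 < Ga &
  forall w x n t, tail_weight w -> halving w x -> 0 < t ->
  \sum_(k < n | x k < t) dual_tail a w (x k) <= Ga * dual_tail a w t.
Proof.
move=> a1; have ka0 : 0 < (a - 1)^-1 by rewrite invr_gt0 subr_gt0.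
have [L L1 LE] : exists2 L : R, 1 < L & L = 2 `^ (a - 1)^-1.
  exists (2 `^ (a - 1)^-1) => //; have E1 : 1 = 1 `^ (a - 1)^-1 :> R by rewrite powR1.
  by rewrite [ltLHS]E1; apply: gt0_ltr_powR; rewrite ?nnegrE ?ltr1n ?ler01 ?ler0n.
have L0 : 0 < L by lra.
exists (L / (L - 1)); first by rewrite divr_gt0 // subr_gt0.
move=> w x n t hw hx t0; have [_ xp _] := hx.
have nuS k : dual_tail a w (x k.+1) = L * dual_tail a w (x k).
  by rewrite LE; exact: dual_tail_halving.
have full m : \sum_(k < m.+1) dual_tail a w (x k) <= L / (L - 1) * dual_tail a w (x m).
  elim: m => [|m IH].
    rewrite big_ord_recr big_ord0 /= add0r -[leLHS]mul1r ler_wpM2r ?powR_ge0 //.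
    by rewrite ler_pdivlMr ?subr_gt0 // mul1r; lra.
  rewrite big_ord_recr /= [in leRHS]nuS; apply: (le_trans (lerD IH (lexx _))).
  rewrite nuS le_eqVlt; apply/orP; left; apply/eqP.
  by field; rewrite gt_eqF // subr_gt0.
have G0 : 0 <= L / (L - 1) by rewrite divr_ge0 //; lra.
elim: n => [|n IH]; first by rewrite big_ord0 mulr_ge0 ?powR_ge0.
have [xt|tx] := ltP (x n) t.
  apply: (@le_trans _ _ (\sum_(k < n.+1) dual_tail a w (x k))).
    rewrite big_mkcond; apply: ler_sum => i _; case: ifP => // _; exact: powR_ge0.
  apply: (le_trans (full n)).
  exact: (ler_wpM2l G0 (dual_tail_homo a1 hw (xp n) (ltW xt))).
by rewrite big_mkcond big_ord_recr /= ltNge tx /= addr0 -big_mkcond.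
Qed.

(* The embedding inequality for combinations of normalised shell functions; the
   condition on the inner radii [s i] makes their [L^{p,a}] norms almost
   orthogonal. *)
Definition shell_bounded (p a b Ga : R) w1 w2 V (D : R) : Prop :=
  forall (I : finType) (s t c : I -> R), (forall i, 0 < s i) -> (forall i, 0 <= c i) ->
  (forall r, 0 < r -> \sum_(i | s i < r) dual_tail a w1 (s i) <= Ga * dual_tail a w1 r) ->
  (wint w2 `]0%R, +oo[ (fun r => (\sum_(i | t i < r) c i * V (s i) (t i) `^ ((p - 1) / p)) `^ b)%R
   <= (D `^ b * (\sum_i rtail w1 (s i) * c i `^ a) `^ (b / a))%:E)%E.

Lemma dual_tail_powa (a s : R) w : 1 < a -> tail_weight w -> 0 < s ->
  rtail w s * dual_tail a w s `^ a = dual_tail a w s.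
Proof.
move=> a1 hw s0; have W0 := rtail_gt0 hw s0.
have an1 : a - 1 != 0 by rewrite gt_eqF // subr_gt0.
rewrite /dual_tail -powRrM -[X in X * _]powRr1 ?(ltW W0) // -powRD ?(gt_eqF W0) ?implybT //.
by congr (_ `^ _); field.
Qed.

Lemma Jint_le_sum (p a : R) : 1 < p -> 1 < a -> exists2 C : R, 0 < C &
  forall w V x n t, tail_weight w -> shell_data V -> halving w x -> t < x n -> 0 < t ->
  (Jint p a w V (x 0%N) t <=
   (C * \sum_(k < n) dual_tail a w (x k) * V (x k) t `^ theta p a)%:E)%E.
Proof.
move=> p1 a1; have [C C0 hC] := dual_int_le_tail a1.
have th0 := theta_gt0 p1 a1.
exists (C * 2 `^ (a - 1)^-1); first by rewrite mulr_gt0 ?powR_gt0.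
move=> w V x n t hw [[V0 Vm] mV Vn Va] hx xt t0; have [xW xp xS] := hx.
have no := dual_nnweight a hw.
have pV : posmeas (fun r : realR R => V r t `^ theta p a) by apply: posmeas_powR; exact: mV.
have [m1 m2] := posmeas_nnweight no pV.
apply: (@le_trans _ _ (wint (dual_weight a w) `]x 0%N, x n[ (fun r => V r t `^ theta p a)%R)).
  apply: wint_subset => // y /=; rewrite !in_itv/= => /andP[-> yt].
  exact: lt_trans yt xt.
have E := integral_itv_sum m1 m2 n (fun i => ltW (xS i)).
rewrite /wint E mulr_sumr -sumEFin; apply: lee_sum => k _.
have vk : 0 <= V (x k) t `^ theta p a by exact: powR_ge0.
apply: (@le_trans _ _ ((V (x k) t `^ theta p a)%:E *
    \int[mu1]_(r in `]x k, x k.+1[) dual_weight a w r)%E).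
  apply: wint_le_cst => // r; rewrite in_itv/= => /andP[kr _].
  by apply: le_powR; [exact: ltW|exact: V0|exact: (Vm _ _ _ _ (xp k) (ltW kr) (lexx _))].
apply: (@le_trans _ _ ((V (x k) t `^ theta p a)%:E * (C * dual_tail a w (x k.+1))%:E)%E).
  apply: lee_wpmul2l; first by rewrite lee_fin.
  apply: le_trans (hC w _ hw (xp k.+1)).
  apply: (integral_itv_subset no.1 no.2) => r /=; rewrite !in_itv/= => /andP[kr ->].
  by rewrite (lt_trans (xp k) kr).
by rewrite -EFinM lee_fin (dual_tail_halving a _ hw hx) le_eqVlt; apply/orP; left; apply/eqP; ring.
Qed.

(** All test shells end at [t] and start at halving points [x k]. With [c k] the dual tail at [x k]
    times [V ^ (theta / a)], both sides of the test reduce to the same sum [S], a Riemann sum of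
    [J], and give [S W2(t) ^ (1/b) <= D S ^ (1/a)]. Then the first halving point tends to 0. *)
Lemma Jint_lower (p a b : R) : 1 < p -> 1 < a -> 1 < b -> exists Ga C : R,
  [/\ 0 < Ga, 0 < C & forall w1 w2 V (J D : R) t,
  tail_weight w1 -> tail_weight w2 -> shell_data V -> 0 <= D ->
  shell_bounded p a b Ga w1 w2 V D -> 0 < t -> Jint p a w1 V 0 t = J%:E ->
  J `^ ((a - 1) / a) * rtail w2 t `^ b^-1 <= C * D].
Proof.
move=> p1 a1 b1; have b0 : 0 < b by lra.
have a0 : 0 < a by lra.
have [pn [an an1]] : p != 0 /\ (a != 0 /\ a - 1 != 0) by rewrite !gt_eqF //; lra.
have bn : b != 0 by rewrite gt_eqF.
have e0 : 0 < (a - 1) / a by rewrite divr_gt0 // subr_gt0.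
have [Ga Ga0 hGa] := halving_dual_sum a1.
have [C C0 hC] := Jint_le_sum p1 a1.
exists Ga, (C `^ ((a - 1) / a)); split; [done|by rewrite powR_gt0|].
move=> w1 w2 V J D t hw1 hw2 hV D0 hB t0 JE.
have [[V0 Vm] mV Vn Va] := hV.
have W0 := rtail_gt0 hw2 t0.
have Wb : 0 < rtail w2 t `^ b^-1 by rewrite powR_gt0.
have [X XE] : {X | X = (D / rtail w2 t `^ b^-1) `^ (a / (a - 1))} by exists ((D / rtail w2 t `^ b^-1) `^ (a / (a - 1))).
have X0 : 0 <= X by rewrite XE powR_ge0.
have key x n : halving w1 x ->
    \sum_(k < n) dual_tail a w1 (x k) * V (x k) t `^ theta p a <= X.
  move=> hx; have [xW xp xS] := hx.
  have [S SE] : {S | S = \sum_(k < n) dual_tail a w1 (x k) * V (x k) t `^ theta p a}.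
    by exists (\sum_(k < n) dual_tail a w1 (x k) * V (x k) t `^ theta p a).
  rewrite -SE; have S0 : 0 <= S by rewrite SE; apply: sumr_ge0 => k _; rewrite mulr_ge0 ?powR_ge0.
  pose c (k : 'I_n) := dual_tail a w1 (x k) * V (x k) t `^ (theta p a / a).
  have c0 k : 0 <= c k by rewrite mulr_ge0 ?powR_ge0.
  have := hB _ (fun k : 'I_n => x k) (fun=> t) c (fun k => xp k) c0
    (fun r r0 => hGa w1 x n r hw1 hx r0).
  have -> : \sum_(i < n) rtail w1 (x i) * c i `^ a = S.
    rewrite SE; apply: eq_bigr => k _; rewrite /c powRM ?powR_ge0 // mulrA dual_tail_powa //.
    by rewrite -powRrM divfK.
  have cV (k : 'I_n) : c k * V (x k) t `^ ((p - 1) / p) = dual_tail a w1 (x k) * V (x k) t `^ theta p a.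
    rewrite /c -mulrA -powR_addr.
      by congr (_ * _ `^ _); rewrite /theta; field; rewrite an pn an1.
    by rewrite addr_gt0 // divr_gt0 ?subr_gt0 ?theta_gt0 //; lra.
  have Sb : posmeas (fun _ : realR R => S `^ b) by apply: posmeas_cst; exact: powR_ge0.
  have -> : wint w2 `]0%R, +oo[ (fun r => (\sum_(i < n | t < r) c i * V (x i) t `^ ((p - 1) / p)) `^ b)%R
     = wint w2 `]0%R, +oo[ (fun r => if t < r then S `^ b else 0).
    apply: eq_wint => r _; case: ifP => _; last by rewrite big_pred0 // powR0.
    by rewrite SE; congr (_ `^ _); apply: eq_bigr => k _; exact: cV.
  rewrite (wint_after w2 Sb (ltW t0)) => h.
  have : ((S `^ b)%:E * (rtail w2 t)%:E <= (D `^ b * S `^ (b / a))%:E)%E.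
    apply: le_trans h; rewrite -rtailE //.
    by apply: (wint_ge_cst (tail_nnweight hw2)) => //; exact: powR_ge0.
  rewrite -EFinM lee_fin => h1.
  have h2 : S * rtail w2 t `^ b^-1 <= D * S `^ a^-1.
    apply: (@le_powR_inv _ b _ _ b0 (mulr_ge0 D0 (powR_ge0 _ _))).
    rewrite (powRM _ S0 (powR_ge0 _ _)) (powRM _ D0 (powR_ge0 _ _)) -!powRrM.
    by rewrite mulVf // (powRr1 (ltW W0)) [a^-1 * b]mulrC.
  have [S1|S1] := leP S 0; first exact: le_trans S1 X0.
  have Sa : 0 < S `^ a^-1 by rewrite powR_gt0.
  rewrite XE; apply: (@le_powR_inv _ ((a - 1) / a) _ _ e0 (powR_ge0 _ _)).
  rewrite -powRrM (_ : a / (a - 1) * ((a - 1) / a) = 1); last by field; rewrite an an1.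
  rewrite powRr1 ?divr_ge0 ?(ltW Wb) // ler_pdivlMr //.
  rewrite -(ler_pM2r Sa) mulrAC (_ : S `^ ((a - 1) / a) * S `^ a^-1 = S) //.
  have e1 : (a - 1) / a + a^-1 = 1 by field.
  by rewrite -powR_addr e1 ?powRr1 ?(ltW S1).
have : (Jint p a w1 V 0 t <= (C * X)%:E)%E.
  have no := dual_nnweight a hw1.
  have pV : posmeas (fun r : realR R => V r t `^ theta p a) by apply: posmeas_powR; exact: mV.
  have [m1 m2] := posmeas_nnweight no pV.
  apply: (integral_itv_left_le m1 m2) => [|s s0 _].
    by rewrite lee_fin mulr_ge0 // ltW.
  have [y [y0 yW yp yS]] := halving_points hw1 s0.
  have hy : halving w1 y by split => // k; rewrite yW y0.
  have [n tn] := halving_unbounded t hw1 hy.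
  rewrite -y0; apply: (le_trans (hC w1 V y n t hw1 hV hy tn t0)).
  by rewrite lee_fin ler_wpM2l ?(ltW C0) //; exact: key.
rewrite JE lee_fin => JX.
have J0 : 0 <= J.
  rewrite -lee_fin -JE; apply: wint_ge0; first exact: dual_nnweight.
  by apply: posmeas_powR; exact: mV.
rewrite -ler_pdivlMr //; apply: (le_trans (le_powR (ltW e0) J0 JX)).
rewrite powRM // ?(ltW C0) // XE -powRrM (_ : a / (a - 1) * ((a - 1) / a) = 1); last first.
  by field; rewrite an an1.
by rewrite powRr1 ?divr_ge0 ?(ltW Wb) // mulrA.
Qed.

End lower_bound.

(** * Necessity of the Hardy condition *)

Section hardy_lower_bound.
Context {R : realType}.
Local Notation mu1 := (@completed_lebesgue_measure R).
Implicit Types (w : realR R -> \bar R) (V : R -> R -> R).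

(** Consecutive shells are disjoint, so the L^p norm of a combination of normalised shell functions
    is governed by the l^p norm of the coefficients, without any packing hypothesis. *)
Definition hardy_shells (p b : R) w V (x D : R) : Prop :=
  forall (n : nat) (q : nat -> R) (y : 'I_n -> R), q 0%N = x -> (forall i, q i <= q i.+1) ->
  (forall i, 0 <= y i) ->
  (wint w `]0%R, +oo[ (fun r => (\sum_(i < n | q i.+1 < r) y i * V (q i) (q i.+1) `^ ((p - 1) / p)) `^ b)%R
   <= (D `^ b * (\sum_(i < n) y i `^ p) `^ (b / p))%:E)%E.

Definition shell_continuous V : Prop :=
  (forall x t M, 0 < x -> x < t -> (forall s, x < s -> s < t -> V x s <= M) -> V x t <= M) /\
  (forall x s t y, 0 < x -> x <= s -> s <= t -> V x s <= y -> y <= V x t ->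
     exists2 v, s <= v <= t & V x v = y).

(** The points double [V x], so the shell between two neighbours carries at least a quarter of the
    mass [V x] at the following point. The choice of the least [N] keeps the last step, to [T],
    within a factor 2. *)
Lemma doubling_points V x s T : shell_data V -> shell_continuous V -> 0 < x -> x < s -> s < T ->
  0 < V x s -> exists (n : nat) (q : nat -> R),
  [/\ q 0%N = x /\ q 1%N = s, q n.+2 = T, forall i, q i <= q i.+1 &
      forall i, (i <= n)%N -> V x (q i.+2) <= 4 * V (q i) (q i.+1)].
Proof.
move=> [[V0 Vm] mV Vn Va] [_ hivt] x0 xs sT v0; set v := V x s in v0.
have T0 : 0 < T by exact: lt_trans (lt_trans x0 xs) sT.
have exN : exists N, V x T < 2 ^+ N * v.
  exists (Num.truncn (V x T / v)).+1; rewrite -ltr_pdivrMr //.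
  apply: lt_le_trans (truncnS_gt _) _; rewrite -natrX ler_nat.
  exact: ltnW (ltn_expl _ _).
case: (ex_minnP exN) => N hN Nmin.
have vT : v <= V x T by apply: Vm => //; exact: ltW.
case: N hN Nmin => [|n] hN Nmin; first by move: hN; rewrite expr0 mul1r ltNge vT.
have hn i : (i <= n)%N -> 2 ^+ i * v <= V x T.
  move=> li; rewrite leNgt; apply/negP => /Nmin; rewrite ltnNge => /negP; apply.
  exact: leq_ltn_trans li (ltnSn _).
have /choice[u hu] (i : nat) : exists t, s <= t <= T /\ ((i <= n)%N -> V x t = 2 ^+ i * v).
  have [li|li] := leqP i n; last by exists s; rewrite lexx (ltW sT).
  have h1 : V x s <= 2 ^+ i * v.
    by rewrite -/v -[leLHS]mul1r ler_wpM2r ?(ltW v0) // exprn_ege1 // ler1n.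
  have [t st tE] := hivt x s T (2 ^+ i * v) x0 (ltW xs) (ltW sT) h1 (hn i li).
  by exists t.
pose q i := match i with 0%N => x | 1%N => s | j.+2 => if (j.+1 <= n)%N then u j.+1 else T end.
have usT i : s <= u i /\ u i <= T by have [/andP[]] := hu i.
have qV i : (i <= n)%N -> V x (q i.+1) = 2 ^+ i * v.
  case: i => [|i] li; first by rewrite /= expr0 mul1r.
  by rewrite /= li; have [_] := hu i.+1; apply.
have qS i : q i <= q i.+1.
  case: i => [|[|i]] /=; first exact: ltW.
    by case: ifP => _; [exact: (usT _).1|exact: ltW].
  case: ifPn => [li|]; case: ifPn => [li'|] //.
  - rewrite leNgt; apply/negP => /ltW uu.
    have := Vm x x _ _ x0 (lexx _) uu.
    have [_ ->] := hu i.+1 => //; have [_ ->] := hu i.+2 => //.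
    by rewrite leNgt => /negP; apply; rewrite ltr_pM2r // ltr_eXn2l // ltr1n.
  - by move=> _; exact: (usT _).2.
  - by move=> /negP h; exfalso; apply: h; exact: ltnW.
exists n, q; split => //; first by rewrite /= ltnn.
have xq i : x <= q i by elim: i => // i /le_trans; apply.
move=> i li; apply: (@le_trans _ _ (2 * (2 ^+ i * v))).
  rewrite mulrA -exprS; have [li1|li1] := leqP i.+1 n; first by rewrite (qV i.+1 li1).
  have -> : i = n by apply/eqP; rewrite eqn_leq li -ltnS.
  by rewrite /= ltnn ltW.
rewrite -(qV i li); case: i li => [|i] li /=.
  by rewrite ler_wpM2r ?(ltW v0) // ler_nat.
have E := Va x (q i.+1) (q i.+2) x0 (xq _) (qS _).
move: E; rewrite (qV i.+1 li) (qV i (ltnW li)) exprS => E.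
have -> : V (q i.+1) (q i.+2) = 2 ^+ i * v.
  by apply: (@addrI _ (2 ^+ i * v)); rewrite -E; ring.
by rewrite le_eqVlt; apply/orP; left; apply/eqP; ring.
Qed.

(** For [p <= b] one shell is enough. For [b < p] the integral is cut at doubling points of [V x];
    on each piece [V x] is at most 4 times a single shell, so [discrete_lower] bounds the Riemann
    sum. *)
Lemma hardy_lower (p b : R) : 1 < p -> 1 < b -> exists2 C : R, 0 < C &
  forall w V x D, tail_weight w -> shell_data V -> shell_continuous V -> 0 < x -> 0 <= D ->
  hardy_shells p b w V x D -> hardy_cond p b w V x (C * D).
Proof.
move=> p1 b1; have b0 : 0 < b by lra.
have p0 : 0 < p by lra.
have [bn pn] : b != 0 /\ p != 0 by rewrite !gt_eqF.
have [pb|bp] := leP p b.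
  exists 1 => // w V x D hw hV hc x0 D0 hD; split; last by move=> h; move: (lt_le_trans h pb); rewrite ltxx.
  move=> _ z xz; have [[V0 _] _ _ _] := hV; rewrite mul1r.
  have z0 : 0 < z by exact: lt_trans xz.
  pose q i := if i is 0%N then x else z.
  have qS i : q i <= q i.+1 by case: i => [|i] //=; exact: ltW.
  have := hD 1%N q (fun=> 1) erefl qS (fun=> ler01).
  rewrite big_ord1 powR1 powR1 mulr1.
  have -> : wint w `]0%R, +oo[ (fun r => (\sum_(i < 1 | q i.+1 < r) 1 * V (q i) (q i.+1) `^ ((p - 1) / p)) `^ b)%R
     = wint w `]0%R, +oo[ (fun r => if z < r then (V x z `^ ((p - 1) / p)) `^ b else 0)%R.
    apply: eq_wint => r _; rewrite big_mkcond big_ord1 /= mul1r; case: ifP => // _.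
    by rewrite powR0.
  have Sb : posmeas (fun _ : realR R => (V x z `^ ((p - 1) / p)) `^ b).
    by apply: posmeas_cst; exact: powR_ge0.
  rewrite (wint_after w Sb (ltW z0)) => h.
  have W0 := rtail_ge0 hw z.
  have : (((V x z `^ ((p - 1) / p)) `^ b)%:E * (rtail w z)%:E <= (D `^ b)%:E)%E.
    apply: le_trans h; rewrite -rtailE //.
    by apply: (wint_ge_cst (tail_nnweight hw)) => //; exact: powR_ge0.
  rewrite -EFinM lee_fin => h1.
  apply: (@le_powR_inv _ b _ _ b0 D0).
  by rewrite (powRM _ (powR_ge0 _ _) (powR_ge0 _ _)) -[X in _ * X]powRrM mulVf // (powRr1 W0).
have pb0 : 0 < p - b by rewrite subr_gt0.
have pbn : p - b != 0 by rewrite gt_eqF.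
have pn1 : p - 1 != 0 by rewrite gt_eqF // subr_gt0.
have [C C0 hC] := discrete_lower b1 bp.
have [al alE] : {al | al = b * (p - 1) / (p - b)} by exists (b * (p - 1) / (p - b)).
have [be beE] : {be | be = b / (p - b)} by exists (b / (p - b)).
have [ro roE] : {ro | ro = p * b / (p - b)} by exists (p * b / (p - b)).
have al0 : 0 < al by rewrite alE divr_gt0 // mulr_gt0 // subr_gt0.
have be0 : 0 < be by rewrite beE divr_gt0.
have ro0 : 0 < ro by rewrite roE divr_gt0 // mulr_gt0.
have K0 : 0 < 4 `^ al * C by rewrite mulr_gt0 ?powR_gt0.
exists ((4 `^ al * C) `^ ro^-1); first by rewrite powR_gt0.
move=> w V x D hw hV hc x0 D0 hD; split; first by rewrite leNgt bp.
move=> _; have [[V0 Vm] mV Vn Va] := hV; have [hl _] := hc.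
rewrite -alE -beE -roE powRM ?powR_ge0 // -powRrM mulVf ?gt_eqF // powRr1 ?(ltW K0) //.
set X := (X in wint _ _ X).
have pX : posmeas X.
  apply: posmeasM; first by apply: posmeas_shell_powR => //; split.
  exact: posmeas_rtail_powR.
have [m1 m2] := posmeas_nnweight (tail_nnweight hw) pX.
have KD0 : 0 <= 4 `^ al * C * D `^ ro by rewrite mulr_ge0 ?powR_ge0 // ltW.
have core s T : x < s -> s < T -> 0 < V x s ->
    (wint w `]s, T[ X <= (4 `^ al * C * D `^ ro)%:E)%E.
  move=> xs sT vs; have [n [q [[q0 q1] qT qS qV]]] := doubling_points hV hc x0 xs sT vs.
  have xq i : x <= q i by elim: i => [|i]; [rewrite q0|move/le_trans; apply].
  have qp i : 0 < q i by exact: lt_le_trans (xq i).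
  pose k (i : 'I_n.+1) := V (q i) (q i.+1) `^ ((p - 1) / p).
  have k0 i : 0 <= k i by exact: powR_ge0.
  have kE i : k i `^ (p / (p - 1)) = V (q i) (q i.+1).
    rewrite /k -powRrM (_ : (p - 1) / p * (p / (p - 1)) = 1) ?powRr1 //.
    by field; rewrite pn pn1.
  have hDL := hC w _ (fun i : 'I_n.+1 => q i.+1) k D hw D0 (fun i => qp i.+1) k0
    (fun y y0 => hD n.+1 q y q0 qS y0).
  rewrite -q1 -qT /wint (integral_itv_sum m1 m2 (x := q \o S) n.+1 (fun i => qS i.+1)) /=.
  apply: (@le_trans _ _ (4 `^ al * (C * D `^ (p * b / (p - b))))%:E); last first.
    by rewrite roE mulrA lexx.
  apply: (@le_trans _ _ (4 `^ al * \sum_i k i `^ (p / (p - 1)) *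
    (\sum_(l : 'I_n.+1 | q l.+1 <= q i.+1) k l `^ (p / (p - 1))) `^ (p * (b - 1) / (p - b)) *
    rtail w (q i.+1) `^ (p / (p - b)))%:E); last first.
    by rewrite lee_fin; apply: ler_wpM2l; [exact: powR_ge0|exact: hDL].
  rewrite mulr_sumr -sumEFin; apply: lee_sum => i _.
  have Vi := V0 (q i) (q i.+1).
  have Wi := rtail_gt0 hw (qp i.+1).
  have c0 : 0 <= 4 `^ al * V (q i) (q i.+1) `^ al * rtail w (q i.+1) `^ be.
    by rewrite !mulr_ge0 ?powR_ge0.
  apply: (@le_trans _ _ ((4 `^ al * V (q i) (q i.+1) `^ al * rtail w (q i.+1) `^ be)%:E *
     tail_int w (q i.+1))%E).
    apply: (@le_trans _ _ ((4 `^ al * V (q i) (q i.+1) `^ al * rtail w (q i.+1) `^ be)%:E *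
      \int[mu1]_(r in `]q i.+1, q i.+2[) w r)%E).
      apply: (wint_le_cst (tail_nnweight hw) pX) => r; rewrite in_itv/= => /andP[ir ri].
      apply: ler_pM; [exact: powR_ge0|exact: powR_ge0| |].
        rewrite -powRM //; apply: (le_powR (ltW al0) (V0 _ _)).
        apply: le_trans (qV i _); last by rewrite -ltnS.
        exact: (Vm _ _ _ _ x0 (lexx _) (ltW ri)).
      apply: (le_powR (ltW be0) (rtail_ge0 hw _)).
      exact: (rtail_anti hw (qp i.+1) (ltW ir)).
    apply: lee_wpmul2l; first by rewrite lee_fin.
    have [nw1 nw2] := tail_nnweight hw.
    apply: (integral_itv_subset nw1 nw2) => r /=; rewrite !in_itv/= => /andP[-> _] //.
  rewrite (rtailE hw) // -EFinM lee_fin !kE -![in leLHS]mulrA; apply: ler_wpM2l; first exact: powR_ge0.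
  have -> : rtail w (q i.+1) `^ be * rtail w (q i.+1) = rtail w (q i.+1) `^ (p / (p - b)).
    rewrite mulrC powR_mul_self ?(ltW Wi) //; last by rewrite addr_gt0.
    by rewrite beE; congr (_ `^ _); field.
  apply: ler_wpM2r; first exact: powR_ge0.
  apply: (@le_trans _ _ (V (q i) (q i.+1) * V (q i) (q i.+1) `^ (p * (b - 1) / (p - b)))).
    have e1 : al = p * (b - 1) / (p - b) + 1 by rewrite alE; field.
    by rewrite powR_mul_self -?e1 // lexx.
  apply: ler_wpM2l => //; apply: le_powR => //.
    by rewrite divr_ge0 ?mulr_ge0 ?(ltW p0) ?(ltW pb0) // subr_ge0 ltW.
  rewrite (bigD1 i) //= kE lerDl; apply: sumr_ge0 => l _; exact: powR_ge0.
have [[T xT vT]|hz] := pselect (exists2 T, x < T & 0 < V x T); last first.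
  have -> : wint w `]x, +oo[ X = 0%E.
    apply: integral0_eq => r /=; rewrite in_itv/= andbT => xr.
    rewrite /X (_ : V x r = 0) ?powR0 ?mul0r ?mul0e ?gt_eqF //.
    apply/eqP; rewrite eq_le V0 andbT leNgt; apply/negP => vr.
    by apply: hz; exists r.
  by rewrite lee_fin.
(* Doubling needs [0 < V x s]. The integrand vanishes up to [sup A], and [V x] is positive beyond
   it. *)
pose A := [set s | x <= s /\ V x s <= 0].
have Ax : A x by split=> //; rewrite Vn.
have TA : ubound A T.
  move=> s [xs vs]; rewrite leNgt; apply/negP => Ts.
  have := Vm x x _ _ x0 (lexx _) (ltW Ts).
  by rewrite leNgt (le_lt_trans vs vT).
have supA : has_sup A by split; [exists x|exists T].
have xsup : x <= sup A by apply: ub_le_sup => //; exists T.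
have -> : wint w `]x, +oo[ X = wint w `]x, +oo[ (fun s => if sup A < s then X s else 0).
  apply: eq_wint => s; rewrite in_itv/= andbT => xs; case: ifPn => //; rewrite -leNgt => sA.
  rewrite /X (_ : V x s = 0) ?powR0 ?mul0r ?gt_eqF //.
  apply/eqP; rewrite eq_le V0 andbT.
  apply: hl => // r xr rs.
  have rA : 0 < sup A - r by rewrite subr_gt0 (lt_le_trans rs).
  have [t [xt vt] rt] := sup_adherent rA supA.
  apply: le_trans vt; apply: Vm => //; move: rt; rewrite subKr; exact: ltW.
rewrite (wint_after w pX xsup); apply: (integral_itv_left_le m1 m2) => [|s As _].
  by rewrite lee_fin.
apply: (integral_itv_infty_le m1 m2) => t st.
have xs : x < s by exact: le_lt_trans xsup As.
apply: core => //; rewrite ltNge; apply/negP => vs.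
have : s <= sup A by apply: ub_le_sup; [exists T|split => //; exact: ltW].
by rewrite leNgt As.
Qed.

End hardy_lower_bound.

(** * Lower bounds for sums over blocks with freely chosen shells *)

Section lower_integral.
Context {R : realType}.
Local Notation mu1 := (@completed_lebesgue_measure R).
Implicit Types (w : realR R -> \bar R) (V : R -> R -> R).

Lemma shell_sum V (x : nat -> R) j n : shell_data V -> (forall k, 0 < x k) ->
  (forall k, x k <= x k.+1) -> (j <= n)%N ->
  V (x j) (x n) = \sum_(j <= i < n) V (x i) (x i.+1).
Proof.
move=> [_ _ Vn Va] xp xS /subnK <-; elim: (n - j)%N => [|m IH].
  by rewrite add0n big_geq // Vn.
rewrite addSn big_nat_recr ?leq_addl //= -IH; apply: Va => //.
by elim: m {IH} => // m; move/le_trans; apply.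
Qed.

(** [V (x j) (x k)] is a tail sum of block shells and the dual tails are geometric, so
    [geometric_tail_sum] reduces the tail sums to single blocks. *)
Lemma tail_block_sum (p a : R) : 1 < p -> 1 < a -> exists2 C : R, 0 < C &
  forall w V x k, tail_weight w -> shell_data V -> halving w x ->
  \sum_(j < k) dual_tail a w (x j) * V (x j) (x k) `^ theta p a <=
  C * \sum_(j < k) block_weight p a w V x j.
Proof.
move=> p1 a1; have ka0 : 0 < (a - 1)^-1 by rewrite invr_gt0 subr_gt0.
have [L L1 LE] : exists2 L : R, 1 < L & L = 2 `^ (a - 1)^-1.
  exists (2 `^ (a - 1)^-1) => //; have E1 : 1 = 1 `^ (a - 1)^-1 :> R by rewrite powR1.
  by rewrite [ltLHS]E1; apply: gt0_ltr_powR; rewrite ?nnegrE ?ltr1n ?ler01 ?ler0n.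
have [C C0 hC] := geometric_tail_sum (theta_gt0 p1 a1) L1.
exists C => // w V x k hw hV hx; have [xW xp xS] := hx; have [[V0 _] _ _ _] := hV.
have nuE j : dual_tail a w (x j) = L ^+ j * dual_tail a w (x 0%N).
  elim: j => [|j IH]; first by rewrite expr0 mul1r.
  by rewrite (dual_tail_halving a _ hw hx) IH exprS mulrA LE.
have nu0 : 0 <= dual_tail a w (x 0%N) by exact: powR_ge0.
have h := hC k (fun j => V (x j) (x j.+1)) (fun j => V0 _ _).
rewrite big_mkord [X in _ <= C * X]big_mkord in h.
apply: (@le_trans _ _ (dual_tail a w (x 0%N) * \sum_(i < k) L ^+ i * (\sum_(i <= j < k) V (x j) (x j.+1)) `^ theta p a)).
  rewrite [leRHS]mulr_sumr; apply: ler_sum => j _.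
  have E := shell_sum hV xp (fun i => ltW (xS i)) (ltnW (ltn_ord j)).
  by rewrite -E (nuE j) mulrAC mulrC lexx.
apply: (le_trans (ler_wpM2l nu0 h)); rewrite mulrCA; apply: ler_wpM2l; first exact: ltW.
rewrite [leLHS]mulr_sumr; apply: ler_sum => j _; rewrite /block_weight -/(theta p a) (nuE j).
by rewrite le_eqVlt; apply/orP; left; apply/eqP; ring.
Qed.

(** Counterpart of [block_tail_sum_le]: inside the k-th block [J] is bounded by the completed blocks
    and the one shell that reaches [t]. *)
Lemma Jint_block (p a : R) : 1 < p -> 1 < a -> exists2 C : R, 0 < C &
  forall w V x k t, tail_weight w -> shell_data V -> halving w x -> x k <= t -> t <= x k.+1 ->
  (Jint p a w V (x 0%N) t <= (C * (\sum_(j < k) block_weight p a w V x j +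
     dual_tail a w (x k) * V (x k) t `^ theta p a))%:E)%E.
Proof.
move=> p1 a1; have [C1 C10 h1] := Jint_growth p1 a1.
have [C2 C20 h2] := Jint_le_sum p1 a1.
have [C3 C30 h3] := tail_block_sum p1 a1.
have th0 := theta_gt0 p1 a1.
pose L : R := 2 `^ (a - 1)^-1; have L0 : 0 < L by rewrite powR_gt0.
have LE : 2 `^ (a - 1)^-1 = L by []. clearbody L.
exists (C1 * (C2 * C3 + L)); first by rewrite mulr_gt0 ?addr_gt0 ?mulr_gt0.
move=> w V x k t hw hV hx kt tk; have [xW xp xS] := hx; have [[V0 Vm] mV Vn Va] := hV.
have x0k : x 0%N <= x k by exact: (halving_mono hx).
apply: (le_trans (h1 w V (x 0%N) (x k) t hw hV (ltW (xp 0%N)) x0k (xp k) kt)).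
have S0 : 0 <= \sum_(j < k) block_weight p a w V x j.
  by apply: sumr_ge0 => j _; exact: block_weight_ge0.
have [S SE] : {S | S = \sum_(j < k) block_weight p a w V x j}.
  by exists (\sum_(j < k) block_weight p a w V x j).
rewrite -SE; rewrite -SE in S0.
have hk : (Jint p a w V (x 0%N) (x k) <= (C2 * (C3 * S))%:E)%E.
  apply: (le_trans (h2 w V x k.+1 (x k) hw hV hx (xS k) (xp k))).
  have E0 : dual_tail a w (x k) * V (x k) (x k) `^ theta p a = 0.
    by rewrite (Vn _ _ (lexx _)) powR0 ?mulr0 // gt_eqF.
  rewrite lee_fin; apply: ler_wpM2l; first exact: ltW.
  have [F FE] : {F : nat -> R | forall j, F j = dual_tail a w (x j) * V (x j) (x k) `^ theta p a}.
    by exists (fun j => dual_tail a w (x j) * V (x j) (x k) `^ theta p a).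
  have h := h3 w V x k hw hV hx.
  rewrite -SE in h; apply: le_trans h.
  have E1 m : \sum_(j < m) dual_tail a w (x j) * V (x j) (x k) `^ theta p a = \sum_(j < m) F j.
    by apply: eq_bigr => j _; rewrite FE.
  by rewrite (E1 k.+1) (E1 k) big_ord_recr /= FE E0 addr0 lexx.
have tp : 0 < t by exact: lt_le_trans kt.
have nt : dual_tail a w t <= L * dual_tail a w (x k).
  by rewrite -LE -(dual_tail_halving a _ hw hx); exact: dual_tail_homo.
have Y0 : 0 <= V (x k) t `^ theta p a by exact: powR_ge0.
apply: (@le_trans _ _ (C1%:E * ((C2 * (C3 * S))%:E + (V (x k) t `^ theta p a * dual_tail a w t)%:E))%E).
  have C1e : (0 <= C1%:E)%E by rewrite lee_fin ltW.
  exact: (lee_wpmul2l C1e (leeD hk (lexx _))).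
rewrite -EFinD -EFinM lee_fin -[leRHS]mulrA ler_wpM2l ?(ltW C10) //.
have N0 : 0 <= dual_tail a w (x k) by exact: powR_ge0.
have h4 := ler_wpM2l Y0 nt.
have h5 : 0 <= C2 * C3 * (dual_tail a w (x k) * V (x k) t `^ theta p a).
  by rewrite !mulr_ge0 // ltW.
have h6 : 0 <= L * S by rewrite mulr_ge0 // ltW.
move: h4 h5 h6; move: (V (x k) t `^ theta p a) (dual_tail a w (x k)) (dual_tail a w t) => y z u h4 h5 h6.
clear - h4 h5 h6.
have -> : (C2 * C3 + L) * (S + z * y) = C2 * (C3 * S) + y * (L * z) + (C2 * C3 * (z * y) + L * S) by ring.
by rewrite -[leLHS]addr0 !lerD // addr_ge0.
Qed.

(* Each summand is replaced by twice its value at a nearly extremal point. *)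
Lemma sum_selection (I : finType) (A : I -> set R) (g : I -> R -> R) (M : R) :
  (forall i, A i !=set0) -> (forall i z, A i z -> 0 <= g i z) ->
  (forall z : I -> R, (forall i, A i (z i)) -> \sum_i g i (z i) <= M) ->
  exists P : I -> R, [/\ forall i, 0 <= P i, forall i z, A i z -> g i z <= P i &
    \sum_i P i <= 2 * M].
Proof.
move=> A0 g0 h; have /choice[y hy] := A0.
pose G i := [set g i z | z in A i].
have GM i : ubound (G i) M.
  move=> _ [z Az <-]; pose y' j := if j == i then z else y j.
  have Ay' j : A j (y' j) by rewrite /y'; case: eqP => [->|].
  apply: le_trans (h y' Ay'); rewrite (bigD1 i) //= {1}/y' eqxx lerDl.
  by apply: sumr_ge0 => j _; exact: g0.
have sG i : has_sup (G i) by split; [exists (g i (y i)); exists (y i)|exists M].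
exists (fun i => sup (G i)); split.
- move=> i; apply: (@le_trans _ _ (g i (y i))); first exact: g0.
  by apply: ub_le_sup; [exists M|exists (y i)].
- by move=> i z Az; apply: ub_le_sup; [exists M|exists z].
have /choice[z hz] (i : I) : exists z, A i z /\ sup (G i) <= 2 * g i z.
  have [s0|s0] := leP (sup (G i)) 0.
    exists (y i); split => //; apply: (le_trans s0); rewrite mulr_ge0 //; exact: g0.
  have s2 : 0 < sup (G i) / 2 by rewrite divr_gt0.
  have [_ [z Az <-] hz] := sup_adherent s2 (sG i).
  by exists z; split => //; lra.
apply: (@le_trans _ _ (\sum_i 2 * g i (z i))); first by apply: ler_sum => i _; exact: (hz i).2.
by rewrite -mulr_sumr ler_wpM2l // h // => i; exact: (hz i).1.
Qed.

(** Two families of shells are tested together: the shells up to the free radii [z k] and the blocks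
    themselves. The partial sums of [discrete_lower] then contain both the blocks before [x k] and
    the shell up to [z k]. Each starting point occurs twice, hence the packing constant [2 Ga]. *)
Lemma shells_discrete_lower (p a b : R) : 1 < p -> 1 < a -> 1 < b -> b < a -> exists Ga C : R,
  [/\ 0 < Ga, 0 < C & forall w1 w2 V D, tail_weight w1 -> tail_weight w2 -> shell_data V ->
  0 <= D -> shell_bounded p a b Ga w1 w2 V D -> forall x n (z : 'I_n -> R), halving w1 x ->
  (forall k : 'I_n, x k < z k) ->
  \sum_(k < n) dual_tail a w1 (x k) * V (x k) (z k) `^ theta p a *
    (\sum_(j < k) block_weight p a w1 V x j + dual_tail a w1 (x k) * V (x k) (z k) `^ theta p a)
      `^ (a * (b - 1) / (a - b)) * rtail w2 (z k) `^ (a / (a - b)) <=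
  C * D `^ (a * b / (a - b))].
Proof.
move=> p1 a1 b1 ba; have a0 : 0 < a by lra.
have [an an1] : a != 0 /\ a - 1 != 0 by rewrite !gt_eqF // subr_gt0.
have [Ga Ga0 hGa] := halving_dual_sum a1.
have [C C0 hC] := discrete_lower b1 ba.
exists (2 * Ga), C; split => //; first by rewrite mulr_gt0.
move=> w1 w2 V D hw1 hw2 [[V0 Vm] mV Vn Va] D0 hB x n z hx xz; have [xW xp xS] := hx.
pose I := ('I_n * bool)%type.
pose s (i : I) := x i.1; pose t (i : I) := if i.2 then z i.1 else x i.1.+1.
have st i : s i < t i by rewrite /s /t; case: i.2; [exact: xz|exact: xS].
have s0 i : 0 < s i by exact: xp.
have t0 i : 0 < t i by exact: lt_trans (st i).
pose k i := rtail w1 (s i) `^ (- a^-1) * V (s i) (t i) `^ ((p - 1) / p).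
have k0 i : 0 <= k i by rewrite mulr_ge0 ?powR_ge0.
have kE i : k i `^ (a / (a - 1)) = dual_tail a w1 (s i) * V (s i) (t i) `^ theta p a.
  rewrite /k -(block_power w1 V _ _ p1 a1) -powRrM.
  rewrite (_ : (a - 1) / a * (a / (a - 1)) = 1) ?powRr1 //.
    by rewrite mulr_ge0 ?powR_ge0.
  by field; rewrite an an1.
have sumI (f : I -> R) : \sum_i f i = \sum_(k < n) (f (k, true) + f (k, false)).
  have -> : \sum_i f i = \sum_(k < n) \sum_b f (k, b).
    by rewrite pair_bigA /=; apply: eq_bigr => -[].
  by apply: eq_bigr => i _; rewrite big_bool.
have hy (y : I -> R) : (forall i, 0 <= y i) ->
    (wint w2 `]0%R, +oo[ (fun r => (\sum_(i | t i < r) y i * k i) `^ b)%R <=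
       (D `^ b * (\sum_i y i `^ a) `^ (b / a))%:E)%E.
  move=> y0; pose c i := y i * rtail w1 (s i) `^ (- a^-1).
  have c0 i : 0 <= c i by rewrite mulr_ge0 ?powR_ge0.
  have pack r : 0 < r -> \sum_(i | s i < r) dual_tail a w1 (s i) <= 2 * Ga * dual_tail a w1 r.
    move=> r0; rewrite big_mkcond sumI /s /= big_split /= -!big_mkcond /=.
    by have := hGa w1 x n r hw1 hx r0; lra.
  have := hB _ s t c s0 c0 pack.
  have -> : \sum_i rtail w1 (s i) * c i `^ a = \sum_i y i `^ a.
    apply: eq_bigr => i _; have W0 := rtail_gt0 hw1 (s0 i).
    rewrite /c (powRM _ (y0 i) (powR_ge0 _ _)) -powRrM mulNr mulVf // powRN powRr1 ?(ltW W0) //.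
    by rewrite mulrCA mulfV ?mulr1 // gt_eqF.
  suff -> : wint w2 `]0%R, +oo[ (fun r => (\sum_(i | t i < r) c i * V (s i) (t i) `^ ((p - 1) / p)) `^ b)%R
    = wint w2 `]0%R, +oo[ (fun r => (\sum_(i | t i < r) y i * k i) `^ b)%R by [].
  apply: eq_wint => r _; congr (_ `^ _); apply: eq_bigr => i _.
  by rewrite /c /k mulrA.
have kT (j : 'I_n) : k (j, true) `^ (a / (a - 1)) = dual_tail a w1 (x j) * V (x j) (z j) `^ theta p a.
  exact: kE.
have kF (j : 'I_n) : k (j, false) `^ (a / (a - 1)) = block_weight p a w1 V x j by exact: kE.
have tT (j : 'I_n) : t (j, true) = z j by [].
have tF (j : 'I_n) : t (j, false) = x j.+1 by [].
have := hC w2 _ t k D hw2 D0 t0 k0 hy.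
have [K KE] : {K : I -> R | forall i, K i = k i `^ (a / (a - 1))}.
  by exists (fun i => k i `^ (a / (a - 1))).
have K0 i : 0 <= K i by rewrite KE powR_ge0.
under eq_bigr => i _ do rewrite -KE.
under eq_bigr => i _ do under eq_bigr => l _ do rewrite -KE.
move=> h; apply: le_trans h.
have {}kT (j : 'I_n) : dual_tail a w1 (x j) * V (x j) (z j) `^ theta p a = K (j, true) by rewrite KE kT.
have {}kF (j : 'I_n) : block_weight p a w1 V x j = K (j, false) by rewrite KE kF.
clear hy k0 kE KE; clearbody t; clear k.
rewrite sumI; apply: ler_sum => j _; apply: ler_wpDr.
  by rewrite !mulr_ge0 ?powR_ge0.
rewrite kT tT; apply: ler_wpM2r; first exact: powR_ge0.
apply: ler_wpM2l => //; apply: le_powR.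
- by rewrite divr_ge0 ?mulr_ge0 ?(ltW a0) //; lra.
- by rewrite addr_ge0 // sumr_ge0 // => i _; exact: block_weight_ge0.
rewrite [leRHS]big_mkcond sumI big_split /= addrC; apply: lerD; last first.
  have single (F : 'I_n -> R) : (forall i, 0 <= F i) -> F j <= \sum_i F i.
    by move=> F0; rewrite (bigD1 j) //= lerDl sumr_ge0.
  apply: (le_trans _ (single (fun i => if t (i, true) <= z j then K (i, true) else 0) _)).
    by rewrite tT lexx.
  by move=> i; case: ifP => _.
apply: (@le_trans _ _ (\sum_(i < n | (i < j)%N) K (i, false))).
  have E := big_ord_widen_cond n xpredT (fun i => block_weight p a w1 V x i) (ltnW (ltn_ord j)).
  under [leRHS]eq_bigr => i _ do rewrite -kF.
  by rewrite E lexx.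
rewrite big_mkcond; apply: ler_sum => i _; case: ifPn => ij; last by case: ifP.
rewrite ifT // tF.
by apply: ltW; apply: le_lt_trans (xz j); exact: (halving_mono hx).
Qed.

End lower_integral.

(** * Lower bound for the integral of [J] against a supremum of shells *)

Section lower_sup.
Context {R : realType}.
Local Notation mu1 := (@completed_lebesgue_measure R).
Implicit Types (w : realR R -> \bar R) (V : R -> R -> R).

Lemma Jint_homo (p a c s t : R) w V : 0 <= c -> 1 < p -> 1 < a -> tail_weight w -> shell_data V ->
  s <= t -> (Jint p a w V c s <= Jint p a w V c t)%E.
Proof.
move=> c0 p1 a1 hw [[V0 Vm] mV _ _] st; have no := dual_nnweight a hw.
have pV v : posmeas (fun r : realR R => V r v `^ theta p a) by apply: posmeas_powR; exact: mV.
apply: (@le_trans _ _ (wint (dual_weight a w) `]c, s[ (fun r => V r t `^ theta p a)%R)).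
  apply: (wint_le no) => // r; rewrite in_itv/= => /andP[cr _].
  apply: le_powR; [exact: ltW (theta_gt0 p1 a1)|exact: V0|].
  exact: (Vm _ _ _ _ (le_lt_trans c0 cr) (lexx _) st).
apply: (wint_subset no) => // r /=; rewrite !in_itv/= => /andP[-> rs].
exact: lt_le_trans rs st.
Qed.

Lemma Jint_anti (p a c d t : R) w V : c <= d -> tail_weight w -> shell_data V ->
  (Jint p a w V d t <= Jint p a w V c t)%E.
Proof.
move=> cd hw [_ mV _ _]; have no := dual_nnweight a hw.
apply: (wint_subset no); first by apply: posmeas_powR; exact: mV.
move=> r /=; rewrite !in_itv/= => /andP[dr ->]; rewrite andbT.
exact: le_lt_trans dr.
Qed.

(** The radii [z k] of [shells_discrete_lower] are chosen nearly extremal for the supremum in [M].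
    Blocks start at some [c > 0], so [J] is first replaced by the integral [J c] from [c]; the sets
    where [Jr <= 2 J c] exhaust the half-line as [c] tends to 0. *)
Lemma Jint_sup_lower (p a b : R) : 1 < p -> 1 < a -> 1 < b -> b < a -> exists Ga C : R,
  [/\ 0 < Ga, 0 < C & forall w1 w2 V (Jr : R -> R) (M : R -> \bar R) D,
  tail_weight w1 -> tail_weight w2 -> shell_data V ->
  0 <= D -> shell_bounded p a b Ga w1 w2 V D ->
  (forall t, 0 < t -> Jint p a w1 V 0 t = (Jr t)%:E) ->
  measurable_fun setT (Jr : realR R -> R) ->
  measurable_fun setT (M : realR R -> \bar R) -> (forall t, 0 <= M t)%E ->
  (forall t X, 0 < t -> (forall z, t < z ->
     ((V t z `^ theta p a * rtail w2 z `^ (a / (a - b)))%:E <= X)%E) -> (M t <= X)%E) ->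
  (\int[mu1]_(t in `]0%R, +oo[)
      ((Jr t `^ (a * (b - 1) / (a - b)))%:E * M t * dual_weight a w1 t)
    <= ((C * D) `^ (a * b / (a - b)))%:E)%E].
Proof.
move=> p1 a1 b1 ba; have th0 := theta_gt0 p1 a1.
have [a0 ab0] : 0 < a /\ 0 < a - b by lra.
have [q qE] : {q | q = a * (b - 1) / (a - b)} by exists (a * (b - 1) / (a - b)).
have [ro roE] : {ro | ro = a * b / (a - b)} by exists (a * b / (a - b)).
have q0 : 0 < q by rewrite qE divr_gt0 // mulr_gt0 // subr_gt0.
have ro0 : 0 < ro by rewrite roE divr_gt0 // mulr_gt0 //; lra.
have [Ga [C1 [Ga0 C10 h1]]] := shells_discrete_lower p1 a1 b1 ba.
have [C2 C20 h2] := Jint_block p1 a1.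
have [C3 C30 h3] := dual_int_le_tail a1.
pose L : R := 2 `^ (a - 1)^-1; have L0 : 0 < L by rewrite powR_gt0.
have LE : 2 `^ (a - 1)^-1 = L by []. clearbody L.
pose K := 2 `^ q * (C2 `^ q * (C3 * L) * (2 * C1)).
have K0 : 0 < K by rewrite !mulr_gt0 ?powR_gt0.
exists Ga, (K `^ ro^-1); split => //; first by rewrite powR_gt0.
move=> w1 w2 V Jr M D hw1 hw2 hV D0 hB JE mJ mM M0 Mlub.
rewrite -qE -roE (powRM _ (powR_ge0 _ _) D0) -powRrM mulVf ?gt_eqF // (powRr1 (ltW K0)).
have Dr0 : 0 <= D `^ ro by exact: powR_ge0.
have [[V0 Vm] mV Vn Va] := hV.
have [mo o0] := dual_nnweight a hw1.
have Jr0 t : 0 < t -> 0 <= Jr t.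
  move=> t0; rewrite -lee_fin -JE //; apply: (wint_ge0 (dual_nnweight a hw1)).
  by apply: posmeas_powR; exact: mV.
have Jc0 c t : (0 <= Jint p a w1 V c t)%E.
  apply: (wint_ge0 (dual_nnweight a hw1)); by apply: posmeas_powR; exact: mV.
pose J c t := fine (Jint p a w1 V c t).
have JcE c t : 0 <= c -> 0 < t -> Jint p a w1 V c t = (J c t)%:E.
  move=> c0 t0; rewrite fineK // ge0_fin_numE //.
  by apply: le_lt_trans (Jint_anti _ _ _ c0 hw1 hV) _; rewrite JE // ltry.
have J0 c t : 0 <= J c t by exact: fine_ge0.
have mJc c : 0 <= c -> measurable_fun setT (J c : realR R -> R).
  move=> c0; apply: (@measurableT_comp _ _ _ _ _ _ fine); first exact: fine_measurable.
  by apply: measurable_homo => s t st; exact: Jint_homo.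
have mf (g : R -> R) : measurable_fun setT (g : realR R -> R) ->
    measurable_fun setT (fun t : realR R => (g t `^ q)%:E * M t * dual_weight a w1 t)%E.
  move=> mg; apply: emeasurable_funM; last exact: mo.
  apply: emeasurable_funM; last exact: mM.
  by apply/measurable_EFinP; exact: measurable_powR_comp.
have f0 (g : R -> R) t : (0 <= (g t `^ q)%:E * M t * dual_weight a w1 t)%E.
  apply: mule_ge0; last exact: o0.
  by apply: mule_ge0; [rewrite lee_fin powR_ge0|exact: M0].
have step c : 0 < c -> (\int[mu1]_(t in `]c, +oo[) ((J c t `^ q)%:E * M t * dual_weight a w1 t)
    <= (C2 `^ q * (C3 * L) * (2 * C1) * D `^ ro)%:E)%E.
  move=> c0; have [x [x0 xW xp xS]] := halving_points hw1 c0.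
  have hx : halving w1 x by split => // k; rewrite xW x0.
  apply: (integral_itv_infty_le (mf _ (mJc c (ltW c0))) (f0 _)) => t ct.
  have [n tn] := halving_unbounded t hw1 hx.
  apply: (@le_trans _ _ (\int[mu1]_(t in `]x 0%N, x n[) ((J c t `^ q)%:E * M t * dual_weight a w1 t))%E).
    apply: (integral_itv_subset (mf _ (mJc c (ltW c0))) (f0 _)) => r /=.
    by rewrite !in_itv/= x0 => /andP[-> rt]; exact: lt_trans rt tn.
  rewrite (integral_itv_sum (mf _ (mJc c (ltW c0))) (f0 _) n (fun i => ltW (xS i))).
  pose g (k : 'I_n) z := dual_tail a w1 (x k) * V (x k) z `^ theta p a *
    (\sum_(j < k) block_weight p a w1 V x j + dual_tail a w1 (x k) * V (x k) z `^ theta p a) `^ q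
      * rtail w2 z `^ (a / (a - b)).
  have g0 k z : 0 <= g k z by rewrite !mulr_ge0 ?powR_ge0.
  (* [P k] majorises the k-th term for all radii beyond [x k]; solving [g k z <= P k] for the shell
     term bounds [M] on the block. *)
  have [P [P0 gP Psum]] : exists P : 'I_n -> R, [/\ forall i, 0 <= P i,
      forall (i : 'I_n) z, x i < z -> g i z <= P i & \sum_i P i <= 2 * (C1 * D `^ ro)].
    apply: (@sum_selection _ _ (fun i : 'I_n => [set z | x i < z])) => //.
    - by move=> i; exists (x i.+1); exact: xS.
    - by move=> z hz; rewrite roE /g qE; exact: (h1 w1 w2 V D hw1 hw2 hV D0 hB x n z hx hz).
  apply: (@le_trans _ _ (\sum_(i < n) (C2 `^ q * (C3 * L) * P i)%:E)%E); last first.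
    rewrite sumEFin lee_fin -mulr_sumr -[leRHS]mulrA -[X in _ <= _ * X]mulrA.
    by apply: ler_wpM2l => //; rewrite !mulr_ge0 ?powR_ge0 // ltW.
  apply: lee_sum => k _.
  have nu0 : 0 < dual_tail a w1 (x k) by exact: dual_tail_gt0.
  apply: (@le_trans _ _ ((C2 `^ q * P k / dual_tail a w1 (x k))%:E *
     \int[mu1]_(t in `]x k, x k.+1[) dual_weight a w1 t)%E); last first.
    apply: (@le_trans _ _ ((C2 `^ q * P k / dual_tail a w1 (x k))%:E * (C3 * dual_tail a w1 (x k.+1))%:E)%E).
      apply: lee_wpmul2l; first by rewrite lee_fin divr_ge0 ?mulr_ge0 ?powR_ge0.
      apply: le_trans (h3 w1 _ hw1 (xp k.+1)).
      apply: (integral_itv_subset mo o0) => r /=; rewrite !in_itv/= => /andP[kr ->].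
      by rewrite (lt_trans (xp k) kr).
    rewrite -EFinM lee_fin (dual_tail_halving a _ hw1 hx) LE.
    move: (dual_tail a w1 (x k)) nu0 (C2 `^ q) (P k) => v v0 y z.
    by rewrite le_eqVlt; apply/orP; left; apply/eqP; field; rewrite gt_eqF.
  have N0 : 0 <= C2 `^ q * P k / dual_tail a w1 (x k).
    by rewrite divr_ge0 ?mulr_ge0 ?powR_ge0.
  rewrite -ge0_integralZl; first last.
  - by rewrite lee_fin.
  - by move=> r _; exact: o0.
  - exact: measurable_funTS.
  - exact: measurable_itvR.
  apply: ge0_le_integral.
  - exact: measurable_itvR.
  - by move=> r _; exact: f0.
  - by apply: measurable_funTS; exact: mf (mJc c (ltW c0)).
  - by apply: measurable_funTS; apply: emeasurable_funM; [exact: measurable_cst|exact: mo].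
  move=> r; rewrite /= in_itv/= => /andP[kr rk]; apply: lee_wpmul2r; first exact: o0.
  have r0 : 0 < r by exact: lt_trans (xp k) kr.
  (* Where the power of [J] vanishes the integrand is 0; elsewhere this power can be divided out,
     which puts the claim in the form of the defining bound of [M]. *)
  have [Jn|Jp] := leP (J c r `^ q) 0.
    have -> : J c r `^ q = 0 by apply/eqP; rewrite eq_le Jn powR_ge0.
    by rewrite mul0e lee_fin.
  suff h : (M r <= (C2 `^ q * P k / dual_tail a w1 (x k) / J c r `^ q)%:E)%E.
    apply: (le_trans (lee_wpmul2l _ h)); first by rewrite lee_fin ltW.
    by rewrite -EFinM lee_fin mulrC divfK // gt_eqF.
  apply: (Mlub r _ r0) => z rz; rewrite lee_fin (ler_pdivlMr _ _ Jp) (ler_pdivlMr _ _ nu0).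
  have kz : x k < z by exact: lt_trans rz.
  apply: le_trans (ler_wpM2l (powR_ge0 _ _) (gP k z kz)).
  have Vr : V r z `^ theta p a <= V (x k) z `^ theta p a.
    apply: le_powR; [exact: ltW|exact: V0|exact: (Vm _ _ _ _ (xp k) (ltW kr) (lexx _))].
  have Vz : V (x k) r `^ theta p a <= V (x k) z `^ theta p a.
    apply: le_powR; [exact: ltW|exact: V0|exact: (Vm _ _ _ _ (xp k) (lexx _) (ltW rz))].
  have [Y YE] : {Y | Y = \sum_(j < k) block_weight p a w1 V x j +
      dual_tail a w1 (x k) * V (x k) z `^ theta p a}.
    by exists (\sum_(j < k) block_weight p a w1 V x j +
      dual_tail a w1 (x k) * V (x k) z `^ theta p a).
  have hJ : J c r <= C2 * Y.
    rewrite -lee_fin -JcE ?(ltW c0) // -x0.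
    apply: (le_trans (h2 w1 V x k r hw1 hV hx (ltW kr) (ltW rk))).
    rewrite lee_fin YE; apply: ler_wpM2l; first exact: ltW.
    exact: (lerD (lexx _) (ler_wpM2l (ltW nu0) Vz)).
  have hJq := le_powR (ltW q0) (J0 c r) hJ.
  have Y0 : 0 <= Y.
    rewrite YE addr_ge0 ?mulr_ge0 ?powR_ge0 // sumr_ge0 // => i _; exact: block_weight_ge0.
  rewrite (powRM _ (ltW C20) Y0) in hJq.
  rewrite /g -YE; move: hJq Vr Jp (powR_ge0 (V r z) (theta p a)) (powR_ge0 (rtail w2 z) (a / (a - b))) nu0.
  move: (J c r `^ q) (V r z `^ theta p a) (V (x k) z `^ theta p a) (Y `^ q) (C2 `^ q)
    (rtail w2 z `^ (a / (a - b))) (dual_tail a w1 (x k)) => j v1 v2 s y W nu hj v12 j0 v10 W0 nu00.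
  rewrite (_ : v1 * W * j * nu = (nu * W) * (v1 * j)); last by ring.
  rewrite (_ : y * (nu * v2 * s * W) = (nu * W) * (v2 * (y * s))); last by ring.
  apply: ler_wpM2l; first by rewrite mulr_ge0 // ltW.
  by apply: ler_pM => //; exact: ltW.
pose c n : R := n.+1%:R^-1; have c0 n : 0 < c n by rewrite invr_gt0 ltr0Sn.
pose E n := [set t : realR R | c n < t /\ Jr t <= 2 * J (c n) t].
have cm m n : (m <= n)%N -> c n <= c m by move=> mn; rewrite lef_pV2 ?posrE ?ltr0Sn // ler_nat ltnS.
have mE n : measurable (E n).
  rewrite (_ : E n = `]c n, +oo[%classic `&` [set t | ((Jr t)%:E <= (2 * J (c n) t)%:E)%E]); last first.
    apply/seteqP; split => t /=.
      by move=> [ct Jt]; rewrite in_itv/= ct lee_fin.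
    by move=> []; rewrite in_itv/= andbT lee_fin.
  apply: emeasurable_fun_le; first exact: measurable_itvR.
    by apply/measurable_EFinP; apply: measurable_funTS; exact: mJ.
  apply/measurable_EFinP; apply: measurable_funTS; apply: measurable_funM; first exact: measurable_cst.
  exact: (mJc _ (ltW (c0 n))).
have cs s : 0 < s -> exists n, c n < s.
  by move=> s0; have [n _ hn] := near_infty_natSinv_lt (PosNum s0); exists n; exact: (hn n (leqnn n)).
have EU : `]0%R, +oo[%classic = \bigcup_n E n.
  apply/seteqP; split => t /=; last first.
    by case=> n _ [ct _]; rewrite in_itv/= andbT; exact: lt_trans ct.
  rewrite in_itv/= andbT => t0; apply: contrapT => hE.
  have hn n : c n < t -> J (c n) t <= Jr t / 2.
    move=> ct; rewrite leNgt; apply/negP => h; apply: hE; exists n => //; split=> //; lra.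
  have [n ct] := cs t t0.
  (* If no [E n] contained [t], all truncated integrals would be at most half of [Jr t], and hence
     so would [Jr t] itself. *)
  have hJ : Jr t <= Jr t / 2.
    rewrite -lee_fin -(JE t t0).
    have pV : posmeas (fun r : realR R => V r t `^ theta p a) by apply: posmeas_powR; exact: mV.
    have [m1 m2] := posmeas_nnweight (dual_nnweight a hw1) pV.
    apply: (integral_itv_left_le m1 m2) => [|s s0 _].
      by rewrite lee_fin divr_ge0 ?Jr0.
    have st0 : 0 < Num.min s t by rewrite lt_min s0.
    have [m cm'] := cs _ st0; move: cm'; rewrite lt_min => /andP[ms mt].
    apply: (le_trans (Jint_anti p a t (ltW ms) hw1 hV)).
    by rewrite (JcE _ _ (ltW (c0 m)) t0) lee_fin hn.
  apply: hE; exists n => //; split => //; have := J0 (c n) t; lra.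
rewrite EU; apply: (integral_bigcup_le (mu := mu1)).
- move=> m n mn t [ct Jt]; split; first exact: le_lt_trans (cm _ _ mn) ct.
  apply: (le_trans Jt); apply: ler_wpM2l; first by [].
  have t0 : 0 < t by exact: lt_trans ct.
  rewrite -lee_fin -(JcE _ _ (ltW (c0 m)) t0) -(JcE _ _ (ltW (c0 n)) t0).
  exact: (Jint_anti p a t (cm _ _ mn) hw1 hV).
- exact: mE.
- by apply: measurable_funTS; exact: mf mJ.
- exact: f0.
move=> n.
apply: (@le_trans _ _ (\int[mu1]_(t in E n) ((2 `^ q)%:E * ((J (c n) t `^ q)%:E * M t * dual_weight a w1 t)))%E).
  apply: ge0_le_integral.
  - exact: mE.
  - by move=> t _; exact: f0.
  - by apply: measurable_funTS; exact: mf mJ.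
  - apply: measurable_funTS; apply: emeasurable_funM; first exact: measurable_cst.
    exact: mf (mJc _ (ltW (c0 n))).
  move=> t [ct Jt].
  rewrite -(muleA (J (c n) t `^ q)%:E) [leRHS]muleA -(muleA (Jr t `^ q)%:E).
  apply: lee_wpmul2r; first exact: mule_ge0 (M0 t) (o0 t).
  have t0 : 0 < t by exact: lt_trans ct.
  rewrite -EFinM lee_fin -powRM //; apply: (le_powR (ltW q0) (Jr0 t t0) Jt).
rewrite ge0_integralZl; first last.
- by rewrite lee_fin powR_ge0.
- by move=> t _; exact: f0.
- by apply: measurable_funTS; exact: mf (mJc _ (ltW (c0 n))).
- exact: mE.
rewrite /K -mulrA EFinM; apply: lee_wpmul2l; first by rewrite lee_fin powR_ge0.
apply: le_trans (step (c n) (c0 n)).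
apply: ge0_subset_integral.
- exact: mE.
- exact: measurable_itvR.
- by apply: measurable_funTS; exact: mf (mJc _ (ltW (c0 n))).
- by move=> t _; exact: f0.
- by move=> t [ct _] /=; rewrite in_itv/= andbT.
Qed.

End lower_sup.

(** * From the embedding to inequalities for shells *)

Section embedding_tests.
Context {R : realType} {d : measure_display} {T : measurableType d}.
Variables (mu : {measure set T -> \bar R}) (rho : T -> R).
Hypotheses (mrho : measurable_fun setT rho)
  (null_sphere : forall t, mu [set y | rho y = t] = 0%E).
Implicit Types (u : T -> \bar R) (w : realR R -> \bar R).

Definition radial_weight u : Prop :=
  [/\ measurable_fun setT u, forall y, (0 <= u y)%E &
      forall s t, 0 < s -> (eV mu rho u s t < +oo)%E].

Lemma shell_data_radial u : radial_weight u -> shell_data (rV mu rho u).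
Proof. by move=> [mu_ u0 fin]; exact: shell_data_rV. Qed.

Lemma shell_continuous_radial u : radial_weight u -> shell_continuous (rV mu rho u).
Proof.
move=> [mu_ u0 fin]; split; first exact: rV_left_le.
exact: rV_ivt.
Qed.

(** By [glue_norm_le] the norm is at most that of the step function [K]. With [nu] the dual tail,
    [c ^ a = nu ^ (a - 1) (W c ^ a)], so the increments of [K] are tied to those of [F] through [U],
    the sum of dual tails, and the packing hypothesis is the condition of [hardy_upper] with both
    exponents equal to [a]. *)
Lemma glue_Lnorm1 (p a : R) : 1 < p -> 1 < a -> exists2 C : R, 0 < C &
  forall u w1, radial_weight u -> tail_weight w1 -> forall (I : finType) (z c : I -> R)
  (f : I -> T -> R) (Ga : R), 0 <= Ga -> (forall i, 0 < z i) -> (forall i, 0 <= c i) ->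
  (forall i, ptest (f i)) -> (forall i y, rho y <= z i -> f i y = 0) ->
  (forall i, (sint mu u setT (fun y => f i y `^ p)%R <= 1)%E) ->
  (forall t, 0 < t -> \sum_(i | z i < t) dual_tail a w1 (z i) <= Ga * dual_tail a w1 t) ->
  (Lnorm1 mu rho u p a w1 (fun y => \sum_i c i * f i y)%R <=
   (C * (Ga `^ (a - 1) * \sum_i rtail w1 (z i) * c i `^ a))%:E)%E.
Proof.
move=> p1 a1; have [p0 a0] : 0 < p /\ 0 < a by lra.
have [C C0 HU] := hardy_upper a1 a0.
exists C => // u w1 [mu_ u0 fin] hw1 I z c f Ga Ga0 z0 c0 hf fz f1 hGa.
have an : a != 0 by rewrite gt_eqF.
have an1 : a - 1 != 0 by rewrite gt_eqF // subr_gt0.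
pose K t := \sum_(i | z i < t) c i.
have pK : posmeas (K : realR R -> R) by exact: posmeas_step_sum.
have pKa : posmeas (fun t : realR R => K t `^ a) by apply: posmeas_powR; exact: pK.1.
pose U t := \sum_(i | z i < t) dual_tail a w1 (z i).
have nu0 i : 0 <= dual_tail a w1 (z i) by exact: powR_ge0.
have pU : posmeas (U : realR R -> R) by exact: posmeas_step_sum.
pose g i := rtail w1 (z i) * c i `^ a.
have g0 i : 0 <= g i by rewrite mulr_ge0 ?powR_ge0 ?(rtail_ge0 hw1).
pose F t := \sum_(i | z i < t) g i.
have F0 t : 0 <= F t by exact: sumr_ge0.
have sub (t : R) (h : I -> R) : (forall i, 0 <= h i) ->
    \sum_(i | z i < t) h i <= \sum_i h i.
  by move=> h0; rewrite [leRHS](bigID (fun i => z i < t)) /= lerDl sumr_ge0.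
apply: (le_trans (Lnorm1_le_wint mrho mu_ u0 p1 a1 hw1 (ptest_scaled_sum c0 hf) pKa _)) => [t t0|].
  have hs := glue_norm_le mrho mu_ u0 p1 t c0 hf fz f1.
  apply: (@le_trans _ _ (((K t `^ p)%:E) `^ (a / p))%E).
    apply: poweR_le => //; first by rewrite divr_ge0 ?(ltW a0) ?(ltW p0).
    exact: (sint_ge0 mu mu_ u0 _ (ptest_powR p (ptest_scaled_sum c0 hf))).
  by rewrite poweR_EFin -powRrM (_ : p * (a / p) = a) //; field; rewrite gt_eqF.
have inc s t : s <= t -> (K t - K s) `^ a <= U t `^ (a - 1) * (F t - F s).
  move=> st; rewrite /K /F !step_sum_diff //.
  apply: (@le_trans _ _ ((\sum_(i | (z i < t) && ~~ (z i < s)) dual_tail a w1 (z i)) `^ (a - 1)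
     * \sum_(i | (z i < t) && ~~ (z i < s)) g i)).
    apply: finite_holder => // i _; split => //.
    rewrite /g mulrA dual_tail_powR // mul1r; exact: lexx.
  apply: ler_wpM2r; first exact: sumr_ge0.
  apply: le_powR; [by rewrite subr_ge0 ltW|exact: sumr_ge0|].
  rewrite /U [leRHS](bigID (fun i => z i < s)) /= addrC lerDl.
  exact: sumr_ge0.
have [m1 m2] := posmeas_nnweight (tail_nnweight hw1) pKa.
have Cg : 0 <= C * (Ga `^ (a - 1) * \sum_i g i).
  by rewrite !mulr_ge0 ?powR_ge0 ?sumr_ge0 // ltW.
apply: (integral_itv_left_le m1 m2); first by rewrite lee_fin.
move=> s s0 _; apply: (integral_itv_infty_le m1 m2) => t st.
have sum0 : 0 <= \sum_i g i by exact: sumr_ge0.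
have zz0 := HU w1 s t (\sum_i c i) (\sum_i g i) (Ga `^ ((a - 1) / a)) K U F hw1 s0 (ltW st)
  sum0 (powR_ge0 _ _) pK.1 pU.1.
have E : (Ga `^ ((a - 1) / a)) `^ a = Ga `^ (a - 1) by rewrite -powRrM divfK.
move: zz0; rewrite E divff // (powRr1 sum0); apply.
- move=> y _; split; [exact: pK.2|exact: sub|exact: pU.2|exact: F0|exact: sub].
- by move=> y v _ yv _; rewrite -subr_ge0 step_sum_diff // sumr_ge0.
- move=> y; rewrite in_itv/= => /andP[sy _].
  have y0 : 0 <= y by exact: ltW (lt_trans s0 sy).
  have zz (h : I -> R) : \sum_(i | z i < 0) h i = 0.
    by rewrite big_pred0 // => i; apply/negbTE; rewrite -leNgt ltW.
  by have := inc 0 y y0; rewrite /K /F !zz !subr0.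
- by move=> y v _ yv _; apply: inc; exact: ltW.
- move=> _ y; rewrite in_itv/= => /andP[sy _].
  have y0 : 0 < y by exact: lt_trans sy.
  have W0 := rtail_gt0 hw1 y0.
  have e1 : dual_tail a w1 y `^ ((a - 1) / a) * rtail w1 y `^ a^-1 = 1.
    rewrite /dual_tail -powRrM (_ : - (a - 1)^-1 * ((a - 1) / a) = - a^-1).
      by rewrite -powRD ?(gt_eqF W0) ?implybT // addNr powRr0.
    by field; rewrite an an1.
  rewrite -[leRHS]mulr1 -[X in _ <= _ * X]e1 [leRHS]mulrA; apply: ler_wpM2r; first exact: powR_ge0.
  rewrite -powRM ?powR_ge0 //; apply: le_powR; [|exact: pU.2|exact: hGa].
  by rewrite divr_ge0 ?(ltW a0) // subr_ge0 ltW.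
- by rewrite ltxx.
Qed.

Lemma shell_mass_le (p : R) u (I : finType) (s t c : I -> R) r : 1 < p -> radial_weight u ->
  (forall i, 0 < s i) -> (forall i, 0 <= c i) ->
  ((\sum_(i | t i < r) c i * rV mu rho u (s i) (t i) `^ ((p - 1) / p))%:E <=
   sint mu u (rball rho r) (fun y => \sum_i c i * shell_test mu rho u p (s i) (t i) y)%R)%E.
Proof.
move=> p1 [mu_ u0 fin] s0 c0; have hf i := ptest_shell mu u mrho p (s i) (t i).
rewrite (sint_scaled_sum mu mrho mu_ u0 r c0 hf) big_mkcond -sumEFin.
apply: lee_sum => i _; have f0 : (0 <= sint mu u (rball rho r) (shell_test mu rho u p (s i) (t i)))%E.
  exact: sint_ge0.
case: ifPn => [tr|_]; last by apply: mule_ge0 => //; rewrite lee_fin.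
rewrite (shell_test_mass mrho mu_ u0 fin p1 (s0 i)) ?EFinM ?lexx //.
  exact: measurable_rball.
by move=> y /= /andP[_ yt]; exact: lt_trans yt tr.
Qed.

Lemma shell_mass_Lnorm2 (p b : R) u w (I : finType) (s t c : I -> R) : 1 < p -> 1 < b ->
  radial_weight u -> tail_weight w -> (forall i, 0 < s i) -> (forall i, 0 <= c i) ->
  (wint w `]0%R, +oo[ (fun r => (\sum_(i | (t i < r)%R) c i * rV mu rho u (s i) (t i) `^ ((p - 1) / p)) `^ b)%R
   <= Lnorm2 mu rho u b w (fun y => \sum_i c i * shell_test mu rho u p (s i) (t i) y)%R)%E.
Proof.
move=> p1 b1 hu hw s0 c0; have [mu_ u0 fin] := hu.
have hf i := ptest_shell mu u mrho p (s i) (t i).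
have pX : posmeas (fun r : realR R => (\sum_(i | (t i < r)%R) c i * rV mu rho u (s i) (t i) `^ ((p - 1) / p)) `^ b).
  apply: posmeas_powR; apply: (posmeas_step_sum t (fun i => mulr_ge0 (c0 i) (powR_ge0 _ _))).1.
apply: (Lnorm2_wint_le mrho mu_ u0 b1 hw (ptest_scaled_sum c0 hf) pX) => r r0.
rewrite -poweR_EFin; apply: poweR_le; first by lra.
  by rewrite lee_fin sumr_ge0 // => i _; rewrite mulr_ge0 ?powR_ge0.
exact: shell_mass_le.
Qed.

Lemma bounded_shells (p a b Ga : R) : 1 < p -> 1 < a -> 1 < b -> 0 < Ga -> exists2 C : R, 0 < C &
  forall u w1 w2 B, radial_weight u -> tail_weight w1 -> tail_weight w2 -> 0 <= B ->
  bounded_by mu rho u p a b w1 w2 B ->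
  shell_bounded p a b Ga w1 w2 (rV mu rho u) (C * B).
Proof.
move=> p1 a1 b1 Ga0; have [C C0 hC] := glue_Lnorm1 p1 a1.
have a0 : 0 < a by lra.
have [an bn] : a != 0 /\ b != 0 by rewrite !gt_eqF //; lra.
pose K := (C * Ga `^ (a - 1)) `^ a^-1; have K0 : 0 < K by rewrite powR_gt0 // mulr_gt0 ?powR_gt0.
have KE : K `^ b = (C * Ga `^ (a - 1)) `^ (b / a) by rewrite /K -powRrM [a^-1 * b]mulrC.
clearbody K; exists K => // u w1 w2 B hu hw1 hw2 B0 hB I s t c s0 c0 pack.
have [mu_ u0 fin] := hu.
have hf i := ptest_shell mu u mrho p (s i) (t i).
apply: (le_trans (shell_mass_Lnorm2 t p1 b1 hu hw2 s0 c0)).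
have S0 : 0 <= \sum_i rtail w1 (s i) * c i `^ a.
  by apply: sumr_ge0 => i _; rewrite mulr_ge0 ?powR_ge0 ?(rtail_ge0 hw1).
have CG0 : 0 <= C * Ga `^ (a - 1) by rewrite mulr_ge0 ?powR_ge0 // ltW.
have N0 : 0 <= C * (Ga `^ (a - 1) * \sum_i rtail w1 (s i) * c i `^ a).
  by rewrite mulrA mulr_ge0.
have -> : (K * B) `^ b * (\sum_i rtail w1 (s i) * c i `^ a) `^ (b / a) =
    B `^ b * (C * (Ga `^ (a - 1) * \sum_i rtail w1 (s i) * c i `^ a)) `^ (b / a).
  by rewrite (powRM _ (ltW K0) B0) KE mulrA (powRM _ CG0 S0) mulrA [_ * B `^ b]mulrC.
apply: (hB _ (ptest_scaled_sum c0 hf) _ N0).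
apply: (hC u w1 hu hw1 I s c (fun i => shell_test mu rho u p (s i) (t i)) Ga (ltW Ga0) s0 c0 hf) => //.
- by move=> i y ys; rewrite /shell_test ltNge ys.
- by move=> i; exact: shell_test_norm.
Qed.

(** The supports are disjoint, so the p-th power of the sum splits and the coefficients only have to
    be normalised in l^p by [e = N ^ (-1/p)]; homogeneity restores [N]. *)
Lemma hardy_test_shells (p b : R) u w x D : 1 < p -> 1 < b -> radial_weight u -> tail_weight w ->
  0 < x -> 0 <= D -> hardy_test mu rho u p b w x D -> hardy_shells p b w (rV mu rho u) x D.
Proof.
move=> p1 b1 hu hw x0 D0 hD n q y q0 qS y0; have [mu_ u0 fin] := hu.
have p0 : 0 < p by lra.
have b0 : 0 < b by lra.
have [pn bn] : p != 0 /\ b != 0 by rewrite !gt_eqF.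
have qm i j : (i <= j)%N -> q i <= q j.
  by move=> /subnK <-; elim: (j - i)%N => // m; move/le_trans; apply.
have qx i : x <= q i by rewrite -q0 qm.
have qp i : 0 < q i by exact: lt_le_trans (qx i).
have [N NE] : {N | N = \sum_(i < n) y i `^ p} by exists (\sum_(i < n) y i `^ p).
have N0 : 0 <= N by rewrite NE sumr_ge0 // => i _; exact: powR_ge0.
rewrite -NE; have [Nz|Np] := leP N 0.
  have yz i : y i = 0.
    apply/eqP; have : y i `^ p == 0.
      rewrite eq_le powR_ge0 andbT; apply: le_trans Nz; rewrite NE (bigD1 i) //= lerDl.
      by apply: sumr_ge0 => j _; exact: powR_ge0.
    by rewrite powR_eq0 => /andP[].
  rewrite (@eq_wint _ w _ _ (fun=> 0)) => [|r _]; last first.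
    by rewrite big1 ?powR0 // => i _; rewrite yz mul0r.
  rewrite /wint integral0_eq => [|r _]; last by rewrite mul0e.
  by rewrite lee_fin mulr_ge0 ?powR_ge0.
pose e := N `^ (- p^-1); have e0 : 0 < e by rewrite powR_gt0.
have eE : e `^ p = N^-1 by rewrite /e -powRrM mulNr mulVf // powR_inv1.
have eb : e `^ b * N `^ (b / p) = 1.
  by rewrite /e -powRrM mulNr mulrC [p^-1 * b]mulrC -powRD ?subrr ?powRr0 // (gt_eqF Np) implybT.
clearbody e; pose c i := e * y i.
have c0 i : 0 <= c i by rewrite mulr_ge0 // ltW.
pose f (i : 'I_n) := shell_test mu rho u p (q i) (q i.+1).
have hf (i : 'I_n) : ptest (f i) by exact: ptest_shell.
have fz (i : 'I_n) z : (q i < rho z < q i.+1) = false -> f i z = 0.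
  by move=> h; rewrite /f /shell_test h.
have disj (i j : 'I_n) z : i != j -> f i z = 0 \/ f j z = 0.
  wlog ij : i j / (i < j)%N => [hw' nij|nij].
    move: (nij); rewrite neq_ltn => /orP[h|h]; first exact: hw'.
    by rewrite or_comm; apply: hw' => //; rewrite eq_sym.
  case E : (q i < rho z < q i.+1); last by left; exact: fz.
  right; apply: fz; have /andP[_ zi] := E; rewrite ltNge.
  by rewrite (le_trans (ltW zi) (qm _ _ ij)).
have := hD (fun z => \sum_i c i * f i z) (ptest_scaled_sum c0 hf).
have h1 z : rho z <= x -> \sum_i c i * f i z = 0.
  move=> zx; rewrite big1 // => i _.
  by rewrite fz ?mulr0 // ltNge (le_trans zx (qx i)).
have h2 : (sint mu u setT (fun z => (\sum_i c i * f i z) `^ p)%R <= 1)%E.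
  have -> : (fun z => (\sum_i c i * f i z) `^ p) = (fun z => \sum_i (e `^ p * y i `^ p) * f i z `^ p).
    apply/funext => z; rewrite (sum_powR_single p0) => [|i j ij].
      apply: eq_bigr => i _; rewrite (powRM _ (c0 i) ((hf i).2 z)) /c.
      by rewrite (powRM _ (ltW e0) (y0 i)).
    by case: (disj i j z ij) => ->; rewrite mulr0; [left|right].
  have ey0 i : 0 <= e `^ p * y i `^ p by rewrite mulr_ge0 ?powR_ge0.
  have hfp i := ptest_powR p (hf i).
  rewrite (sint_sum mu mu_ u0 measurableT (fun i => ptestZ (ey0 i) (hfp i))).
  apply: (@le_trans _ _ (\sum_i (e `^ p * y i `^ p)%:E)%E).
    apply: lee_sum => i _; rewrite (sintZ mu mu_ u0 measurableT (ey0 i) (hfp i)).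
    rewrite -[leRHS]mule1; apply: lee_wpmul2l; first by rewrite lee_fin.
    exact: (shell_test_norm mrho mu_ u0 fin (q i.+1) p1 (qp i)).
  by rewrite sumEFin lee_fin -mulr_sumr -NE eE mulVf // gt_eqF.
move=> /(_ h1 h2) h3.
have := shell_mass_Lnorm2 (fun i : 'I_n => q i.+1) p1 b1 hu hw (fun i : 'I_n => qp i) c0.
move=> /le_trans /(_ h3).
have pY : posmeas (fun r : realR R => \sum_(i < n | q i.+1 < r) y i * rV mu rho u (q i) (q i.+1) `^ ((p - 1) / p)).
  exact: (posmeas_step_sum (fun i : 'I_n => q i.+1) (fun i => mulr_ge0 (y0 i) (powR_ge0 _ _))).
have pYb := posmeas_powR b pY.1.
rewrite (@eq_wint _ w _ _ (fun r => e `^ b * (\sum_(i < n | q i.+1 < r) y i * rV mu rho u (q i) (q i.+1) `^ ((p - 1) / p)) `^ b)); last first.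
  move=> r _; rewrite -(powRM _ (ltW e0) (pY.2 r)); congr (_ `^ _).
  by rewrite mulr_sumr; apply: eq_bigr => i _; rewrite /c mulrA.
rewrite (wintZ (tail_nnweight hw) _ (powR_ge0 _ _) pYb) => h4.
have Nb0 : 0 <= N `^ (b / p) by exact: powR_ge0.
have := lee_wpmul2l (_ : (0 <= (N `^ (b / p))%:E)%E) h4.
rewrite lee_fin => /(_ Nb0).
rewrite muleA -!EFinM [N `^ (b / p) * e `^ b]mulrC eb mul1e [N `^ (b / p) * _]mulrC.
by [].
Qed.

End embedding_tests.

Lemma poweR_superadd (R : realType) (b : R) (x y : \bar R) : 1 <= b -> (0 <= x)%E -> (0 <= y)%E ->
  (x `^ b + y `^ b <= (x + y) `^ b)%E.
Proof.
move=> b1; have b0 : 0 < b by lra.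
case: x y => [x| |] [y| |] // x0 y0.
- rewrite lee_fin in x0; rewrite lee_fin in y0.
  rewrite !poweR_EFin -!EFinD ?poweR_EFin lee_fin.
  have := @sum_powR_le R bool xpredT (fun i => if i then x else y) b b1.
  by rewrite !big_bool /=; apply; case.
- by rewrite addey // poweRyr ?gt_eqF // leey.
- by rewrite addye // poweRyr ?gt_eqF // leey.
- by rewrite addye // poweRyr ?gt_eqF // leey.
Qed.

Lemma poweR_sum_superadd (R : realType) (b : R) (I : finType) (x : I -> \bar R) : 1 <= b ->
  (forall i, 0 <= x i)%E -> (\sum_i x i `^ b <= (\sum_i x i) `^ b)%E.
Proof.
move=> b1 x0.
suff [] : (\sum_i x i `^ b <= (\sum_i x i) `^ b)%E /\ (0 <= \sum_i x i)%E by [].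
elim/big_rec2 : _ => [|i y X _ [h X0]].
  by rewrite poweR0r ?lexx // gt_eqF //; lra.
split; last exact: adde_ge0.
exact: (le_trans (leeD (lexx _) h) (poweR_superadd b1 (x0 i) X0)).
Qed.

(** * Gluing nearly extremal tests *)

Section lower_blocks.
Context {R : realType} {d : measure_display} {T : measurableType d}.
Variables (mu : {measure set T -> \bar R}) (rho : T -> R).
Hypotheses (mrho : measurable_fun setT rho).
Implicit Types (u : T -> \bar R) (w : realR R -> \bar R).

(** Powers with exponent at least 1 are superadditive on nonnegative numbers, so the second norm of
    a glued function keeps the contribution of each test. *)
Lemma Lnorm2_superadd u w (b : R) (I : finType) (c : I -> R) (f : I -> T -> R) : 1 < b ->
  radial_weight mu rho u -> tail_weight w -> (forall i, 0 <= c i) -> (forall i, ptest (f i)) ->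
  (\sum_i (c i `^ b)%:E * Lnorm2 mu rho u b w (f i) <=
   Lnorm2 mu rho u b w (fun y => \sum_i c i * f i y)%R)%E.
Proof.
move=> b1 [mu_ u0 fin] hw c0 hf; have b0 : 0 < b by lra.
have [mw w0] := tail_nnweight hw.
have m0 i t : (0 <= sint mu u (rball rho t) (f i) `^ b * w t)%E.
  by apply: mule_ge0; [exact: poweR_ge0|exact: w0].
have mm i := measurable_Lnorm2 mu mrho mu_ u0 b1 hw (hf i).
have mfi i : measurable_fun (`]0%R, +oo[%classic : set (realR R)) (fun t : realR R => (sint mu u (rball rho t) (f i) `^ b * w t)%E).
  by apply: measurable_funTS; exact: mm.
have E i : ((c i `^ b)%:E * Lnorm2 mu rho u b w (f i) =
    \int[@completed_lebesgue_measure R]_(t in `]0%R, +oo[)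
      ((c i `^ b)%:E * (sint mu u (rball rho t) (f i) `^ b * w t)))%E.
  rewrite ge0_integralZl; first by [].
  - exact: measurable_itvR.
  - exact: mfi.
  - by move=> t _; exact: m0.
  - by rewrite lee_fin powR_ge0.
rewrite (eq_bigr _ (fun i _ => E i)) -ge0_integral_sum; first last.
- by move=> i t _; apply: mule_ge0; [rewrite lee_fin powR_ge0|exact: m0].
- by move=> i; apply: emeasurable_funM; [exact: measurable_cst|exact: mfi].
- exact: measurable_itvR.
apply: ge0_le_integral.
- exact: measurable_itvR.
- by move=> t _; apply: sume_ge0 => i _; apply: mule_ge0; [rewrite lee_fin powR_ge0|exact: m0].
- by apply: emeasurable_sum => i; apply: emeasurable_funM; [exact: measurable_cst|exact: mfi].
- apply: measurable_funTS.
  exact: (measurable_Lnorm2 mu mrho mu_ u0 b1 hw (ptest_scaled_sum c0 hf)).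
move=> t _; have s0 i : (0 <= sint mu u (rball rho t) (f i))%E by exact: sint_ge0.
rewrite (sint_scaled_sum mu mrho mu_ u0 t c0 hf).
apply: (@le_trans _ _ ((\sum_i ((c i)%:E * sint mu u (rball rho t) (f i)) `^ b) * w t)%E).
  rewrite ge0_sume_distrl; last by move=> i _; exact: poweR_ge0.
  apply: lee_sum => i _; rewrite poweRM ?lee_fin //; last first.
  by rewrite poweR_EFin muleA lexx.
apply: lee_wpmul2r; first exact: w0.
apply: poweR_sum_superadd; first exact: ltW.
by move=> i; apply: mule_ge0 => //; rewrite lee_fin.
Qed.

(** [h ^ b] is the supremum of [Lnorm2] over the tests. It is finite because of [D], and some test
    attains at least half of it, hence the factor 2. *)
Lemma sharp_hardy_test (p b : R) u w x D : 1 < p -> 1 < b -> radial_weight mu rho u ->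
  tail_weight w -> 0 <= D -> hardy_test mu rho u p b w x D -> exists h f,
  [/\ 0 <= h, hardy_test mu rho u p b w x h,
      [/\ ptest f, forall y, rho y <= x -> f y = 0 &
          (sint mu u setT (fun y => f y `^ p)%R <= 1)%E] &
      ((h `^ b)%:E <= 2%:E * Lnorm2 mu rho u b w f)%E].
Proof.
move=> p1 b1 [mu_ u0 fin] hw D0 hD.
have [mw w0] := tail_nnweight hw.
have L0 f : (0 <= Lnorm2 mu rho u b w f)%E.
  by apply: integral_ge0 => t _; apply: mule_ge0; [exact: poweR_ge0|exact: w0].
pose A := [set f | [/\ ptest f, forall y, rho y <= x -> f y = 0 &
          (sint mu u setT (fun y => f y `^ p)%R <= 1)%E]].
have A0 : A (fun=> 0).
  split; [by split => [|y]; [exact: measurable_cst|]|by []|].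
  rewrite /sint integral0_eq => [|y _]; first by rewrite lee_fin.
  by rewrite powR0 ?mul0e // gt_eqF //; lra.
have [N NE] : {N | N = ereal_sup [set Lnorm2 mu rho u b w f | f in A]}.
  by exists (ereal_sup [set Lnorm2 mu rho u b w f | f in A]).
have Nub f : A f -> (Lnorm2 mu rho u b w f <= N)%E.
  by move=> Af; rewrite NE; apply: ereal_sup_ubound; exists f.
have N0 : (0 <= N)%E by exact: le_trans (L0 _) (Nub _ A0).
have ND : (N <= (D `^ b)%:E)%E.
  by rewrite NE; apply: ge_ereal_sup => _ [f [hf fx f1] <-]; exact: hD.
have Nf : N = (fine N)%:E.
  by rewrite fineK // ge0_fin_numE //; apply: le_lt_trans ND (ltry _).
have n0 : 0 <= fine N by exact: fine_ge0.
have hE : (fine N `^ b^-1) `^ b = fine N.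
  by rewrite -powRrM mulVf ?powRr1 // gt_eqF //; lra.
have hh : hardy_test mu rho u p b w x (fine N `^ b^-1).
  by move=> f hf fx f1; rewrite hE; apply: (le_trans (Nub f _)); [split|rewrite {1}Nf].
have [Nz|Np] := leP (fine N) 0.
  exists (fine N `^ b^-1), (fun=> 0); split => //; first exact: powR_ge0.
  rewrite hE; apply: (@le_trans _ _ 0%E); first by rewrite lee_fin.
  by apply: mule_ge0 => //; rewrite lee_fin.
have hlt : ((fine N / 2)%:E < ereal_sup [set Lnorm2 mu rho u b w f | f in A])%E.
  by rewrite -NE {2}Nf lte_fin; lra.
have [_ [f Af <-] hf] := ereal_sup_gt hlt.
exists (fine N `^ b^-1), f; split => //; first exact: powR_ge0.
rewrite hE; apply: (@le_trans _ _ (2%:E * (fine N / 2)%:E)%E).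
  by rewrite -EFinM lee_fin; lra.
by apply: lee_wpmul2l; [rewrite lee_fin|exact: ltW].
Qed.

(** Nearly extremal tests at the halving points are glued with coefficients
    [c k = y k W1(x k) ^ (-1/a)], so that the first norm is at most a multiple of the l^a norm of
    [y]. The second norm dominates the sum of [(c k h(x k)) ^ b] up to a constant, and
    [multiplier_sharp] applies. *)
Lemma lower_blocks (p a b : R) : 1 < p -> 1 < a -> 1 < b -> b < a -> exists2 C : R, 0 < C &
  forall u w1 w2 B, radial_weight mu rho u -> tail_weight w1 -> tail_weight w2 -> 0 <= B ->
  bounded_by mu rho u p a b w1 w2 B -> exists h : R -> R,
  (forall x, 0 < x -> 0 <= h x /\ hardy_test mu rho u p b w2 x (h x)) /\
  (forall x n, halving w1 x ->
     \sum_(k < n) (h (x k) * rtail w1 (x k) `^ (- a^-1)) `^ (a * b / (a - b))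
       <= (C * B) `^ (a * b / (a - b))).
Proof.
move=> p1 a1 b1 ba; have [a0 b0] : 0 < a /\ 0 < b by lra.
have [an bn] : a != 0 /\ b != 0 by rewrite !gt_eqF.
have [C C0 hC] := glue_Lnorm1 mu mrho p1 a1.
have [Ga Ga0 hGa] := halving_dual_sum a1.
pose K := (C * Ga `^ (a - 1)) `^ a^-1; have K0 : 0 < K by rewrite powR_gt0 // mulr_gt0 ?powR_gt0.
have KE : K `^ b = (C * Ga `^ (a - 1)) `^ (b / a) by rewrite /K -powRrM [a^-1 * b]mulrC.
(* [e ^ b = 2] compensates that the tests attain only half of the supremum; [K] comes from the
   gluing constant. *)
pose e : R := 2 `^ b^-1; have e0 : 0 < e by rewrite powR_gt0.
have eE : e `^ b = 2 by rewrite /e -powRrM mulVf // powRr1.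
clearbody K e; exists (e * K); first by rewrite mulr_gt0.
move=> u w1 w2 B hu hw1 hw2 B0 hB; have [mu_ u0 fin] := hu.
have /choice[hf hhf] (x : R) : exists hf : R * (T -> R), 0 < x ->
  [/\ 0 <= hf.1, hardy_test mu rho u p b w2 x hf.1,
      [/\ ptest hf.2, forall y, rho y <= x -> hf.2 y = 0 &
          (sint mu u setT (fun y => hf.2 y `^ p)%R <= 1)%E] &
      ((hf.1 `^ b)%:E <= 2%:E * Lnorm2 mu rho u b w2 hf.2)%E].
  have [x0|x0] := leP x 0; first by exists (0, fun=> 0).
  have hD := bounded_hardy_test mrho mu_ u0 p1 a1 hw1 B0 x0 hB.
  have D0 : 0 <= B * rtail w1 x `^ a^-1 by rewrite mulr_ge0 ?powR_ge0.
  have [h [f hh]] := sharp_hardy_test p1 b1 hu hw2 D0 hD.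
  by exists (h, f).
exists (fun x => (hf x).1); split=> [x x0|x n hx]; first by have [] := hhf x x0.
have [xW xp xS] := hx.
have h0 k : 0 <= (hf (x k)).1 by have [] := hhf _ (xp k).
have W0 k : 0 < rtail w1 (x k) by exact: rtail_gt0.
have eKB : 0 <= e * K * B by rewrite !mulr_ge0 // ltW.
apply: (@multiplier_sharp _ _ a b (fun k : 'I_n => (hf (x k)).1 * rtail w1 (x k) `^ (- a^-1)) _ b0 ba eKB).
  by move=> k; rewrite mulr_ge0 ?powR_ge0.
move=> y y0; pose c (k : 'I_n) := y k * rtail w1 (x k) `^ (- a^-1).
have c0 k : 0 <= c k by rewrite mulr_ge0 ?powR_ge0.
pose f (k : 'I_n) := (hf (x k)).2.
have ht k : ptest (f k) by have [_ _ [h _ _] _] := hhf _ (xp k); exact: h.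
have hz (k : 'I_n) z : rho z <= x k -> f k z = 0 by have [_ _ [_ h _] _] := hhf _ (xp k); exact: h.
have h1 k : (sint mu u setT (fun z => f k z `^ p)%R <= 1)%E by have [_ _ [_ _ h] _] := hhf _ (xp k); exact: h.
have h2 (k : 'I_n) : (((hf (x k)).1 `^ b)%:E <= 2%:E * Lnorm2 mu rho u b w2 (f k))%E.
  by have [] := hhf _ (xp k).
have Y0 : 0 <= \sum_i y i `^ a by apply: sumr_ge0 => i _; exact: powR_ge0.
have CG0 : 0 <= C * Ga `^ (a - 1) by rewrite mulr_ge0 ?powR_ge0 // ltW.
have hN : (Lnorm1 mu rho u p a w1 (fun z => \sum_i c i * f i z)%R <=
    (C * Ga `^ (a - 1) * \sum_i y i `^ a)%:E)%E.
  have := hC u w1 hu hw1 _ (fun k : 'I_n => x k) c f Ga (ltW Ga0) (fun k => xp k) c0 ht hz h1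
    (fun r r0 => hGa w1 x n r hw1 hx r0).
  have -> : \sum_(i < n) rtail w1 (x i) * c i `^ a = \sum_i y i `^ a.
    apply: eq_bigr => i _; rewrite /c (powRM _ (y0 i) (powR_ge0 _ _)) -powRrM mulNr mulVf //.
    by rewrite powRN powRr1 ?(ltW (W0 _)) // mulrCA mulfV ?mulr1 // gt_eqF.
  by rewrite mulrA.
have := hB _ (ptest_scaled_sum c0 ht) _ (mulr_ge0 CG0 Y0) hN.
move=> /(le_trans (Lnorm2_superadd b1 hu hw2 c0 ht)) h3.
rewrite -lee_fin; apply: (@le_trans _ _ (\sum_(i < n) 2%:E * ((c i `^ b)%:E * Lnorm2 mu rho u b w2 (f i)))%E).
  rewrite -sumEFin; apply: lee_sum => i _.
  rewrite (_ : _ * y i = c i * (hf (x i)).1); last by rewrite /c; ring.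
  rewrite (powRM _ (c0 i) (h0 i)) EFinM muleCA; apply: lee_wpmul2l => //.
  by rewrite lee_fin powR_ge0.
rewrite -ge0_sume_distrr; last first.
  move=> i _; apply: mule_ge0; first by rewrite lee_fin powR_ge0.
  apply: integral_ge0 => t _; apply: mule_ge0; first exact: poweR_ge0.
  exact: (tail_nnweight hw2).2.
apply: (@le_trans _ _ (2%:E * (B `^ b * (C * Ga `^ (a - 1) * \sum_i y i `^ a) `^ (b / a))%:E)%E).
  by apply: lee_wpmul2l => //; rewrite lee_fin.
rewrite -EFinM lee_fin (powRM _ CG0 Y0) -KE.
rewrite (powRM _ (mulr_ge0 (ltW e0) (ltW K0)) B0) (powRM _ (ltW e0) (ltW K0)) eE.
by rewrite le_eqVlt; apply/orP; left; apply/eqP; ring.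
Qed.

End lower_blocks.

(** * Hardy conditions in integral form *)

Section dual_integral.
Context {R : realType}.
Local Notation mu1 := (@completed_lebesgue_measure R).
Implicit Types (w : realR R -> \bar R) (V : R -> R -> R).

Definition dual_int (a : R) w (t : R) : \bar R :=
  (\int[mu1]_(s in `]0%R, t[) dual_weight a w s)%E.

Lemma dual_int_ge0 (a : R) w t : tail_weight w -> (0 <= dual_int a w t)%E.
Proof. by move=> hw; apply: integral_ge0 => s _; exact: (dual_nnweight a hw).2. Qed.

Lemma dual_int_homo (a : R) w s t : tail_weight w -> s <= t -> (dual_int a w s <= dual_int a w t)%E.
Proof.
move=> hw st; have [mo o0] := dual_nnweight a hw.
apply: (integral_itv_subset mo o0) => r /=; rewrite !in_itv/= => /andP[-> rs].
exact: lt_le_trans rs st.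
Qed.

Lemma measurable_dual_integrand (a q : R) w (Q : R -> \bar R) : tail_weight w -> 0 <= q ->
  measurable_fun setT (Q : realR R -> \bar R) ->
  measurable_fun setT (fun t : realR R => (dual_int a w t `^ q * dual_weight a w t * Q t)%E).
Proof.
move=> hw q0 mQ; apply: emeasurable_funM; last exact: mQ.
apply: emeasurable_funM; last exact: (dual_nnweight a hw).1.
apply: measurable_homo => s t st; apply: poweR_le => //; first exact: dual_int_ge0.
exact: dual_int_homo.
Qed.

Lemma dual_integrand_ge0 (a q : R) w (Q : R -> \bar R) t : tail_weight w -> (0 <= Q t)%E ->
  (0 <= dual_int a w t `^ q * dual_weight a w t * Q t)%E.
Proof.
move=> hw Q0; apply: mule_ge0 => //; apply: mule_ge0; first exact: poweR_ge0.
exact: (dual_nnweight a hw).2.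
Qed.

Lemma hardy_cond_mono (p b : R) w V x h h' : 0 < p -> 0 < b -> 0 <= h -> h <= h' ->
  hardy_cond p b w V x h -> hardy_cond p b w V x h'.
Proof.
move=> p0 b0 h0 hh [c1 c2]; split=> [pb z xz|bp].
  exact: le_trans (c1 pb z xz) hh.
apply: (le_trans (c2 bp)); rewrite lee_fin; apply: le_powR => //.
by rewrite divr_ge0 ?mulr_ge0 // ?(ltW p0) ?(ltW b0) // subr_ge0 ltW.
Qed.

(** A point with no point to its left where the tail is double carries at least half of the total
    mass; that case is paid by the head condition. *)
Lemma level_left w x : tail_weight w -> 0 < x -> (tail_int w 0 <= (2 * rtail w x)%:E)%E \/
  exists2 y, 0 < y < x & rtail w y = 2 * rtail w x.
Proof.
move=> hw x0; have W0 := rtail_gt0 hw x0.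
have [h|h] := leP (tail_int w 0) (2 * rtail w x)%:E; [by left|right].
have h1 : rtail w x <= 2 * rtail w x by lra.
have [y /andP[y0 yx] yE] := rtail_ivt_left hw x0 h1 h.
exists y => //; rewrite y0 /= lt_neqAle yx andbT; apply/eqP => e.
by move: yE; rewrite e; lra.
Qed.

(** In the second case of [level_left] the block [(y, x)] has dual mass comparable with the dual
    tail at [x], and this mass to the power [-(a - 1) / a] is comparable with [W1(x) ^ (1/a)]. In
    the first case the total mass is comparable with [W1(x)]. *)
Lemma upper_pointwise (p a b : R) : 1 < p -> 1 < a -> 1 < b -> exists2 C : R, 0 < C &
  forall w1 w2 V S x, tail_weight w1 -> 0 <= S -> 0 < x ->
  ((tail_int w1 0 < +oo)%E -> hardy_cond p b w2 V x (S * fine (tail_int w1 0) `^ a^-1)) ->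
  (forall Om, 0 < Om -> (Om%:E <= dual_int a w1 x)%E ->
     hardy_cond p b w2 V x (S * Om `^ (- ((a - 1) / a)))) ->
  hardy_cond p b w2 V x (C * S * rtail w1 x `^ a^-1).
Proof.
move=> p1 a1 b1; have [p0 [a0 b0]] : 0 < p /\ (0 < a /\ 0 < b) by lra.
have [an an1] : a != 0 /\ a - 1 != 0 by rewrite !gt_eqF // subr_gt0.
have [C C0 hC] := dual_half_le a1.
have e0 : 0 < (a - 1) / a by rewrite divr_gt0 // subr_gt0.
exists (2 `^ a^-1 + C `^ ((a - 1) / a)); first by rewrite addr_gt0 ?powR_gt0.
move=> w1 w2 V S x hw1 S0 x0 h1 h2; have W0 := rtail_gt0 hw1 x0.
have Wa := powR_ge0 (rtail w1 x) a^-1.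
have c1 := powR_ge0 2 a^-1; have c2 := powR_ge0 C ((a - 1) / a).
have [hl|[y /andP[y0 yx] yE]] := level_left hw1 x0.
  have fin : (tail_int w1 0 < +oo)%E by apply: le_lt_trans hl (ltry _).
  have t0 : (0 <= tail_int w1 0)%E.
    by apply: integral_ge0 => s _; exact: (tail_nnweight hw1).2.
  apply: (hardy_cond_mono p0 b0 _ _ (h1 fin)); first exact: mulr_ge0 S0 (powR_ge0 _ _).
  have h3 : fine (tail_int w1 0) `^ a^-1 <= 2 `^ a^-1 * rtail w1 x `^ a^-1.
    rewrite -(powRM _ (ler0n _ 2) (ltW W0)); apply: le_powR.
    - by rewrite invr_ge0 ltW.
    - exact: fine_ge0.
    - by rewrite -lee_fin fineK // ge0_fin_numE.
  apply: (le_trans (ler_wpM2l S0 h3)).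
  rewrite mulrCA mulrA; apply: (ler_wpM2r Wa); apply: (ler_wpM2r S0).
  by rewrite lerDl.
have hh : rtail w1 x = rtail w1 y / 2 by rewrite yE; field.
have nu0 : 0 < dual_tail a w1 x by exact: dual_tail_gt0.
have hOm : ((dual_tail a w1 x / C)%:E <= dual_int a w1 x)%E.
  have := hC w1 y x hw1 y0 (ltW yx) hh.
  have [mo o0] := dual_nnweight a hw1.
  have hs : (\int[mu1]_(s in `]y, x[) dual_weight a w1 s <= dual_int a w1 x)%E.
    apply: (integral_itv_subset mo o0) => r /=; rewrite !in_itv/= => /andP[yr ->].
    by rewrite (lt_trans y0 yr).
  move=> /le_trans /(_ (lee_wpmul2l _ hs)) => h.
  have C0e : (0 <= C%:E)%E by rewrite lee_fin ltW.
  have {}h := h C0e.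
  have C0p : (0 < C%:E)%E by rewrite lte_fin.
  by rewrite -(lee_pmul2l _ C0p) // -EFinM mulrC divfK // gt_eqF.
have vC : 0 < dual_tail a w1 x / C by rewrite divr_gt0.
apply: (hardy_cond_mono p0 b0 _ _ (h2 _ vC hOm)); first exact: mulr_ge0 S0 (powR_ge0 _ _).
have -> : (dual_tail a w1 x / C) `^ (- ((a - 1) / a)) = C `^ ((a - 1) / a) * rtail w1 x `^ a^-1.
  rewrite powRM ?(ltW nu0) ?invr_ge0 ?(ltW C0) // mulrC -powR_inv1 ?(ltW C0) // -powRrM mulN1r opprK.
  rewrite /dual_tail -powRrM; congr (_ * _ `^ _); field; exact/andP.
rewrite mulrCA mulrA; apply: (ler_wpM2r Wa); apply: (ler_wpM2r S0).
by rewrite lerDr.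
Qed.

(** The power of [dual_int] and the dual mass both have to be bounded below on one block, so it is
    split at [m]: [(y, m)] makes [dual_int] large on [(m, x)], and [(m, x)] supplies the mass.
    Together they give the dual tail to the power [q + 1]. *)
Lemma dual_block_power (a b : R) : 1 < a -> 1 < b -> b < a -> exists2 C : R, 0 < C &
  forall w y x (Q : R -> \bar R) (k : R), tail_weight w -> 0 < y -> y < x -> rtail w y = 2 * rtail w x ->
  measurable_fun setT (Q : realR R -> \bar R) -> (forall t, 0 <= Q t)%E -> 0 <= k ->
  (forall t, y < t -> t < x -> (k%:E <= Q t)%E) ->
  ((k * (rtail w x `^ (- a^-1)) `^ (a * b / (a - b)))%:E <= C%:E *
   \int[mu1]_(t in `]y, x[) (dual_int a w t `^ (a * (b - 1) / (a - b)) * dual_weight a w t * Q t))%E.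
Proof.
move=> a1 b1 ba; have [a0 ab0] : 0 < a /\ 0 < a - b by lra.
have [an [an1 abn]] : a != 0 /\ (a - 1 != 0 /\ a - b != 0) by rewrite !gt_eqF // subr_gt0.
have [q qE] : {q | q = a * (b - 1) / (a - b)} by exists (a * (b - 1) / (a - b)).
have q0 : 0 < q by rewrite qE divr_gt0 // mulr_gt0 // subr_gt0.
have q10 : 0 < q + 1 by lra.
have ka : 0 <= (a - 1)^-1 by rewrite invr_ge0 subr_ge0 ltW.
exists ((4 * 2 `^ (a - 1)^-1) `^ (q + 1)); first by rewrite powR_gt0 // mulr_gt0 ?powR_gt0.
move=> w y x Q k hw y0 yx yE mQ Q0 k0 hQ; rewrite -qE.
have x0 : 0 < x by exact: lt_trans yx.
have Wy := rtail_gt0 hw y0; have Wx := rtail_gt0 hw x0.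
have hm1 : rtail w y * (3 / 4) <= rtail w y by lra.
have hm0 : 0 < rtail w y * (3 / 4) by lra.
(* Since [W x] is half of [W y], the value [3/4] lets the tail lose a quarter of [W y] on each side
   of [m]. *)
have [m ym mE] := rtail_ivt_right hw y0 hm0 hm1.
have mx : m <= x.
  rewrite leNgt; apply/negP => /ltW xm; have := rtail_anti hw x0 xm; rewrite mE; lra.
have m0 : 0 < m by exact: lt_le_trans ym.
have [mo o0] := dual_nnweight a hw.
have mI := measurable_dual_integrand a hw (ltW q0) mQ.
have I0 t : (0 <= dual_int a w t `^ q * dual_weight a w t * Q t)%E by exact: dual_integrand_ge0.
pose g := rtail w y `^ (- (a / (a - 1))) * (rtail w y / 4).
have g0 : 0 <= g by rewrite mulr_ge0 ?powR_ge0 //; lra.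
have gE : g = dual_tail a w y / 4.
  by rewrite /g mulrA (dual_tail_mul a1 hw y0).
have h1 : (g%:E <= dual_int a w m)%E.
  apply: (@le_trans _ _ (\int[mu1]_(s in `]y, m[) dual_weight a w s)%E).
    apply: le_trans (dual_int_ge a1 hw y0 ym).
    by rewrite lee_fin /g mE; apply: ler_wpM2l; [exact: powR_ge0|lra].
  apply: (integral_itv_subset mo o0) => r /=; rewrite !in_itv/= => /andP[yr ->].
  by rewrite (lt_trans y0 yr).
have h2 : (g%:E <= \int[mu1]_(s in `]m, x[) dual_weight a w s)%E.
  apply: le_trans (dual_int_ge a1 hw m0 mx); rewrite lee_fin /g.
  apply: ler_pM; [exact: powR_ge0|lra| |rewrite mE; lra].
  apply: powR_neg_anti; [by rewrite divr_ge0 ?(ltW a0) // subr_ge0 ltW|exact: rtail_gt0|].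
  exact: rtail_anti.
apply: (@le_trans _ _ (((4 * 2 `^ (a - 1)^-1) `^ (q + 1))%:E * ((k * g `^ q)%:E * g%:E))%E).
  rewrite -!EFinM lee_fin; have -> : k * g `^ q * g = k * g `^ (q + 1).
    by rewrite -mulrA [g `^ q * g]mulrC powR_mul_self.
  rewrite mulrCA; apply: ler_wpM2l => //; rewrite -(powRM _ (mulr_ge0 (ler0n _ 4) (powR_ge0 _ _)) g0).
  have yx2 : dual_tail a w x = 2 `^ (a - 1)^-1 * dual_tail a w y.
    by apply: dual_tail_div => //; rewrite yE; field.
  have -> : 4 * 2 `^ (a - 1)^-1 * g = dual_tail a w x by rewrite yx2 gE; field.
  rewrite le_eqVlt; apply/orP; left; apply/eqP; rewrite /dual_tail -!powRrM; congr (_ `^ _).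
  by rewrite qE; field; rewrite an an1 abn.
apply: lee_wpmul2l; first by rewrite lee_fin powR_ge0.
apply: (@le_trans _ _ (\int[mu1]_(t in `]m, x[) (dual_int a w t `^ q * dual_weight a w t * Q t))%E); last first.
  apply: (integral_itv_subset mI I0) => r /=; rewrite !in_itv/= => /andP[mr ->].
  by rewrite (le_lt_trans ym mr).
have kg0 : 0 <= k * g `^ q by rewrite mulr_ge0 ?powR_ge0.
apply: (@le_trans _ _ ((k * g `^ q)%:E * \int[mu1]_(s in `]m, x[) dual_weight a w s)%E).
  by apply: lee_wpmul2l h2; rewrite lee_fin.
rewrite -ge0_integralZl; first last.
- by rewrite lee_fin.
- by move=> r _; exact: o0.
- exact: measurable_funTS.
- exact: measurable_itvR.
apply: ge0_le_integral.
- exact: measurable_itvR.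
- by move=> r _; apply: mule_ge0 (o0 r); rewrite lee_fin.
- by apply: measurable_funTS; apply: emeasurable_funM; [exact: measurable_cst|exact: mo].
- exact: measurable_funTS.
move=> r /=; rewrite in_itv/= => /andP[mr rx].
have -> : (dual_int a w r `^ q * dual_weight a w r * Q r = dual_int a w r `^ q * Q r * dual_weight a w r)%E.
  by rewrite -muleA [X in (_ * X)%E]muleC [LHS]muleA.
apply: lee_wpmul2r; first exact: o0.
rewrite mulrC EFinM; apply: lee_pmul.
- by rewrite lee_fin powR_ge0.
- by rewrite lee_fin.
- rewrite -poweR_EFin; apply: poweR_le; [exact: ltW|by rewrite lee_fin|].
  exact: (le_trans h1 (dual_int_homo a hw (ltW mr))).
- exact: hQ (le_lt_trans ym mr) rx.
Qed.

End dual_integral.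

Section hardy_power.
Context {R : realType}.
Local Notation mu1 := (@completed_lebesgue_measure R).
Implicit Types (w : realR R -> \bar R) (V : R -> R -> R) (Q : R -> \bar R).

(* [Q t] is comparable with the [r]-th power of the best constant in the
   Hardy condition on [(t, oo)]. *)
Definition hardy_power (p b r : R) w V Q : Prop :=
  [/\ measurable_fun setT (Q : realR R -> \bar R), forall t, (0 <= Q t)%E,
      forall s t, 0 < s -> s <= t -> (Q t <= Q s)%E &
      forall t h, 0 < t -> 0 <= h -> (Q t <= (h `^ r)%:E)%E <-> hardy_cond p b w V t h].

Lemma dual_tail_block (a b s : R) w : 1 < a -> b < a -> 1 < b ->
  dual_tail a w s `^ (a * (b - 1) / (a - b) + 1) =
  (rtail w s `^ (- a^-1)) `^ (a * b / (a - b)).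
Proof.
move=> a1 ba b1; have [an [an1 abn]] : a != 0 /\ (a - 1 != 0 /\ a - b != 0).
  by rewrite !gt_eqF ?subr_gt0 //; lra.
rewrite /dual_tail -!powRrM; congr (_ `^ _); field.
by rewrite an an1 abn.
Qed.

(** On each block [Q] is at most its value at the left end and [dual_int] at most a multiple of the
    dual tail there, so the integral is bounded by the sum over halving points. *)
Lemma dual_integral_upper (a b : R) : 1 < a -> 1 < b -> b < a -> exists2 C : R, 0 < C &
  forall w Q (h : R -> R) D, tail_weight w -> measurable_fun setT (Q : realR R -> \bar R) ->
  (forall t, 0 <= Q t)%E -> (forall s t, 0 < s -> s <= t -> (Q t <= Q s)%E) ->
  (forall x, 0 < x -> 0 <= h x) ->
  (forall x, 0 < x -> (Q x <= (h x `^ (a * b / (a - b)))%:E)%E) -> 0 <= D ->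
  (forall x n, halving w x ->
     \sum_(k < n) (h (x k) * rtail w (x k) `^ (- a^-1)) `^ (a * b / (a - b)) <= D) ->
  (\int[mu1]_(t in `]0%R, +oo[)
     (dual_int a w t `^ (a * (b - 1) / (a - b)) * dual_weight a w t * Q t) <= (C * D)%:E)%E.
Proof.
move=> a1 b1 ba; have ab0 : 0 < a - b by lra.
have [q qE] : {q | q = a * (b - 1) / (a - b)} by exists (a * (b - 1) / (a - b)).
have [r rE] : {r | r = a * b / (a - b)} by exists (a * b / (a - b)).
have q0 : 0 < q by rewrite qE divr_gt0 // mulr_gt0 //; lra.
have [C C0 hC] := dual_int_le_tail a1.
pose L : R := 2 `^ (a - 1)^-1; have L0 : 0 < L by rewrite powR_gt0.
have LE : 2 `^ (a - 1)^-1 = L by []. clearbody L.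
have CL0 : 0 < C * L by rewrite mulr_gt0.
exists ((C * L) `^ (q + 1)); first by rewrite powR_gt0.
move=> w Q h D hw mQ Q0 Qa h0 Qh D0; rewrite -qE -rE in Qh * => hD.
have mI := measurable_dual_integrand a hw (ltW q0) mQ.
have I0 t : (0 <= dual_int a w t `^ q * dual_weight a w t * Q t)%E by exact: dual_integrand_ge0.
have [mo o0] := dual_nnweight a hw.
have CD0 : 0 <= (C * L) `^ (q + 1) * D by rewrite mulr_ge0 ?powR_ge0.
apply: (integral_itv_left_le mI I0) => [|s s0 _]; first by rewrite lee_fin.
apply: (integral_itv_infty_le mI I0) => t st.
have [x [x0 xW xp xS]] := halving_points hw s0.
have hx : halving w x by split => // k; rewrite xW x0.
have [n tn] := halving_unbounded t hw hx.
apply: (@le_trans _ _ (\int[mu1]_(u in `]x 0%N, x n[) (dual_int a w u `^ q * dual_weight a w u * Q u))%E).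
  apply: (integral_itv_subset mI I0) => y /=; rewrite !in_itv/= x0 => /andP[-> yt].
  exact: lt_trans yt tn.
rewrite (integral_itv_sum mI I0 n (fun i => ltW (xS i))).
apply: (@le_trans _ _ (\sum_(k < n) ((C * L) `^ (q + 1) *
    (h (x k) * rtail w (x k) `^ (- a^-1)) `^ r)%:E)%E); last first.
  rewrite sumEFin lee_fin -mulr_sumr; apply: ler_wpM2l; [exact: powR_ge0|exact: hD].
apply: lee_sum => k _.
have hk := h0 _ (xp k).
have nu0 : 0 < dual_tail a w (x k) by exact: dual_tail_gt0.
have Lnu0 : 0 <= C * L * dual_tail a w (x k) by rewrite mulr_ge0 // ltW.
have OmS : (dual_int a w (x k.+1) <= (C * L * dual_tail a w (x k))%:E)%E.
  by apply: (le_trans (hC w _ hw (xp k.+1))); rewrite (dual_tail_halving a _ hw hx) LE mulrA.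
have K0 : 0 <= (C * L * dual_tail a w (x k)) `^ q * h (x k) `^ r by rewrite mulr_ge0 ?powR_ge0.
apply: (@le_trans _ _ (((C * L * dual_tail a w (x k)) `^ q * h (x k) `^ r)%:E *
    \int[mu1]_(u in `]x k, x k.+1[) dual_weight a w u)%E).
  rewrite -ge0_integralZl; first last.
  - by rewrite lee_fin.
  - by move=> u _; exact: o0.
  - exact: measurable_funTS.
  - exact: measurable_itvR.
  apply: ge0_le_integral.
  - exact: measurable_itvR.
  - by move=> u _; exact: I0.
  - exact: measurable_funTS.
  - by apply: measurable_funTS; apply: emeasurable_funM; [exact: measurable_cst|exact: mo].
  move=> u /=; rewrite in_itv/= => /andP[ku uk].
  have -> : (dual_int a w u `^ q * dual_weight a w u * Q u = dual_int a w u `^ q * Q u * dual_weight a w u)%E.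
    by rewrite -muleA [X in (_ * X)%E]muleC [LHS]muleA.
  apply: lee_wpmul2r; first exact: o0.
  rewrite EFinM; apply: lee_pmul.
  - exact: poweR_ge0.
  - exact: Q0.
  - rewrite -poweR_EFin; apply: poweR_le; [exact: ltW|exact: dual_int_ge0|].
    exact: (le_trans (dual_int_homo a hw (ltW uk)) OmS).
  - exact: (le_trans (Qa _ _ (xp k) (ltW ku)) (Qh _ (xp k))).
apply: (@le_trans _ _ (((C * L * dual_tail a w (x k)) `^ q * h (x k) `^ r)%:E *
    (C * L * dual_tail a w (x k))%:E)%E).
  apply: lee_wpmul2l; first by rewrite lee_fin.
  apply: le_trans OmS; apply: (integral_itv_subset mo o0) => u /=.
  by rewrite !in_itv/= => /andP[ku ->]; rewrite (lt_trans (xp k) ku).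
rewrite -EFinM lee_fin (powRM _ hk (powR_ge0 _ _)) rE -(dual_tail_block _ _ a1 ba b1) -qE.
rewrite mulrAC [_ `^ q * _]mulrC (powR_mul_self Lnu0) ?addr_gt0 // (powRM _ (ltW CL0) (ltW nu0)).
by rewrite le_eqVlt; apply/orP; left; apply/eqP; ring.
Qed.

(** The choice is [h = Q ^ (1/r)]. Since [Q] is nonincreasing, the term of [x k.+1] is charged to
    the integral over [(x k, x k.+1)]; the first term is treated by [level_left], that is, by the
    head condition or by a block further left. *)
Lemma upper_blocks_sum (p a b : R) : 1 < p -> 1 < a -> 1 < b -> b < a -> exists2 C : R, 0 < C &
  forall w1 w2 V Q S, tail_weight w1 -> 0 <= S ->
  hardy_power p b (a * b / (a - b)) w2 V Q ->
  ((tail_int w1 0 < +oo)%E -> forall x, 0 < x ->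
     hardy_cond p b w2 V x (S * fine (tail_int w1 0) `^ a^-1)) ->
  (\int[mu1]_(t in `]0%R, +oo[)
     (dual_int a w1 t `^ (a * (b - 1) / (a - b)) * dual_weight a w1 t * Q t)
   <= (S `^ (a * b / (a - b)))%:E)%E ->
  exists h : R -> R, (forall x, 0 < x -> 0 <= h x /\ hardy_cond p b w2 V x (h x)) /\
  (forall x n, halving w1 x ->
     \sum_(k < n) (h (x k) * rtail w1 (x k) `^ (- a^-1)) `^ (a * b / (a - b))
       <= (C * S) `^ (a * b / (a - b))).
Proof.
move=> p1 a1 b1 ba; have [a0 ab0] : 0 < a /\ 0 < a - b by lra.
have an : a != 0 by rewrite gt_eqF.
have [C C0 hC] := dual_block_power a1 b1 ba.
have [q qE] : {q | q = a * (b - 1) / (a - b)} by exists (a * (b - 1) / (a - b)).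
have [r rE] : {r | r = a * b / (a - b)} by exists (a * b / (a - b)).
rewrite -qE -rE in hC *.
have q0 : 0 < q by rewrite qE divr_gt0 // mulr_gt0 //; lra.
have r0 : 0 < r by rewrite rE divr_gt0 // mulr_gt0 //; lra.
have [K KE] : {K : R | K = (2 `^ a^-1) `^ r} by exists ((2 `^ a^-1) `^ r).
have K0 : 0 < K by rewrite KE !powR_gt0.
have C20 : 0 < K + C + C by lra.
exists ((K + C + C) `^ r^-1); first by rewrite powR_gt0.
move=> w1 w2 V Q S hw1 S0 [mQ Q0 Qa Qh] hc hI; have Sr0 := powR_ge0 S r.
have mI := measurable_dual_integrand a hw1 (ltW q0) mQ.
have I0 t : (0 <= dual_int a w1 t `^ q * dual_weight a w1 t * Q t)%E by exact: dual_integrand_ge0.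
have intle y x : 0 < y -> (\int[mu1]_(t in `]y, x[) (dual_int a w1 t `^ q * dual_weight a w1 t * Q t)
    <= (S `^ r)%:E)%E.
  move=> y0; apply: le_trans hI; apply: (integral_itv_subset mI I0) => u /=.
  by rewrite !in_itv/= andbT => /andP[yu _]; exact: lt_trans yu.
have blk y x k : 0 < y -> y < x -> rtail w1 y = 2 * rtail w1 x -> 0 <= k -> (k%:E <= Q x)%E ->
    ((k * (rtail w1 x `^ (- a^-1)) `^ r)%:E <= C%:E *
     \int[mu1]_(t in `]y, x[) (dual_int a w1 t `^ q * dual_weight a w1 t * Q t))%E.
  move=> y0 yx yE k0 kQ; apply: (hC w1 y x Q k hw1 y0 yx yE mQ Q0 k0) => t yt tx.
  exact: le_trans kQ (Qa _ _ (lt_trans y0 yt) (ltW tx)).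
have Ce : (0 <= C%:E)%E by rewrite lee_fin ltW.
(* This bound serves twice: it pays for the first term, and with a large [k] it shows that [Q x] is
   finite. *)
have one x k : 0 < x -> 0 <= k -> (k%:E <= Q x)%E -> k * (rtail w1 x `^ (- a^-1)) `^ r <= (K + C) * S `^ r.
  move=> x0 k0 kQ; have W0 := rtail_gt0 hw1 x0.
  have [hl|[y /andP[y0 yx] yE]] := level_left hw1 x0; last first.
    rewrite -lee_fin; apply: (le_trans (blk y x k y0 yx yE k0 kQ)).
    apply: (le_trans (lee_wpmul2l Ce (intle y x y0))).
    by rewrite -EFinM lee_fin; apply: ler_wpM2r => //; rewrite lerDr ltW.
  have fin : (tail_int w1 0 < +oo)%E by apply: le_lt_trans hl (ltry _).
  have t0 : (0 <= tail_int w1 0)%E.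
    by apply: integral_ge0 => s _; exact: (tail_nnweight hw1).2.
  have h3 : fine (tail_int w1 0) `^ a^-1 <= 2 `^ a^-1 * rtail w1 x `^ a^-1.
    rewrite -(powRM _ (ler0n _ 2) (ltW W0)); apply: le_powR.
    - by rewrite invr_ge0 ltW.
    - exact: fine_ge0.
    - by rewrite -lee_fin fineK // ge0_fin_numE.
  have Sf0 : 0 <= S * fine (tail_int w1 0) `^ a^-1 by rewrite mulr_ge0 ?powR_ge0.
  have hQ := (Qh x _ x0 Sf0).2 (hc fin x x0).
  have kS : k <= (S * (2 `^ a^-1 * rtail w1 x `^ a^-1)) `^ r.
    rewrite -lee_fin; apply: (le_trans (le_trans kQ hQ)); rewrite lee_fin.
    exact: (le_powR (ltW r0) Sf0 (ler_wpM2l S0 h3)).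
  have W1 : rtail w1 x `^ a^-1 * rtail w1 x `^ (- a^-1) = 1.
    by rewrite -powRD ?(gt_eqF W0) ?implybT // subrr powRr0.
  apply: (le_trans (ler_wpM2r (powR_ge0 _ _) kS)).
  rewrite -(powRM _ (mulr_ge0 S0 (mulr_ge0 (powR_ge0 _ _) (powR_ge0 _ _))) (powR_ge0 _ _)).
  rewrite (_ : S * _ * _ = 2 `^ a^-1 * S); last by rewrite -!mulrA W1 mulr1 mulrC.
  rewrite (powRM _ (powR_ge0 _ _) S0) -KE; apply: ler_wpM2r => //.
  by rewrite lerDl ltW.
have Wr0 x : 0 < x -> 0 < (rtail w1 x `^ (- a^-1)) `^ r.
  by move=> x0; rewrite !powR_gt0 // rtail_gt0.
have Qf x : 0 < x -> Q x = (fine (Q x))%:E.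
  move=> x0; rewrite fineK // ge0_fin_numE // ltey; apply/eqP => E.
  pose k := ((K + C) * S `^ r + 1) / (rtail w1 x `^ (- a^-1)) `^ r.
  have KS0 : 0 <= (K + C) * S `^ r by rewrite mulr_ge0 //; lra.
  have k0 : 0 <= k by rewrite divr_ge0 ?powR_ge0 //; lra.
  have := one x k x0 k0; rewrite E leey => /(_ isT).
  by rewrite /k divfK ?gt_eqF ?Wr0 //; lra.
have fQ0 x : 0 <= fine (Q x) by exact: fine_ge0.
have hE x : (fine (Q x) `^ r^-1) `^ r = fine (Q x) by rewrite -powRrM mulVf ?powRr1 // gt_eqF.
exists (fun x => fine (Q x) `^ r^-1); split=> [x x0|x n hx].
  split; first exact: powR_ge0.
  by apply/Qh => //; [exact: powR_ge0|rewrite hE -Qf].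
have [xW xp xS] := hx.
rewrite (powRM _ (powR_ge0 _ _) S0) -powRrM mulVf ?gt_eqF // (powRr1 (ltW C20)).
have tE k : (fine (Q (x k)) `^ r^-1 * rtail w1 (x k) `^ (- a^-1)) `^ r =
    fine (Q (x k)) * (rtail w1 (x k) `^ (- a^-1)) `^ r.
  by rewrite (powRM _ (powR_ge0 _ _) (powR_ge0 _ _)) hE.
have CS0 : 0 <= (K + C + C) * S `^ r by rewrite mulr_ge0 // ltW.
case: n => [|m]; first by rewrite big_ord0.
rewrite big_ord_recl mulrDl; apply: lerD.
  by rewrite tE; apply: one => //; rewrite -Qf.
rewrite -lee_fin -sumEFin.
apply: (@le_trans _ _ (C%:E * \int[mu1]_(t in `]x 0%N, x m[) (dual_int a w1 t `^ q * dual_weight a w1 t * Q t))%E).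
  rewrite (integral_itv_sum mI I0 m (fun i => ltW (xS i))) ge0_sume_distrr; last first.
    by move=> i _; apply: integral_ge0 => u _; exact: I0.
  apply: lee_sum => i _; rewrite tE /bump /=; apply: blk => //.
  - by rewrite (xW i) (xW i.+1) exprS; field; rewrite expf_neq0.
  - by rewrite -Qf.
rewrite EFinM; apply: (lee_wpmul2l Ce); exact: intle.
Qed.

End hardy_power.

(** * Conditions on a pair of half-line weights *)

Section conditions.
Context {R : realType}.
Local Notation mu1 := (@completed_lebesgue_measure R).
Implicit Types (w : realR R -> \bar R) (V : R -> R -> R) (Q M : R -> \bar R).

Definition Jreal (p a : R) w V (t : R) : R := fine (Jint p a w V 0 t).

Definition Jfinite (p a : R) w V : Prop := forall t, 0 < t -> (Jint p a w V 0 t < +oo)%E.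

(** Void when the total mass is infinite, in accordance with the convention that makes the leading
    factor of [I_3] and [I_7] vanish. *)
Definition head_cond (p a b : R) w1 w2 V S : Prop :=
  (tail_int w1 0 < +oo)%E -> forall x, 0 < x ->
  hardy_cond p b w2 V x (S * fine (tail_int w1 0) `^ a^-1).

(** The condition behind [I_4]. *)
Definition J_cond (p a b : R) w1 w2 V S : Prop :=
  forall t, 0 < t -> Jreal p a w1 V t `^ ((a - 1) / a) * rtail w2 t `^ b^-1 <= S.

(** The condition behind [I_8]; lower bounds [Om] stand for the dual mass, which keeps the formula
    in real numbers. *)
Definition dual_cond (p a b : R) w1 w2 V S : Prop :=
  forall x Om, 0 < x -> 0 < Om -> (Om%:E <= dual_int a w1 x)%E ->
  hardy_cond p b w2 V x (S * Om `^ (- ((a - 1) / a))).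

(** With the two choices of [Q] made later, this is the condition behind [I_5] or [I_9]. *)
Definition Q_cond (a b : R) w1 Q S : Prop :=
  (\int[mu1]_(t in `]0%R, +oo[)
     (dual_int a w1 t `^ (a * (b - 1) / (a - b)) * dual_weight a w1 t * Q t)
   <= (S `^ (a * b / (a - b)))%:E)%E.

(** The condition behind [I_6]; [M] stands for the supremum over the outer radii. *)
Definition M_cond (p a b : R) w1 V M S : Prop :=
  (\int[mu1]_(t in `]0%R, +oo[)
     ((Jreal p a w1 V t `^ (a * (b - 1) / (a - b)))%:E * M t * dual_weight a w1 t)
   <= (S `^ (a * b / (a - b)))%:E)%E.

(** The least upper bound property is asked at positive [t], so [M] may take a convenient value
    elsewhere. *)
Definition shell_sup (p a b : R) w2 V M : Prop :=
  [/\ measurable_fun setT (M : realR R -> \bar R), forall t, (0 <= M t)%E,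
      forall s t, s <= t -> (M t <= M s)%E,
      forall t z, 0 < t -> t < z ->
        ((V t z `^ theta p a * rtail w2 z `^ (a / (a - b)))%:E <= M t)%E &
      forall t X, 0 < t -> (forall z, t < z ->
        ((V t z `^ theta p a * rtail w2 z `^ (a / (a - b)))%:E <= X)%E) -> (M t <= X)%E].

(** [G] and [F] stand for the masses of [g] and [h] on shells with inner radius [x0]; the constant
    [K] is uniform in [x0]. *)
Definition upper_est (p a b : R) w1 w2 V K : Prop :=
  forall N x0 (G F : R -> R), 0 < x0 ->
  measurable_fun setT (G : realR R -> R) -> measurable_fun setT (F : realR R -> R) ->
  (forall s t, x0 <= s -> s <= t -> G s <= G t /\ F s <= F t) ->
  G x0 = 0 -> F x0 = 0 ->
  (forall s t, x0 <= s -> s < t -> (G t - G s) `^ p <= V s t `^ (p - 1) * (F t - F s)) ->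
  0 <= N -> (wint w1 `]x0, +oo[ (fun t => F t `^ (a / p))%R <= N%:E)%E ->
  (wint w2 `]x0, +oo[ (fun t => G t `^ b)%R <= (K `^ b * N `^ (b / a))%:E)%E.

Section J_facts.
Variables (p a : R) (w : realR R -> \bar R) (V : R -> R -> R).
Hypotheses (p1 : 1 < p) (a1 : 1 < a) (hw : tail_weight w) (hV : shell_data V)
  (hJ : Jfinite p a w V).

Lemma Jint_ge0 c t : (0 <= Jint p a w V c t)%E.
Proof.
have [_ mV _ _] := hV.
by apply: (wint_ge0 (dual_nnweight a hw)); apply: posmeas_powR; exact: mV.
Qed.

Lemma JrealE t : 0 < t -> Jint p a w V 0 t = (Jreal p a w V t)%:E.
Proof. by move=> t0; rewrite fineK // ge0_fin_numE ?Jint_ge0 //; exact: hJ. Qed.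

Lemma Jreal_mono s t : 0 < s -> s <= t ->
  0 <= Jreal p a w V s /\ Jreal p a w V s <= Jreal p a w V t.
Proof.
move=> s0 st; split; first by apply: fine_ge0; exact: Jint_ge0.
have t0 : 0 < t by exact: lt_le_trans st.
have fJ r : 0 < r -> Jint p a w V 0 r \is a fin_num by move=> r0; rewrite (JrealE r0).
exact: (fine_le (fJ s s0) (fJ t t0) (Jint_homo (lexx 0) p1 a1 hw hV st)).
Qed.

Lemma measurable_Jreal : measurable_fun setT (Jreal p a w V : realR R -> R).
Proof.
apply: (@measurableT_comp _ _ _ _ _ _ fine); first exact: fine_measurable.
by apply: measurable_homo => s t st; exact: (Jint_homo (lexx 0) p1 a1 hw hV st).
Qed.

End J_facts.

Lemma upper_est_le (p a b : R) : 1 < p -> 1 < a -> 1 < b -> a <= b -> exists2 C : R, 0 < C &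
  forall w1 w2 V S, tail_weight w1 -> tail_weight w2 -> shell_data V -> Jfinite p a w1 V ->
  0 <= S -> head_cond p a b w1 w2 V S -> J_cond p a b w1 w2 V S -> dual_cond p a b w1 w2 V S ->
  upper_est p a b w1 w2 V (C * S).
Proof.
move=> p1 a1 b1 ab; have b0 : 0 < b by lra.
have p0 : 0 < p by lra.
have [C1 C10 h1] := upper_pointwise p1 a1 b1.
have [C2 C20 h2] := upper_le p1 a1 b1 ab.
(* [C1 + 1] dominates both 1 and [C1], so one multiple of [S] serves for all conditions. *)
have C3 : 1 <= C1 + 1 by lra.
exists (C2 `^ b^-1 * (C1 + 1)); first by rewrite mulr_gt0 ?powR_gt0 //; lra.
move=> w1 w2 V S hw1 hw2 hV hJ S0 hh hJc hd N x0 G F x00 mG mF GF Gx Fx hH N0 hN.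
have CS0 : 0 <= (C1 + 1) * S by rewrite mulr_ge0 //; lra.
have := h2 w1 w2 V (Jreal p a w1 V) ((C1 + 1) * S) N x0 G F hw1 hw2 hV x00 mG mF GF Gx Fx hH CS0 N0 hN
  (JrealE hw1 hV hJ).
have -> : (C2 `^ b^-1 * (C1 + 1) * S) `^ b = C2 * ((C1 + 1) * S) `^ b.
  rewrite -mulrA (powRM _ (powR_ge0 _ _) CS0) -powRrM mulVf ?gt_eqF //.
  by rewrite (powRr1 (ltW C20)).
rewrite mulrA; apply.
  move=> x x0'; have := h1 w1 w2 V S x hw1 S0 x0' (fun f => hh f x x0') (fun Om => hd x Om x0').
  apply: hardy_cond_mono => //; first by rewrite !mulr_ge0 ?powR_ge0 // ltW.
  apply: ler_wpM2r; first exact: powR_ge0.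
  by apply: ler_wpM2r => //; rewrite lerDl.
move=> t t0; apply: (le_trans (hJc t t0)).
by rewrite -[leLHS]mul1r; apply: ler_wpM2r.
Qed.

Lemma upper_est_gt (p a b : R) : 1 < p -> 1 < a -> 1 < b -> b < a -> exists2 C : R, 0 < C &
  forall w1 w2 V Q M S, tail_weight w1 -> tail_weight w2 -> shell_data V -> Jfinite p a w1 V ->
  hardy_power p b (a * b / (a - b)) w2 V Q -> shell_sup p a b w2 V M ->
  0 <= S -> head_cond p a b w1 w2 V S -> Q_cond a b w1 Q S -> M_cond p a b w1 V M S ->
  upper_est p a b w1 w2 V (C * S).
Proof.
move=> p1 a1 b1 ba; have b0 : 0 < b by lra.
have p0 : 0 < p by lra.
have [C1 C10 h1] := upper_blocks_sum p1 a1 b1 ba.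
have [C2 C20 h2] := upper_gt p1 a1 b1 ba.
have C3 : 1 <= C1 + 1 by lra.
have r0 : 0 <= a * b / (a - b) by rewrite divr_ge0 ?mulr_ge0 //; lra.
exists (C2 `^ b^-1 * (C1 + 1)); first by rewrite mulr_gt0 ?powR_gt0 //; lra.
move=> w1 w2 V Q M S hw1 hw2 hV hJ hQ [mM M0 Ma Mub Mlub] S0 hh hQc hM N x0 G F x00 mG mF GF Gx Fx hH N0 hN.
have CS0 : 0 <= (C1 + 1) * S by rewrite mulr_ge0 //; lra.
have CS1 : C1 * S <= (C1 + 1) * S by apply: ler_wpM2r => //; rewrite lerDl.
have CS2 : S <= (C1 + 1) * S by rewrite -[leLHS]mul1r; apply: ler_wpM2r.
have C1S0 : 0 <= C1 * S by rewrite mulr_ge0 // ltW.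
have [h [hx hs]] := h1 w1 w2 V Q S hw1 S0 hQ hh hQc.
have hs' x n : halving w1 x -> x 0%N = x0 ->
     \sum_(k < n) (h (x k) * rtail w1 (x k) `^ (- a^-1)) `^ (a * b / (a - b))
       <= ((C1 + 1) * S) `^ (a * b / (a - b)).
  by move=> hx' _; apply: (le_trans (hs x n hx')); exact: le_powR.
have hM' : (\int[mu1]_(t in `]0%R, +oo[)
     ((Jreal p a w1 V t `^ (a * (b - 1) / (a - b)))%:E * M t * dual_weight a w1 t)
   <= (((C1 + 1) * S) `^ (a * b / (a - b)))%:E)%E.
  by apply: (le_trans hM); rewrite lee_fin; exact: le_powR.
have := h2 w1 w2 V (Jreal p a w1 V) M h ((C1 + 1) * S) N x0 G F hw1 hw2 hV x00 mG mF GF Gx Fx hH CS0 N0 hN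
  (JrealE hw1 hV hJ) (measurable_Jreal p1 a1 hw1 hV)
  (fun s t => @Jreal_mono p a w1 V p1 a1 hw1 hV hJ s t) hx hs' mM M0 Mub Ma hM'.
have -> : (C2 `^ b^-1 * (C1 + 1) * S) `^ b = C2 * ((C1 + 1) * S) `^ b.
  rewrite -mulrA (powRM _ (powR_ge0 _ _) CS0) -powRrM mulVf ?gt_eqF //.
  by rewrite (powRr1 (ltW C20)).
by rewrite mulrA.
Qed.

(* When [p <= b] the integral defining [J] controls [dual_int] times a shell. *)
Lemma dual_cond_J (p a b : R) w1 w2 V S : 1 < p -> 1 < a -> 1 < b -> p <= b ->
  tail_weight w1 -> tail_weight w2 -> shell_data V -> Jfinite p a w1 V -> 0 <= S ->
  J_cond p a b w1 w2 V S -> dual_cond p a b w1 w2 V S.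
Proof.
move=> p1 a1 b1 pb hw1 hw2 hV hJ S0 hc x Om x0 Om0 hOm.
split; last by rewrite ltNge pb.
move=> _ z xz; have z0 : 0 < z by exact: lt_trans xz.
have e0 : 0 < (a - 1) / a by rewrite divr_gt0 //; lra.
have [pn [an an1]] : p != 0 /\ (a != 0 /\ a - 1 != 0) by rewrite !gt_eqF //; lra.
have [[V0 Vm] mV Vn Va] := hV.
have h : V x z `^ theta p a * Om <= Jreal p a w1 V z.
  rewrite -lee_fin -(JrealE hw1 hV hJ z0) EFinM.
  have pV : posmeas (fun r : realR R => V r z `^ theta p a) by apply: posmeas_powR; exact: mV.
  have no := dual_nnweight a hw1.
  apply: (@le_trans _ _ (wint (dual_weight a w1) `]0%R, x[ (fun r => V r z `^ theta p a)%R)); last first.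
    apply: (wint_subset no pV) => r /=; rewrite !in_itv/= => /andP[-> rx].
    exact: lt_trans rx xz.
  apply: (@le_trans _ _ ((V x z `^ theta p a)%:E * dual_int a w1 x)%E).
    by apply: lee_wpmul2l hOm; rewrite lee_fin powR_ge0.
  apply: (wint_ge_cst no _ pV) => [|r]; first exact: powR_ge0.
  rewrite in_itv/= => /andP[r0 rx]; apply: le_powR; [exact: ltW (theta_gt0 p1 a1)|exact: V0|].
  exact: (Vm _ _ _ _ r0 (ltW rx) (lexx _)).
have vO : 0 <= V x z `^ theta p a * Om by rewrite mulr_ge0 ?powR_ge0 // ltW.
have := hc z z0; have W0 := powR_ge0 (rtail w2 z) b^-1.
move=> /(le_trans (ler_wpM2r W0 (le_powR (ltW e0) vO h))).
rewrite (powRM _ (powR_ge0 _ _) (ltW Om0)) -powRrM.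
have -> : theta p a * ((a - 1) / a) = (p - 1) / p.
  by rewrite /theta; field; rewrite pn an an1.
have Oe : 0 < Om `^ ((a - 1) / a) by rewrite powR_gt0.
by move=> hS; rewrite powRN (ler_pdivlMr _ _ Oe) mulrAC.
Qed.

Section lower_conditions.
Context {d : measure_display} {T : measurableType d}.
Variables (mu : {measure set T -> \bar R}) (rho : T -> R).
Hypotheses (mrho : measurable_fun setT rho)
  (null_sphere : forall t, mu [set y | rho y = t] = 0%E).

Lemma hardy_bounded (p a b : R) : 1 < p -> 1 < a -> 1 < b -> exists2 C : R, 0 < C &
  forall u w1 w2 B x, radial_weight mu rho u -> tail_weight w1 -> tail_weight w2 -> 0 <= B ->
  bounded_by mu rho u p a b w1 w2 B -> 0 < x ->
  hardy_cond p b w2 (rV mu rho u) x (C * (B * rtail w1 x `^ a^-1)).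
Proof.
move=> p1 a1 b1; have [C C0 hC] := @hardy_lower R p b p1 b1.
exists C => // u w1 w2 B x hu hw1 hw2 B0 hB x0; have [mu_ u0 fin] := hu.
have D0 : 0 <= B * rtail w1 x `^ a^-1 by rewrite mulr_ge0 ?powR_ge0.
apply: (hC w2 _ x _ hw2 (shell_data_radial mrho null_sphere hu)
  (shell_continuous_radial mrho null_sphere hu) x0 D0).
apply: (hardy_test_shells mrho p1 b1 hu hw2 x0 D0).
exact: (bounded_hardy_test mrho mu_ u0 p1 a1 hw1 B0 x0 hB).
Qed.

Lemma lower_conditions (p a b : R) : 1 < p -> 1 < a -> 1 < b -> exists2 C : R, 0 < C &
  forall u w1 w2 B, radial_weight mu rho u -> tail_weight w1 -> tail_weight w2 ->
  Jfinite p a w1 (rV mu rho u) -> 0 <= B -> bounded_by mu rho u p a b w1 w2 B ->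
  [/\ head_cond p a b w1 w2 (rV mu rho u) (C * B), J_cond p a b w1 w2 (rV mu rho u) (C * B),
      dual_cond p a b w1 w2 (rV mu rho u) (C * B),
      b < a -> forall Q, hardy_power p b (a * b / (a - b)) w2 (rV mu rho u) Q ->
        Q_cond a b w1 Q (C * B) &
      b < a -> forall M, shell_sup p a b w2 (rV mu rho u) M ->
        M_cond p a b w1 (rV mu rho u) M (C * B)].
Proof.
move=> p1 a1 b1; have [p0 [a0 b0]] : 0 < p /\ (0 < a /\ 0 < b) by lra.
have [an [an1 pn]] : a != 0 /\ (a - 1 != 0 /\ p != 0) by rewrite !gt_eqF ?subr_gt0.
have e0 : 0 < (a - 1) / a by rewrite divr_gt0 // subr_gt0.
have [C1 C10 h1] := hardy_bounded p1 a1 b1.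
have [Ga2 [C2' [Ga20 C20' h2']]] := Jint_lower p1 a1 b1 (R := R).
have [K2 K20 hK2] := bounded_shells mu mrho p1 a1 b1 Ga20.
have [C3 C30 h3] := @dual_int_le_tail R a a1.
have [C4 C40 h4] := @hardy_lower R p b p1 b1.
(* [C5] has to exist whether or not [b < a]; for [a <= b] any positive value will do. *)
have [C5 C50 h5] : exists2 C5 : R, 0 < C5 & b < a ->
    forall u w1 w2 B, radial_weight mu rho u -> tail_weight w1 -> tail_weight w2 -> 0 <= B ->
    bounded_by mu rho u p a b w1 w2 B ->
    (forall Q, hardy_power p b (a * b / (a - b)) w2 (rV mu rho u) Q -> Q_cond a b w1 Q (C5 * B)) /\
    (forall M, Jfinite p a w1 (rV mu rho u) -> shell_sup p a b w2 (rV mu rho u) M ->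
       M_cond p a b w1 (rV mu rho u) M (C5 * B)).
  have [ab|ba] := leP a b; first by exists 1 => //.
  have r0 : 0 < a * b / (a - b) by rewrite divr_gt0 ?mulr_gt0 // subr_gt0.
  have [L1 L10 hL1] := lower_blocks mu mrho p1 a1 b1 ba.
  have [L2 L20 hL2] := @dual_integral_upper R a b a1 b1 ba.
  have [Ga3 [L3 [Ga30 L30 hL3]]] := @Jint_sup_lower R p a b p1 a1 b1 ba.
  have [K3 K30 hK3] := bounded_shells mu mrho p1 a1 b1 Ga30.
  have [K KE] : {K | K = L2 `^ (a * b / (a - b))^-1 * (C4 * L1)} by exists (L2 `^ (a * b / (a - b))^-1 * (C4 * L1)).
  have Kp : 0 < K by rewrite KE !mulr_gt0 ?powR_gt0.
  exists (K + L3 * K3); first by rewrite addr_gt0 ?mulr_gt0.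
  move=> _ u w1 w2 B hu hw1 hw2 B0 hB; have [mu_ u0 fin] := hu.
  have KB1 : 0 <= K * B by rewrite mulr_ge0 // ltW.
  have KB2 : 0 <= L3 * (K3 * B) by rewrite !mulr_ge0 // ltW.
  split=> [Q hQ|M hJ [mM M0 Ma Mub Mlub]]; last first.
    have hs := hK3 u w1 w2 B hu hw1 hw2 B0 hB.
    have KB0 : 0 <= K3 * B by rewrite mulr_ge0 // ltW.
    have := hL3 w1 w2 (rV mu rho u) (Jreal p a w1 (rV mu rho u)) M _ hw1 hw2
      (shell_data_radial mrho null_sphere hu) KB0 hs
      (JrealE hw1 (shell_data_radial mrho null_sphere hu) hJ)
      (measurable_Jreal p1 a1 hw1 (shell_data_radial mrho null_sphere hu)) mM M0 Mlub.
    move=> /le_trans; apply; rewrite lee_fin; apply: (le_powR (ltW r0) KB2).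
    by rewrite mulrDl mulrA lerDr.
  have [h [hx hs]] := hL1 u w1 w2 B hu hw1 hw2 B0 hB.
  have [mQ Q0 Qa Qh] := hQ.
  have D0 : 0 <= (C4 * L1 * B) `^ (a * b / (a - b)) by exact: powR_ge0.
  have := hL2 w1 Q (fun x => C4 * h x) _ hw1 mQ Q0 Qa _ _ D0 _.
  have g1 x : 0 < x -> 0 <= C4 * h x by move=> /hx[h0 _]; rewrite mulr_ge0 // ltW.
  have g2 x : 0 < x -> (Q x <= ((C4 * h x) `^ (a * b / (a - b)))%:E)%E.
    move=> x0; apply/(Qh x _ x0 (g1 x x0)); have [hx0 ht] := hx x x0.
    apply: (h4 w2 _ x (h x) hw2 (shell_data_radial mrho null_sphere hu)
      (shell_continuous_radial mrho null_sphere hu) x0 hx0).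
    exact: (hardy_test_shells mrho p1 b1 hu hw2 x0 hx0 ht).
  have g3 x n : halving w1 x ->
     \sum_(k < n) (C4 * h (x k) * rtail w1 (x k) `^ (- a^-1)) `^ (a * b / (a - b)) <=
     (C4 * L1 * B) `^ (a * b / (a - b)).
    move=> hal; have [_ xp _] := hal.
    have LB0 : 0 <= L1 * B by rewrite mulr_ge0 // ltW.
    rewrite -(mulrA C4 L1) (powRM _ (ltW C40) LB0).
    apply: le_trans (ler_wpM2l (powR_ge0 _ _) (hs x n hal)).
    rewrite [leRHS]mulr_sumr; apply: ler_sum => k _.
    have [hk _] := hx _ (xp k).
    by rewrite -(mulrA C4 (h (x k))) (powRM _ (ltW C40) (mulr_ge0 hk (powR_ge0 _ _))) lexx.
  move=> /(_ g1 g2 g3) /le_trans; apply; rewrite lee_fin.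
  apply: (@le_trans _ _ ((K * B) `^ (a * b / (a - b)))).
    have CLB : 0 <= C4 * L1 * B by rewrite !mulr_ge0 // ltW.
    have -> : K * B = L2 `^ (a * b / (a - b))^-1 * (C4 * L1 * B) by rewrite KE; ring.
    rewrite (powRM _ (powR_ge0 _ _) CLB) -[X in _ <= X * _]powRrM mulVf ?gt_eqF //.
    by rewrite (powRr1 (ltW L20)) lexx.
  apply: (le_powR (ltW r0) KB1); rewrite mulrDl lerDl.
  by rewrite -mulrA.
pose C := C1 + C2' * K2 + C1 * C3 `^ ((a - 1) / a) + C5.
have p1' := mulr_gt0 C20' K20.
have p2' : 0 < C1 * C3 `^ ((a - 1) / a) by rewrite mulr_gt0 ?powR_gt0.
exists C; first by rewrite /C !addr_gt0.
have l1 : C1 <= C by rewrite /C; lra.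
have l2 : C2' * K2 <= C by rewrite /C; lra.
have l3 : C1 * C3 `^ ((a - 1) / a) <= C by rewrite /C; lra.
have l4 : C5 <= C by rewrite /C; lra.
clearbody C; move=> u w1 w2 B hu hw1 hw2 hJ B0 hB; have [mu_ u0 fin] := hu.
have hV := shell_data_radial mrho null_sphere hu.
have r0 : b < a -> 0 <= a * b / (a - b) by move=> ba; rewrite divr_ge0 ?mulr_ge0 //; lra.
have C5B : 0 <= C5 * B by rewrite mulr_ge0 // ltW.
split.
- move=> fin1 x x0; apply: hardy_cond_mono (h1 u w1 w2 B x hu hw1 hw2 B0 hB x0) => //.
    by rewrite !mulr_ge0 ?powR_ge0 // ltW.
  have W0 := rtail_gt0 hw1 x0.
  have t0 : (0 <= tail_int w1 0)%E.
    by apply: integral_ge0 => s _; exact: (tail_nnweight hw1).2.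
  rewrite mulrA; apply: ler_pM; [by rewrite mulr_ge0 // ltW|exact: powR_ge0|exact: ler_wpM2r|].
  apply: le_powR; [by rewrite invr_ge0 ltW|exact: ltW|].
  have f0 : tail_int w1 0 \is a fin_num by rewrite ge0_fin_numE.
  have fx : tail_int w1 x \is a fin_num by rewrite (rtailE hw1 x0).
  exact: (fine_le fx f0 (tail_int_anti hw1 (ltW x0))).
- move=> t t0; have KB : 0 <= K2 * B by rewrite mulr_ge0 // ltW.
  have := h2' w1 w2 _ (Jreal p a w1 (rV mu rho u) t) _ t hw1 hw2 hV KB (hK2 u w1 w2 B hu hw1 hw2 B0 hB) t0
    (JrealE hw1 hV hJ t0).
  by move=> /le_trans; apply; rewrite mulrA; exact: ler_wpM2r.
- move=> x Om x0 Om0 hOm.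
  apply: hardy_cond_mono (h1 u w1 w2 B x hu hw1 hw2 B0 hB x0) => //.
    by rewrite !mulr_ge0 ?powR_ge0 // ltW.
  (* The dual mass is at most a multiple of the dual tail, so the power of [W1(x)] can be exchanged
     for a negative power of [Om]. *)
  have hO : Om <= C3 * dual_tail a w1 x by rewrite -lee_fin; exact: (le_trans hOm (h3 w1 x hw1 x0)).
  have nu0 : 0 < dual_tail a w1 x by exact: dual_tail_gt0.
  have := powR_neg_anti (ltW e0) Om0 hO.
  have -> : (C3 * dual_tail a w1 x) `^ (- ((a - 1) / a)) =
      (C3 `^ ((a - 1) / a))^-1 * rtail w1 x `^ a^-1.
    rewrite (powRM _ (ltW C30) (ltW nu0)) powRN /dual_tail -powRrM; congr (_ * _ `^ _).
    by field; rewrite an an1.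
  have c3 : 0 < C3 `^ ((a - 1) / a) by rewrite powR_gt0.
  rewrite ler_pdivrMl // => h.
  rewrite mulrCA; apply: (@le_trans _ _ (B * (C1 * (C3 `^ ((a - 1) / a) * Om `^ (- ((a - 1) / a)))))).
    by apply: ler_wpM2l => //; apply: ler_wpM2l h; exact: ltW.
  rewrite mulrCA !mulrA; apply: ler_wpM2r; first exact: powR_ge0.
  by rewrite mulrAC; apply: ler_wpM2r.
- move=> ba Q hQ; have [hq _] := h5 ba u w1 w2 B hu hw1 hw2 B0 hB.
  apply: (le_trans (hq Q hQ)); rewrite lee_fin; apply: (le_powR (r0 ba) C5B).
  exact: ler_wpM2r.
- move=> ba M hM; have [_ hm] := h5 ba u w1 w2 B hu hw1 hw2 B0 hB.
  apply: (le_trans (hm M hJ hM)); rewrite lee_fin; apply: (le_powR (r0 ba) C5B).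
  exact: ler_wpM2r.
Qed.

End lower_conditions.

End conditions.

(** * Spheres and shells in R^n *)

Section euclidean_facts.
Context {R : realType}.
Local Notation mu1 := (@completed_lebesgue_measure R).

Lemma measurable_euclidean n (A : set (n.-tuple (measurableTypeR R))) : measurable A ->
  measurable (A : set (euclidean R n)).
Proof. by move=> mA; apply: sub_caratheodory; exact: sub_sigma_algebra. Qed.

Lemma measurable_sqnorm n :
  measurable_fun setT (fun y : n.-tuple (measurableTypeR R) => \sum_(i < n) (tnth y i : R) ^+ 2).
Proof.
apply: measurable_sum => i; apply: measurable_funX; exact: measurable_tnth.
Qed.

Lemma measurable_enorm n : measurable_fun setT (@enorm R n).
Proof.
have m : measurable_fun setT (fun y : n.-tuple (measurableTypeR R) =>
    Num.sqrt (\sum_(i < n) (tnth y i : R) ^+ 2)).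
  apply: (@measurableT_comp _ _ _ _ _ _ (@Num.sqrt R)); last exact: measurable_sqnorm.
  by apply: continuous_measurable_fun; exact: sqrt_continuous.
move=> _ Y mY; rewrite setTI; apply: measurable_euclidean.
by have := m measurableT Y mY; rewrite setTI.
Qed.

(** Fubini in the first coordinate: once the others are fixed, the equation has at most two
    solutions. At least one coordinate must exist. *)
Lemma null_sqnorm n (c : R) : (1 <= n)%N ->
  @lebesgue_tuple R n [set y | \sum_(i < n) (tnth y i : R) ^+ 2 = c] = 0%E.
Proof.
case: n => // n _; set A := [set y | _].
have mA : measurable A.
  rewrite (_ : A = setT `&` (fun y : n.+1.-tuple (measurableTypeR R) =>
      \sum_(i < n.+1) (tnth y i : R) ^+ 2) @^-1` [set c]); last by rewrite setTI.
  exact: measurable_sqnorm.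
rewrite /= /cons_measure /pushforward.
set B := _ @^-1` A.
have mB : measurable B.
  by rewrite -[B]setTI; exact: measurable_tuple_cons.
(* The product measure is rewritten with the integration over the other coordinates outside. *)
rewrite (@product_measure_unique _ _ _ _ _ lebesgue_measure (lebesgue_tuple n)
  (lebesgue_measure \x^ lebesgue_tuple n)%E) //; last first.
  by move=> X Y mX mY; exact: product_measure2E.
apply: integral0_eq => t _ /=.
have E : ysection B t `<=` [set x : measurableTypeR R | x = Num.sqrt (c - \sum_(i < n) (tnth t i : R) ^+ 2)]
    `|` [set - Num.sqrt (c - \sum_(i < n) (tnth t i : R) ^+ 2)].
  move=> x; rewrite /ysection /= inE /B /A /= big_ord_recl /=.
  rewrite (eq_bigr (fun i : 'I_n => (tnth t i : R) ^+ 2)); last first.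
    by move=> i _; rewrite tnthS.
  move=> h; have -> : c - \sum_(i < n) (tnth t i : R) ^+ 2 = (x : R) ^+ 2.
    by rewrite -h /tuple_cons /= addrK.
  rewrite sqrtr_sqr; case: (leP 0 (x : R)) => x0; [left|right] => /=; first by rewrite ger0_norm.
  by rewrite ltr0_norm // opprK.
have h2 (x y : R) : @lebesgue_measure R ([set z | z = x] `|` [set y]) = 0%E.
  apply/eqP; rewrite eq_le measure_ge0 andbT.
  have := @measureU2 _ (measurableTypeR R) R (@lebesgue_measure R) [set x] [set y]
    (measurable_set1 x) (measurable_set1 y).
  by move=> /le_trans; apply; rewrite /= !lebesgue_measure_set1 adde0.
apply/eqP; rewrite eq_le measure_ge0 andbT -(h2 (Num.sqrt (c - \sum_(i < n) (tnth t i : R) ^+ 2))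
  (- Num.sqrt (c - \sum_(i < n) (tnth t i : R) ^+ 2))).
apply: le_measure; rewrite ?inE.
- exact: measurable_ysection.
- by apply: measurableU; exact: measurable_set1.
- exact: E.
Qed.

Lemma null_sphere n (t : R) : (1 <= n)%N ->
  @lebesgue_euclidean R n [set y | enorm y = t] = 0%E.
Proof.
move=> n1; have [t0|t0] := ltP t 0.
  rewrite (_ : [set y | _] = set0) ?measure0 //.
  by apply/seteqP; split => // y /= h; move: t0; rewrite -h ltNge sqrtr_ge0.
have S0 (y : euclidean R n) : 0 <= \sum_(i < n) (tnth y i : R) ^+ 2.
  by apply: sumr_ge0 => i _; exact: sqr_ge0.
rewrite (_ : [set y | _] = [set y : euclidean R n | \sum_(i < n) (tnth y i : R) ^+ 2 = t ^+ 2]); last first.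
  apply/seteqP; split => y; rewrite /enorm /=.
    by move=> <-; rewrite sqr_sqrtr.
  by move=> ->; rewrite sqrtr_sqr ger0_norm.
(* The sphere is a Borel set, on which the completed measure agrees with the product measure. *)
rewrite /lebesgue_euclidean /completed_measure_extension measurable_mu_extE; first exact: null_sqnorm.
rewrite (_ : [set y | _] = setT `&` (fun y : n.-tuple (measurableTypeR R) =>
      \sum_(i < n) (tnth y i : R) ^+ 2) @^-1` [set t ^+ 2]); last by rewrite setTI.
exact: measurable_sqnorm.
Qed.

(** A vanishing integral would force [f = 0] almost everywhere on [D], and two null sets would cover
    [D]. *)
Lemma integral_gt0 d (T : measurableType d) (mu : {measure set T -> \bar R}) (D : set T)
  (f : T -> \bar R) : measurable D -> measurable_fun D f -> (forall x, D x -> 0 <= f x)%E ->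
  {ae mu, forall x, D x -> (0 < f x)%E} -> (0 < mu D)%E -> (0 < \int[mu]_(x in D) f x)%E.
Proof.
move=> mD mf f0 [N [mN N0 sN]] D0.
rewrite lt_neqAle integral_ge0 // andbT eq_sym; apply/eqP => E.
have /(ae_eq_integral_abs mu mD mf) [M [mM M0 sM]] : (\int[mu]_(x in D) `|f x| = 0)%E.
  rewrite -E; apply: eq_integral => x; rewrite inE => Dx; rewrite gee0_abs //; exact: f0.
have sD : D `<=` N `|` M.
  move=> x Dx; apply: contrapT => /not_orP[nN nM].
  have fx : (0 < f x)%E by apply: contrapT => h; apply: nN; apply: sN => /= /(_ Dx).
  apply: nM; apply: sM => /= /(_ Dx) h; by move: fx; rewrite h ltxx.
move: D0; rewrite ltNge => /negP; apply.
apply: (@le_trans _ _ (mu (N `|` M))); first by apply: le_measure; rewrite ?inE //; exact: measurableU.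
have := measureU2 mu mN mM; rewrite /= N0 M0 adde0; exact.
Qed.

Lemma measurable_inve d (T : measurableType d) (D : set T) (f : T -> \bar R) :
  measurable D -> measurable_fun D f -> (forall x, 0 <= f x)%E -> measurable_fun D (fun x => (f x)^-1)%E.
Proof.
move=> mD mf f0; apply: (measurability _ (ErealGenOInfty.measurableE R)).
move=> _ [_ [r ->] <-].
have [r0|r0] := ltP r 0.
  rewrite (_ : _ `&` _ = D) //; apply/seteqP; split => [x []//|x Dx]; split => //=.
  by rewrite in_itv/= andbT (lt_le_trans _ (_ : 0 <= _)%E) ?lte_fin // inve_ge0.
rewrite (_ : _ `&` _ = D `&` f @^-1` `]-oo, (r%:E)^-1%E[).
  by apply: mf => //; exact: emeasurable_itv.
have E x : (r%:E < (f x)^-1)%E = (f x < (r%:E)^-1)%E.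
  by apply: inve_pgt; rewrite inE ?lee_fin //; exact: f0.
by apply/seteqP; split => x [Dx /=]; rewrite in_itv/= ?andbT => h; split => //=;
  rewrite in_itv/= ?andbT ?E // -E.
Qed.

Lemma lebesgue_itv_gt0 (s t : R) : s < t -> (0 < mu1 `]s, t[%classic)%E.
Proof.
move=> st; rewrite /completed_lebesgue_measure.
rewrite (_ : (0 : \bar R) = 0%:E) //.
have -> : completed_lebesgue_stieltjes_measure idfun `]s, t[%classic = lebesgue_measure (`]s, t[%classic : set R).
  by [].
by rewrite lebesgue_measure_itv /= lte_fin st -EFinB lte_fin subr_gt0.
Qed.

End euclidean_facts.

Section concrete_weights.
Context {R : realType} {n : nat}.
Local Notation mun := (@lebesgue_euclidean R n).
Local Notation mu1 := (@completed_lebesgue_measure R).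
Variables (p1 p2 q1 q2 : R) (n_ge1 : (1 <= n)%N) (p2_gt0 : 0 < p2)
  (p21 : p2 < p1) (q21 : p2 < q1) (q22 : p2 < q2).

(** A weight is measurable on the half-line only; the extension of [w ^ q] by 0 is measurable and
    nonnegative everywhere and has the same integrals over subsets of [(0, +oo)]. *)
Definition normal_weight (q : R) (w : realR R -> \bar R) : realR R -> \bar R :=
  fun t => if 0 < t then (w t `^ q)%E else 0%E.

Lemma normal_weight_ge0 q w t : (0 <= normal_weight q w t)%E.
Proof. by rewrite /normal_weight; case: ifP => // _; exact: poweR_ge0. Qed.

Lemma measurable_normal_weight q w : halfline_weight w ->
  measurable_fun setT (normal_weight q w).
Proof.
move=> [mw _].
rewrite (_ : normal_weight q w = (fun t => (w t `^ q)%E) \_ (`]0%R, +oo[%classic : set (realR R))); last first.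
  apply/funext => t; rewrite /normal_weight /patch.
  have -> : (t \in (`]0%R, +oo[%classic : set (realR R))) = (0 < t).
    by apply/idP/idP; rewrite inE /= in_itv/= andbT.
  by [].
apply/(measurable_restrictT _ (measurable_itvR _)).
exact: (measurableT_comp (measurable_poweR q)).
Qed.

Lemma tail_normal q w t : 0 <= t -> tail_int (normal_weight q w) t = tail q w t.
Proof.
move=> t0; apply: eq_integral => s; rewrite inE /= in_itv/= andbT => ts.
by rewrite /normal_weight (le_lt_trans t0 ts).
Qed.

Lemma normal_weight_ae q w : 0 < q -> halfline_weight w ->
  {ae mu1, forall t, `]0%R, +oo[%classic t -> (0 < normal_weight q w t)%E}.
Proof.
move=> q0 [_ [N [mN N0 sN]]]; exists N; split => // t /= h; apply: sN => /= h'.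
apply: h => t0; have /andP[w0 _] := h' t0.
move: t0; rewrite /= in_itv/= andbT /normal_weight => ->.
by apply: poweR_gt0.
Qed.

Lemma tail_weight_normal q w : 0 < q -> halfline_weight w ->
  (forall t : R, 0 < t -> (tail q w t < +oo)%E) -> tail_weight (normal_weight q w).
Proof.
move=> q0 hw fin; split; [exact: measurable_normal_weight|exact: normal_weight_ge0|].
move=> t t0; apply/andP; split; last by rewrite tail_normal ?(ltW t0) //; exact: fin.
apply: integral_gt0.
- exact: measurable_itvR.
- by apply: measurable_funTS; exact: measurable_normal_weight.
- by move=> s _; exact: normal_weight_ge0.
- have [N [mN N0 sN]] := normal_weight_ae q0 hw.
  exists N; split => // s /= h; apply: sN => /= h'; apply: h.
  by rewrite in_itv/= andbT => ts; apply: h'; rewrite /= in_itv/= andbT (lt_trans t0 ts).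
- apply: (lt_le_trans (lebesgue_itv_gt0 (_ : t < t + 1))); first by rewrite ltrDl.
  apply: le_measure; rewrite ?inE; [exact: measurable_itvR..|].
  by move=> s /=; rewrite !in_itv/= => /andP[-> _].
Qed.

Definition density (v1 v2 : euclidean R n -> \bar R) (y : euclidean R n) : \bar R :=
  ((v1 y `^ (p1 * p2 / (p1 - p2)))^-1 * v2 y `^ (p1 * p2 / (p1 - p2)))%E.

Lemma density_ge0 v1 v2 y : (0 <= density v1 v2 y)%E.
Proof. by apply: mule_ge0; [rewrite inve_ge0; exact: poweR_ge0|exact: poweR_ge0]. Qed.

Lemma measurable_density v1 v2 : space_weight v1 -> space_weight v2 ->
  measurable_fun setT (density v1 v2).
Proof.
move=> [m1 _] [m2 _]; apply: emeasurable_funM.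
  apply: (measurable_inve measurableT); last by move=> y; exact: poweR_ge0.
  exact: (measurableT_comp (measurable_poweR _)).
exact: (measurableT_comp (measurable_poweR _)).
Qed.

Lemma measurable_eshell s t : measurable (@eshell R n s t).
Proof. exact: (@measurable_rshell R _ (euclidean R n) (@enorm R n) (@measurable_enorm R n) s t). Qed.

Section admissible_weights.
Variables (v1 v2 : euclidean R n -> \bar R) (w1 w2 : realR R -> \bar R).
Hypothesis adm : admissible p1 p2 q1 q2 v1 v2 w1 w2.

Let p10 : 0 < p1. Proof. exact: lt_trans p21. Qed.
Let q10 : 0 < q1. Proof. exact: lt_trans q21. Qed.
Let q20 : 0 < q2. Proof. exact: lt_trans q22. Qed.

Lemma adm_tail1 : tail_weight (normal_weight q1 w1).
Proof. by have [_ [hw _] ht _] := adm; apply: tail_weight_normal => // t /ht[]. Qed.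

Lemma adm_tail2 : tail_weight (normal_weight q2 w2).
Proof. by have [_ [_ hw] ht _] := adm; apply: tail_weight_normal => // t /ht[]. Qed.

Lemma adm_density : measurable_fun setT (density v1 v2).
Proof. by have [[h1 h2] _ _ _] := adm; exact: measurable_density. Qed.

(** For [s > 0] the tail is positive and finite, so the inverse of its power is the negative
    power. *)
Lemma omegaE s : 0 < s ->
  omega p2 q1 w1 s = dual_weight (q1 / p2) (normal_weight q1 w1) s.
Proof.
move=> s0; rewrite /omega /dual_weight /normal_weight s0 -(tail_normal _ _ (ltW s0)).
have W0 := rtail_gt0 adm_tail1 s0.
rewrite (rtailE adm_tail1 s0) poweR_EFin inver gt_eqF ?powR_gt0 //; congr (_%:E * _)%E.
rewrite -powRN; congr (_ `^ (- _)).
have h : q1 - p2 != 0 by rewrite gt_eqF // subr_gt0.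
have h2 : p2 != 0 by rewrite gt_eqF.
by field; rewrite ?mulN1r h h2.
Qed.

Lemma measurable_V t : measurable_fun setT (V p1 p2 v1 v2 ^~ t : realR R -> \bar R).
Proof.
apply: measurable_antihomo => r s rs; apply: ge0_subset_integral.
- exact: measurable_eshell.
- exact: measurable_eshell.
- by apply: measurable_funTS; exact: adm_density.
- by move=> y _; exact: density_ge0.
- by move=> y /= /andP[h1 h2]; apply/andP; split => //; exact: le_lt_trans h1.
Qed.

Lemma J_dual t : J p1 p2 q1 v1 v2 w1 t =
  (\int[mu1]_(s in `]0%R, t[) (V p1 p2 v1 v2 s t `^ (q1 * (p1 - p2) / (p1 * (q1 - p2)))
     * dual_weight (q1 / p2) (normal_weight q1 w1) s))%E.
Proof.
by apply: eq_integral => s; rewrite inE /= in_itv/= => /andP[s0 _]; rewrite omegaE.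
Qed.

(** If a shell with [s > 0] had infinite mass, so would all larger shells [(r, t)] with [r < s], and
    [J t] would be infinite, as the dual mass of [(0, s)] is positive. *)
Lemma density_shell_fin s t : 0 < s -> (eV mun (@enorm R n) (density v1 v2) s t < +oo)%E.
Proof.
move=> s0; rewrite ltey; apply/eqP => E.
have [st|ts] := ltP s t; last first.
  move: E; rewrite /eV (_ : rshell _ s t = set0) ?integral_set0 //.
  apply/seteqP; split => // y /= /andP[h1 h2].
  by have := lt_trans h1 h2; rewrite ltNge ts.
have t0 : 0 < t by exact: lt_trans st.
have [_ [hw _] _ hJ] := adm; have /andP[_ Jt] := hJ t t0.
have e0 : 0 < q1 * (p1 - p2) / (p1 * (q1 - p2)).
  by rewrite divr_gt0 // mulr_gt0 // subr_gt0.
have Voo r : 0 < r -> r < s -> V p1 p2 v1 v2 r t = +oo%E.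
  move=> r0 rs; apply/eqP; rewrite -leye_eq -E.
  apply: ge0_subset_integral.
  - exact: measurable_eshell.
  - exact: measurable_eshell.
  - by apply: measurable_funTS; exact: adm_density.
  - by move=> y _; exact: density_ge0.
  - by move=> y /= /andP[h1 h2]; apply/andP; split => //; exact: lt_trans h1.
have [mo o0] := dual_nnweight (q1 / p2) adm_tail1.
have c0 : (0 < \int[mu1]_(r in `]0%R, s[) dual_weight (q1 / p2) (normal_weight q1 w1) r)%E.
  apply: integral_gt0.
  - exact: measurable_itvR.
  - exact: measurable_funTS.
  - by move=> r _; exact: o0.
  - have [N [mN N0 sN]] := normal_weight_ae q10 hw.
    exists N; split => // r /= h; apply: sN => /= h'; apply: h.
    rewrite in_itv/= => /andP[r0 _]; apply: mule_gt0.
      by rewrite lte_fin powR_gt0 // (rtail_gt0 adm_tail1).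
    by apply: h'; rewrite /= in_itv/= andbT.
  - exact: lebesgue_itv_gt0.
have bnd k : 0 < k -> (k%:E * \int[mu1]_(r in `]0%R, s[) dual_weight (q1 / p2) (normal_weight q1 w1) r
    <= J p1 p2 q1 v1 v2 w1 t)%E.
  move=> k0; rewrite -ge0_integralZl; first last.
  - by rewrite lee_fin ltW.
  - by move=> r _; exact: o0.
  - exact: measurable_funTS.
  - exact: measurable_itvR.
  have mI : measurable_fun setT (fun r : realR R => V p1 p2 v1 v2 r t `^ (q1 * (p1 - p2) / (p1 * (q1 - p2)))
     * dual_weight (q1 / p2) (normal_weight q1 w1) r)%E.
    apply: emeasurable_funM; last exact: mo.
    by apply: (measurableT_comp (measurable_poweR _)); exact: measurable_V.
  have I0 (r : realR R) : (0 <= V p1 p2 v1 v2 r t `^ (q1 * (p1 - p2) / (p1 * (q1 - p2)))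
     * dual_weight (q1 / p2) (normal_weight q1 w1) r)%E.
    by apply: mule_ge0; [exact: poweR_ge0|exact: o0].
  rewrite J_dual; apply: (@le_trans _ _ (\int[mu1]_(r in `]0%R, s[)
    (V p1 p2 v1 v2 r t `^ (q1 * (p1 - p2) / (p1 * (q1 - p2)))
     * dual_weight (q1 / p2) (normal_weight q1 w1) r))%E); last first.
    apply: (integral_itv_subset mI I0) => r /=; rewrite !in_itv/= => /andP[-> rs].
    exact: lt_trans rs st.
  apply: ge0_le_integral.
  - exact: measurable_itvR.
  - by move=> r _; apply: mule_ge0 (o0 r); rewrite lee_fin ltW.
  - by apply: measurable_funTS; apply: emeasurable_funM; [exact: measurable_cst|exact: mo].
  - exact: measurable_funTS.
  move=> r; rewrite /= in_itv/= => /andP[r0 rs]; apply: lee_wpmul2r; first exact: o0.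
  by rewrite (Voo r r0 rs) poweRyr ?gt_eqF // leey.
have J0 : (0 <= J p1 p2 q1 v1 v2 w1 t)%E.
  rewrite J_dual; apply: integral_ge0 => r _.
  by apply: mule_ge0; [exact: poweR_ge0|exact: o0].
have Jfin : J p1 p2 q1 v1 v2 w1 t \is a fin_num by rewrite ge0_fin_numE.
have j0 : 0 <= fine (J p1 p2 q1 v1 v2 w1 t) by exact: fine_ge0.
move: bnd; rewrite -(fineK Jfin) => bnd.
have cfin : (\int[mu1]_(r in `]0%R, s[) dual_weight (q1 / p2) (normal_weight q1 w1) r)%E \is a fin_num.
  rewrite ge0_fin_numE ?(ltW c0) //; apply: le_lt_trans (ltry (fine (J p1 p2 q1 v1 v2 w1 t))).
  by have := bnd 1 ltr01; rewrite mul1e.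
move: c0 bnd; rewrite -(fineK cfin) lte_fin; move: (fine _) => c c0 bnd.
move: j0 bnd; move: (fine _) => j j0 /(_ ((j + 1) / c)).
rewrite -EFinM lee_fin divfK ?gt_eqF // => h.
have : 0 < (j + 1) / c by rewrite divr_gt0 //; lra.
by move=> /h; lra.
Qed.

Lemma adm_radial : radial_weight mun (@enorm R n) (density v1 v2).
Proof.
by split; [exact: adm_density|exact: density_ge0|exact: density_shell_fin].
Qed.

Local Notation rV := (rV mun (@enorm R n) (density v1 v2)).

Lemma adm_shell_data : shell_data rV.
Proof.
apply: (shell_data_radial _ _ adm_radial); first exact: measurable_enorm.
by move=> t; exact: null_sphere.
Qed.

Lemma VE s t : 0 < s -> V p1 p2 v1 v2 s t = (rV s t)%:E.
Proof.
move=> s0; have := @eVE R _ _ mun (@enorm R n) (density v1 v2) (density_ge0 v1 v2) density_shell_fin s t s0.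
exact.
Qed.

Lemma theta_normal : q1 * (p1 - p2) / (p1 * (q1 - p2)) = theta (p1 / p2) (q1 / p2).
Proof.
have [h1 h2] : p2 != 0 /\ p1 != 0 by rewrite !gt_eqF.
have h3 : q1 - p2 != 0 by rewrite gt_eqF // subr_gt0.
by rewrite /theta; field; rewrite ?mulN1r h1 h2 h3.
Qed.

Lemma J_normal t : J p1 p2 q1 v1 v2 w1 t =
  Jint (p1 / p2) (q1 / p2) (normal_weight q1 w1) rV 0 t.
Proof.
rewrite J_dual theta_normal; apply: eq_integral => s; rewrite inE /= in_itv/= => /andP[s0 _].
by rewrite VE // poweR_EFin.
Qed.

Lemma adm_Jfinite : Jfinite (p1 / p2) (q1 / p2) (normal_weight q1 w1) rV.
Proof.
by move=> t t0; rewrite -J_normal; have [_ _ _ hJ] := adm; have /andP[] := hJ t t0.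
Qed.

End admissible_weights.
End concrete_weights.

(** * The characteristics as conditions *)

Lemma poweR_le_powR (R : realType) (s S : R) (X : \bar R) : 0 < s -> 0 <= S -> (0 <= X)%E ->
  (X `^ s <= (S `^ s)%:E)%E <-> (X <= S%:E)%E.
Proof.
move=> s0 S0; case: X => [x| |] // X0; last by rewrite poweRyr ?gt_eqF //.
rewrite poweR_EFin !lee_fin; split => h; first exact: le_powR_inv h.
by apply: le_powR => //; exact: ltW.
Qed.

Section exhaustion.
Context {R : realType}.
Local Notation mu1 := (@completed_lebesgue_measure R).

(** The limit of vanishing inner radius. [g] is at most the supremum of the [gn], so the sets where
    [g <= 2 gn] exhaust the half-line, at the price of the factor [2 ^ r]. *)
Lemma exhaust_wint (w : realR R -> \bar R) (g : R -> R) (gn : nat -> R -> R) (X : realR R -> R) (r M : R) :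
  nnweight w -> 0 < r -> posmeas (g : realR R -> R) -> (forall n, posmeas (gn n : realR R -> R)) ->
  (forall m n t, (m <= n)%N -> m.+1%:R^-1 < t -> gn m t <= gn n t) ->
  (forall t K, 0 < t -> (forall n, n.+1%:R^-1 < t -> gn n t <= K) -> g t <= K) ->
  posmeas X -> 0 <= M ->
  (forall n, (wint w `](n.+1%:R^-1)%R, +oo[ (fun t => gn n t `^ r * X t)%R <= M%:E)%E) ->
  (wint w `]0%R, +oo[ (fun t => g t `^ r * X t)%R <= (2 `^ r * M)%:E)%E.
Proof.
move=> hw r0 pg pgn gmono glim pX M0 hM.
pose c n : R := n.+1%:R^-1; have c0 n : 0 < c n by rewrite invr_gt0 ltr0Sn.
have cm m n : (m <= n)%N -> c n <= c m by move=> mn; rewrite lef_pV2 ?posrE ?ltr0Sn // ler_nat ltnS.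
have cs s : 0 < s -> exists n, c n < s.
  by move=> s0; have [n _ hn] := near_infty_natSinv_lt (PosNum s0); exists n; exact: (hn n (leqnn n)).
pose E n := [set t : realR R | c n < t /\ g t <= 2 * gn n t].
have pgX : posmeas (fun t : realR R => g t `^ r * X t).
  by apply: posmeasM pX; apply: posmeas_powR; exact: pg.1.
have pgnX n : posmeas (fun t : realR R => gn n t `^ r * X t).
  by apply: posmeasM pX; apply: posmeas_powR; exact: (pgn n).1.
have [m1 m2] := posmeas_nnweight hw pgX.
have mE n : measurable (E n).
  rewrite (_ : E n = `]c n, +oo[%classic `&` [set t | ((g t)%:E <= (2 * gn n t)%:E)%E]); last first.
    apply/seteqP; split => t /=.
      by move=> [ct Jt]; rewrite in_itv/= ct lee_fin.
    by move=> []; rewrite in_itv/= andbT lee_fin.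
  apply: emeasurable_fun_le; first exact: measurable_itvR.
    by apply/measurable_EFinP; apply: measurable_funTS; exact: pg.1.
  apply/measurable_EFinP; apply: measurable_funTS; apply: measurable_funM; first exact: measurable_cst.
  exact: (pgn n).1.
have EU : `]0%R, +oo[%classic = \bigcup_n E n.
  apply/seteqP; split => t /=; last first.
    by case=> n _ [ct _]; rewrite in_itv/= andbT; exact: lt_trans ct.
  rewrite in_itv/= andbT => t0; apply: contrapT => hE.
  have hn n : c n < t -> gn n t <= g t / 2.
    move=> ct; rewrite leNgt; apply/negP => h; apply: hE; exists n => //; split=> //; lra.
  have [n ct] := cs t t0.
  have := glim t _ t0 hn => h.
  apply: hE; exists n => //; split => //; have := (pgn n).2 t; lra.
rewrite /wint EU; apply: (integral_bigcup_le (mu := mu1)).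
- move=> m n mn t [ct Jt]; split; first exact: le_lt_trans (cm _ _ mn) ct.
  by apply: (le_trans Jt); apply: ler_wpM2l => //; exact: gmono.
- exact: mE.
- by apply: measurable_funTS; exact: m1.
- exact: m2.
move=> n; have [m3 m4] := posmeas_nnweight hw (pgnX n).
apply: (@le_trans _ _ (\int[mu1]_(t in E n) ((2 `^ r)%:E * ((gn n t `^ r * X t)%:E * w t)))%E).
  apply: ge0_le_integral.
  - exact: mE.
  - by move=> t _; exact: m2.
  - by apply: measurable_funTS; exact: m1.
  - by apply: measurable_funTS; apply: emeasurable_funM; [exact: measurable_cst|exact: m3].
  move=> t [ct Jt]; rewrite muleA -EFinM; apply: lee_wpmul2r; first exact: hw.2.
  rewrite lee_fin mulrA; apply: ler_wpM2r; first exact: pX.2.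
  rewrite -(powRM _ (ler0n _ 2) ((pgn n).2 t)); apply: le_powR => //; [exact: ltW|exact: pg.2].
rewrite ge0_integralZl; first last.
- by rewrite lee_fin powR_ge0.
- by move=> t _; exact: m4.
- by apply: measurable_funTS; exact: m3.
- exact: mE.
rewrite EFinM; apply: lee_wpmul2l; first by rewrite lee_fin powR_ge0.
apply: le_trans (hM n); apply: ge0_subset_integral.
- exact: mE.
- exact: measurable_itvR.
- by apply: measurable_funTS; exact: m3.
- by move=> t _; exact: m4.
- by move=> t [ct _] /=; rewrite in_itv/= andbT.
Qed.

End exhaustion.

Section conversions.
Context {R : realType} {n : nat}.
Local Notation mun := (@lebesgue_euclidean R n).
Local Notation mu1 := (@completed_lebesgue_measure R).
Variables (p1 p2 q1 q2 : R) (n_ge1 : (1 <= n)%N) (p2_gt0 : 0 < p2)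
  (p21 : p2 < p1) (q21 : p2 < q1) (q22 : p2 < q2).
Variables (v1 v2 : euclidean R n -> \bar R) (w1 w2 : realR R -> \bar R).
Hypothesis adm : admissible p1 p2 q1 q2 v1 v2 w1 w2.
Local Notation u := (density p1 p2 v1 v2).
Local Notation rV := (rV mun (@enorm R n) u).
Local Notation N1 := (normal_weight q1 w1).
Local Notation N2 := (normal_weight q2 w2).
Local Notation p := (p1 / p2).
Local Notation a := (q1 / p2).
Local Notation b := (q2 / p2).

Let p10 : 0 < p1. Proof. exact: lt_trans p21. Qed.
Let q10 : 0 < q1. Proof. exact: lt_trans q21. Qed.
Let q20 : 0 < q2. Proof. exact: lt_trans q22. Qed.
Let p2n : p2 != 0. Proof. by rewrite gt_eqF. Qed.
Let p1n : p1 != 0. Proof. by rewrite gt_eqF. Qed.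
Let q1n : q1 != 0. Proof. by rewrite gt_eqF. Qed.
Let q2n : q2 != 0. Proof. by rewrite gt_eqF. Qed.
Let q1p2n : q1 - p2 != 0. Proof. by rewrite gt_eqF // subr_gt0. Qed.
Let p1p2n : p1 - p2 != 0. Proof. by rewrite gt_eqF // subr_gt0. Qed.
Let h1 : tail_weight N1. Proof. exact: (adm_tail1 p2_gt0 q21 adm). Qed.
Let h2 : tail_weight N2. Proof. exact: (adm_tail2 p2_gt0 q22 adm). Qed.
Let hV : shell_data rV. Proof. exact: (adm_shell_data n_ge1 p2_gt0 p21 q21 adm). Qed.
Let hJ : Jfinite p a N1 rV. Proof. exact: (adm_Jfinite p2_gt0 p21 q21 adm). Qed.
Let pe0 : 0 < p2^-1. Proof. by rewrite invr_gt0. Qed.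

Lemma tail2E t : 0 < t -> tail q2 w2 t = (rtail N2 t)%:E.
Proof. by move=> t0; rewrite -(tail_normal _ _ (ltW t0)) (rtailE h2 t0). Qed.

Lemma J_realE t : 0 < t -> J p1 p2 q1 v1 v2 w1 t = (Jreal p a N1 rV t)%:E.
Proof. by move=> t0; rewrite (J_normal p2_gt0 p21 q21 adm); exact: JrealE. Qed.

Lemma dual_intE t : (\int[mu1]_(s in `]0%R, t[) omega p2 q1 w1 s)%E = dual_int a N1 t.
Proof.
by apply: eq_integral => s; rewrite inE /= in_itv/= => /andP[s0 _]; rewrite (omegaE p2_gt0 q21 adm s0).
Qed.

(** [S] is a constant for [g = (|f| v2) ^ p2], hence the power [1 / p2] between it and the
    characteristics, here and in the conversions below. *)
Lemma I4_cond S : 0 <= S -> (I4 p1 p2 q1 q2 v1 v2 w1 w2 <= (S `^ p2^-1)%:E)%E <->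
  J_cond p a b N1 N2 rV S.
Proof.
move=> S0.
have E t : 0 < t -> (tail q2 w2 t `^ q2^-1 * J p1 p2 q1 v1 v2 w1 t `^ ((q1 - p2) / (q1 * p2)))%E =
   ((Jreal p a N1 rV t `^ ((a - 1) / a) * rtail N2 t `^ b^-1) `^ p2^-1)%:E.
  move=> t0; rewrite (tail2E t0) (J_realE t0) poweR_EFin poweR_EFin -EFinM; congr (_%:E).
  rewrite [RHS](powRM _ (powR_ge0 _ _) (powR_ge0 _ _)) [LHS]mulrC.
  rewrite -[X in _ = X * _]powRrM -[X in _ = _ * X]powRrM.
  by congr (_ `^ _ * _ `^ _); field; rewrite ?q1n ?q2n ?p2n.
have X0 t : 0 <= Jreal p a N1 rV t `^ ((a - 1) / a) * rtail N2 t `^ b^-1.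
  by rewrite mulr_ge0 ?powR_ge0.
split=> [h t t0|h].
  apply: (le_powR_inv pe0 S0); rewrite -lee_fin -(E t t0).
  by apply: le_trans h; apply: ereal_sup_ubound; exists t => //=; rewrite in_itv/= t0.
apply: ge_ereal_sup => _ [t t0 <-]; move: t0; rewrite /= in_itv/= andbT => t0.
by rewrite (E t t0) lee_fin; apply: (le_powR (ltW pe0) (X0 t)); exact: h.
Qed.

Lemma power_conv (q S : R) (X : \bar R) : q2 < q1 -> 0 <= S -> (0 <= X)%E ->
  (X `^ ((q1 - q2) / (q1 * q2)) <= (S `^ p2^-1)%:E)%E <->
  (X <= (S `^ (a * b / (a - b)))%:E)%E.
Proof.
move=> q12 S0 X0; have qn : q1 - q2 != 0 by rewrite gt_eqF // subr_gt0.
have -> : S `^ p2^-1 = (S `^ (a * b / (a - b))) `^ ((q1 - q2) / (q1 * q2)).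
  by rewrite -powRrM; congr (_ `^ _); field; rewrite ?mulN1r ?q1n ?q2n ?p2n ?qn.
by apply: poweR_le_powR => //; [rewrite divr_gt0 ?mulr_gt0 // subr_gt0|exact: powR_ge0].
Qed.

Lemma exponentE : q2 < q1 -> q1 * (q2 - p2) / (p2 * (q1 - q2)) = a * (b - 1) / (a - b).
Proof.
move=> q12; have qn : q1 - q2 != 0 by rewrite gt_eqF // subr_gt0.
by field; rewrite ?mulN1r ?p2n ?qn.
Qed.

(** The value [+oo] for [t <= 0] makes the function nonincreasing on the whole line, hence
    measurable. *)
Definition sup_from (e1 e2 : R) (t : R) : \bar R := if 0 < t then
  ereal_sup [set (V p1 p2 v1 v2 t z `^ e1 * tail q2 w2 z `^ e2)%E | z in `]t, +oo[%classic] else +oo%E.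

Lemma sup_from_ge0 e1 e2 t : (0 <= sup_from e1 e2 t)%E.
Proof.
rewrite /sup_from; case: ifP => // t0.
apply: (@le_trans _ _ (V p1 p2 v1 v2 t (t + 1) `^ e1 * tail q2 w2 (t + 1) `^ e2)%E).
  by apply: mule_ge0; exact: poweR_ge0.
by apply: ereal_sup_ubound; exists (t + 1) => //=; rewrite in_itv/= andbT ltrDl.
Qed.

Lemma sup_from_le e1 e2 t X : 0 < t ->
  (sup_from e1 e2 t <= X)%E <->
  (forall z, t < z -> ((rV t z `^ e1 * rtail N2 z `^ e2)%:E <= X)%E).
Proof.
move=> t0; rewrite /sup_from t0.
have E z : t < z -> (V p1 p2 v1 v2 t z `^ e1 * tail q2 w2 z `^ e2)%E = (rV t z `^ e1 * rtail N2 z `^ e2)%:E.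
  move=> tz; rewrite (tail2E (lt_trans t0 tz)) (VE p2_gt0 p21 q21 adm _ t0).
  by rewrite poweR_EFin poweR_EFin -EFinM.
split=> [h z tz|h].
  rewrite -(E z tz); apply: le_trans h; apply: ereal_sup_ubound; exists z => //=.
  by rewrite in_itv/= andbT.
apply: ge_ereal_sup => _ [z tz <-]; move: tz; rewrite /= in_itv/= andbT => tz.
by rewrite (E z tz); exact: h.
Qed.

Lemma sup_from_anti e1 e2 s t : 0 <= e1 -> s <= t -> (sup_from e1 e2 t <= sup_from e1 e2 s)%E.
Proof.
move=> e10 st; have [s0|s0] := ltP 0 s; last by rewrite {2}/sup_from ltNge s0 leey.
have t0 : 0 < t by exact: lt_le_trans st.
have [[V0 Vm] _ _ _] := hV.
apply/(sup_from_le _ _ _ t0) => z tz.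
have := (sup_from_le e1 e2 (sup_from e1 e2 s) s0).1 (lexx _) z (le_lt_trans st tz).
apply: le_trans; rewrite lee_fin; apply: ler_wpM2r; first exact: powR_ge0.
by apply: le_powR => //; exact: (Vm _ _ _ _ s0 st (lexx _)).
Qed.

Lemma measurable_sup_from e1 e2 : 0 <= e1 ->
  measurable_fun setT (sup_from e1 e2 : realR R -> \bar R).
Proof. by move=> e10; apply: measurable_antihomo => s t; exact: sup_from_anti. Qed.

Lemma shell_sup_from : q2 < q1 ->
  shell_sup p a b N2 rV (sup_from (q1 * (p1 - p2) / (p1 * (q1 - p2))) (q1 / (q1 - q2))).
Proof.
move=> q12; have qn : q1 - q2 != 0 by rewrite gt_eqF // subr_gt0.
have e10 : 0 <= q1 * (p1 - p2) / (p1 * (q1 - p2)).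
  by rewrite divr_ge0 // mulr_ge0 // ?(ltW q10) ?(ltW p10) // subr_ge0 ltW.
have ee : q1 / (q1 - q2) = a / (a - b) by field; rewrite ?mulN1r ?p2n ?qn.
split.
- exact: measurable_sup_from.
- exact: sup_from_ge0.
- by move=> s t; exact: sup_from_anti.
- move=> t z t0 tz; rewrite -(theta_normal p2_gt0 p21 q21) -ee.
  exact: ((sup_from_le _ _ _ t0).1 (lexx _) z tz).
- move=> t X t0; rewrite -(theta_normal p2_gt0 p21 q21) -ee => h.
  exact/(sup_from_le _ _ _ t0).
Qed.

Lemma I6_cond S : q2 < q1 -> 0 <= S -> (I6 p1 p2 q1 q2 v1 v2 w1 w2 <= (S `^ p2^-1)%:E)%E <->
  M_cond p a b N1 rV (sup_from (q1 * (p1 - p2) / (p1 * (q1 - p2))) (q1 / (q1 - q2))) S.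
Proof.
move=> q12 S0; have qn : q1 - q2 != 0 by rewrite gt_eqF // subr_gt0.
have E : (\int[mu1]_(t in `]0%R, +oo[)
     (J p1 p2 q1 v1 v2 w1 t `^ (q1 * (q2 - p2) / (p2 * (q1 - q2)))
      * ereal_sup
          [set V p1 p2 v1 v2 t z `^ (q1 * (p1 - p2) / (p1 * (q1 - p2)))
               * tail q2 w2 z `^ (q1 / (q1 - q2))
          | z in `]t, +oo[%classic]
      * omega p2 q1 w1 t) = \int[mu1]_(t in `]0%R, +oo[)
     ((Jreal p a N1 rV t `^ (a * (b - 1) / (a - b)))%:E *
      sup_from (q1 * (p1 - p2) / (p1 * (q1 - p2))) (q1 / (q1 - q2)) t * dual_weight a N1 t))%E.
  apply: eq_integral => t; rewrite inE /= in_itv/= andbT => t0.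
  by rewrite (J_realE t0) poweR_EFin (omegaE p2_gt0 q21 adm t0) /sup_from t0 (exponentE q12).
rewrite /I6 E; apply: power_conv => //.
apply: integral_ge0 => t _; apply: mule_ge0; last exact: (dual_nnweight _ h1).2.
by apply: mule_ge0; [rewrite lee_fin powR_ge0|exact: sup_from_ge0].
Qed.

Lemma Q_conv Q S : q2 < q1 -> 0 <= S -> (forall t, 0 <= Q t)%E ->
  ((\int[mu1]_(t in `]0%R, +oo[)
     ((\int[mu1]_(s in `]0%R, t[) omega p2 q1 w1 s)
        `^ (q1 * (q2 - p2) / (p2 * (q1 - q2)))
      * omega p2 q1 w1 t * Q t)) `^ ((q1 - q2) / (q1 * q2)) <= (S `^ p2^-1)%:E)%E <->
  Q_cond a b N1 Q S.
Proof.
move=> q12 S0 Q0; have qn : q1 - q2 != 0 by rewrite gt_eqF // subr_gt0.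
rewrite (_ : (\int[mu1]_(t in `]0%R, +oo[) _)%E = (\int[mu1]_(t in `]0%R, +oo[)
     (dual_int a N1 t `^ (a * (b - 1) / (a - b)) * dual_weight a N1 t * Q t))%E).
  apply: power_conv => //.
  by apply: integral_ge0 => t _; exact: dual_integrand_ge0.
apply: eq_integral => t; rewrite inE /= in_itv/= andbT => t0.
by rewrite dual_intE (omegaE p2_gt0 q21 adm t0) (exponentE q12).
Qed.

(** For [p <= b] the Hardy condition is the one with a supremum, and its [r]-th power is the
    supremum in [I_5]. *)
Lemma hardy_power_sup : q2 < q1 -> p1 <= q2 ->
  hardy_power p b (a * b / (a - b)) N2 rV
    (sup_from (q1 * q2 * (p1 - p2) / (p1 * p2 * (q1 - q2))) (q1 / (q1 - q2))).
Proof.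
move=> q12 pq; have qn : q1 - q2 != 0 by rewrite gt_eqF // subr_gt0.
have r0 : 0 < a * b / (a - b).
  have -> : a * b / (a - b) = q1 * q2 / (p2 * (q1 - q2)) by field; rewrite ?mulN1r ?p2n ?qn.
  by rewrite divr_gt0 ?mulr_gt0 // subr_gt0.
have e10 : 0 <= q1 * q2 * (p1 - p2) / (p1 * p2 * (q1 - q2)).
  by rewrite divr_ge0 // !mulr_ge0 // ?(ltW q10) ?(ltW q20) ?(ltW p10) ?(ltW p2_gt0) // subr_ge0 ltW.
have pb : p <= b by rewrite ler_pM2r.
split.
- exact: measurable_sup_from.
- exact: sup_from_ge0.
- by move=> s t _; exact: sup_from_anti.
move=> t h t0 hh0.
have E z : rV t z `^ (q1 * q2 * (p1 - p2) / (p1 * p2 * (q1 - q2))) * rtail N2 z `^ (q1 / (q1 - q2)) =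
    (rV t z `^ ((p - 1) / p) * rtail N2 z `^ b^-1) `^ (a * b / (a - b)).
  rewrite (powRM _ (powR_ge0 _ _) (powR_ge0 _ _)) -!powRrM.
  by congr (_ `^ _ * _ `^ _); field; rewrite ?mulN1r ?p2n ?qn ?p1n ?q2n.
split=> [/(sup_from_le _ _ _ t0) H|[H _]].
  split=> [_ z tz|]; last by rewrite ltNge pb.
  by apply: (le_powR_inv r0 hh0); rewrite -E -lee_fin; exact: H.
apply/(sup_from_le _ _ _ t0) => z tz; rewrite E lee_fin; apply: le_powR; first exact: ltW.
  by rewrite mulr_ge0 ?powR_ge0.
exact: H.
Qed.

Lemma I5_cond S : q2 < q1 -> 0 <= S -> (I5 p1 p2 q1 q2 v1 v2 w1 w2 <= (S `^ p2^-1)%:E)%E <->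
  Q_cond a b N1 (sup_from (q1 * q2 * (p1 - p2) / (p1 * p2 * (q1 - q2))) (q1 / (q1 - q2))) S.
Proof.
move=> q12 S0; have <- := Q_conv q12 S0 (sup_from_ge0 _ _).
rewrite /I5 (_ : (\int[mu1]_(t in `]0%R, +oo[) _)%E = (\int[mu1]_(t in `]0%R, +oo[)
     ((\int[mu1]_(s in `]0%R, t[) omega p2 q1 w1 s)
        `^ (q1 * (q2 - p2) / (p2 * (q1 - q2)))
      * omega p2 q1 w1 t *
      sup_from (q1 * q2 * (p1 - p2) / (p1 * p2 * (q1 - q2))) (q1 / (q1 - q2)) t))%E) //.
by apply: eq_integral => t; rewrite inE /= in_itv/= andbT => t0; rewrite /sup_from t0.
Qed.

End conversions.

(** * Conversion of [I_3], [I_7], [I_8] and [I_9] *)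

Section conversions.
Context {R : realType} {n : nat}.
Local Notation mun := (@lebesgue_euclidean R n).
Local Notation mu1 := (@completed_lebesgue_measure R).
Variables (p1 p2 q1 q2 : R) (n_ge1 : (1 <= n)%N) (p2_gt0 : 0 < p2)
  (p21 : p2 < p1) (q21 : p2 < q1) (q22 : p2 < q2).
Variables (v1 v2 : euclidean R n -> \bar R) (w1 w2 : realR R -> \bar R).
Hypothesis adm : admissible p1 p2 q1 q2 v1 v2 w1 w2.
Local Notation u := (density p1 p2 v1 v2).
Local Notation rV := (rV mun (@enorm R n) u).
Local Notation N1 := (normal_weight q1 w1).
Local Notation N2 := (normal_weight q2 w2).
Local Notation p := (p1 / p2).
Local Notation a := (q1 / p2).
Local Notation b := (q2 / p2).

Let p10 : 0 < p1. Proof. exact: lt_trans p21. Qed.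
Let q10 : 0 < q1. Proof. exact: lt_trans q21. Qed.
Let q20 : 0 < q2. Proof. exact: lt_trans q22. Qed.
Let p2n : p2 != 0. Proof. by rewrite gt_eqF. Qed.
Let p1n : p1 != 0. Proof. by rewrite gt_eqF. Qed.
Let q1n : q1 != 0. Proof. by rewrite gt_eqF. Qed.
Let q2n : q2 != 0. Proof. by rewrite gt_eqF. Qed.
Let q1p2n : q1 - p2 != 0. Proof. by rewrite gt_eqF // subr_gt0. Qed.
Let p1p2n : p1 - p2 != 0. Proof. by rewrite gt_eqF // subr_gt0. Qed.
Let h1 : tail_weight N1. Proof. exact: (adm_tail1 p2_gt0 q21 adm). Qed.
Let h2 : tail_weight N2. Proof. exact: (adm_tail2 p2_gt0 q22 adm). Qed.
Let hV : shell_data rV. Proof. exact: (adm_shell_data n_ge1 p2_gt0 p21 q21 adm). Qed.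
Let hJ : Jfinite p a N1 rV. Proof. exact: (adm_Jfinite p2_gt0 p21 q21 adm). Qed.
Let pe0 : 0 < p2^-1. Proof. by rewrite invr_gt0. Qed.

Lemma exponentK : q2 < p1 -> [/\ q2 * (p1 - p2) / (p2 * (p1 - q2)) = b * (p - 1) / (p - b),
  q2 / (p1 - q2) = b / (p - b), 0 < b * (p - 1) / (p - b), 0 < b / (p - b) & 0 < p * b / (p - b)].
Proof.
move=> qp; have qn : p1 - q2 != 0 by rewrite gt_eqF // subr_gt0.
have e1 : q2 * (p1 - p2) / (p2 * (p1 - q2)) = b * (p - 1) / (p - b).
  by field; rewrite ?mulN1r ?p2n ?qn.
have e2 : q2 / (p1 - q2) = b / (p - b) by field; rewrite ?mulN1r ?p2n ?qn.
have b0 : 0 < b by rewrite divr_gt0.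
have pb : 0 < p - b by rewrite subr_gt0 ltr_pM2r.
have pp : 0 < p by rewrite divr_gt0.
split=> //; [|by rewrite divr_gt0|by rewrite divr_gt0 ?mulr_gt0].
by rewrite divr_gt0 ?mulr_gt0 // subr_gt0 ltr_pdivlMr // mul1r.
Qed.

(** For positive [t] and [q2 < p1] this is [K], written with real-valued shells. *)
Definition Kint (t : R) : \bar R := wint N2 `]t, +oo[ (fun s => rV t s `^ (b * (p - 1) / (p - b)) *
  rtail N2 s `^ (b / (p - b)))%R.

Lemma posmeas_K t : 0 < t -> posmeas (fun s : realR R => rV t s `^ (b * (p - 1) / (p - b)) *
  rtail N2 s `^ (b / (p - b))).
Proof.
move=> t0; apply: posmeasM; last exact: posmeas_rtail_powR.
by apply: posmeas_shell_powR => //; have [] := hV.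
Qed.

Lemma K_normal t : q2 < p1 -> 0 < t -> K p1 p2 q2 v1 v2 w2 t = Kint t.
Proof.
move=> qp t0; have [e1 e2 _ _ _] := exponentK qp.
apply: eq_integral => s; rewrite inE /= in_itv/= andbT => ts.
have s0 : 0 < s by exact: lt_trans ts.
rewrite (VE p2_gt0 p21 q21 adm _ t0) (tail2E p2_gt0 q22 adm s0) poweR_EFin poweR_EFin -EFinM e1 e2.
by rewrite /normal_weight s0.
Qed.

Lemma Kint_ge0 t : 0 < t -> (0 <= Kint t)%E.
Proof. by move=> t0; apply: (wint_ge0 (tail_nnweight h2)); exact: posmeas_K. Qed.

Lemma Kint_anti s t : q2 < p1 -> 0 < s -> s <= t -> (Kint t <= Kint s)%E.
Proof.
move=> qp s0 st; have t0 : 0 < t by exact: lt_le_trans st.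
have [_ _ e0 _ _] := exponentK qp; have [[V0 Vm] _ _ _] := hV.
apply: (@le_trans _ _ (wint N2 `]t, +oo[ (fun r => rV s r `^ (b * (p - 1) / (p - b)) *
  rtail N2 r `^ (b / (p - b)))%R)).
  apply: (wint_le (tail_nnweight h2) (posmeas_K t0) (posmeas_K s0)) => r _.
  apply: ler_wpM2r; first exact: powR_ge0.
  by apply: le_powR; [exact: ltW|exact: V0|exact: (Vm _ _ _ _ s0 st (lexx _))].
apply: (wint_subset (tail_nnweight h2) (posmeas_K s0)) => r /=.
by rewrite !in_itv/= !andbT; exact: le_lt_trans.
Qed.

Lemma hardy_cond_K x h : q2 < p1 -> hardy_cond p b N2 rV x h <->
  (Kint x <= (h `^ (p * b / (p - b)))%:E)%E.
Proof.
move=> qp; have bp : b < p by rewrite ltr_pM2r.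
split=> [[_ H]|H]; first exact: H.
by split=> [|_ //]; rewrite leNgt bp.
Qed.

(** The value [+oo] at [t <= 0] has the same reason as in [sup_from]. *)
Definition K_power (e t : R) : \bar R := if 0 < t then (Kint t `^ e)%E else +oo%E.

Lemma K_power_ge0 e t : (0 <= K_power e t)%E.
Proof. by rewrite /K_power; case: ifP => // _; exact: poweR_ge0. Qed.

Lemma hardy_power_K : q2 < q1 -> q2 < p1 ->
  hardy_power p b (a * b / (a - b)) N2 rV (K_power (q1 * (p1 - q2) / (p1 * (q1 - q2)))).
Proof.
move=> q12 qp; have qn : q1 - q2 != 0 by rewrite gt_eqF // subr_gt0.
have qpn : p1 - q2 != 0 by rewrite gt_eqF // subr_gt0.
have e0 : 0 < q1 * (p1 - q2) / (p1 * (q1 - q2)).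
  by rewrite divr_gt0 ?mulr_gt0 // subr_gt0.
have anti s t : s <= t -> (K_power (q1 * (p1 - q2) / (p1 * (q1 - q2))) t <=
    K_power (q1 * (p1 - q2) / (p1 * (q1 - q2))) s)%E.
  move=> st; rewrite /K_power; have [s0|s0] := ltP 0 s; last exact: leey.
  have t0 : 0 < t by exact: lt_le_trans st.
  rewrite t0; apply: poweR_le; [exact: ltW|exact: Kint_ge0|exact: Kint_anti].
split.
- exact: measurable_antihomo.
- exact: K_power_ge0.
- by move=> s t _; exact: anti.
move=> t h t0 hh0; have := hardy_cond_K t h qp; rewrite /K_power t0 => ->.
have -> : h `^ (a * b / (a - b)) =
    (h `^ (p * b / (p - b))) `^ (q1 * (p1 - q2) / (p1 * (q1 - q2))).
  by rewrite -powRrM; congr (_ `^ _); field; rewrite ?mulN1r ?p2n ?qn ?p1n ?qpn.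
by apply: (poweR_le_powR e0 (powR_ge0 _ _)); exact: Kint_ge0.
Qed.

Lemma I9_cond S : q2 < q1 -> q2 < p1 -> 0 <= S ->
  (I9 p1 p2 q1 q2 v1 v2 w1 w2 <= (S `^ p2^-1)%:E)%E <->
  Q_cond a b N1 (K_power (q1 * (p1 - q2) / (p1 * (q1 - q2)))) S.
Proof.
move=> q12 qp S0; have <- := Q_conv p2_gt0 q21 q22 adm q12 S0 (K_power_ge0 _).
rewrite /I9 (_ : (\int[mu1]_(t in `]0%R, +oo[) _)%E = (\int[mu1]_(t in `]0%R, +oo[)
     ((\int[mu1]_(s in `]0%R, t[) omega p2 q1 w1 s)
        `^ (q1 * (q2 - p2) / (p2 * (q1 - q2)))
      * omega p2 q1 w1 t * K_power (q1 * (p1 - q2) / (p1 * (q1 - q2))) t))%E) //.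
apply: eq_integral => t; rewrite inE /= in_itv/= andbT => t0.
by rewrite /K_power t0 (K_normal qp t0).
Qed.

Lemma K_root_conv t (h : R) : q2 < p1 -> 0 < t -> 0 <= h ->
  (Kint t `^ ((p1 - q2) / (p1 * q2)) <= (h `^ p2^-1)%:E)%E <-> hardy_cond p b N2 rV t h.
Proof.
move=> qp t0 hh; have qpn : p1 - q2 != 0 by rewrite gt_eqF // subr_gt0.
have e0 : 0 < (p1 - q2) / (p1 * q2) by rewrite divr_gt0 ?mulr_gt0 // subr_gt0.
have -> := hardy_cond_K t h qp.
have -> : h `^ p2^-1 = (h `^ (p * b / (p - b))) `^ ((p1 - q2) / (p1 * q2)).
  by rewrite -powRrM; congr (_ `^ _); field; rewrite ?mulN1r ?p2n ?p1n ?q2n ?qpn.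
by apply: (poweR_le_powR e0 (powR_ge0 _ _)); exact: Kint_ge0.
Qed.

(** The supremum unfolds into a Hardy condition at each radius. For the converse, the dual mass is
    finite and can itself be taken as [Om], unless it is 0 and the product vanishes. *)
Lemma I8_cond S : q2 < p1 -> 0 <= S -> (I8 p1 p2 q1 q2 v1 v2 w1 w2 <= (S `^ p2^-1)%:E)%E <->
  dual_cond p a b N1 N2 rV S.
Proof.
move=> qp S0; have ee : (q1 - p2) / (q1 * p2) = ((a - 1) / a) * p2^-1.
  by field; rewrite ?q1n ?p2n.
have a1 : 1 < a by rewrite ltr_pdivlMr // mul1r.
have e0 : 0 < (q1 - p2) / (q1 * p2) by rewrite divr_gt0 ?mulr_gt0 // subr_gt0.
have S1 Om : 0 < Om -> S `^ p2^-1 * (Om `^ ((q1 - p2) / (q1 * p2)))^-1 =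
    (S * Om `^ (- ((a - 1) / a))) `^ p2^-1.
  by move=> O0; rewrite (powRM _ S0 (powR_ge0 _ _)) -[X in _ = _ * X]powRrM mulNr -ee powRN.
have SO0 Om : 0 <= S * Om `^ (- ((a - 1) / a)) by rewrite mulr_ge0 ?powR_ge0.
split=> [H x Om x0 Om0 hOm|H].
  apply/(K_root_conv qp x0 (SO0 Om)); rewrite -S1 //.
  have Oe : 0 < Om `^ ((q1 - p2) / (q1 * p2)) by rewrite powR_gt0.
  have Oee : (0 < (Om `^ ((q1 - p2) / (q1 * p2)))%:E)%E by rewrite lte_fin.
  rewrite -(lee_pmul2l _ Oee) // -EFinM mulrCA mulfV ?gt_eqF // mulr1.
  apply: (@le_trans _ _ (dual_int a N1 x `^ ((q1 - p2) / (q1 * p2)) * Kint x `^ ((p1 - q2) / (p1 * q2)))%E).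
    apply: lee_wpmul2r; first exact: poweR_ge0.
    by rewrite -poweR_EFin; apply: poweR_le; [exact: ltW|rewrite lee_fin ltW|].
  apply: le_trans H; apply: ereal_sup_ubound; exists x; first by rewrite /= in_itv/= x0.
  by rewrite (dual_intE p2_gt0 q21 adm) (K_normal qp x0).
apply: ge_ereal_sup => _ [t t0 <-]; move: t0; rewrite /= in_itv/= andbT => t0.
rewrite (dual_intE p2_gt0 q21 adm) (K_normal qp t0).
have [C C0 hC] := @dual_int_le_tail R a a1.
have d0 := dual_int_ge0 a t h1.
have dfin : dual_int a N1 t \is a fin_num.
  by rewrite ge0_fin_numE //; apply: le_lt_trans (hC N1 t h1 t0) (ltry _).
have [Om OmE] : {Om | dual_int a N1 t = Om%:E} by exists (fine (dual_int a N1 t)); rewrite fineK.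
rewrite OmE poweR_EFin; rewrite OmE lee_fin in d0.
have [z0|n0] := eqVneq Om 0.
  by rewrite z0 powR0 ?gt_eqF // mul0e lee_fin powR_ge0.
have Om0 : 0 < Om by rewrite lt_neqAle eq_sym n0.
have Oe : 0 < Om `^ ((q1 - p2) / (q1 * p2)) by rewrite powR_gt0.
have hO : (Om%:E <= dual_int a N1 t)%E by rewrite OmE.
have := (K_root_conv qp t0 (SO0 Om)).2 (H t Om t0 Om0 hO).
rewrite -S1 // => h.
have Oee : (0 <= (Om `^ ((q1 - p2) / (q1 * p2)))%:E)%E by rewrite lee_fin ltW.
apply: (le_trans (lee_wpmul2l Oee h)).
by rewrite -EFinM mulrCA mulfV ?gt_eqF // mulr1.
Qed.

Lemma tail0_ge0 : (0 <= tail_int N1 0)%E.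
Proof. by apply: integral_ge0 => s _; exact: (tail_nnweight h1).2. Qed.

(** If the total mass is infinite, its inverse is 0 and [0 * X = 0] even for [X = +oo], so both
    sides are true. *)
Lemma head_conv S (X : \bar R) : 0 <= S -> (0 <= X)%E ->
  ((tail q1 w1 0 `^ q1^-1)^-1 * X <= (S `^ p2^-1)%:E)%E <->
  ((tail_int N1 0 < +oo)%E -> (X <= ((S * fine (tail_int N1 0) `^ a^-1) `^ p2^-1)%:E)%E).
Proof.
move=> S0 X0; rewrite -(tail_normal _ _ (lexx 0)).
have t0 := tail0_ge0.
have [E|fin] := eqVneq (tail_int N1 0) +oo%E.
  rewrite E poweRyr ?invr_eq0 // invey mul0e lee_fin powR_ge0.
  by split=> // _; rewrite ltxx.
have lt : (tail_int N1 0 < +oo)%E by rewrite ltey.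
have [c cE] : {c | tail_int N1 0 = c%:E} by exists (fine (tail_int N1 0)); rewrite fineK // ge0_fin_numE.
have c0 : 0 < c.
  rewrite -lte_fin -cE; apply: (@lt_le_trans _ _ (tail_int N1 1)).
    by have [_ _ /(_ 1 ltr01)/andP[]] := h1.
  by apply: (tail_int_anti h1); exact: ler01.
rewrite cE [fine _]/= poweR_EFin inver.
have ce : 0 < c `^ q1^-1 by rewrite powR_gt0.
rewrite gt_eqF //; have cee : (0 < (c `^ q1^-1)%:E)%E by rewrite lte_fin.
have E2 : (S * c `^ a^-1) `^ p2^-1 = c `^ q1^-1 * S `^ p2^-1.
  rewrite (powRM _ S0 (powR_ge0 _ _)) -[X in _ * X]powRrM mulrC; congr (_ `^ _ * _).
  by field; rewrite ?q1n ?p2n.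
rewrite E2; split=> [h _|h].
  have := lee_wpmul2l (ltW cee) h.
  by rewrite muleA -!EFinM mulfV ?gt_eqF // mul1e.
have ci : (0 <= ((c `^ q1^-1)^-1)%:E)%E by rewrite lee_fin invr_ge0 ltW.
have := lee_wpmul2l ci (h (ltry _)).
by rewrite -[X in (_ <= X)%E]EFinM mulrA mulVf ?gt_eqF // mul1r.
Qed.


Lemma rV_le_V0 x t : 0 < x -> ((rV x t)%:E <= V p1 p2 v1 v2 0 t)%E.
Proof.
move=> x0; rewrite -(VE p2_gt0 p21 q21 adm _ x0); apply: ge0_subset_integral.
- exact: measurable_eshell.
- exact: measurable_eshell.
- by apply: measurable_funTS; exact: (adm_density adm).
- by move=> y _; exact: density_ge0.
- by move=> y /= /andP[g1 g2]; apply/andP; split => //; exact: lt_trans g1.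
Qed.

Lemma V0_le t M : (forall k, k.+1%:R^-1 < t -> rV k.+1%:R^-1 t <= M) -> 0 < t ->
  (V p1 p2 v1 v2 0 t <= M%:E)%E.
Proof.
move=> hM t0; pose c k : R := k.+1%:R^-1; have c0 k : 0 < c k by rewrite invr_gt0 ltr0Sn.
have [[rV0 _] _ Vn _] := hV.
have M0 : 0 <= M.
  have [k _ hk] := near_infty_natSinv_lt (PosNum t0).
  by apply: le_trans (hM k (hk k (leqnn k))); exact: rV0.
rewrite /V (_ : eshell 0 t = \bigcup_k (eshell (c k) t : set (euclidean R n))); last first.
  apply/seteqP; split => y; rewrite /eshell /=.
    move=> /andP[g1 g2]; have [k _ hk] := near_infty_natSinv_lt (PosNum g1).
    by exists k => //=; rewrite g2 andbT; exact: (hk k (leqnn k)).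
  by case=> k _ /= /andP[g1 ->]; rewrite andbT (lt_trans (c0 k) g1).
apply: integral_bigcup_le.
- move=> m k mk y /= /andP[g1 g2]; apply/andP; split => //; apply: le_lt_trans g1.
  by rewrite lef_pV2 ?posrE ?ltr0Sn // ler_nat ltnS.
- by move=> k; exact: measurable_eshell.
- by apply: measurable_funTS; exact: (adm_density adm).
- exact: density_ge0.
move=> k; have := VE p2_gt0 p21 q21 adm t (c0 k); rewrite /V => ->.
rewrite lee_fin; have [ct|tc] := ltP (c k) t; first exact: hM.
by rewrite (Vn _ _ tc).
Qed.

(** The supremum in [I_3] has inner radius 0, the head condition all inner radii [x > 0]:
    monotonicity of the shells gives one direction, their exhaustion in [V0_le] the other. *)
Lemma I3_cond S : p1 <= q2 -> 0 <= S -> (I3 p1 p2 q1 q2 v1 v2 w1 w2 <= (S `^ p2^-1)%:E)%E <->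
  head_cond p a b N1 N2 rV S.
Proof.
move=> pq S0; have pb : p <= b by rewrite ler_pM2r.
have e0 : 0 < (p1 - p2) / (p1 * p2) by rewrite divr_gt0 ?mulr_gt0 // subr_gt0.
have e0' : 0 < (p - 1) / p.
  by rewrite divr_gt0 ?divr_gt0 // subr_gt0 ltr_pdivlMr // mul1r.
have ee1 : (p1 - p2) / (p1 * p2) = ((p - 1) / p) * p2^-1 by field; rewrite ?p1n ?p2n.
have ee2 : q2^-1 = b^-1 * p2^-1 by field; rewrite ?q2n ?p2n.
have X0 : (0 <= ereal_sup [set V p1 p2 v1 v2 0 t `^ ((p1 - p2) / (p1 * p2)) * tail q2 w2 t `^ q2^-1
            | t in `]0%R, +oo[%classic])%E.
  apply: (@le_trans _ _ (V p1 p2 v1 v2 0 1 `^ ((p1 - p2) / (p1 * p2)) * tail q2 w2 1 `^ q2^-1)%E).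
    by apply: mule_ge0; exact: poweR_ge0.
  by apply: ereal_sup_ubound; exists 1 => //=; rewrite in_itv/= ltr01.
rewrite /I3; have -> := head_conv S0 X0.
have F0 : 0 <= S * fine (tail_int N1 0) `^ a^-1 by rewrite mulr_ge0 ?powR_ge0.
split=> H fin; have {H} := H fin; move: F0; move: (S * _) => h hh0 H.
  move=> x x0; split; last by rewrite ltNge pb.
  move=> _ z xz; have z0 : 0 < z by exact: lt_trans xz.
  have [[rV0 _] _ _ _] := hV.
  apply: (le_powR_inv pe0 hh0); rewrite (powRM _ (powR_ge0 _ _) (powR_ge0 _ _)) -!powRrM -ee1 -ee2.
  rewrite -lee_fin; apply: le_trans H.
  apply: (@le_trans _ _ (V p1 p2 v1 v2 0 z `^ ((p1 - p2) / (p1 * p2)) * tail q2 w2 z `^ q2^-1)%E).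
    rewrite (tail2E p2_gt0 q22 adm z0) poweR_EFin EFinM; apply: lee_wpmul2r.
      by rewrite lee_fin powR_ge0.
    rewrite -poweR_EFin; apply: poweR_le; [exact: ltW|by rewrite lee_fin rV0|exact: rV_le_V0].
  by apply: ereal_sup_ubound; exists z => //=; rewrite in_itv/= z0.
apply: ge_ereal_sup => _ [t t0 <-]; move: t0; rewrite /= in_itv/= andbT => t0.
have W0 := rtail_gt0 h2 t0; have Wb : 0 < rtail N2 t `^ b^-1 by rewrite powR_gt0.
have [M ME] : {M | M = (h / rtail N2 t `^ b^-1) `^ (p / (p - 1))} by exists ((h / rtail N2 t `^ b^-1) `^ (p / (p - 1))).
have M0 : 0 <= M by rewrite ME powR_ge0.
have hq0 : 0 <= h / rtail N2 t `^ b^-1 by rewrite divr_ge0 // ltW.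
have MEe : M `^ ((p - 1) / p) = h / rtail N2 t `^ b^-1.
  rewrite ME -powRrM (_ : p / (p - 1) * ((p - 1) / p) = 1) ?powRr1 //.
  by field; rewrite ?mulN1r ?p1n ?p2n ?p1p2n.
have VM : (V p1 p2 v1 v2 0 t <= M%:E)%E.
  apply: V0_le => // k kt; have c0 : 0 < k.+1%:R^-1 :> R by rewrite invr_gt0 ltr0Sn.
  apply: (le_powR_inv e0' M0); rewrite MEe ler_pdivlMr //.
  by have [H1 _] := H _ c0; exact: H1.
have V00 : (0 <= V p1 p2 v1 v2 0 t)%E by apply: integral_ge0 => y _; exact: density_ge0.
apply: (@le_trans _ _ ((M `^ ((p1 - p2) / (p1 * p2)))%:E * (rtail N2 t `^ q2^-1)%:E)%E).
  rewrite (tail2E p2_gt0 q22 adm t0) poweR_EFin; apply: lee_wpmul2r; first by rewrite lee_fin powR_ge0.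
  by rewrite -poweR_EFin; apply: poweR_le => //; exact: ltW.
rewrite -EFinM lee_fin ee1 ee2 [X in X * _]powRrM [X in _ * X]powRrM.
rewrite -(powRM _ (powR_ge0 _ _) (powR_ge0 _ _)) MEe divfK ?gt_eqF //.
Qed.

(** Shells with inner radius [x] lie in those with inner radius 0, so this direction costs no
    constant. *)
Lemma I7_upper S : q2 < p1 -> 0 <= S -> (I7 p1 p2 q1 q2 v1 v2 w1 w2 <= (S `^ p2^-1)%:E)%E ->
  head_cond p a b N1 N2 rV S.
Proof.
move=> qp S0; have [e1 e2 e10 _ _] := exponentK qp.
have -> := head_conv S0 (poweR_ge0 _ _) => H fin x x0.
have F0 : 0 <= S * fine (tail_int N1 0) `^ a^-1 by rewrite mulr_ge0 ?powR_ge0.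
apply/(K_root_conv qp x0 F0); apply: le_trans (H fin).
apply: poweR_le; [by rewrite divr_ge0 ?mulr_ge0 // ?subr_ge0 ltW|exact: Kint_ge0|].
have [[rV0 _] _ _ _] := hV.
have mV0 : measurable_fun setT (fun s : realR R => V p1 p2 v1 v2 0 s).
  apply: measurable_homo => s t st; apply: ge0_subset_integral.
  - exact: measurable_eshell.
  - exact: measurable_eshell.
  - by apply: measurable_funTS; exact: (adm_density adm).
  - by move=> y _; exact: density_ge0.
  - by move=> y /= /andP[g1 g2]; apply/andP; split => //; exact: lt_le_trans g2 st.
have mW2 : measurable_fun setT (fun s : realR R => ((rtail N2 s `^ (b / (p - b)))%:E)).
  by apply/measurable_EFinP; exact: (posmeas_rtail_powR _ h2).1.
have [mN2 N20] := tail_nnweight h2.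
have KE : K p1 p2 q2 v1 v2 w2 0 = (\int[mu1]_(s in `]0%R, +oo[)
    (V p1 p2 v1 v2 0 s `^ (b * (p - 1) / (p - b)) * (rtail N2 s `^ (b / (p - b)))%:E * N2 s))%E.
  apply: eq_integral => s; rewrite inE /= in_itv/= andbT => s0.
  by rewrite (tail2E p2_gt0 q22 adm s0) poweR_EFin e1 e2 /normal_weight s0.
have mI : measurable_fun setT (fun s : realR R =>
    V p1 p2 v1 v2 0 s `^ (b * (p - 1) / (p - b)) * (rtail N2 s `^ (b / (p - b)))%:E * N2 s)%E.
  apply: emeasurable_funM; last exact: mN2.
  apply: emeasurable_funM; last exact: mW2.
  exact: (measurableT_comp (measurable_poweR _) mV0).
have I0 (s : realR R) : (0 <= V p1 p2 v1 v2 0 s `^ (b * (p - 1) / (p - b)) *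
    (rtail N2 s `^ (b / (p - b)))%:E * N2 s)%E.
  by apply: mule_ge0 => //; apply: mule_ge0; [exact: poweR_ge0|rewrite lee_fin powR_ge0].
rewrite KE; apply: (@le_trans _ _ (\int[mu1]_(s in `]x, +oo[)
    (V p1 p2 v1 v2 0 s `^ (b * (p - 1) / (p - b)) * (rtail N2 s `^ (b / (p - b)))%:E * N2 s))%E); last first.
  apply: (integral_itv_subset mI I0) => r /=; rewrite !in_itv/= !andbT.
  exact: lt_trans.
have [m3 m4] := posmeas_nnweight (tail_nnweight h2) (posmeas_K x0).
apply: ge0_le_integral.
- exact: measurable_itvR.
- by move=> s _; exact: m4.
- by apply: measurable_funTS; exact: m3.
- by apply: measurable_funTS; exact: mI.
move=> s _; apply: lee_wpmul2r; first exact: N20.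
rewrite EFinM; apply: lee_wpmul2r; first by rewrite lee_fin powR_ge0.
rewrite -poweR_EFin; apply: poweR_le; [exact: ltW|by rewrite lee_fin rV0|exact: rV_le_V0].
Qed.

End conversions.

(** * Local Morrey norms *)

(** Hoelder's inequality recovered from its linearised form, which integrates directly from a
    pointwise estimate. The balanced choice [l = (H / U) ^ (1/p)] makes both terms equal, hence the
    factor 2. *)
Lemma holder_of_split (R : realType) (p G U H : R) : 1 < p -> 0 <= G -> 0 <= U -> 0 <= H ->
  (forall l, 0 < l -> G <= l * U + l `^ (1 - p) * H) -> G `^ p <= 2 `^ p * (U `^ (p - 1) * H).
Proof.
move=> p1 G0 U0 H0 h; have p0 : 0 < p by lra.
have [pn p1n] : p != 0 /\ p - 1 != 0 by rewrite !gt_eqF // subr_gt0.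
have RHS0 : 0 <= 2 `^ p * (U `^ (p - 1) * H) by rewrite !mulr_ge0 ?powR_ge0.
have [Gn|Gp] := leP G 0.
  have -> : G = 0 by apply/eqP; rewrite eq_le Gn.
  by rewrite powR0.
have [U1|Up] := leP U 0.
  have UE : U = 0 by apply/eqP; rewrite eq_le U1.
  (* With [U = 0] the second term can be made arbitrarily small: this [l] turns it into
     [m H < G]. *)
  exfalso; pose m := G / (2 * (H + 1)).
  have m0 : 0 < m by rewrite divr_gt0 // mulr_gt0 //; lra.
  have l0 : 0 < m `^ (- (p - 1)^-1) by rewrite powR_gt0.
  have := h _ l0; rewrite UE mulr0 add0r -powRrM.
  have -> : - (p - 1)^-1 * (1 - p) = 1 by field.
  rewrite powRr1 ?(ltW m0) // /m => h2.
  have : G / (2 * (H + 1)) * H < G.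
    rewrite mulrAC ltr_pdivrMr; last by rewrite mulr_gt0 //; lra.
    by rewrite ltr_pM2l //; lra.
  by rewrite ltNge h2.
have [H1|Hp] := leP H 0.
  have HE : H = 0 by apply/eqP; rewrite eq_le H1.
  exfalso; pose l := G / (2 * U).
  have l0 : 0 < l by rewrite divr_gt0 // mulr_gt0.
  have := h l l0; rewrite HE mulr0 addr0 /l.
  rewrite (_ : G / (2 * U) * U = G / 2); first by lra.
  by field; rewrite gt_eqF.
pose l := H `^ p^-1 * U `^ (- p^-1).
have l0 : 0 < l by rewrite mulr_gt0 ?powR_gt0.
have e1 : l * U = U `^ ((p - 1) / p) * H `^ p^-1.
  rewrite /l -mulrA mulrC; congr (_ * _); rewrite mulrC powR_mul_self //.
    by congr (_ `^ _); field.
  by rewrite addrC subr_gt0 invf_lt1.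
have e2 : l `^ (1 - p) * H = U `^ ((p - 1) / p) * H `^ p^-1.
  rewrite /l (powRM _ (powR_ge0 _ _) (powR_ge0 _ _)) -!powRrM mulrAC mulrC; congr (_ * _).
    by congr (_ `^ _); field.
  rewrite mulrC powR_mul_self //; first by congr (_ `^ _); field.
  by rewrite (_ : p^-1 * (1 - p) + 1 = p^-1) ?invr_gt0 //; field.
have := h l l0; rewrite e1 e2 => h2.
have h3 : G <= 2 * (U `^ ((p - 1) / p) * H `^ p^-1) by lra.
apply: (le_trans (le_powR (ltW p0) G0 h3)).
rewrite (powRM _ (ler0n _ 2) (mulr_ge0 (powR_ge0 _ _) (powR_ge0 _ _))).
rewrite (powRM _ (powR_ge0 _ _) (powR_ge0 _ _)) -[X in _ * (X * _)]powRrM -[X in _ * (_ * X)]powRrM.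
by rewrite mulVf // (powRr1 H0) divfK.
Qed.

(** The left side is [U ^ ((p1 - p2) / p1) H ^ (p2 / p1)], a weighted geometric mean; one of the
    terms on the right dominates it, according to how [H] compares with [l ^ (p1 / p2) U]. *)
Lemma split_pointwise (R : realType) (p1 p2 l x1 x2 f : R) : 0 < p2 -> p2 < p1 -> 0 < l -> 0 < x1 -> 0 < x2 ->
  0 <= f ->
  f `^ p2 * x2 `^ p2 <= l * ((x1 `^ (p1 * p2 / (p1 - p2)))^-1 * x2 `^ (p1 * p2 / (p1 - p2))) +
    l `^ (1 - p1 / p2) * (f `^ p1 * x1 `^ p1).
Proof.
move=> p20 p21 l0 x10 x20 f0; have p10 : 0 < p1 by exact: lt_trans p21.
have [p2n [p1n dn]] : p2 != 0 /\ (p1 != 0 /\ p1 - p2 != 0) by rewrite !gt_eqF // subr_gt0.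
have [s sE] : {s | s = p1 * p2 / (p1 - p2)} by exists (p1 * p2 / (p1 - p2)).
rewrite -sE; have U0 : 0 < (x1 `^ s)^-1 * x2 `^ s by rewrite mulr_gt0 ?invr_gt0 ?powR_gt0.
have [fz|fn] := eqVneq f 0.
  rewrite fz powR0 // mul0r; apply: addr_ge0; first by apply: mulr_ge0; exact: ltW.
  by apply: mulr_ge0; [exact: powR_ge0|apply: mulr_ge0; exact: powR_ge0].
have fp : 0 < f by rewrite lt_neqAle eq_sym fn.
have H0 : 0 < f `^ p1 * x1 `^ p1 by rewrite mulr_gt0 ?powR_gt0.
have G0 : 0 < f `^ p2 * x2 `^ p2 by rewrite mulr_gt0 ?powR_gt0.
have key : f `^ p2 * x2 `^ p2 =
    ((x1 `^ s)^-1 * x2 `^ s) `^ ((p1 - p2) / p1) * (f `^ p1 * x1 `^ p1) `^ (p2 / p1).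
  rewrite -powRN !powRM ?powR_ge0 // -!powRrM.
  have -> : p1 * (p2 / p1) = p2 by field.
  have -> : s * ((p1 - p2) / p1) = p2 by rewrite sE; field; rewrite ?mulN1r p1n dn.
  have -> : - s * ((p1 - p2) / p1) = - p2 by rewrite sE; field; rewrite ?mulN1r p1n dn.
  rewrite powRN mulrACA [_ * x1 `^ p2]mulrC -!mulrA.
  by field; rewrite gt_eqF // powR_gt0.
rewrite key; move: U0 H0; set U := _ * x2 `^ s; set H := f `^ p1 * _; clearbody U H => U0 H0.
have e1 : 0 < (p1 - p2) / p1 by rewrite divr_gt0 // subr_gt0.
have e2 : 0 < p2 / p1 by rewrite divr_gt0.
have e12 : (p1 - p2) / p1 + p2 / p1 = 1 by field.
have [hH|hH] := leP H (l `^ (p1 / p2) * U).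
  apply: (@le_trans _ _ (l * U)); last by rewrite lerDl mulr_ge0 ?powR_ge0 // ltW.
  apply: (le_trans (ler_wpM2l (powR_ge0 _ _) (le_powR (ltW e2) (ltW H0) hH))).
  rewrite (powRM _ (powR_ge0 _ _) (ltW U0)) -powRrM (_ : p1 / p2 * (p2 / p1) = 1); last by field; rewrite p1n p2n.
  by rewrite (powRr1 (ltW l0)) mulrCA -powRD ?e12 ?(gt_eqF U0) ?implybT // (powRr1 (ltW U0)).
apply: (@le_trans _ _ (l `^ (1 - p1 / p2) * H)); last by rewrite lerDr mulr_ge0 // ltW.
have hU : U <= l `^ (- (p1 / p2)) * H.
  by rewrite powRN mulrC ler_pdivlMr ?powR_gt0 // mulrC ltW.
apply: (le_trans (ler_wpM2r (powR_ge0 _ _) (le_powR (ltW e1) (ltW U0) hU))).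
rewrite (powRM _ (powR_ge0 _ _) (ltW H0)) -powRrM -mulrA -powRD ?e12 ?(gt_eqF H0) ?implybT //.
rewrite (powRr1 (ltW H0)) le_eqVlt; apply/orP; left; apply/eqP; congr (_ `^ _ * _).
by field; rewrite p1n p2n.
Qed.

Section function_side.
Context {R : realType} {n : nat}.
Local Notation mun := (@lebesgue_euclidean R n).
Local Notation mu1 := (@completed_lebesgue_measure R).

Lemma measurable_eball t : measurable (@eball R n t).
Proof. exact: (@measurable_rball R _ (euclidean R n) (@enorm R n) (@measurable_enorm R n) t). Qed.

Definition ball_mass (f v : euclidean R n -> \bar R) (p t : R) : \bar R :=
  (\int[mun]_(y in eball t) (`|f y| `^ p * v y `^ p))%E.

Lemma ball_density_ge0 (f v : euclidean R n -> \bar R) (p : R) y : (0 <= `|f y| `^ p * v y `^ p)%E.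
Proof. by apply: mule_ge0; exact: poweR_ge0. Qed.

Lemma measurable_ball_density (f v : euclidean R n -> \bar R) (p : R) :
  measurable_fun setT f -> measurable_fun setT v ->
  measurable_fun setT (fun y => `|f y| `^ p * v y `^ p)%E.
Proof.
move=> mf mv; apply: emeasurable_funM.
  by apply: (measurableT_comp (measurable_poweR _)); exact: measurableT_comp.
exact: (measurableT_comp (measurable_poweR _)).
Qed.

Lemma ball_mass_homo f v p : measurable_fun setT f -> measurable_fun setT v ->
  {homo ball_mass f v p : s t / s <= t >-> (s <= t)%E}.
Proof.
move=> mf mv s t st; apply: ge0_subset_integral.
- exact: measurable_eball.
- exact: measurable_eball.
- by apply: measurable_funTS; exact: measurable_ball_density.
- by move=> y _; exact: ball_density_ge0.
- by move=> y; rewrite /eball /=; move=> ys; exact: lt_le_trans ys st.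
Qed.

(** [F] is nondecreasing: an infinite value at [t] would persist on [(t, +oo)], where [w] has
    positive mass. *)
Lemma finite_of_integral (F : R -> \bar R) (w : realR R -> \bar R) (e t : R) :
  {homo F : s t / s <= t >-> (s <= t)%E} -> (forall s, 0 <= F s)%E -> tail_weight w -> 0 < e ->
  (\int[mu1]_(s in `]0%R, +oo[) (F s `^ e * w s) < +oo)%E -> 0 < t -> (F t < +oo)%E.
Proof.
move=> Fm F0 hw e0 fin t0; rewrite ltey; apply/eqP => E.
have [mw w0] := tail_nnweight hw.
have mI : measurable_fun setT (fun s : realR R => F s `^ e * w s)%E.
  apply: emeasurable_funM; last exact: mw.
  by apply: (measurableT_comp (measurable_poweR _)); exact: measurable_homo.
have I0 (s : realR R) : (0 <= F s `^ e * w s)%E by apply: mule_ge0 => //; exact: poweR_ge0.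
have bnd k : 0 < k -> (k%:E * tail_int w t <= \int[mu1]_(s in `]0%R, +oo[) (F s `^ e * w s))%E.
  move=> k0; apply: (@le_trans _ _ (\int[mu1]_(s in `]t, +oo[) (F s `^ e * w s))%E); last first.
    apply: (integral_itv_subset mI I0) => s /=; rewrite !in_itv/= !andbT; exact: lt_trans.
  rewrite -ge0_integralZl; first last.
  - by rewrite lee_fin ltW.
  - by move=> r _; exact: w0.
  - by apply: measurable_funTS; exact: mw.
  - exact: measurable_itvR.
  apply: ge0_le_integral.
  - exact: measurable_itvR.
  - by move=> r _; apply: mule_ge0 (w0 r); rewrite lee_fin ltW.
  - by apply: measurable_funTS; apply: emeasurable_funM; [exact: measurable_cst|exact: mw].
  - by apply: measurable_funTS; exact: mI.
  move=> r; rewrite /= in_itv/= andbT => tr; apply: lee_wpmul2r; first exact: w0.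
  have -> : F r = +oo%E by apply/eqP; rewrite -leye_eq -E; exact: Fm (ltW tr).
  by rewrite poweRyr ?gt_eqF // leey.
have W0 := rtail_gt0 hw t0; move: bnd; rewrite (rtailE hw t0).
have J0 : (0 <= \int[mu1]_(s in `]0%R, +oo[) (F s `^ e * w s))%E.
  by apply: integral_ge0 => s _; exact: I0.
have [j jE] : {j | (\int[mu1]_(s in `]0%R, +oo[) (F s `^ e * w s))%E = j%:E}.
  by exists (fine (\int[mu1]_(s in `]0%R, +oo[) (F s `^ e * w s))%E); rewrite fineK // ge0_fin_numE.
move: J0; rewrite jE lee_fin => j0 bnd.
have k0 : 0 < (j + 1) / rtail w t by rewrite divr_gt0 //; lra.
have := bnd _ k0; rewrite -EFinM lee_fin divfK ?gt_eqF //; lra.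
Qed.

End function_side.

(** The factor [2 ^ p] of [holder_of_split] is moved into [F]; the first integral grows by [2 ^ a]
    and the final constant by the factor 2. *)
Lemma upper_est_shell (R : realType) (p a b Ku N x0 : R) (w1 w2 : realR R -> \bar R) (V G H : R -> R -> R) :
  0 < a -> 0 < p -> 0 <= Ku -> upper_est p a b w1 w2 V Ku -> nnweight w1 -> shell_data G -> shell_data H ->
  (forall s t, 0 < s -> G s t `^ p <= 2 `^ p * (V s t `^ (p - 1) * H s t)) -> 0 <= N -> 0 < x0 ->
  (wint w1 `]x0, +oo[ (fun t => H x0 t `^ (a / p))%R <= N%:E)%E ->
  (wint w2 `]x0, +oo[ (fun t => G x0 t `^ b)%R <= ((2 * Ku) `^ b * N `^ (b / a))%:E)%E.
Proof.
move=> a0 p0 K0 hK hw hG hH hold N0 x00 hN.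
have [an pn] : a != 0 /\ p != 0 by rewrite !gt_eqF.
have [[G0 Gm] _ Gn GD] := hG; have [[H0 Hm] _ Hn HD] := hH.
have -> : (2 * Ku) `^ b * N `^ (b / a) = Ku `^ b * (2 `^ a * N) `^ (b / a).
  rewrite (powRM _ (ler0n _ 2) K0) (powRM _ (powR_ge0 _ _) N0) -powRrM mulrCA mulrA.
  by congr (_ `^ _ * _ * _); field.
apply: (hK (2 `^ a * N) x0 (G x0) (fun t => 2 `^ p * H x0 t) x00).
- by have [] := posmeas_shell (conj G0 Gm) x00.
- by apply: measurable_funM; [exact: measurable_cst|have [] := posmeas_shell (conj H0 Hm) x00].
- move=> s t xs st; split; first by apply: (Gm _ _ _ _ x00 (lexx _) st).
  by apply: ler_wpM2l; [exact: powR_ge0|exact: (Hm _ _ _ _ x00 (lexx _) st)].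
- by rewrite (Gn _ _ (lexx x0)).
- by rewrite (Hn _ _ (lexx x0)) mulr0.
- move=> s t xs st; rewrite (GD x0 s t x00 xs (ltW st)) (HD x0 s t x00 xs (ltW st)).
  have -> (A B : R) : A + B - A = B by rewrite addrC addKr.
  rewrite -mulrBr addrAC subrr add0r.
  by rewrite mulrCA; apply: hold; exact: lt_le_trans xs.
- by rewrite mulr_ge0 ?powR_ge0.
rewrite (@eq_wint _ _ _ _ (fun t => 2 `^ a * H x0 t `^ (a / p))); last first.
  move=> t _; rewrite (powRM _ (powR_ge0 _ _) (H0 _ _)) -powRrM.
  by congr (_ `^ _ * _); field.
have pX : posmeas (fun t : realR R => H x0 t `^ (a / p)) by exact: posmeas_shell_powR.
by rewrite (wintZ hw _ (powR_ge0 _ _) pX) EFinM; apply: lee_wpmul2l; first by rewrite lee_fin powR_ge0.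
Qed.

Section conversions.
Context {R : realType} {n : nat}.
Local Notation mun := (@lebesgue_euclidean R n).
Local Notation mu1 := (@completed_lebesgue_measure R).
Variables (p1 p2 q1 q2 : R) (n_ge1 : (1 <= n)%N) (p2_gt0 : 0 < p2)
  (p21 : p2 < p1) (q21 : p2 < q1) (q22 : p2 < q2).
Variables (v1 v2 : euclidean R n -> \bar R) (w1 w2 : realR R -> \bar R).
Hypothesis adm : admissible p1 p2 q1 q2 v1 v2 w1 w2.
Local Notation u := (density p1 p2 v1 v2).
Local Notation Vu := (rV mun (@enorm R n) u).
Local Notation N1 := (normal_weight q1 w1).
Local Notation N2 := (normal_weight q2 w2).
Local Notation p := (p1 / p2).
Local Notation a := (q1 / p2).
Local Notation b := (q2 / p2).

Let p10 : 0 < p1. Proof. exact: lt_trans p21. Qed.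
Let q10 : 0 < q1. Proof. exact: lt_trans q21. Qed.
Let q20 : 0 < q2. Proof. exact: lt_trans q22. Qed.
Let p2n : p2 != 0. Proof. by rewrite gt_eqF. Qed.
Let p1n : p1 != 0. Proof. by rewrite gt_eqF. Qed.
Let q1n : q1 != 0. Proof. by rewrite gt_eqF. Qed.
Let q2n : q2 != 0. Proof. by rewrite gt_eqF. Qed.
Let q1p2n : q1 - p2 != 0. Proof. by rewrite gt_eqF // subr_gt0. Qed.
Let p1p2n : p1 - p2 != 0. Proof. by rewrite gt_eqF // subr_gt0. Qed.
Let h1 : tail_weight N1. Proof. exact: (adm_tail1 p2_gt0 q21 adm). Qed.
Let h2 : tail_weight N2. Proof. exact: (adm_tail2 p2_gt0 q22 adm). Qed.
Let hV : shell_data Vu. Proof. exact: (adm_shell_data n_ge1 p2_gt0 p21 q21 adm). Qed.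
Let hJ : Jfinite p a N1 Vu. Proof. exact: (adm_Jfinite p2_gt0 p21 q21 adm). Qed.
Let pe0 : 0 < p2^-1. Proof. by rewrite invr_gt0. Qed.

Lemma V0_shell_sup_le t M : 0 < t -> (forall k, k.+1%:R^-1 < t -> Vu k.+1%:R^-1 t <= M) ->
  (V p1 p2 v1 v2 0 t <= M%:E)%E.
Proof. by move=> t0 h; apply: (V0_le n_ge1 p2_gt0 p21 q21 adm h t0). Qed.

(** [V 0 t] is a limit of shells with positive inner radius. Its finiteness comes first, from
    [hardy_cond_sup]; then [exhaust_wint] costs [2 ^ (b (p - 1) / (p - b))], which is the origin of
    the factor [2 ^ ((p - 1) / p)]. *)
Lemma I7_lower S : q2 < p1 -> 0 <= S -> head_cond p a b N1 N2 Vu S ->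
  (I7 p1 p2 q1 q2 v1 v2 w1 w2 <= ((2 `^ ((p - 1) / p) * S) `^ p2^-1)%:E)%E.
Proof.
move=> qp S0 H; have [e1 e2 e10 e20 ro0] := exponentK p2_gt0 p21 q22 qp.
have qpn : p1 - q2 != 0 by rewrite gt_eqF // subr_gt0.
have tau0 : 0 < (p1 - q2) / (p1 * q2) by rewrite divr_gt0 ?mulr_gt0 // subr_gt0.
have CS0 : 0 <= 2 `^ ((p - 1) / p) * S by rewrite mulr_ge0 ?powR_ge0.
apply/(head_conv p2_gt0 q21 adm CS0 (poweR_ge0 _ _)) => fin; have {H} := H fin.
have F0 : 0 <= S * fine (tail_int N1 0) `^ a^-1 by rewrite mulr_ge0 ?powR_ge0.
rewrite -mulrA; move: F0; move: (S * _) => h hh0 H.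
have c2h : 0 <= 2 `^ ((p - 1) / p) * h by rewrite mulr_ge0 ?powR_ge0.
have -> : (2 `^ ((p - 1) / p) * h) `^ p2^-1 =
   ((2 `^ ((p - 1) / p) * h) `^ (p * b / (p - b))) `^ ((p1 - q2) / (p1 * q2)).
  by rewrite -[RHS]powRrM; congr (_ `^ _); field; rewrite ?mulN1r ?p2n ?p1n ?q2n ?qpn.
have -> : (2 `^ ((p - 1) / p) * h) `^ (p * b / (p - b)) = 2 `^ (b * (p - 1) / (p - b)) * h `^ (p * b / (p - b)).
  rewrite (powRM _ (powR_ge0 _ _) hh0) -[X in X * _]powRrM; congr (_ `^ _ * _).
  by field; rewrite ?mulN1r ?p2n ?p1n ?qpn.
have [[rV0 Vm] _ Vn _] := hV.
have V00 t : (0 <= V p1 p2 v1 v2 0 t)%E by apply: integral_ge0 => y _; exact: density_ge0.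
have Vhomo : {homo (fun t => V p1 p2 v1 v2 0 t) : s t / s <= t >-> (s <= t)%E}.
  move=> s t st; apply: ge0_subset_integral.
  - exact: measurable_eshell.
  - exact: measurable_eshell.
  - by apply: measurable_funTS; exact: (adm_density adm).
  - by move=> y _; exact: density_ge0.
  - by move=> y /= /andP[g1 g2]; apply/andP; split => //; exact: lt_le_trans g2 st.
have p_1 : 1 < p by rewrite ltr_pdivlMr // mul1r.
have b_0 : 0 < b by rewrite divr_gt0.
have e0' : 0 < (p - 1) / p by rewrite divr_gt0 ?subr_gt0 //; lra.
have [C C0 hC] := @hardy_cond_sup R p b p_1 b_0.
have Vfin t : 0 < t -> V p1 p2 v1 v2 0 t = (fine (V p1 p2 v1 v2 0 t))%:E.
  move=> t0; rewrite fineK // ge0_fin_numE //.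
  have W0 := rtail_gt0 h2 t0; have Wb : 0 < rtail N2 t `^ b^-1 by rewrite powR_gt0.
  apply: (@le_lt_trans _ _ ((C * h / rtail N2 t `^ b^-1) `^ (p / (p - 1)))%:E); last exact: ltry.
  have hq0 : 0 <= C * h / rtail N2 t `^ b^-1 by rewrite divr_ge0 ?mulr_ge0 // ltW.
  apply: V0_shell_sup_le => // k kt; have c0 : 0 < k.+1%:R^-1 :> R by rewrite invr_gt0 ltr0Sn.
  apply: (le_powR_inv e0' (powR_ge0 _ _)).
  rewrite -[X in _ <= X]powRrM (_ : p / (p - 1) * ((p - 1) / p) = 1); last first.
    by field; rewrite ?mulN1r ?p1n ?p2n ?p1p2n.
  rewrite (powRr1 hq0) ler_pdivlMr //.
  by apply: (hC N2 Vu _ h t h2 _ c0 kt hh0 (H _ c0)); have [] := hV.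
have SS0 : 0 <= 2 `^ (b * (p - 1) / (p - b)) * h `^ (p * b / (p - b)) by rewrite mulr_ge0 ?powR_ge0.
have X0 : (0 <= K p1 p2 q2 v1 v2 w2 0)%E.
  by apply: integral_ge0 => s _; apply: mule_ge0; [apply: mule_ge0|]; exact: poweR_ge0.
apply/(poweR_le_powR tau0 SS0 X0).
have -> : K p1 p2 q2 v1 v2 w2 0 = wint N2 `]0%R, +oo[ (fun s =>
    fine (V p1 p2 v1 v2 0 s) `^ (b * (p - 1) / (p - b)) * rtail N2 s `^ (b / (p - b)))%R.
  apply: eq_integral => s; rewrite inE /= in_itv/= andbT => s0.
  rewrite (tail2E p2_gt0 q22 adm s0) (Vfin s s0) poweR_EFin poweR_EFin -EFinM e1 e2.
  by rewrite /normal_weight s0.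
apply: (@exhaust_wint R N2 (fun s => fine (V p1 p2 v1 v2 0 s)) (fun k => Vu k.+1%:R^-1)
  (fun s => rtail N2 s `^ (b / (p - b))) (b * (p - 1) / (p - b)) (h `^ (p * b / (p - b)))
  (tail_nnweight h2) e10 _ _ _ _ _ (powR_ge0 _ _) _).
- split; last by move=> t; exact: fine_ge0.
  apply: (@measurableT_comp _ _ _ _ _ _ fine); first exact: fine_measurable.
  exact: measurable_homo.
- by move=> k; apply: posmeas_shell; [have [] := hV|rewrite invr_gt0 ltr0Sn].
- move=> m k t mk _; apply: Vm; [by rewrite invr_gt0 ltr0Sn| |exact: lexx].
  by rewrite lef_pV2 ?posrE ?ltr0Sn // ler_nat ltnS.
- move=> t M t0 hM; rewrite -lee_fin -(Vfin t t0); exact: V0_shell_sup_le.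
- exact: posmeas_rtail_powR.
- move=> k; have c0 : 0 < k.+1%:R^-1 :> R by rewrite invr_gt0 ltr0Sn.
  by have [_ H2] := H _ c0; apply: H2; rewrite ltr_pM2r.
Qed.

(** The ball is the union of the shells with inner radii [1 / (k + 1)], up to the sphere of radius
    0, which is null. *)
Lemma ball_le_shells (g : euclidean R n -> \bar R) t M : measurable_fun setT g -> (forall y, 0 <= g y)%E ->
  (forall k, eV mun (@enorm R n) g k.+1%:R^-1 t <= M)%E -> (\int[mun]_(y in eball t) g y <= M)%E.
Proof.
move=> mg g0 hM; have mE := @measurable_enorm R n.
have mN : measurable ([set y | enorm y = 0] : set (euclidean R n)).
  by have := mE measurableT _ (measurable_set1 0); rewrite setTI.
rewrite (@ge0_negligible_integral _ _ _ mun _ _ g mN (measurable_eball t)) //; last 2 first.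
- by apply: measurable_funTS; exact: mg.
- exact: null_sphere.
pose c k : R := k.+1%:R^-1; have c0 k : 0 < c k by rewrite invr_gt0 ltr0Sn.
rewrite (_ : _ `\` _ = \bigcup_k (rshell (@enorm R n) (c k) t : set (euclidean R n))); last first.
  apply/seteqP; split => y; rewrite /eball /rshell /=.
    move=> [g2 /eqP g1]; have {}g1 : 0 < enorm y by rewrite lt_neqAle eq_sym g1 sqrtr_ge0.
    have [k _ hk] := near_infty_natSinv_lt (PosNum g1).
    by exists k => //=; rewrite g2 andbT; exact: (hk k (leqnn k)).
  case=> k _ /= /andP[g1 g2]; split => // g3; move: g1; rewrite g3.
  by rewrite ltNge ltW.
apply: integral_bigcup_le.
- move=> m k mk y /= /andP[g1 g2]; apply/andP; split => //; apply: le_lt_trans g1.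
  by rewrite lef_pV2 ?posrE ?ltr0Sn // ler_nat ltnS.
- by move=> k; exact: (@measurable_rshell R _ (euclidean R n) (@enorm R n) mE (c k) t).
- by apply: measurable_funTS; exact: mg.
- exact: g0.
exact: hM.
Qed.

Lemma LMnormE (pp qq : R) (v : euclidean R n -> \bar R) w f : LMnorm pp qq v w f =
  ((\int[mu1]_(t in `]0%R, +oo[) (ball_mass f v pp t `^ (qq / pp) * normal_weight qq w t)) `^ qq^-1)%E.
Proof.
congr (_ `^ _)%E; apply: eq_integral => t; rewrite inE /= in_itv/= andbT => t0.
by rewrite /normal_weight t0.
Qed.

Lemma poweR_fin (e : R) (X : \bar R) : 0 < e -> (0 <= X)%E -> (X `^ e < +oo)%E -> (X < +oo)%E.
Proof.
by move=> e0 X0; rewrite !ltey; apply: contra_neq => ->; rewrite poweRyr // gt_eqF.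
Qed.

(** The masses of [g] and [h] on shells satisfy Hoelder's inequality up to [2 ^ p], so the estimate
    holds from each inner radius [x0], and exhaustion reaches the balls. One factor 2 of [4 Ku]
    comes from Hoelder's inequality, the other from the exhaustion. *)
Lemma LM_upper Ku f : 0 <= Ku -> upper_est p a b N1 N2 Vu Ku -> measurable_fun setT f ->
  (LMnorm p1 q1 v1 w1 f < +oo)%E ->
  (LMnorm p2 q2 v2 w2 f <= ((4 * Ku) `^ p2^-1)%:E * LMnorm p1 q1 v1 w1 f)%E.
Proof.
move=> K0 hK mf; rewrite !LMnormE => fin1.
have [[mv1 ae1] [mv2 ae2]] : space_weight v1 /\ space_weight v2 by have [] := adm.
have [p_1 [a_1 b_1]] : 1 < p /\ (1 < a /\ 1 < b) by rewrite !ltr_pdivlMr // !mul1r.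
have [a_0 [b_0 p_0]] : 0 < a /\ (0 < b /\ 0 < p) by lra.
have [an [bn pn]] : a != 0 /\ (b != 0 /\ p != 0) by rewrite !gt_eqF.
have bm0 v r t : (0 <= ball_mass f v r t)%E by apply: integral_ge0 => y _; exact: ball_density_ge0.
have bmH v r : measurable_fun setT v -> {homo ball_mass f v r : s t / s <= t >-> (s <= t)%E}.
  by move=> mv; exact: ball_mass_homo.
have J0 : (0 <= \int[mu1]_(t in `]0%R, +oo[) (ball_mass f v1 p1 t `^ (q1 / p1) * N1 t))%E.
  by apply: integral_ge0 => t _; apply: mule_ge0; [exact: poweR_ge0|exact: normal_weight_ge0].
have iq1 : 0 < q1^-1 by rewrite invr_gt0.
have {}fin1 := poweR_fin iq1 J0 fin1.
have [N NE] : {N | (\int[mu1]_(t in `]0%R, +oo[) (ball_mass f v1 p1 t `^ (q1 / p1) * N1 t))%E = N%:E}.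
  by exists (fine (\int[mu1]_(t in `]0%R, +oo[) (ball_mass f v1 p1 t `^ (q1 / p1) * N1 t))%E);
    rewrite fineK // ge0_fin_numE.
rewrite NE in J0 fin1 *; rewrite lee_fin in J0.
have qp1 : 0 < q1 / p1 by rewrite divr_gt0.
have hfin t : 0 < t -> (ball_mass f v1 p1 t < +oo)%E.
  move=> t0; have I1 : (\int[mu1]_(t in `]0%R, +oo[) (ball_mass f v1 p1 t `^ (q1 / p1) * N1 t) < +oo)%E.
    by rewrite NE ltry.
  exact: (@finite_of_integral R (ball_mass f v1 p1) N1 (q1 / p1) t (bmH v1 p1 mv1) (bm0 v1 p1) h1 qp1 I1 t0).
pose gg y := (`|f y| `^ p2 * v2 y `^ p2)%E; pose hh y := (`|f y| `^ p1 * v1 y `^ p1)%E.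
have mg : measurable_fun setT gg by exact: measurable_ball_density.
have mh : measurable_fun setT hh by exact: measurable_ball_density.
have g0 y : (0 <= gg y)%E by exact: ball_density_ge0.
have hh0 y : (0 <= hh y)%E by exact: ball_density_ge0.
have mE := @measurable_enorm R n.
have mS s t : measurable (rshell (@enorm R n) s t : set (euclidean R n)).
  exact: (@measurable_rshell R _ (euclidean R n) (@enorm R n) mE s t).
have nS t : mun [set y | enorm y = t] = 0%E by exact: null_sphere.
have hrad : radial_weight mun (@enorm R n) hh.
  split => // s t s0; have m0 : 0 < Num.max s t by rewrite lt_max s0.
  apply: le_lt_trans (hfin _ m0); apply: ge0_subset_integral.
  - exact: mS.
  - exact: measurable_eball.
  - by apply: measurable_funTS; exact: mh.
  - by move=> y _; exact: hh0.
  - by move=> y /= /andP[_ yt]; rewrite /eball /= lt_max yt orbT.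
have urad := adm_radial p2_gt0 p21 q21 adm.
(* The weights are positive and finite only almost everywhere, so the pointwise splitting is too. *)
have split_ae l : 0 < l -> {ae mun, forall y, (gg y <= l%:E * u y + (l `^ (1 - p))%:E * hh y)%E}.
  move=> l0; have [A [mA A0 sA]] := ae1; have [B [mB B0 sB]] := ae2.
  exists (A `|` B); split; [exact: measurableU| |].
    apply/eqP; rewrite eq_le measure_ge0 andbT.
    by have := measureU2 mun mA mB; rewrite /= A0 B0 adde0.
  move=> y /= h; apply: contrapT => /not_orP[nA nB]; apply: h.
  have v1p : (0 < v1 y < +oo)%E by apply: contrapT => h'; apply: nA; apply: sA => /= /(_ I).
  have v2p : (0 < v2 y < +oo)%E by apply: contrapT => h'; apply: nB; apply: sB => /= /(_ I).
  rewrite /gg /hh /density.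
  case: (v1 y) v1p => [x1| |] //; rewrite ?ltxx ?andbF // => /andP[x10 _].
  case: (v2 y) v2p => [x2| |] //; rewrite ?ltxx ?andbF // => /andP[x20 _].
  rewrite lte_fin in x10; rewrite lte_fin in x20.
  have := abse_ge0 (f y); case: (`|f y|)%E => [z| |] // z0.
    rewrite !poweR_EFin inver gt_eqF ?powR_gt0 // -!EFinM -EFinD lee_fin.
    exact: split_pointwise.
  (* Where [f] is infinite, the term with [hh] is [+oo]. *)
  have lp : (0 < (l `^ (1 - p))%:E)%E by rewrite lte_fin powR_gt0.
  have xp : (0 < x1%:E `^ p1)%E by rewrite poweR_EFin lte_fin powR_gt0.
  rewrite (poweRyr p1n) (gt0_mulye xp) (gt0_muley lp).
  rewrite addey ?leey //.
  have : (0 <= l%:E * ((x1%:E `^ (p1 * p2 / (p1 - p2)))^-1 * x2%:E `^ (p1 * p2 / (p1 - p2))))%E.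
    apply: mule_ge0; first by rewrite lee_fin ltW.
    by apply: mule_ge0; [rewrite inve_ge0; exact: poweR_ge0|exact: poweR_ge0].
  by move=> h2'; rewrite gt_eqF // (@lt_le_trans _ _ 0%E) // ltNy0.
have split_int l s t : 0 < l -> (eV mun (@enorm R n) gg s t <=
    l%:E * eV mun (@enorm R n) u s t + (l `^ (1 - p))%:E * eV mun (@enorm R n) hh s t)%E.
  move=> l0; have mu_ := adm_density adm; have l1 : 0 <= l `^ (1 - p) by exact: powR_ge0.
  have mus : measurable_fun (rshell (@enorm R n) s t) u by apply: measurable_funTS; exact: mu_.
  have mhs : measurable_fun (rshell (@enorm R n) s t) hh by apply: measurable_funTS; exact: mh.
  have E1 : (\int[mun]_(y in rshell (@enorm R n) s t) (l%:E * u y) = l%:E * eV mun (@enorm R n) u s t)%E.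
    by apply: (ge0_integralZl _ (mS s t) mus) => [y _|]; [exact: density_ge0|rewrite lee_fin ltW].
  have E2 : (\int[mun]_(y in rshell (@enorm R n) s t) ((l `^ (1 - p))%:E * hh y) =
      (l `^ (1 - p))%:E * eV mun (@enorm R n) hh s t)%E.
    by apply: (ge0_integralZl _ (mS s t) mhs) => [y _|]; [exact: hh0|rewrite lee_fin].
  rewrite -E1 -E2 /eV -ge0_integralD; first last.
  - by apply: emeasurable_funM; [exact: measurable_cst|exact: mhs].
  - by move=> y _; apply: mule_ge0 (hh0 y); rewrite lee_fin.
  - by apply: emeasurable_funM; [exact: measurable_cst|exact: mus].
  - by move=> y _; apply: mule_ge0 (density_ge0 _ _ _ _ y); rewrite lee_fin ltW.
  - exact: mS.
  apply: (@ae_ge0_le_integral _ _ _ mun _ (mS s t)).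
  - by move=> y _; exact: g0.
  - by apply: measurable_funTS; exact: mg.
  - move=> y _; apply: adde_ge0; apply: mule_ge0; [|exact: density_ge0| |exact: hh0].
      by rewrite lee_fin ltW.
    by rewrite lee_fin.
  - apply: measurable_funTS; apply: emeasurable_funD; apply: emeasurable_funM.
    + exact: measurable_cst.
    + exact: mu_.
    + exact: measurable_cst.
    + exact: mh.
  by apply: filterS (split_ae l l0) => y hy _; exact: hy.
have [_ u0 ufin] := urad; have [_ _ hfin2] := hrad.
have grad : radial_weight mun (@enorm R n) gg.
  split => // s t s0; apply: (le_lt_trans (split_int 1 s t ltr01)).
  rewrite (eVE u0 ufin t s0) (eVE hh0 hfin2 t s0) -!EFinM -EFinD; exact: ltry.
have [_ _ gfin2] := grad.
have hVg : shell_data (rV mun (@enorm R n) gg) by exact: shell_data_radial.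
have hVh : shell_data (rV mun (@enorm R n) hh) by exact: shell_data_radial.
have [[rg0 rgm] mrg rgn rgD] := hVg; have [[rh0 rhm] mrh rhn rhD] := hVh; have [[ru0 _] _ _ _] := hV.
have hold s t : 0 < s -> rV mun (@enorm R n) gg s t `^ p <=
    2 `^ p * (Vu s t `^ (p - 1) * rV mun (@enorm R n) hh s t).
  move=> s0; apply: (holder_of_split p_1 (rg0 s t) (ru0 s t) (rh0 s t)) => l l0.
  have := split_int l s t l0.
  by rewrite (eVE u0 ufin t s0) (eVE hh0 hfin2 t s0) (eVE g0 gfin2 t s0) -!EFinM -EFinD lee_fin.
have [nn1 nn2] : nnweight N1 /\ nnweight N2 by split; exact: tail_nnweight.
pose M0 := (2 * Ku) `^ b * N `^ (b / a).
have M00 : 0 <= M0 by rewrite mulr_ge0 ?powR_ge0.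
have est x0 : 0 < x0 -> (wint N2 `]x0, +oo[ (fun t => rV mun (@enorm R n) gg x0 t `^ b)%R <= M0%:E)%E.
  move=> x00.
  have aE : a / p = q1 / p1 by field; rewrite ?p1n ?p2n.
  apply: (upper_est_shell a_0 p_0 K0 hK nn1 hVg hVh hold J0 x00); rewrite aE.
  have pX : posmeas (fun t : realR R => rV mun (@enorm R n) hh x0 t `^ (q1 / p1)).
    exact: posmeas_shell_powR.
  rewrite -NE; have [mN1 N10] := nn1.
  have mI : measurable_fun setT (fun t : realR R => ball_mass f v1 p1 t `^ (q1 / p1) * N1 t)%E.
    apply: emeasurable_funM; last exact: mN1.
    by apply: (measurableT_comp (measurable_poweR _)); apply: measurable_homo; exact: bmH.
  have I0 (t : realR R) : (0 <= ball_mass f v1 p1 t `^ (q1 / p1) * N1 t)%E.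
    by apply: mule_ge0; [exact: poweR_ge0|exact: N10].
  apply: (@le_trans _ _ (\int[mu1]_(t in `]x0, +oo[) (ball_mass f v1 p1 t `^ (q1 / p1) * N1 t))%E); last first.
    by apply: (integral_itv_subset mI I0) => t /=; rewrite !in_itv/= !andbT; exact: lt_trans.
  have [m3 m4] := posmeas_nnweight nn1 pX.
  apply: ge0_le_integral.
  - exact: measurable_itvR.
  - by move=> t _; exact: m4.
  - by apply: measurable_funTS; exact: m3.
  - by apply: measurable_funTS; exact: mI.
  move=> t _; apply: lee_wpmul2r; first exact: N10.
  rewrite -poweR_EFin; apply: poweR_le; [exact: ltW|by rewrite lee_fin|].
  rewrite -(eVE hh0 hfin2 t x00); apply: ge0_subset_integral.
  - exact: mS.
  - exact: measurable_eball.
  - by apply: measurable_funTS; exact: mh.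
  - by move=> y _; exact: hh0.
  - by move=> y /= /andP[].
have c0 k : 0 < k.+1%:R^-1 :> R by rewrite invr_gt0 ltr0Sn.
(* Finiteness of the ball masses of [g] follows from the estimate itself, since the tail of [w2^q2]
   beyond [t] is positive. *)
have gbfin t : 0 < t -> (ball_mass f v2 p2 t < +oo)%E.
  move=> t0; have W0 := rtail_gt0 h2 t0.
  apply: (@le_lt_trans _ _ ((M0 / rtail N2 t) `^ b^-1)%:E); last exact: ltry.
  apply: ball_le_shells => // k; have [kt|tk] := ltP k.+1%:R^-1 t; last first.
    by rewrite (eVE g0 gfin2 t (c0 k)) lee_fin (rgn _ _ tk) powR_ge0.
  rewrite (eVE g0 gfin2 t (c0 k)) lee_fin; apply: (le_powR_inv b_0 (powR_ge0 _ _)).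
  rewrite -[X in _ <= X]powRrM mulVf // (powRr1 (divr_ge0 M00 (ltW W0))) ler_pdivlMr //.
  rewrite -lee_fin EFinM -(rtailE h2 t0).
  have pG : posmeas (fun s : realR R => rV mun (@enorm R n) gg k.+1%:R^-1 s `^ b).
    exact: posmeas_shell_powR.
  apply: le_trans (est _ (c0 k)).
  apply: (@le_trans _ _ (wint N2 `]t, +oo[ (fun s => rV mun (@enorm R n) gg k.+1%:R^-1 s `^ b)%R)).
    apply: (wint_ge_cst nn2 (powR_ge0 _ _) pG) => s; rewrite in_itv/= andbT => ts.
    by apply: le_powR; [exact: ltW|exact: rg0|apply: rgm => //; exact: ltW].
  by apply: (wint_subset nn2 pG) => s /=; rewrite !in_itv/= !andbT; exact: lt_trans.
have iq2 : 0 < q2^-1 by rewrite invr_gt0.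
have -> : (((4 * Ku) `^ p2^-1)%:E * N%:E `^ q1^-1)%E = ((2 `^ b * M0) `^ q2^-1)%:E.
  rewrite poweR_EFin -EFinM; congr (_%:E).
  rewrite /M0 mulrA -(powRM _ (ler0n _ 2) (mulr_ge0 (ler0n _ 2) K0)) mulrA -natrM.
  rewrite (powRM _ (powR_ge0 _ _) (powR_ge0 _ _)) -!powRrM.
  by congr (_ `^ _ * _ `^ _); field; rewrite ?q1n ?p2n ?q2n.
have X0 : (0 <= \int[mu1]_(t in `]0%R, +oo[) (ball_mass f v2 p2 t `^ (q2 / p2) * N2 t))%E.
  by apply: integral_ge0 => t _; apply: mule_ge0; [exact: poweR_ge0|exact: normal_weight_ge0].
have SS0 : 0 <= 2 `^ b * M0 by rewrite mulr_ge0 ?powR_ge0.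
apply/(poweR_le_powR iq2 SS0 X0).
have -> : (\int[mu1]_(t in `]0%R, +oo[) (ball_mass f v2 p2 t `^ (q2 / p2) * N2 t))%E =
    wint N2 `]0%R, +oo[ (fun t => fine (ball_mass f v2 p2 t) `^ b * 1)%R.
  apply: eq_integral => t; rewrite inE /= in_itv/= andbT => t0.
  by rewrite mulr1 -poweR_EFin fineK // ge0_fin_numE // gbfin.
apply: (@exhaust_wint R N2 (fun t => fine (ball_mass f v2 p2 t)) (fun k => rV mun (@enorm R n) gg k.+1%:R^-1)
  (fun=> 1) b M0 nn2 b_0 _ _ _ _ _ M00 _).
- split; last by move=> t; exact: fine_ge0.
  apply: (@measurableT_comp _ _ _ _ _ _ fine); first exact: fine_measurable.
  by apply: measurable_homo; exact: bmH.
- by move=> k; apply: posmeas_shell.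
- move=> m k t mk _; apply: rgm; [exact: c0| |exact: lexx].
  by rewrite lef_pV2 ?posrE ?ltr0Sn // ler_nat ltnS.
- move=> t M t0 hM; rewrite -lee_fin fineK ?ge0_fin_numE ?gbfin //.
  apply: ball_le_shells => // k; rewrite (eVE g0 gfin2 t (c0 k)) lee_fin.
  have [kt|tk] := ltP k.+1%:R^-1 t; first exact: hM.
  rewrite (rgn _ _ tk); have [j _ hj] := near_infty_natSinv_lt (PosNum t0).
  by apply: le_trans (hM j (hj j (leqnn j))).
- by split => // t; exact: ler01.
move=> k; rewrite (@eq_wint _ _ _ _ (fun t => rV mun (@enorm R n) gg k.+1%:R^-1 t `^ b)); first exact: est.
by move=> t _; rewrite mulr1.
Qed.

End conversions.

Lemma test_function_density (R : realType) (p1 p2 x1 x2 : R) : 0 < p2 -> p2 < p1 -> 0 < x1 -> 0 < x2 ->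
  ((x1 `^ (p1 * p2 / (p1 - p2)))^-1 * x2 `^ (p1 * p2 / (p1 - p2))) `^ (p1 / p2) * (x2^-1) `^ p1 * x1 `^ p1 =
  (x1 `^ (p1 * p2 / (p1 - p2)))^-1 * x2 `^ (p1 * p2 / (p1 - p2)).
Proof.
move=> p20 p21 x10 x20; have p10 : 0 < p1 by exact: lt_trans p21.
have [p2n dn] : p2 != 0 /\ p1 - p2 != 0 by rewrite !gt_eqF // subr_gt0.
have n1 : x1 != 0 by rewrite gt_eqF.
have n2 : x2 != 0 by rewrite gt_eqF.
rewrite -!powRN -(powR_inv1 (ltW x20)) (powRM _ (powR_ge0 _ _) (powR_ge0 _ _)) -!powRrM.
rewrite -mulrA [_ * x1 `^ p1]mulrC mulrACA -powRD ?n1 ?implybT // -powRD ?n2 ?implybT //.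
by congr (_ `^ _ * _ `^ _); field; rewrite ?mulN1r ?p2n ?dn.
Qed.

(** A finite norm makes all ball masses finite, because every tail of the weight is positive; so
    membership in [LM] reduces to measurability and a finite norm. *)
Lemma LMnorm_Lploc (R : realType) (n : nat) (p q : R) (v : euclidean R n -> \bar R) w f : 0 < p -> 0 < q ->
  space_weight v -> tail_weight (normal_weight q w) -> measurable_fun setT f ->
  (LMnorm p q v w f < +oo)%E -> Lploc p v f.
Proof.
move=> p0 q0 [mv [A [mA A0 sA]]] hw mf fin; split => // r r0.
have J0 : (0 <= \int[@completed_lebesgue_measure R]_(t in `]0%R, +oo[) (ball_mass f v p t `^ (q / p) * normal_weight q w t))%E.
  by apply: integral_ge0 => t _; apply: mule_ge0; [exact: poweR_ge0|exact: normal_weight_ge0].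
have iq : 0 < q^-1 by rewrite invr_gt0.
move: fin; rewrite LMnormE => fin; have I1 := poweR_fin iq J0 fin.
have qp : 0 < q / p by rewrite divr_gt0.
have bm0 t : (0 <= ball_mass f v p t)%E by apply: integral_ge0 => y _; exact: ball_density_ge0.
have := finite_of_integral (ball_mass_homo p mf mv) bm0 hw qp I1 r0.
congr (_ < _)%E; have mfv : measurable_fun setT (fun y => `|f y * v y| `^ p)%E.
  have mp : measurable_fun setT (fun y => f y * v y)%E by exact: emeasurable_funM.
  have mp' : measurable_fun setT (fun y => `|f y * v y|)%E by exact: (measurableT_comp _ mp).
  exact: (measurableT_comp (measurable_poweR p) mp').
apply: ge0_ae_eq_integral.
- exact: measurable_eball.
- by apply: measurable_funTS; exact: measurable_ball_density.
- by apply: measurable_funTS; exact: mfv.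
- by move=> y _; exact: ball_density_ge0.
- by move=> y _; exact: poweR_ge0.
exists A; split => // y /= h; apply: sA => /= /(_ I) /andP[vy _]; apply: h => _.
by rewrite abseM (gee0_abs (ltW vy)) poweRM // ltW.
Qed.

Section conversions.
Context {R : realType} {n : nat}.
Local Notation mun := (@lebesgue_euclidean R n).
Local Notation mu1 := (@completed_lebesgue_measure R).
Variables (p1 p2 q1 q2 : R) (n_ge1 : (1 <= n)%N) (p2_gt0 : 0 < p2)
  (p21 : p2 < p1) (q21 : p2 < q1) (q22 : p2 < q2).
Variables (v1 v2 : euclidean R n -> \bar R) (w1 w2 : realR R -> \bar R).
Hypothesis adm : admissible p1 p2 q1 q2 v1 v2 w1 w2.
Local Notation u := (density p1 p2 v1 v2).
Local Notation Vu := (rV mun (@enorm R n) u).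
Local Notation N1 := (normal_weight q1 w1).
Local Notation N2 := (normal_weight q2 w2).
Local Notation p := (p1 / p2).
Local Notation a := (q1 / p2).
Local Notation b := (q2 / p2).

Let p10 : 0 < p1. Proof. exact: lt_trans p21. Qed.
Let q10 : 0 < q1. Proof. exact: lt_trans q21. Qed.
Let q20 : 0 < q2. Proof. exact: lt_trans q22. Qed.
Let p2n : p2 != 0. Proof. by rewrite gt_eqF. Qed.
Let p1n : p1 != 0. Proof. by rewrite gt_eqF. Qed.
Let q1n : q1 != 0. Proof. by rewrite gt_eqF. Qed.
Let q2n : q2 != 0. Proof. by rewrite gt_eqF. Qed.
Let q1p2n : q1 - p2 != 0. Proof. by rewrite gt_eqF // subr_gt0. Qed.
Let p1p2n : p1 - p2 != 0. Proof. by rewrite gt_eqF // subr_gt0. Qed.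
Let h1 : tail_weight N1. Proof. exact: (adm_tail1 p2_gt0 q21 adm). Qed.
Let h2 : tail_weight N2. Proof. exact: (adm_tail2 p2_gt0 q22 adm). Qed.
Let hV : shell_data Vu. Proof. exact: (adm_shell_data n_ge1 p2_gt0 p21 q21 adm). Qed.
Let hJ : Jfinite p a N1 Vu. Proof. exact: (adm_Jfinite p2_gt0 p21 q21 adm). Qed.
Let pe0 : 0 < p2^-1. Proof. by rewrite invr_gt0. Qed.

Lemma LM_lower B : 0 <= B -> (forall f, measurable_fun setT f -> (forall y, 0 <= f y)%E ->
    (LMnorm p1 q1 v1 w1 f < +oo)%E -> (LMnorm p2 q2 v2 w2 f <= B%:E * LMnorm p1 q1 v1 w1 f)%E) ->
  bounded_by mun (@enorm R n) u p a b N1 N2 (B `^ p2).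
Proof.
move=> B0 hB phi [mphi phi0] N N0 hN.
have [[mv1 ae1] [mv2 ae2]] : space_weight v1 /\ space_weight v2 by have [] := adm.
have mu_ := adm_density adm; have u0 : forall y, (0 <= u y)%E by exact: density_ge0.
(* This choice gives [(f v2) ^ p2 = phi u] and, by the definition of [u], [(f v1) ^ p1 = phi ^ p u]
   almost everywhere, so both norms of [f] are expressed by [phi]. *)
pose f y := (((phi y)%:E * u y) `^ p2^-1 * (`|v2 y|)^-1)%E.
have f0 y : (0 <= f y)%E by apply: mule_ge0; [exact: poweR_ge0|rewrite inve_ge0; exact: abse_ge0].
have mphi' : measurable_fun setT (fun y => (phi y)%:E) by exact/measurable_EFinP.
have mf : measurable_fun setT f.
  apply: emeasurable_funM.
    have mm : measurable_fun setT (fun y => (phi y)%:E * u y)%E by exact: (emeasurable_funM mphi' mu_).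
    exact: (measurableT_comp (measurable_poweR _) mm).
  apply: (measurable_inve measurableT); last by move=> y; exact: abse_ge0.
  exact: (measurableT_comp _ mv2).
have p12 : p != 0 by rewrite gt_eqF // divr_gt0.
have fae : {ae mun, forall y, (`|f y| `^ p2 * v2 y `^ p2)%E = ((phi y)%:E * u y)%E /\
    (`|f y| `^ p1 * v1 y `^ p1)%E = ((phi y `^ p)%:E * u y)%E}.
  have [A [mA A0 sA]] := ae1; have [D [mD D0 sD]] := ae2.
  exists (A `|` D); split; [exact: measurableU| |].
    apply/eqP; rewrite eq_le measure_ge0 andbT.
    by have := measureU2 mun mA mD; rewrite /= A0 D0 adde0.
  move=> y /= h; apply: contrapT => /not_orP[nA nD]; apply: h.
  have v1p : (0 < v1 y < +oo)%E by apply: contrapT => h'; apply: nA; apply: sA => /= /(_ I).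
  have v2p : (0 < v2 y < +oo)%E by apply: contrapT => h'; apply: nD; apply: sD => /= /(_ I).
  rewrite gee0_abs // /f /density.
  case: (v1 y) v1p => [x1| |] //; rewrite ?ltxx ?andbF // => /andP[x10 _].
  case: (v2 y) v2p => [x2| |] //; rewrite ?ltxx ?andbF // => /andP[x20 _].
  rewrite lte_fin in x10; rewrite lte_fin in x20; move: (phi0 y); move: (phi y) => z z0.
  have -> : ((x1%:E `^ (p1 * p2 / (p1 - p2)))^-1 * x2%:E `^ (p1 * p2 / (p1 - p2)))%E =
      ((x1 `^ (p1 * p2 / (p1 - p2)))^-1 * x2 `^ (p1 * p2 / (p1 - p2)))%:E.
    by rewrite !poweR_EFin inver gt_eqF ?powR_gt0.
  have -> : (`|x2%:E|^-1)%E = (x2^-1)%:E by rewrite gee0_abs ?lee_fin ?(ltW x20) // inver (gt_eqF x20).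
  have [U [UE U0]] : exists U, U = (x1 `^ (p1 * p2 / (p1 - p2)))^-1 * x2 `^ (p1 * p2 / (p1 - p2)) /\ 0 <= U.
    by eexists; split; [reflexivity|rewrite mulr_ge0 ?invr_ge0 ?powR_ge0].
  have := test_function_density p2_gt0 p21 x10 x20; rewrite -UE => key.
  have iv0 : 0 <= x2^-1 by rewrite invr_ge0 ltW.
  have zU : 0 <= z * U by rewrite mulr_ge0.
  rewrite -(EFinM z U) poweR_EFin -EFinM !poweR_EFin -!EFinM; split; congr (_%:E).
    rewrite (powRM _ (powR_ge0 _ _) iv0) -powRrM mulVf // (powRr1 zU).
    rewrite -[LHS]mulrA -(powRM _ iv0 (ltW x20)) mulVf ?gt_eqF //.
    by rewrite powR1 mulr1.
  rewrite (powRM _ (powR_ge0 _ _) iv0) -powRrM [p2^-1 * p1]mulrC (powRM _ z0 U0) -[in RHS]key.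
  by rewrite !mulrA.
have sE2 t : ball_mass f v2 p2 t = sint mun u (rball (@enorm R n) t) phi.
  apply: ge0_ae_eq_integral.
  - exact: measurable_eball.
  - by apply: measurable_funTS; exact: measurable_ball_density.
  - by apply: measurable_funTS; apply: emeasurable_funM; [exact: mphi'|exact: mu_].
  - by move=> y _; exact: ball_density_ge0.
  - by move=> y _; apply: mule_ge0 (u0 y); rewrite lee_fin.
  by apply: filterS fae => y [h _] _; exact: h.
have sE1 t : ball_mass f v1 p1 t = sint mun u (rball (@enorm R n) t) (fun y => phi y `^ p).
  apply: ge0_ae_eq_integral.
  - exact: measurable_eball.
  - by apply: measurable_funTS; exact: measurable_ball_density.
  - apply: measurable_funTS; apply: emeasurable_funM; last exact: mu_.
    by apply/measurable_EFinP; apply: (measurableT_comp (measurable_powR _)); exact: mphi.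
  - by move=> y _; exact: ball_density_ge0.
  - by move=> y _; apply: mule_ge0 (u0 y); rewrite lee_fin powR_ge0.
  by apply: filterS fae => y [_ h] _; exact: h.
have aE : q1 / p1 = a / p by field; rewrite ?p1n ?p2n.
have L1E : LMnorm p1 q1 v1 w1 f = (Lnorm1 mun (@enorm R n) u p a N1 phi `^ q1^-1)%E.
  by rewrite LMnormE; congr (_ `^ _)%E; apply: eq_integral => t _; rewrite sE1 aE.
have L2E : LMnorm p2 q2 v2 w2 f = (Lnorm2 mun (@enorm R n) u b N2 phi `^ q2^-1)%E.
  have E : (\int[mu1]_(t in `]0%R, +oo[) (ball_mass f v2 p2 t `^ b * N2 t))%E =
      Lnorm2 mun (@enorm R n) u b N2 phi.
    by rewrite /Lnorm2; apply: eq_integral => t _; rewrite sE2; reflexivity.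
  by rewrite LMnormE E.
have iq1 : 0 < q1^-1 by rewrite invr_gt0.
have iq2 : 0 < q2^-1 by rewrite invr_gt0.
have L10 : (0 <= Lnorm1 mun (@enorm R n) u p a N1 phi)%E.
  by apply: integral_ge0 => t _; apply: mule_ge0; [exact: poweR_ge0|exact: normal_weight_ge0].
have L20 : (0 <= Lnorm2 mun (@enorm R n) u b N2 phi)%E.
  by apply: integral_ge0 => t _; apply: mule_ge0; [exact: poweR_ge0|exact: normal_weight_ge0].
have H1 : (LMnorm p1 q1 v1 w1 f <= (N `^ q1^-1)%:E)%E.
  by rewrite L1E; apply/(poweR_le_powR iq1 N0 L10).
have H2 := hB f mf f0 (le_lt_trans H1 (ltry _)).
have S0 : 0 <= (B `^ p2) `^ b * N `^ (b / a) by rewrite mulr_ge0 ?powR_ge0.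
apply/(poweR_le_powR iq2 S0 L20); rewrite -L2E.
apply: (le_trans H2); apply: (@le_trans _ _ (B%:E * (N `^ q1^-1)%:E)%E).
  by apply: lee_wpmul2l => //; rewrite lee_fin.
rewrite -EFinM lee_fin (powRM _ (powR_ge0 _ _) (powR_ge0 _ _)) -!powRrM.
rewrite [X in _ <= B `^ X * _](_ : _ = 1) ?(powRr1 B0); last by field; rewrite ?p2n ?q2n.
by rewrite [X in _ <= _ * N `^ X](_ : _ = q1^-1) //; field; rewrite ?p2n ?q1n ?q2n.
Qed.

End conversions.

(** * The embedding and its best constant *)

Section conversions.
Context {R : realType} {n : nat}.
Local Notation mun := (@lebesgue_euclidean R n).
Local Notation mu1 := (@completed_lebesgue_measure R).
Variables (p1 p2 q1 q2 : R) (n_ge1 : (1 <= n)%N) (p2_gt0 : 0 < p2)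
  (p21 : p2 < p1) (q21 : p2 < q1) (q22 : p2 < q2).
Variables (v1 v2 : euclidean R n -> \bar R) (w1 w2 : realR R -> \bar R).
Hypothesis adm : admissible p1 p2 q1 q2 v1 v2 w1 w2.
Local Notation u := (density p1 p2 v1 v2).
Local Notation Vu := (rV mun (@enorm R n) u).
Local Notation N1 := (normal_weight q1 w1).
Local Notation N2 := (normal_weight q2 w2).
Local Notation p := (p1 / p2).
Local Notation a := (q1 / p2).
Local Notation b := (q2 / p2).

Let p10 : 0 < p1. Proof. exact: lt_trans p21. Qed.
Let q10 : 0 < q1. Proof. exact: lt_trans q21. Qed.
Let q20 : 0 < q2. Proof. exact: lt_trans q22. Qed.
Let p2n : p2 != 0. Proof. by rewrite gt_eqF. Qed.
Let p1n : p1 != 0. Proof. by rewrite gt_eqF. Qed.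
Let q1n : q1 != 0. Proof. by rewrite gt_eqF. Qed.
Let q2n : q2 != 0. Proof. by rewrite gt_eqF. Qed.
Let q1p2n : q1 - p2 != 0. Proof. by rewrite gt_eqF // subr_gt0. Qed.
Let p1p2n : p1 - p2 != 0. Proof. by rewrite gt_eqF // subr_gt0. Qed.
Let h1 : tail_weight N1. Proof. exact: (adm_tail1 p2_gt0 q21 adm). Qed.
Let h2 : tail_weight N2. Proof. exact: (adm_tail2 p2_gt0 q22 adm). Qed.
Let hV : shell_data Vu. Proof. exact: (adm_shell_data n_ge1 p2_gt0 p21 q21 adm). Qed.
Let hJ : Jfinite p a N1 Vu. Proof. exact: (adm_Jfinite p2_gt0 p21 q21 adm). Qed.
Let pe0 : 0 < p2^-1. Proof. by rewrite invr_gt0. Qed.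

(** The common frame of the four cases: [T] is the sum of the characteristics, [hU] their
    sufficiency and [hL] their necessity. Functions of infinite first norm constrain neither the
    embedding nor the best constant. *)
Lemma embedding_criterion (Cu Cl lam : R) (T : \bar R) : 0 < Cu -> 0 < Cl ->
  (4 * Cu) `^ p2^-1 <= lam -> Cl <= lam -> (0 <= T)%E ->
  (forall S, 0 <= S -> (T <= (S `^ p2^-1)%:E)%E -> upper_est p a b N1 N2 Vu (Cu * S)) ->
  (forall B, 0 <= B -> bounded_by mun (@enorm R n) u p a b N1 N2 (B `^ p2) -> (T <= (Cl * B)%:E)%E) ->
  (embeds (LM p1 q1 v1 w1) (LM p2 q2 v2 w2) (LMnorm p1 q1 v1 w1) (LMnorm p2 q2 v2 w2) <-> (T < +oo)%E) /\
  equivalent_up_to lam (best_constant (LMnorm p1 q1 v1 w1) (LMnorm p2 q2 v2 w2)) T.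
Proof.
move=> Cu0 Cl0 kl Cll T0 hU hL.
have [sv1 sv2] : space_weight v1 /\ space_weight v2 by have [] := adm.
have lam0 : 0 < lam by exact: lt_le_trans Cll.
have n10 f : (0 <= LMnorm p1 q1 v1 w1 f)%E by exact: poweR_ge0.
have n20 f : (0 <= LMnorm p2 q2 v2 w2 f)%E by exact: poweR_ge0.
have upper t f : T = t%:E -> measurable_fun setT f -> (LMnorm p1 q1 v1 w1 f < +oo)%E ->
    (LMnorm p2 q2 v2 w2 f <= (lam * t)%:E * LMnorm p1 q1 v1 w1 f)%E.
  move=> TE mf fin; have t0 : 0 <= t by rewrite -lee_fin -TE.
  have tE : (t `^ p2) `^ p2^-1 = t by rewrite -powRrM mulfV // powRr1.
  have S0 : 0 <= t `^ p2 by exact: powR_ge0.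
  have hS : (T <= ((t `^ p2) `^ p2^-1)%:E)%E by rewrite tE TE.
  have K0 : 0 <= Cu * t `^ p2 by rewrite mulr_ge0 ?(ltW Cu0).
  apply: (le_trans (LM_upper n_ge1 p2_gt0 p21 q21 q22 adm K0 (hU _ S0 hS) mf fin)).
  apply: lee_wpmul2r => //; rewrite lee_fin mulrA powRM ?powR_ge0 //; last by rewrite mulr_ge0 // ltW.
  by rewrite tE; apply: ler_wpM2r.
have lower B : 0 <= B -> (forall f, measurable_fun setT f -> (forall y, 0 <= f y)%E ->
    (LMnorm p1 q1 v1 w1 f < +oo)%E -> (LMnorm p2 q2 v2 w2 f <= B%:E * LMnorm p1 q1 v1 w1 f)%E) ->
    (T <= (Cl * B)%:E)%E.
  by move=> B0 hB; apply: (hL B B0); exact: (LM_lower p2_gt0 p21 q21 q22 adm B0 hB).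
split.
  split=> [[sub [C C0 hC]]|fin].
    apply: (le_lt_trans (lower C (ltW C0) _)); last exact: ltry.
    move=> f mf f0 fin; apply: hC; split; last exact: fin.
    exact: (LMnorm_Lploc p10 q10 sv1 h1 mf fin).
  have [t TE] : {t | T = t%:E} by exists (fine T); rewrite fineK // ge0_fin_numE.
  have t0 : 0 <= lam * t by rewrite mulr_ge0 ?(ltW lam0) // -lee_fin -TE.
  split.
    move=> f [[mf _] fin1].
    have fin2 : (LMnorm p2 q2 v2 w2 f < +oo)%E.
      apply: (le_lt_trans (upper t f TE mf fin1)).
      by apply: lte_mul_pinfty => //; rewrite lee_fin.
    by split => //; exact: (LMnorm_Lploc p2_gt0 q20 sv2 h2 mf fin2).
  (* The constant of an embedding must be positive, and [t] may be 0. *)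
  exists (lam * t + 1); first by lra.
  move=> f [[mf _] fin1]; apply: (le_trans (upper t f TE mf fin1)).
  by apply: lee_wpmul2r => //; rewrite lee_fin; lra.
split.
  have B0 : (0 <= best_constant (LMnorm p1 q1 v1 w1) (LMnorm p2 q2 v2 w2))%E.
    apply: (@le_trans _ _ (LMnorm p2 q2 v2 w2 (cst 0%E) / LMnorm p1 q1 v1 w1 (cst 0%E))%E).
      by apply: mule_ge0; rewrite ?inve_ge0.
    by apply: ereal_sup_ubound; exists (cst 0%E) => //; split.
  have ub f : measurable_fun setT f -> (forall y, 0 <= f y)%E ->
      (LMnorm p2 q2 v2 w2 f / LMnorm p1 q1 v1 w1 f <=
       best_constant (LMnorm p1 q1 v1 w1) (LMnorm p2 q2 v2 w2))%E.
    by move=> mf f0; apply: ereal_sup_ubound; exists f.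
  move: B0 ub; case: (best_constant _ _) => [B| |] //.
  - rewrite lee_fin => B0 ub; have TB : (T <= (Cl * B)%:E)%E.
      apply: (lower B B0) => f mf f0; have := ub f mf f0; have := n10 f; have := n20 f.
      case: (LMnorm p1 q1 v1 w1 f) => [r| |] //; rewrite lee_fin => s0 r0.
      (* Zero first norm with positive second norm would make the quotient [+oo], against the
         finiteness of [B]. *)
      have [rz|rn] := eqVneq r 0.
        move: s0; rewrite le_eqVlt => /orP[/eqP <- _ _|s0].
          by rewrite rz mule0.
        by rewrite rz inver eqxx gt0_muley.
      have rp : 0 < r by rewrite lt_neqAle eq_sym rn.
      by rewrite inver (negbTE rn) lee_pdivrMr.
    apply: (le_trans (lee_wpmul2l _ TB)); first by rewrite lee_fin invr_ge0 ltW.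
    by rewrite -EFinM lee_fin mulrC ler_pdivrMr // mulrC; apply: ler_wpM2l.
  - by move=> _ _; rewrite leey.
apply: ge_ereal_sup => _ [f [mf f0] <-].
have [Tfin|] := ltP T +oo%E; last first.
  by rewrite leye_eq => /eqP ->; rewrite gt0_muley ?leey // lte_fin.
have [t TE] : {t | T = t%:E} by exists (fine T); rewrite fineK // ge0_fin_numE.
have t0 : 0 <= t by rewrite -lee_fin -TE.
have R0 : 0 <= lam * t by rewrite mulr_ge0 // ltW.
have := upper t f TE mf; have := n10 f; have := n20 f; rewrite TE -EFinM.
case: (LMnorm p1 q1 v1 w1 f) => [r| |] //; last first.
  by move=> _ _ _; rewrite invey mule0 lee_fin.
rewrite lee_fin => s0 r0 /(_ (ltry r)).
have [rz|rn] := eqVneq r 0.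
  rewrite rz mule0 => s1; have -> : LMnorm p2 q2 v2 w2 f = 0%E by apply/eqP; rewrite eq_le s1 s0.
  by rewrite mul0e lee_fin.
have rp : 0 < r by rewrite lt_neqAle eq_sym rn.
by rewrite inver (negbTE rn) lee_pdivrMr.
Qed.

End conversions.

Section summation.
Context {R : realType}.
Local Open Scope ereal_scope.

Lemma add2_le (x y z : \bar R) : 0 <= x -> 0 <= y -> x + y <= z -> x <= z /\ y <= z.
Proof. by move=> x0 y0 h; split; apply: le_trans h; rewrite ?leeDl ?leeDr. Qed.

Lemma add2_fin (x y : \bar R) : 0 <= x -> 0 <= y -> x + y < +oo <-> x < +oo /\ y < +oo.
Proof.
move=> x0 y0; split=> [h|[hx hy]]; last exact: lte_add_pinfty.
by split; apply: le_lt_trans h; rewrite ?leeDl ?leeDr.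
Qed.

Lemma add3_le (x y t z : \bar R) : 0 <= x -> 0 <= y -> 0 <= t -> x + y + t <= z ->
  [/\ x <= z, y <= z & t <= z].
Proof.
move=> x0 y0 t0 /(add2_le (adde_ge0 x0 y0) t0)[h ->].
by have [-> ->] := add2_le x0 y0 h.
Qed.

Lemma add3_fin (x y t : \bar R) : 0 <= x -> 0 <= y -> 0 <= t ->
  x + y + t < +oo <-> [/\ x < +oo, y < +oo & t < +oo].
Proof.
move=> x0 y0 t0; split=> [/(add2_fin (adde_ge0 x0 y0) t0)[/(add2_fin x0 y0)[? ?] ?]//|[? ? ?]].
by apply/(add2_fin (adde_ge0 x0 y0) t0); split => //; apply/add2_fin.
Qed.

Lemma sup_posreal_ge0 (f : R -> \bar R) : (forall t, 0 <= f t) ->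
  0 <= ereal_sup [set f t | t in `]0%R, +oo[%classic].
Proof.
move=> f0; apply: (le_trans (f0 1%R)); apply: ereal_sup_ubound; exists 1%R => //=.
by rewrite in_itv/= ltr01.
Qed.

Lemma le_bounds3 (x y t : \bar R) (k1 k2 k3 B : R) : x <= (k1 * B)%:E -> y <= (k2 * B)%:E ->
  t <= (k3 * B)%:E -> x + y + t <= ((k1 + k2 + k3) * B)%:E.
Proof. by move=> hx hy ht; rewrite !mulrDl !EFinD; do 2?apply: leeD. Qed.

Lemma root_scale (p2 c B : R) : (0 < p2)%R -> (0 <= c)%R -> (0 <= B)%R ->
  ((c * B `^ p2) `^ p2^-1 = c `^ p2^-1 * B)%R.
Proof.
by move=> p20 c0 B0; rewrite powRM ?powR_ge0 // -powRrM mulfV ?gt_eqF // powRr1.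
Qed.

End summation.

Section nonnegativity.
Context {R : realType} {n : nat} (p1 p2 q1 q2 : R) (v1 v2 : euclidean R n -> \bar R) (w1 w2 : realR R -> \bar R).
Local Open Scope ereal_scope.

Lemma I3_ge0 : 0 <= I3 p1 p2 q1 q2 v1 v2 w1 w2.
Proof.
apply: mule_ge0; first by rewrite inve_ge0; exact: poweR_ge0.
by apply: sup_posreal_ge0 => t; apply: mule_ge0; exact: poweR_ge0.
Qed.

Lemma I4_ge0 : 0 <= I4 p1 p2 q1 q2 v1 v2 w1 w2.
Proof. by apply: sup_posreal_ge0 => t; apply: mule_ge0; exact: poweR_ge0. Qed.

Lemma I5_ge0 : 0 <= I5 p1 p2 q1 q2 v1 v2 w1 w2. Proof. exact: poweR_ge0. Qed.

Lemma I6_ge0 : 0 <= I6 p1 p2 q1 q2 v1 v2 w1 w2. Proof. exact: poweR_ge0. Qed.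

Lemma I7_ge0 : 0 <= I7 p1 p2 q1 q2 v1 v2 w1 w2.
Proof. by apply: mule_ge0; [rewrite inve_ge0|]; exact: poweR_ge0. Qed.

Lemma I8_ge0 : 0 <= I8 p1 p2 q1 q2 v1 v2 w1 w2.
Proof. by apply: sup_posreal_ge0 => t; apply: mule_ge0; exact: poweR_ge0. Qed.

Lemma I9_ge0 : 0 <= I9 p1 p2 q1 q2 v1 v2 w1 w2. Proof. exact: poweR_ge0. Qed.

End nonnegativity.

Unset Implicit Arguments.
Set Strict Implicit.
Set Printing Implicit Defensive.

(* In each case the constant lam of the equivalence is chosen before the
   weights: it depends on n, p1, p2, q1 and q2 only. *)
Theorem theorem3p4 (R : realType) (n : nat) (p1 p2 q1 q2 : R)
    (n_ge1 : (1 <= n)%N) (p2_gt0 : 0 < p2)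
    (p2_lt : p2 < Num.min p1 (Num.min q1 q2)) :
  [/\
   (* (i) *)
   Num.max p1 q1 <= q2 ->
   exists2 lam : R, 0 < lam &
   forall (v1 v2 : euclidean R n -> \bar R) (w1 w2 : realR R -> \bar R),
     admissible p1 p2 q1 q2 v1 v2 w1 w2 ->
     (embeds (LM p1 q1 v1 w1) (LM p2 q2 v2 w2)
             (LMnorm p1 q1 v1 w1) (LMnorm p2 q2 v2 w2) <->
      (I3 p1 p2 q1 q2 v1 v2 w1 w2 < +oo)%E /\
      (I4 p1 p2 q1 q2 v1 v2 w1 w2 < +oo)%E) /\
     equivalent_up_to lam
       (best_constant (LMnorm p1 q1 v1 w1) (LMnorm p2 q2 v2 w2))
       (I3 p1 p2 q1 q2 v1 v2 w1 w2 + I4 p1 p2 q1 q2 v1 v2 w1 w2)%E,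
   (* (ii) *)
   p1 <= q2 -> q2 < q1 ->
   exists2 lam : R, 0 < lam &
   forall (v1 v2 : euclidean R n -> \bar R) (w1 w2 : realR R -> \bar R),
     admissible p1 p2 q1 q2 v1 v2 w1 w2 ->
     (embeds (LM p1 q1 v1 w1) (LM p2 q2 v2 w2)
             (LMnorm p1 q1 v1 w1) (LMnorm p2 q2 v2 w2) <->
      [/\ (I3 p1 p2 q1 q2 v1 v2 w1 w2 < +oo)%E,
          (I5 p1 p2 q1 q2 v1 v2 w1 w2 < +oo)%E &
          (I6 p1 p2 q1 q2 v1 v2 w1 w2 < +oo)%E]) /\
     equivalent_up_to lam
       (best_constant (LMnorm p1 q1 v1 w1) (LMnorm p2 q2 v2 w2))
       (I3 p1 p2 q1 q2 v1 v2 w1 w2 + I5 p1 p2 q1 q2 v1 v2 w1 w2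
        + I6 p1 p2 q1 q2 v1 v2 w1 w2)%E,
   (* (iii) *)
   q1 <= q2 -> q2 < p1 ->
   exists2 lam : R, 0 < lam &
   forall (v1 v2 : euclidean R n -> \bar R) (w1 w2 : realR R -> \bar R),
     admissible p1 p2 q1 q2 v1 v2 w1 w2 ->
     (embeds (LM p1 q1 v1 w1) (LM p2 q2 v2 w2)
             (LMnorm p1 q1 v1 w1) (LMnorm p2 q2 v2 w2) <->
      [/\ (I4 p1 p2 q1 q2 v1 v2 w1 w2 < +oo)%E,
          (I7 p1 p2 q1 q2 v1 v2 w1 w2 < +oo)%E &
          (I8 p1 p2 q1 q2 v1 v2 w1 w2 < +oo)%E]) /\
     equivalent_up_to lam
       (best_constant (LMnorm p1 q1 v1 w1) (LMnorm p2 q2 v2 w2))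
       (I4 p1 p2 q1 q2 v1 v2 w1 w2 + I7 p1 p2 q1 q2 v1 v2 w1 w2
        + I8 p1 p2 q1 q2 v1 v2 w1 w2)%E &
   (* (iv) *)
   q2 < Num.min p1 q1 ->
   exists2 lam : R, 0 < lam &
   forall (v1 v2 : euclidean R n -> \bar R) (w1 w2 : realR R -> \bar R),
     admissible p1 p2 q1 q2 v1 v2 w1 w2 ->
     (embeds (LM p1 q1 v1 w1) (LM p2 q2 v2 w2)
             (LMnorm p1 q1 v1 w1) (LMnorm p2 q2 v2 w2) <->
      [/\ (I6 p1 p2 q1 q2 v1 v2 w1 w2 < +oo)%E,
          (I7 p1 p2 q1 q2 v1 v2 w1 w2 < +oo)%E &
          (I9 p1 p2 q1 q2 v1 v2 w1 w2 < +oo)%E]) /\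
     equivalent_up_to lam
       (best_constant (LMnorm p1 q1 v1 w1) (LMnorm p2 q2 v2 w2))
       (I6 p1 p2 q1 q2 v1 v2 w1 w2 + I7 p1 p2 q1 q2 v1 v2 w1 w2
        + I9 p1 p2 q1 q2 v1 v2 w1 w2)%E].
Proof.
move: p2_lt; rewrite !lt_min => /and3P[p21 q21 q22].
have [p_1 [a_1 b_1]] : 1 < p1 / p2 /\ (1 < q1 / p2 /\ 1 < q2 / p2) by rewrite !ltr_pdivlMr // !mul1r.
have e0 : 0 < p2^-1 by rewrite invr_gt0.
have ip : 0 <= p2^-1 by exact: ltW.
have [Cl Cl0 hlow] := lower_conditions (@measurable_enorm R n)
  (fun t => @null_sphere R n t n_ge1) p_1 a_1 b_1.
(* [k] and [k7] are the necessity constants after the power [1 / p2]; [k7] contains the loss of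
   [I7_lower]. *)
pose k := Cl `^ p2^-1; pose k7 := (2 `^ ((p1 / p2 - 1) / (p1 / p2)) * Cl) `^ p2^-1.
have k0 : 0 < k by rewrite powR_gt0.
have k70 : 0 < k7 by rewrite powR_gt0 // mulr_gt0 // powR_gt0.
have rootE B : 0 <= B -> (Cl * B `^ p2) `^ p2^-1 = k * B by move=> B0; rewrite root_scale // ltW.
have root7E B : 0 <= B ->
    (2 `^ ((p1 / p2 - 1) / (p1 / p2)) * (Cl * B `^ p2)) `^ p2^-1 = k7 * B.
  by move=> B0; rewrite mulrA root_scale // mulr_ge0 ?powR_ge0 // ltW.
have CB0 B : 0 <= Cl * B `^ p2 by rewrite mulr_ge0 ?powR_ge0 // ltW.
have low v1 v2 w1 w2 (adm : admissible p1 p2 q1 q2 v1 v2 w1 w2) B (B0 : 0 <= B) := hlow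
  (density p1 p2 v1 v2) (normal_weight q1 w1) (normal_weight q2 w2) (B `^ p2)
  (adm_radial p2_gt0 p21 q21 adm) (adm_tail1 p2_gt0 q21 adm) (adm_tail2 p2_gt0 q22 adm)
  (adm_Jfinite p2_gt0 p21 q21 adm) (powR_ge0 B p2).
have aleb : q1 <= q2 -> q1 / p2 <= q2 / p2 by move=> h; rewrite ler_pM2r.
have blta : q2 < q1 -> q2 / p2 < q1 / p2 by move=> h; rewrite ltr_pM2r.
have pleb : p1 <= q2 -> p1 / p2 <= q2 / p2 by move=> h; rewrite ler_pM2r.
split.
- rewrite ge_max => /andP[pq qq].
  have [Cu Cu0 hup] := upper_est_le p_1 a_1 b_1 (aleb qq).
  have u0 : 0 < (4 * Cu) `^ p2^-1 by rewrite powR_gt0 // mulr_gt0.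
  (* [lam] dominates the sufficiency constant as well as the sum of the necessity constants of the
     characteristics. *)
  exists ((4 * Cu) `^ p2^-1 + (k + k)); first by lra.
  move=> v1 v2 w1 w2 adm.
  have i3 := I3_ge0 p1 p2 q1 q2 v1 v2 w1 w2; have i4 := I4_ge0 p1 p2 q1 q2 v1 v2 w1 w2.
  rewrite -(add2_fin i3 i4).
  apply: (@embedding_criterion R n p1 p2 q1 q2 n_ge1 p2_gt0 p21 q21 q22 v1 v2 w1 w2 adm Cu (k + k)) => //.
  + by lra.
  + by lra.
  + by lra.
  + exact: adde_ge0.
  + move=> S S0 /(add2_le i3 i4)[h3 h4].
    have J := (I4_cond n_ge1 p2_gt0 p21 q21 q22 adm S0).1 h4.
    apply: hup.
    * exact: (adm_tail1 p2_gt0 q21 adm).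
    * exact: (adm_tail2 p2_gt0 q22 adm).
    * exact: (adm_shell_data n_ge1 p2_gt0 p21 q21 adm).
    * exact: (adm_Jfinite p2_gt0 p21 q21 adm).
    * exact: S0.
    * exact: (I3_cond n_ge1 p2_gt0 p21 q21 q22 adm pq S0).1 h3.
    * exact: J.
    apply: (dual_cond_J p_1 a_1 b_1 (pleb pq)).
    * exact: (adm_tail1 p2_gt0 q21 adm).
    * exact: (adm_tail2 p2_gt0 q22 adm).
    * exact: (adm_shell_data n_ge1 p2_gt0 p21 q21 adm).
    * exact: (adm_Jfinite p2_gt0 p21 q21 adm).
    * exact: S0.
    * exact: J.
  move=> B B0 /(low _ _ _ _ adm B B0)[hh hJ _ _ _].
  rewrite mulrDl EFinD; apply: leeD; rewrite -(rootE B B0).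
    exact: (I3_cond n_ge1 p2_gt0 p21 q21 q22 adm pq (CB0 B)).2 hh.
  exact: (I4_cond n_ge1 p2_gt0 p21 q21 q22 adm (CB0 B)).2 hJ.
- move=> pq qq; have ba := blta qq.
  have [Cu Cu0 hup] := upper_est_gt p_1 a_1 b_1 ba.
  have u0 : 0 < (4 * Cu) `^ p2^-1 by rewrite powR_gt0 // mulr_gt0.
  exists ((4 * Cu) `^ p2^-1 + (k + k + k)); first by lra.
  move=> v1 v2 w1 w2 adm.
  have i3 := I3_ge0 p1 p2 q1 q2 v1 v2 w1 w2; have i5 := I5_ge0 p1 p2 q1 q2 v1 v2 w1 w2.
  have i6 := I6_ge0 p1 p2 q1 q2 v1 v2 w1 w2; rewrite -(add3_fin i3 i5 i6).
  have hQ := hardy_power_sup n_ge1 p2_gt0 p21 q21 q22 adm qq pq.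
  have hM := shell_sup_from n_ge1 p2_gt0 p21 q21 q22 adm qq.
  apply: (@embedding_criterion R n p1 p2 q1 q2 n_ge1 p2_gt0 p21 q21 q22 v1 v2 w1 w2 adm Cu (k + k + k)) => //.
  + by lra.
  + by lra.
  + by lra.
  + by apply: adde_ge0 => //; exact: adde_ge0.
  + move=> S S0 /(add3_le i3 i5 i6)[h3 h5 h6].
    apply: hup hQ hM _ _ _ _.
    * exact: (adm_tail1 p2_gt0 q21 adm).
    * exact: (adm_tail2 p2_gt0 q22 adm).
    * exact: (adm_shell_data n_ge1 p2_gt0 p21 q21 adm).
    * exact: (adm_Jfinite p2_gt0 p21 q21 adm).
    * exact: S0.
    * exact: (I3_cond n_ge1 p2_gt0 p21 q21 q22 adm pq S0).1 h3.
    * exact: (I5_cond p2_gt0 q21 q22 adm qq S0).1 h5.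
    * exact: (I6_cond n_ge1 p2_gt0 p21 q21 q22 adm qq S0).1 h6.
  move=> B B0 /(low _ _ _ _ adm B B0)[hh _ _ /(_ ba _ hQ) Q /(_ ba _ hM) M].
  apply: le_bounds3; rewrite -(rootE B B0).
  + exact: (I3_cond n_ge1 p2_gt0 p21 q21 q22 adm pq (CB0 B)).2 hh.
  + exact: (I5_cond p2_gt0 q21 q22 adm qq (CB0 B)).2 Q.
  exact: (I6_cond n_ge1 p2_gt0 p21 q21 q22 adm qq (CB0 B)).2 M.
- move=> qq qp.
  have [Cu Cu0 hup] := upper_est_le p_1 a_1 b_1 (aleb qq).
  have u0 : 0 < (4 * Cu) `^ p2^-1 by rewrite powR_gt0 // mulr_gt0.
  exists ((4 * Cu) `^ p2^-1 + (k + k7 + k)); first by lra.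
  move=> v1 v2 w1 w2 adm.
  have i4 := I4_ge0 p1 p2 q1 q2 v1 v2 w1 w2; have i7 := I7_ge0 p1 p2 q1 q2 v1 v2 w1 w2.
  have i8 := I8_ge0 p1 p2 q1 q2 v1 v2 w1 w2; rewrite -(add3_fin i4 i7 i8).
  apply: (@embedding_criterion R n p1 p2 q1 q2 n_ge1 p2_gt0 p21 q21 q22 v1 v2 w1 w2 adm Cu (k + k7 + k)) => //.
  + by lra.
  + by lra.
  + by lra.
  + by apply: adde_ge0 => //; exact: adde_ge0.
  + move=> S S0 /(add3_le i4 i7 i8)[h4 h7 h8].
    apply: hup.
    * exact: (adm_tail1 p2_gt0 q21 adm).
    * exact: (adm_tail2 p2_gt0 q22 adm).
    * exact: (adm_shell_data n_ge1 p2_gt0 p21 q21 adm).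
    * exact: (adm_Jfinite p2_gt0 p21 q21 adm).
    * exact: S0.
    * exact: (I7_upper n_ge1 p2_gt0 p21 q21 q22 adm qp S0 h7).
    * exact: (I4_cond n_ge1 p2_gt0 p21 q21 q22 adm S0).1 h4.
    * exact: (I8_cond n_ge1 p2_gt0 p21 q21 q22 adm qp S0).1 h8.
  move=> B B0 /(low _ _ _ _ adm B B0)[hh hJ hD _ _].
  apply: le_bounds3; rewrite -?(rootE B B0) -?(root7E B B0).
  + exact: (I4_cond n_ge1 p2_gt0 p21 q21 q22 adm (CB0 B)).2 hJ.
  + exact: (I7_lower n_ge1 p2_gt0 p21 q21 q22 adm qp (CB0 B) hh).
  exact: (I8_cond n_ge1 p2_gt0 p21 q21 q22 adm qp (CB0 B)).2 hD.
move=> /andP[qp qq]; have ba := blta qq.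
have [Cu Cu0 hup] := upper_est_gt p_1 a_1 b_1 ba.
have u0 : 0 < (4 * Cu) `^ p2^-1 by rewrite powR_gt0 // mulr_gt0.
exists ((4 * Cu) `^ p2^-1 + (k + k7 + k)); first by lra.
move=> v1 v2 w1 w2 adm.
have i6 := I6_ge0 p1 p2 q1 q2 v1 v2 w1 w2; have i7 := I7_ge0 p1 p2 q1 q2 v1 v2 w1 w2.
have i9 := I9_ge0 p1 p2 q1 q2 v1 v2 w1 w2; rewrite -(add3_fin i6 i7 i9).
have hQ := hardy_power_K n_ge1 p2_gt0 p21 q21 q22 adm qq qp.
have hM := shell_sup_from n_ge1 p2_gt0 p21 q21 q22 adm qq.
apply: (@embedding_criterion R n p1 p2 q1 q2 n_ge1 p2_gt0 p21 q21 q22 v1 v2 w1 w2 adm Cu (k + k7 + k)) => //.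
- by lra.
- by lra.
- by lra.
- by apply: adde_ge0 => //; exact: adde_ge0.
- move=> S S0 /(add3_le i6 i7 i9)[h6 h7 h9].
  apply: hup hQ hM _ _ _ _.
  + exact: (adm_tail1 p2_gt0 q21 adm).
  + exact: (adm_tail2 p2_gt0 q22 adm).
  + exact: (adm_shell_data n_ge1 p2_gt0 p21 q21 adm).
  + exact: (adm_Jfinite p2_gt0 p21 q21 adm).
  + exact: S0.
  + exact: (I7_upper n_ge1 p2_gt0 p21 q21 q22 adm qp S0 h7).
  + exact: (I9_cond p2_gt0 p21 q21 q22 adm qq qp S0).1 h9.
  + exact: (I6_cond n_ge1 p2_gt0 p21 q21 q22 adm qq S0).1 h6.
move=> B B0 /(low _ _ _ _ adm B B0)[hh _ _ /(_ ba _ hQ) Q /(_ ba _ hM) M].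
apply: le_bounds3; rewrite -?(rootE B B0) -?(root7E B B0).
- exact: (I6_cond n_ge1 p2_gt0 p21 q21 q22 adm qq (CB0 B)).2 M.
- exact: (I7_lower n_ge1 p2_gt0 p21 q21 q22 adm qp (CB0 B) hh).
exact: (I9_cond p2_gt0 p21 q21 q22 adm qq qp (CB0 B)).2 Q.
Qed.
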